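(* Suppose that $\nu((0,\infty),y)=\infty$ and that $s\mapsto\bar\nu(s,y)=a(y)+\nu((s,\infty),y)$ is absolutely continuous on $(0,\infty)$, for all $y\in E$, and that the Bernstein function $\lambda\mapsto\mathbb{E}f(\lambda,Y)$ is regularly varying at $0+$. Let $\alpha\in[0,1]$ be such that $$\lim_{\lambda\to0}\frac{\mathbb{E}f(\lambda x,Y)}{\mathbb{E}f(\lambda,Y)}=x^\alpha .$$ Let $L^{f,p}(t)=\inf\{s\ge0:\sigma^{f,p}(s)>t\}$ be the inverse of the distributed order subordinator $\sigma^{f,p}$, let $q(x,t)$ be the fundamental solution to $${}_0\mathsf{D}_t^{f,p}q(x,t)=\Delta q(x,t),\qquad x\in\mathbb{R}^n,\ t>0,$$ let $\mathscr{M}(t)=\int_{\mathbb{R}^n}|x-u|^2q(x-u,t)\,du$, and let $B_n$ be the $n$-dimensional Brownian motion. Then: (1) $q(x,t)\,dx=\Pr\{B_n(L^{f,p}(t))\in dx\}$, i.e. $q(x,t)$ is the density of the one-dimensional marginal of the delayed Brownian motion (the Brownian motion $B_n$ time-changed with an independent $L^{f,p}(t)$). (2) $\displaystyle \frac{1}{2n}\Gamma(1+\alpha)\mathscr{M}(t)\sim\frac{1}{\mathbb{E}f(1/t,Y)}$ as $t\to\infty$. (3) If $\mathbb{E}a(Y)>0$ then $\lim_{t\to\infty}\mathscr{M}(t)<\infty$. (4) In general, $$\lim_{t\to\infty}\frac{t}{\frac{1}{2n}\Gamma(1+\alpha)\mathscr{M}(t)}=\mathbb{E}b(Y)+\int_0^\infty\int_W\bar\nu(s,y)\,p(dy)\,ds>0,$$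 which is infinite or finite (but greater than zero), depending on the kernel $\mathbb{E}\bar\nu(s,Y)$.
   Context: Setting. $E$ is a Polish space, $W\subseteq E$ is Borel, $p$ is a probability measure on $W$, $Y$ is a random variable with law $p$, and $\mathbb{E}g(Y)=\int_W g(y)\,p(dy)$. For each $y\in E$, $f(\lambda,y)=a(y)+b(y)\lambda+\int_0^\infty(1-e^{-\lambda s})\,\nu(ds,y)$, $\lambda>0$, where $a(y),b(y)\ge 0$ and $\nu(ds,y)$ is a non-negative $\sigma$-finite measure on $(0,\infty)$ (depending measurably on $y$) with $V(y):=\int_0^\infty (s\wedge 1)\,\nu(ds,y)<\infty$. Standing assumptions. A1) the functions $a,b$ are Borel measurable and either bounded, or such that $\int_W a\,dp<\infty$ and $\int_W b\,dp<\infty$. A2) either $V$ is bounded, or $\int_W V\,dp<\infty$. Distributed order subordinator: $\sigma^{f,p}$ is the (possibly killed, i.e. sent to $\infty$) subordinator with $\mathbb{E}e^{-\lambda\sigma^{f,p}(t)}=e^{-t\,\mathbb{E}f(\lambda,Y)}$. Operator. With $\mathbb{E}\bar\nu(s,Y)=\int_W\bigl(a(y)+\nu((s,\infty),y)\bigr)p(dy)$, the regularized distributed order derivative is $${}_0\mathsf{D}_t^{f,p}u(t)=\mathbb{E}b(Y)\frac{d}{dt}u(t)+\frac{d}{dt}\int_0^t u(s)\,\mathbb{E}\bar\nu(t-s,Y)\,ds-u(0)\,\mathbb{E}\bar\nu(t,Y).$$ It acts on the Laplace transform $\widetilde u(\lambda)=\int_0^\infty e^{-\lambda t}u(t)dt$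 by $\widetilde u(\lambda)\mapsto \mathbb{E}f(\lambda,Y)\,\widetilde u(\lambda)-\lambda^{-1}\mathbb{E}f(\lambda,Y)\,u(0)$. Conventions. The fundamental solution is the solution with initial datum $q(x,0)\,dx=\delta_0(dx)$. $\Delta$ is the Laplacian on $\mathbb{R}^n$. $B_n$ is normalized to have generator $\Delta$, i.e. $\Pr\{B_n(s)\in dx\}=(4\pi s)^{-n/2}e^{-|x|^2/(4s)}dx$, and is independent of $L^{f,p}$. A function $g$ is regularly varying at $0+$ if $\lim_{\lambda\to0}g(\lambda x)/g(\lambda)$ exists and is finite (for every $x>0$); for a Bernstein function the limit is $x^\alpha$ with $\alpha\in[0,1]$. $g(t)\sim h(t)$ means $g(t)/h(t)\to1$. *)

(* Defs.v *)
From HB Require Import structures.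
From mathcomp Require Import all_boot all_order all_algebra.
From mathcomp Require Import all_classical all_reals all_analysis.
From mathcomp Require Import measurable_realfun.

Set Implicit Arguments.
Unset Strict Implicit.
Unset Printing Implicit Defensive.

Import Order.TTheory GRing.Theory Num.Theory.
Import numFieldNormedType.Exports.

Local Open Scope classical_set_scope.
Local Open Scope ring_scope.
Local Open Scope ereal_scope.

Notation borel T := (g_sigma_algebraType (@open T)).

(* Lebesgue measure on the Borel sets of R^n = 'rV[R]_n, obtained by iterating
   the library product of lebesgue_measure along R * R^n -> R^n.+1. *)
Section lebesgue_rV.
Context {R : realType}.

Definition cons_rV (n : nat)
    (z : (measurableTypeR R * borel 'rV[R]_n)%type) : borel 'rV[R]_n.+1 :=
  \row_(i < n.+1) if unlift ord0 i is Some j then z.2 ord0 j else z.1.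

Lemma open_rV_bigcup_ball (m : nat) (U : set 'rV[R]_m) : open U ->
  U = \bigcup_(wk in [set wk : 'rV[rat]_m * nat |
         ball (map_mx ratr wk.1 : 'rV[R]_m) (wk.2.+1%:R^-1)%R `<=` U])
      ball (map_mx ratr wk.1 : 'rV[R]_m) (wk.2.+1%:R^-1)%R.
Proof.
move=> oU; apply/seteqP; split; last by move=> x [wk /= h] /h.
move=> x Ux.
have /nbhs_ballP[e /= e0 xeU] : nbhs x U by exact: open_nbhs_nbhs.
have e20 : (0 < e / 2)%R by rewrite divr_gt0.
have [k ke] : exists k : nat, ((k.+1%:R)^-1 < e / 2 :> R)%R.
  exists (Num.truncn (e / 2)^-1).
  rewrite invf_plt ?posrE//.
  exact: truncnS_gt.
have k0 : (0 < (k.+1%:R)^-1 :> R)%R by rewrite invr_gt0.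
have /choice[w wP] : forall j : 'I_m, exists q : rat,
    (ratr q \in `](x ord0 j - k.+1%:R^-1), (x ord0 j + k.+1%:R^-1)[)%R.
  by move=> j; apply: rat_in_itvoo; rewrite ltrBlDr -addrA ltrDl addr_gt0.
have xw : ball (map_mx ratr (\row_j w j) : 'rV[R]_m) (k.+1%:R^-1)%R x.
  split=> // i j; rewrite !mxE ord1 -ball_normE /=.
  by have := wP j; rewrite in_itv/= -ltr_distlC distrC.
exists (\row_j w j, k) => //= y wy; apply: xeU.
apply: (@le_ball _ _ x (k.+1%:R^-1 + k.+1%:R^-1)%R).
  by rewrite [leRHS]splitr lerD// ltW.
exact: ball_triangle (ball_sym xw) wy.
Qed.

Lemma measurable_cons_rV (n : nat) : measurable_fun setT (@cons_rV n).
Proof.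
apply: (@measurability _ _ _ (borel 'rV[R]_n.+1) setT (@cons_rV n) (@open 'rV[R]_n.+1)) => //.
move=> _ [U oU <-]; rewrite setTI (open_rV_bigcup_ball oU) preimage_bigcup.
rewrite bigcup_mkcond; apply: countable_bigcupT_measurable => [|[w k]] /=.
  exact: countableP.
case: ifP => _ //.
set r := (_^-1)%R.
have r0 : (0 < r)%R by rewrite invr_gt0.
set v : 'rV[R]_n.+1 := map_mx _ _.
rewrite (_ : _ @^-1` _ = (ball (v ord0 ord0) r : set (measurableTypeR R)) `*`
    (ball (\row_j v ord0 (lift ord0 j)) r : set (borel 'rV[R]_n))).
  apply: measurableX; first exact: measurable_ball.
  by apply: sub_sigma_algebra; exact: ball_open.
apply/seteqP; split=> [[x y] [_ /= h]|[x y] [/= hx [_ hy]]].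
  split=> /=.
    by have := h ord0 ord0; rewrite !mxE unlift_none.
  by split=> // i j; have := h ord0 (lift ord0 j); rewrite !mxE liftK !ord1.
split=> // i j; rewrite !ord1; case: (unliftP ord0 j) => [j' ->|->].
  by have := hy ord0 j'; rewrite !mxE liftK.
by rewrite [X in ball _ _ X]mxE unlift_none.
Qed.

Definition uncons_rV (n : nat) (x : borel 'rV[R]_n.+1) :
    (measurableTypeR R * borel 'rV[R]_n)%type :=
  (x ord0 ord0, \row_(j < n) x ord0 (lift ord0 j)).

Lemma cons_rVK (n : nat) : cancel (@cons_rV n) (@uncons_rV n).
Proof.
move=> [x y]; rewrite /uncons_rV mxE unlift_none; congr pair.
by apply/rowP => j; rewrite !mxE liftK.
Qed.

Lemma measurable_uncons_rV (n : nat) : measurable_fun setT (@uncons_rV n).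
Proof.
apply: measurable_fun_pair.
  apply: (@measurability _ _ _ (measurableTypeR R) setT _ (@RGenOpens.G R)).
    exact: RGenOpens.measurableE.
  move=> _ [U + <-]; rewrite /RGenOpens.G setTI => -[a [b ->]].
  apply: sub_sigma_algebra.
  apply: (@open_comp 'rV[R]_n.+1 R (fun x => x ord0 ord0)).
    by move=> x _; exact: coord_continuous.
  exact: interval_open.
apply: (@measurability _ _ _ (borel 'rV[R]_n) setT _ (@open 'rV[R]_n)) => //.
move=> _ [U oU <-]; rewrite setTI; apply: sub_sigma_algebra.
apply: (@open_comp 'rV[R]_n.+1) => // x _ /=.
move=> A /nbhs_ballP[e e0 eA]; apply/(@nbhs_ballP R 'rV[R]_n.+1).
exists e => // y [_ xy]; apply: eA; split => // i j; rewrite !mxE.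
exact: xy.
Qed.

Section step.
Variables (n : nat) (m : {sigma_finite_measure set (borel 'rV[R]_n) -> \bar R}).

Definition lebesgue_cons : set (borel 'rV[R]_n.+1) -> \bar R :=
  pushforward (@lebesgue_measure R \x m) (@cons_rV n).

Let mcons A : measurable A -> measurable (@cons_rV n @^-1` A).
Proof. by move=> mA; rewrite -[X in measurable X]setTI; exact: measurable_cons_rV. Qed.

Let lebesgue_cons0 : lebesgue_cons set0 = 0.
Proof. by rewrite /lebesgue_cons /pushforward preimage_set0 measure0. Qed.

Let lebesgue_cons_ge0 A : 0 <= lebesgue_cons A.
Proof. by rewrite /lebesgue_cons /pushforward measure_ge0. Qed.

Let lebesgue_cons_sigma_additive : semi_sigma_additive lebesgue_cons.
Proof.
move=> F mF tF mUF; rewrite /lebesgue_cons /pushforward preimage_bigcup.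
apply: measure_semi_sigma_additive.
- by move=> k; exact: mcons.
- apply/trivIsetP => i j _ _ ij; rewrite -preimage_setI.
  by move/trivIsetP : tF => ->//; rewrite preimage_set0.
- by rewrite -preimage_bigcup; exact: mcons.
Qed.

HB.instance Definition _ := isMeasure.Build _ _ _ lebesgue_cons
  lebesgue_cons0 lebesgue_cons_ge0 lebesgue_cons_sigma_additive.

Let lebesgue_cons_sigma_finite : sigma_finite setT lebesgue_cons.
Proof.
have /sigma_finiteP[F [FT ndF Foo]] := sigma_finiteT (@lebesgue_measure R).
have /sigma_finiteP[G [GT ndG Goo]] := sigma_finiteT m.
exists (fun k => @uncons_rV n @^-1` (F k `*` G k)).
  apply/seteqP; split => // x _.
  have [i _ Fi] : (\bigcup_k F k) (@uncons_rV n x).1 by rewrite -FT.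
  have [j _ Gj] : (\bigcup_k G k) (@uncons_rV n x).2 by rewrite -GT.
  exists (maxn i j) => //; split => /=.
    by apply: (subsetPset _ _ (ndF _ _ (leq_maxl i j))); exact: Fi.
  by apply: (subsetPset _ _ (ndG _ _ (leq_maxr i j))); exact: Gj.
move=> k; have [mF Fy] := Foo k; have [mG Gy] := Goo k; split.
  rewrite -[X in measurable X]setTI; apply: measurable_uncons_rV => //.
  exact: measurableX.
rewrite /lebesgue_cons /pushforward -comp_preimage.
rewrite (_ : _ \o _ = idfun); last by rewrite funeqE => z; exact: cons_rVK.
rewrite preimage_id product_measure1E//.
by rewrite lte_mul_pinfty// ge0_fin_numE.
Qed.

HB.instance Definition _ := Measure_isSigmaFinite.Build _ _ _ lebesgue_cons
  lebesgue_cons_sigma_finite.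

End step.

Fixpoint lebesgue_rV (n : nat) : {sigma_finite_measure set (borel 'rV[R]_n) -> \bar R} :=
  match n with
  | 0%N => @dirac _ (borel 'rV[R]_0) (0%R : 'rV[R]_0) R
  | n.+1 => lebesgue_cons (lebesgue_rV n)
  end.

End lebesgue_rV.

Section polish.
Variable R : realType.

Definition polish (T : topologicalType) : Prop :=
  exists d : T -> T -> R,
  [/\ [/\ (forall x y, (0 <= d x y)%R),
           (forall x y, d x y = 0%R <-> x = y),
           (forall x y, d x y = d y x)
         & (forall x y z, (d x z <= d x y + d y z)%R)],
      (forall (x : T) (A : set T),
         nbhs x A <-> exists2 e : R, (0 < e)%R & [set y | d x y < e]%R `<=` A),
      (forall u : nat -> T,
         (forall e : R, (0 < e)%R -> exists N : nat, forall i j : nat,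
            (N <= i)%N -> (N <= j)%N -> (d (u i) (u j) < e)%R) ->
         exists l : T, u k @[k --> \oo] --> l)
    & (exists2 D : set T, countable D & dense D)].

End polish.

Section real_functions.
Variable R : realType.
Implicit Types (g h F : R -> R).

Definition Gamma (z : R) : R :=
  (\int[lebesgue_measure]_(x in `]0%R, +oo[) (x `^ (z - 1) * expR (- x)))%R.

Definition regularly_varying_at0 g : Prop :=
  forall x : R, (0 < x)%R ->
    exists l : R, (g (l0 * x) / g l0)%R @[l0 --> 0^'+] --> l.

Definition equivalent_at_infty g h : Prop :=
  (g t / h t)%R @[t --> +oo%R] --> (1 : R)%R.

Definition absolutely_continuous_on (c d : R) F : Prop :=
  forall e : R, (0 < e)%R -> exists2 del : R, (0 < del)%R &
    forall (m : nat) (l r : 'I_m -> R),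
      (forall i, [/\ c <= l i, l i <= r i & r i <= d])%R ->
      trivIset setT (fun i => `]l i, r i[%classic) ->
      (\sum_(i < m) (r i - l i) < del)%R ->
      (\sum_(i < m) `|F (r i) - F (l i)| < e)%R.

(* Absolute continuity on the open half-line is local: the tails considered
   below blow up at 0+, so the epsilon-delta condition can only be required on
   the compact subintervals. *)
Definition absolutely_continuous_pos F : Prop :=
  forall c d : R, (0 < c)%R -> (c <= d)%R -> absolutely_continuous_on c d F.

End real_functions.

Section levy_mixing.
Context {R : realType} {E : ptopologicalType}.
Variables (W : set (borel E)) (p : probability (borel E) R).
Variables (a b : borel E -> R) (nu : R.-sigmafker (borel E) ~> (measurableTypeR R)).

(* E g(Y) for Y with law p on W *)
Definition mean (g : borel E -> \bar R) : \bar R := \int[p]_(y in W) g y.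

Definition truncated_moment (y : borel E) : \bar R :=
  \int[nu y]_(s in `]0%R, +oo[) (Num.min s 1)%:E.

Definition bernstein (lam : R) (y : borel E) : \bar R :=
  (a y)%:E + (b y * lam)%:E +
  \int[nu y]_(s in `]0%R, +oo[) (1 - expR (- (lam * s)))%:E.

Definition nubar (s : R) (y : borel E) : \bar R := (a y)%:E + nu y `]s, +oo[%classic.

Definition assumption_A1 : Prop :=
  [/\ measurable_fun setT a, measurable_fun setT b &
      (exists M : R, forall y, (a y <= M)%R /\ (b y <= M)%R) \/
      (mean (EFin \o a) < +oo /\ mean (EFin \o b) < +oo)].

Definition assumption_A2 : Prop :=
  (exists M : R, forall y, truncated_moment y <= M%:E) \/ mean truncated_moment < +oo.

(* Under assumption_A1 and assumption_A2 the means below are finite (the last one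
   for s > 0), so that fine loses nothing. *)
Definition Ef (lam : R) : R := fine (mean (bernstein lam)).
Definition Eb : R := fine (mean (EFin \o b)).
Definition Enubar (s : R) : R := fine (mean (nubar s)).

Definition convolution (u : R -> R) (t : R) : R :=
  (\int[lebesgue_measure]_(s in `[0%R, t]) (u s * Enubar (t - s)))%R.

Definition distributed_derivative (u : R -> R) (t : R) : R :=
  (Eb * derive1 u t + derive1 (convolution u) t - u 0 * Enubar t)%R.

(* The first term is absent when E b(Y) = 0, and then u itself need not be
   differentiable. *)
Definition distributed_derivable (u : R -> R) (t : R) : Prop :=
  (Eb <> 0%R -> derivable u t 1%R) /\
  derivable (convolution u) t 1%R.

End levy_mixing.

Section euclidean.
Context {R : realType} {n : nat}.
Implicit Types (x : 'rV[R]_n) (phi : 'rV[R]_n -> R).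

Definition sqnorm x : R := (\sum_(i < n) x ord0 i ^+ 2)%R.

Definition partial (i : 'I_n) phi : 'rV[R]_n -> R :=
  fun x => 'D_(delta_mx ord0 i) phi x.

Definition laplacian phi : 'rV[R]_n -> R :=
  fun x => (\sum_(i < n) partial i (partial i phi) x)%R.

Definition smooth phi : Prop := forall s : seq 'I_n,
  continuous (foldr partial phi s) /\
  forall (i : 'I_n) x, derivable (foldr partial phi s) x (delta_mx ord0 i).

Definition test_function phi : Prop :=
  smooth phi /\ compact (closure [set x | phi x != 0%R]).

Definition heat_kernel (s : R) x : R :=
  ((4 * pi * s) `^ (- (n%:R / 2)) * expR (- (sqnorm x / (4 * s))))%R.

End euclidean.

Section fundamental_solution.
Context {R : realType} {E : ptopologicalType}.
Variables (W : set (borel E)) (p : probability (borel E) R).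
Variables (a b : borel E -> R) (nu : R.-sigmafker (borel E) ~> (measurableTypeR R)).
Context {n : nat}.
Implicit Types (q : 'rV[R]_n -> R -> R) (phi : 'rV[R]_n -> R).

(* t |-> int phi(x) q(x,t) dx, with q(x,0)dx the Dirac mass at 0 *)
Definition tested q phi (t : R) : R :=
  if (t <= 0)%R then phi 0%R
  else (\int[lebesgue_rV n]_x (phi x * q x t))%R.

(* q solves the equation in the sense of distributions in x (with the Laplacian
   moved to the test function) and pointwise in t > 0, the measures q(x,t)dx
   depend vaguely continuously on t >= 0 with value the Dirac mass at t = 0,
   and q lies in the class where the Fourier transform in x and the Laplace
   transform in t are defined. *)
Definition fundamental_solution q : Prop :=
  [/\ measurable_fun
        [set z : (borel 'rV[R]_n * measurableTypeR R)%type | (0 < z.2)%R]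
        (fun z => q z.1 z.2 : measurableTypeR R),
      (exists C w : R, forall t : R, (0 < t)%R ->
         \int[lebesgue_rV n]_x `|q x t|%:E <= (C * expR (w * t))%:E)
    & forall phi, test_function phi ->
        {within `[0%R, +oo[%classic, continuous (tested q phi)} /\
        forall t : R, (0 < t)%R ->
          distributed_derivable W p a b nu (tested q phi) t /\
          distributed_derivative W p a b nu (tested q phi) t
            = (\int[lebesgue_rV n]_x (laplacian phi x * q x t))%R].

Definition second_moment q x (t : R) : \bar R :=
  \int[lebesgue_rV n]_u (sqnorm (x - u)%R * q (x - u)%R t)%:E.

End fundamental_solution.

Section processes.
Context {d : measure_display} {Omega : measurableType d} {R : realType}.
Variable P : probability Omega R.

(* sigma-algebra generated by X r, 0 <= r, r in I *)
Definition history d' (T : measurableType d') (X : R -> Omega -> T) (I : set R) :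
    set (set Omega) :=
  <<s [set A | exists r : R, [/\ (0 <= r)%R, I r &
         exists2 B : set T, measurable B & A = X r @^-1` B]] >>.

Definition independent_processes d1 d2 (T1 : measurableType d1)
    (T2 : measurableType d2) (X : R -> Omega -> T1) (Y : R -> Omega -> T2) : Prop :=
  forall A B, history X setT A -> history Y setT B -> P (A `&` B) = P A * P B.

(* Possibly killed subordinator, +oo being the cemetery: on the event that the
   process is alive at time t, the increment after t is independent of the past
   and distributed as the process at time s. *)
Definition subordinator (sig : R -> Omega -> \bar R) : Prop :=
  [/\ [/\ (forall t, (0 <= t)%R -> measurable_fun setT (sig t)),
           (forall w, sig 0%R w = 0),
           (forall w s t, (0 <= s)%R -> (s <= t)%R -> sig s w <= sig t w)
         & (forall w t, (0 <= t)%R -> sig s w @[s --> t^'+] --> sig t w)]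
    & forall s t, (0 <= s)%R -> (0 <= t)%R ->
      forall (A : set Omega) (B : set (\bar R)),
        history sig `[0%R, t] A -> measurable B ->
        P (A `&` [set w | sig t w < +oo /\ B (sig (t + s)%R w - sig t w)])
        = P (A `&` [set w | sig t w < +oo]) * P [set w | B (sig s w)]].

Definition inverse_process (sig : R -> Omega -> \bar R) (t : R) (w : Omega) : \bar R :=
  ereal_inf [set s%:E | s in [set s : R | (0 <= s)%R /\ t%:E < sig s w]].

(* Brownian motion with generator the Laplacian, started at 0 *)
Definition brownian_motion (n : nat) (B : R -> Omega -> borel 'rV[R]_n) : Prop :=
  [/\ (forall t, (0 <= t)%R -> measurable_fun setT (B t)),
      (forall w, B 0%R w = 0%R :> 'rV[R]_n),
      (forall w, {within `[0%R, +oo[%classic,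
         continuous (fun t => B t w : 'rV[R]_n)})
    & forall s t, (0 <= s)%R -> (s < t)%R ->
      forall (A : set Omega) (C : set (borel 'rV[R]_n)),
        history B `[0%R, s] A -> measurable C ->
        P (A `&` [set w | C ((B t w : 'rV[R]_n) - B s w)%R])
        = P A * \int[lebesgue_rV n]_(x in C) (heat_kernel (t - s) x)%:E].

(* Laplace transforms with the convention exp(- +oo) = 0 at the cemetery *)
Definition distributed_order_subordinator (E : ptopologicalType)
    (W : set (borel E)) (p : probability (borel E) R) (a b : borel E -> R)
    (nu : R.-sigmafker (borel E) ~> (measurableTypeR R))
    (sig : R -> Omega -> \bar R) : Prop :=
  subordinator sig /\
  forall lam t : R, (0 < lam)%R -> (0 <= t)%R ->
    \int[P]_w expeR (- (lam%:E * sig t w))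
      = (expR (- (t * Ef W p a b nu lam)))%:E.

End processes.

(* Main.v *)
Require Import Defs.
From HB Require Import structures.
From mathcomp Require Import all_boot all_order all_algebra.
From mathcomp Require Import all_classical all_reals all_analysis.
From mathcomp Require Import measurable_realfun.
From mathcomp Require Import ring lra.

Set Implicit Arguments.
Unset Strict Implicit.
Unset Printing Implicit Defensive.

Import Order.TTheory GRing.Theory Num.Theory.
Import numFieldNormedType.Exports.

Local Open Scope classical_set_scope.
Local Open Scope ring_scope.
Local Open Scope ereal_scope.

(* Write kap = E f(., Y) and L for the inverse subordinator.

   (1) Integrating the equation against exp(- lam t) for lam large gives, for test
   functions phi,
     kap(lam) Q(phi) - Q(Delta phi) = phi(0) kap(lam) / lam,
   where Q(phi) is the Laplace transform of t |-> int phi(x) q(x, t) dx. By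
   truncation this extends to translates of the heat kernels h_r, for which
   Delta h_r = d/dr h_r, so that integration in r gives
     Q(phi) = kap(lam) / lam int_0^oo exp(- kap(lam) s) E phi(B(s)) ds.
   Since int_0^oo exp(- lam t) P(L(t) <= s) dt = (1 - exp(- s kap(lam))) / lam, the
   right-hand side is the Laplace transform of t |-> E phi(B(L(t))). Both functions
   of t are right-continuous, so they coincide, and smoothed indicator functions
   of boxes determine the measure q(x, t) dx.

   (2)-(4) By (1) the second moment is 2 n U(t) with U(t) = E L(t) nondecreasing of
   Laplace transform 1 / (lam kap(lam)), and Karamata's Tauberian theorem gives
   Gamma(1 + alpha) U(t) ~ 1 / kap(1/t). If E a(Y) > 0 then kap >= E a(Y) and U is
   bounded; in general t kap(1/t) = E b(Y) + int_0^oo exp(- s/t) E nubar(s, Y) ds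
   increases to the limit in (4). *)

(** * Integration and the Laplace measures *)

(** The solution [q] may be signed, is only controlled in $L^1(dx)$ with exponential growth in $t$,
    and satisfies the equation only against smooth compactly supported functions. So it is never
    transformed at a fixed [x]: everything goes through its pairing with functions of [x] under the
    product of Lebesgue measure and [lapm lam], the measure exp(- lam t) dt on t > 0, to which
    Fubini, dominated convergence and image measures apply directly. The growth rate [w] restricts
    transforms to [lam > w], and uniqueness is arranged to use only an arithmetic progression of
    rates: the variable exp(- x) turns it into a moment problem on [0, 1], settled by Bernstein
    polynomials. The same moment argument drives the Tauberian theorem. Heat kernels stand in for
    Fourier inversion, because replacing the Laplacian by d/dr leaves a first-order equation in r
    whose decaying solution is an integral over later times. Signs are handled by moving the
    negative part of [q] to the other side of an identity between measures. *)

Section integration.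
Context d (T : measurableType d) (R : realType).
Variable mu : {measure set T -> \bar R}.

Lemma bounded_integrable (f : T -> R) (M : R) : mu setT < +oo ->
  measurable_fun setT f -> (forall x, `|f x| <= M)%R ->
  mu.-integrable setT (EFin \o f).
Proof.
move=> mufin mf fM; apply: measurable_bounded_integrable => //.
exists M; split; first exact: num_real.
by move=> A MA x _ /=; rewrite (le_trans (fM x))// ltW.
Qed.

Lemma integrable_EFinP (f : T -> R) : mu.-integrable setT (EFin \o f) ->
  measurable_fun setT f /\ \int[mu]_x `|f x|%:E < +oo.
Proof.
move=> /integrableP[/measurable_EFinP mf fin]; split => //.
Qed.

Lemma EFin_Rintegral (f : T -> R) : mu.-integrable setT (EFin \o f) ->
  (\int[mu]_x f x)%:E = \int[mu]_x (f x)%:E.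
Proof. by move=> intf; rewrite /Rintegral fineK//; exact: integrable_fin_num. Qed.

Lemma le_integrable_EFin (f g : T -> R) : measurable_fun setT f ->
  (forall x, `|f x| <= g x)%R -> mu.-integrable setT (EFin \o g) ->
  mu.-integrable setT (EFin \o f).
Proof.
move=> mf fg ig; apply: le_integrable ig => //; first exact/measurable_EFinP.
by move=> x _ /=; rewrite lee_fin (le_trans (fg x))// ler_norm.
Qed.

Lemma normr_Rintegral_le (f g : T -> R) : measurable_fun setT f ->
  (forall x, `|f x| <= g x)%R -> mu.-integrable setT (EFin \o g) ->
  (`|\int[mu]_x f x| <= \int[mu]_x g x)%R.
Proof.
move=> mf fg ig; have intf := le_integrable_EFin mf fg ig.
apply: (le_trans (le_normr_Rintegral measurableT intf)).
apply: le_Rintegral => //; exact: integrable_norm.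
Qed.

Lemma Rintegral_dct_ae (f_ : nat -> T -> R) (f g : T -> R) :
  (forall n, measurable_fun setT (f_ n)) -> measurable_fun setT f ->
  {ae mu, forall x, f_ n x @[n --> \oo] --> f x} ->
  mu.-integrable setT (EFin \o g) -> (forall n x, `|f_ n x| <= g x)%R ->
  (\int[mu]_x f_ n x @[n --> \oo] --> \int[mu]_x f x)%R.
Proof.
move=> mf_ mf f_f ig f_g.
have [||||intf _ h] := @dominated_convergence _ _ _ mu setT measurableT
    (fun n => EFin \o f_ n) (EFin \o f) (EFin \o g) _ _ _ ig.
- by move=> n; exact/measurable_EFinP.
- exact/measurable_EFinP.
- by apply: filterS f_f => x fx _ /=; apply: cvg_EFin => //; exact: nearW.
- by apply: aeW => x n _ /=; rewrite lee_fin.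
have intf_ n : mu.-integrable setT (EFin \o f_ n).
  exact: le_integrable_EFin (f_g n) ig.
apply: fine_cvg; rewrite fineK; first exact: h.
exact: integrable_fin_num intf.
Qed.

Lemma Rintegral_dct (f_ : nat -> T -> R) (f g : T -> R) :
  (forall n, measurable_fun setT (f_ n)) ->
  (forall x, f_ n x @[n --> \oo] --> f x) ->
  mu.-integrable setT (EFin \o g) -> (forall n x, `|f_ n x| <= g x)%R ->
  (\int[mu]_x f_ n x @[n --> \oo] --> \int[mu]_x f x)%R.
Proof.
move=> mf_ f_f ig f_g; apply: Rintegral_dct_ae ig f_g => //; last exact: aeW.
by apply: (@measurable_fun_cvg _ _ _ _ f_) => // x _; exact: f_f.
Qed.

End integration.

Section fubini_real.
Context d1 d2 (T1 : measurableType d1) (T2 : measurableType d2) (R : realType).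
Variable m1 : {sigma_finite_measure set T1 -> \bar R}.
Variable m2 : {sigma_finite_measure set T2 -> \bar R}.
Variable f : T1 * T2 -> R.

Hypothesis intf : (m1 \x m2).-integrable setT (EFin \o f).

Let mf : measurable_fun setT f.
Proof. by have [] := integrable_EFinP intf. Qed.

(** The inner integral, read as a real number through [fine], differs from the extended one only
    where the latter is infinite, and integrability makes this a null set. *)
Lemma Rfubini1 :
  (\int[m1 \x m2]_z f z = \int[m1]_x \int[m2]_y f (x, y))%R.
Proof.
rewrite /Rintegral -fubini1//; congr fine.
apply: ae_eq_integral => //.
- exact: measurable_fubini_F intf.
- apply/measurable_EFinP; apply: measurableT_comp => //.
  exact: measurable_fubini_F intf.
- have := integrable_ae measurableT (integrable_fubini_F intf).
  by apply: filterS => x /(_ I) h _; rewrite fineK.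
Qed.

Lemma Rfubini2 :
  (\int[m1 \x m2]_z f z = \int[m2]_y \int[m1]_x f (x, y))%R.
Proof.
rewrite /Rintegral -fubini2//; congr fine.
apply: ae_eq_integral => //.
- exact: measurable_fubini_G intf.
- apply/measurable_EFinP; apply: measurableT_comp => //.
  exact: measurable_fubini_G intf.
- have := ae_integrable2 intf.
  by apply: filterS => x h _; rewrite fineK//; exact: integrable_fin_num h.
Qed.

Lemma Rfubini :
  (\int[m1]_x \int[m2]_y f (x, y) = \int[m2]_y \int[m1]_x f (x, y))%R.
Proof. by rewrite -Rfubini1 Rfubini2. Qed.

End fubini_real.

(** The integrand is dominated by $|Q(x)|\,|K(y)|$, whose iterated integral factors into two finite
    ones. *)
Lemma Rfubini_bounded d1 d2 (T1 : measurableType d1) (T2 : measurableType d2)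
    (R : realType) (m1 : {sigma_finite_measure set T1 -> \bar R})
    (m2 : {sigma_finite_measure set T2 -> \bar R}) (k : T1 * T2 -> R)
    (Q : T1 -> R) (K : T2 -> R) :
  measurable_fun setT k -> (forall x y, `|k (x, y)| <= K y)%R ->
  m1.-integrable setT (EFin \o Q) -> m2.-integrable setT (EFin \o K) ->
  (m1 \x m2).-integrable setT (EFin \o (fun z => k z * Q z.1)%R).
Proof.
move=> mk kK intQ intK.
have [mQ Qoo] := integrable_EFinP intQ; have [mK Koo] := integrable_EFinP intK.
have mkQ : measurable_fun setT (EFin \o (fun z : T1 * T2 => k z * Q z.1)%R).
  apply/measurable_EFinP; apply: measurable_funM => //.
  exact: measurableT_comp.
apply/(integrable12ltyP _ _ mkQ) => /=.
apply: (@le_lt_trans _ _ (\int[m1]_x \int[m2]_y (`|Q x|%:E * `|K y|%:E))).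
  apply: ge0_le_integral => //.
  - by move=> x _; exact: integral_ge0.
  - apply: (measurable_fun_fubini_tonelli_F (fun z => `|(k z * Q z.1)%:E|)) => //.
    exact: measurableT_comp.
  - apply: (measurable_fun_fubini_tonelli_F (fun z => `|Q z.1|%:E * `|K z.2|%:E)) => //.
    apply: emeasurable_funM; apply/measurable_EFinP; apply: measurableT_comp => //;
      exact: measurableT_comp.
  - move=> x _; apply: ge0_le_integral => //.
    + apply/measurable_EFinP; apply: measurableT_comp => //.
      by apply: measurable_funM => //; exact: measurableT_comp.
    + by apply: emeasurable_funM => //; apply/measurable_EFinP; exact: measurableT_comp.
    + move=> y _; rewrite -EFinM lee_fin normrM mulrC ler_wpM2l//.
      by rewrite (le_trans (kK x y))// ler_norm.
under eq_integral => x _.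
  rewrite ge0_integralZl//; last first.
    by apply/measurable_EFinP; exact: measurableT_comp.
  over.
have Kfin : \int[m2]_y `|K y|%:E \is a fin_num.
  by rewrite ge0_fin_numE ?integral_ge0.
rewrite ge0_integralZr//.
- by rewrite lte_mul_pinfty// ?integral_ge0// ge0_fin_numE ?integral_ge0.
- by apply/measurable_EFinP; exact: measurableT_comp.
- exact: integral_ge0.
Qed.

(** * Measures given by a nonnegative density *)

Section density.
Import HBNNSimple.

Section density_measure.
Context d (T : measurableType d) (R : realType).
Variables (mu : {measure set T -> \bar R}) (g : T -> R).
Hypotheses (mg : measurable_fun setT g) (g0 : forall x, (0 <= g x)%R).

(** The two proofs are arguments so that the measure structure declared below, which depends on
    them, can be inferred from the term. *)
Definition density_measure of measurable_fun setT g & (forall x, (0 <= g x)%R) :=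
  fun A : set T => \int[mu]_(x in A) (g x)%:E.

Let density0 : density_measure mg g0 set0 = 0.
Proof. by rewrite /density_measure integral_set0. Qed.

Let density_ge0 A : 0 <= density_measure mg g0 A.
Proof. by apply: integral_ge0 => x _; rewrite lee_fin. Qed.

Let density_sigma_additive : semi_sigma_additive (density_measure mg g0).
Proof.
move=> /= F mF tF mUF; rewrite /density_measure; apply: cvg_toP.
  apply: ereal_nondecreasing_is_cvgn => m n mn.
  by apply: lee_sum_nneg_natr => // k _ _; apply: integral_ge0 => /= x Fkx; rewrite lee_fin.
rewrite ge0_integral_bigcup//=; first exact/measurable_funTS/measurable_EFinP.
by move=> x _; rewrite lee_fin.
Qed.

HB.instance Definition _ := isMeasure.Build _ _ _ (density_measure mg g0)
  density0 density_ge0 density_sigma_additive.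

End density_measure.

(** Both sides are limits along simple functions increasing to [f], and on indicators the identity
    is the hypothesis. The measure [nu] is only required to agree with the density on measurable
    sets, so that image measures and restrictions of P are covered too. *)
Lemma ge0_integral_density d (T : measurableType d) (R : realType)
    (nu mu : {measure set T -> \bar R}) (g : T -> R) (f : T -> \bar R) :
  measurable_fun setT g -> (forall x, (0 <= g x)%R) ->
  (forall A, measurable A -> nu A = \int[mu]_(x in A) (g x)%:E) ->
  measurable_fun setT f -> (forall x, 0 <= f x) ->
  \int[nu]_x f x = \int[mu]_x (f x * (g x)%:E).
Proof.
move=> mg g0 nuE mf f0.
pose f_ := nnsfun_approx measurableT mf.
have md : measurable_fun setT (EFin \o g).
  by apply/measurable_EFinP; exact: mg.
transitivity (limn (fun n => \int[nu]_x (f_ n x)%:E)).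
  rewrite -monotone_convergence//.
  - apply: eq_integral => y _; apply/esym/cvg_lim => //.
    exact: cvg_nnsfun_approx.
  - by move=> n; apply/measurable_EFinP; exact: measurable_funP.
  - by move=> n y _; rewrite lee_fin.
  - by move=> y _ m n mn; rewrite lee_fin; exact/lefP/nd_nnsfun_approx.
transitivity (limn (fun n => \int[mu]_x ((f_ n x)%:E * (g x)%:E))); last first.
  rewrite -monotone_convergence//.
  - apply: eq_integral => y _; apply/cvg_lim => //.
    apply: cvgeZr => //; exact: cvg_nnsfun_approx.
  - by move=> n; apply: emeasurable_funM => //; exact/measurable_EFinP.
  - by move=> n y _; rewrite mule_ge0// lee_fin// g0.
  - move=> y _ m n mn; rewrite lee_wpmul2r// ?lee_fin ?g0//.
    exact/lefP/nd_nnsfun_approx.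
congr (limn _); apply/funext => n.
rewrite integralT_nnsfun sintegralE.
under [RHS]eq_integral => x _.
  rewrite fimfunE -fsumEFin// ge0_mule_fsuml//; last first.
    by move=> r; exact: nnfun_muleindic_ge0.
  over.
rewrite ge0_integral_fsum//; last 2 first.
- move=> r; apply: emeasurable_funM => //; exact/measurable_EFinP/measurable_funM.
- by move=> r x _; rewrite mule_ge0// ?lee_fin ?g0//; exact: nnfun_muleindic_ge0.
apply: eq_fsbigr => r; rewrite inE => -[y _ <-].
under [RHS]eq_integral => x _ do rewrite EFinM -muleA.
rewrite ge0_integralZl//; last 3 first.
- by apply: emeasurable_funM => //; apply/measurable_EFinP.
- by move=> x _; rewrite mule_ge0 ?lee_fin ?g0.
- by rewrite lee_fin.
congr (_ * _); rewrite /= nuE// integral_mkcond; apply: eq_integral => x _.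
rewrite patchE indicE; case: ifPn => _; by rewrite ?mul1e ?mul0e.
Qed.

End density.

(** * The measures exp(- lam x) dx on the positive half-line *)

Section lapm.
Context {R : realType}.
Implicit Types lam x s : R.
Local Notation mu := (@lebesgue_measure R).

Definition lapdens lam x : R := (\1_(`]0%R, +oo[%classic : set R) x * expR (- (lam * x)))%R.

Lemma lapdens_ge0 lam x : (0 <= lapdens lam x)%R.
Proof. by rewrite mulr_ge0// ?expR_ge0// indicE. Qed.

Lemma measurable_lapdens lam : measurable_fun setT (lapdens lam).
Proof.
apply: measurable_funM => //; apply: measurableT_comp => //.
by apply: measurableT_comp => //; exact: measurable_funM.
Qed.

(* Laplace transforms at lam are integrals against this measure. *)
Definition lapm lam : set (measurableTypeR R) -> \bar R :=
  density_measure mu (@measurable_lapdens lam) (lapdens_ge0 lam).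

HB.instance Definition _ lam := Measure.copy (lapm lam)
  (density_measure mu (@measurable_lapdens lam) (lapdens_ge0 lam)).

(** The mass is infinite for [lam <= 0], but on ]-n, n[ the density stays below exp(|lam| n); the
    structure thus exists for every real [lam]. *)
Let lapm_sigma_finite lam : sigma_finite setT (lapm lam).
Proof.
exists (fun n : nat => `](- n%:R)%R, (n%:R : R)[%classic).
  apply/seteqP; split => // x _; exists (Num.truncn `|x|).+1 => //=.
  by rewrite in_itv/= -ltr_norml; exact: truncnS_gt.
move=> n; split => //.
rewrite /lapm /density_measure.
apply: (@le_lt_trans _ _ (\int[mu]_(x in `](- n%:R)%R, (n%:R : R)[) (cst (expR (`|lam| * n%:R))%:E x))).
  apply: ge0_le_integral => //.
  - by move=> x _; rewrite lee_fin lapdens_ge0.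
  - by apply/measurable_funTS/measurable_EFinP; exact: measurable_lapdens.
  - move=> x /=; rewrite in_itv/= => nx.
    rewrite lee_fin /lapdens indicE; case: (_ \in _); last by rewrite mul0r expR_ge0.
    rewrite mul1r ler_expR (le_trans (ler_norm _))// normrN normrM ler_wpM2l//.
    by rewrite ltW// ltr_norml.
rewrite integral_cst//= lebesgue_measure_itv/=.
by case: ifP => _; rewrite -?EFinD -?EFinM ?mule0 ltry.
Qed.

HB.instance Definition _ lam := Measure_isSigmaFinite.Build _ _ _ (lapm lam)
  (lapm_sigma_finite lam).

Lemma ge0_integral_lapm lam (f : measurableTypeR R -> \bar R) :
  measurable_fun setT f -> (forall x, 0 <= f x) ->
  \int[lapm lam]_x f x = \int[mu]_x (f x * (lapdens lam x)%:E).
Proof.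
apply: ge0_integral_density; first exact: measurable_lapdens.
  by move=> x; exact: lapdens_ge0.
by move=> A mA.
Qed.

Lemma ge0_integral_lapm_itv lam (f : measurableTypeR R -> \bar R) :
  measurable_fun setT f -> (forall x, 0 <= f x) ->
  \int[lapm lam]_x f x =
  \int[mu]_(x in `]0%R, +oo[) (f x * (expR (- (lam * x)))%:E).
Proof.
move=> mf f0; rewrite ge0_integral_lapm// [RHS]integral_mkcond.
apply: eq_integral => x _; rewrite patchE /lapdens indicE.
by case: ifPn => _; rewrite ?mul1r ?mul0r ?mule0.
Qed.

Lemma lapm_tail lam s : (0 < lam)%R -> (0 <= s)%R ->
  lapm lam `]s, +oo[%classic = (expR (- (lam * s)) / lam)%:E.
Proof.
move=> l0 s0.
transitivity (\int[mu]_(x in `[s, +oo[) (expR (- (lam * x)))%:E).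
  rewrite /lapm -[in RHS]integral_itv_obnd_cbnd; last first.
    apply/measurable_funTS/measurable_EFinP; apply: measurableT_comp => //.
    by apply: measurableT_comp => //; exact: measurable_funM.
  apply: eq_integral => x; rewrite inE/= in_itv/= andbT => sx.
  rewrite /lapdens indicE mem_set ?mul1r//= in_itv/= andbT.
  exact: le_lt_trans sx.
have D (x : R) : is_derive x (1:R)%R (fun y : R => - (expR (- (lam * y)) / lam))%R (expR (- (lam * x))).
  apply: is_derive_eq.
  by rewrite /GRing.scale/= !mulr1; field; rewrite gt_eqF.
rewrite (@ge0_continuous_FTC2y _ _ (fun y => - (expR (- (lam * y)) / lam))%R s 0%R).
- by rewrite sub0e EFinN oppeK.
- by move=> x _; exact: expR_ge0.
- apply: continuous_subspaceT => x.
  apply: continuous_comp; last exact: continuous_expR.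
  by apply: continuousN; apply: mulrl_continuous.
- rewrite -(@oppr0 R); apply: cvgN; rewrite -(mul0r (lam^-1)%R); apply: cvgMl.
  apply: (@cvg_comp _ _ _ (fun x => lam * x)%R (fun z => expR (- z))%R _ (pinfty_nbhs R)).
    exact: gt0_cvgMry.
  exact: cvgr_expR.
- by move=> x _; have [] := D x.
- apply: cvg_at_right_filter.
  have [/derivable1_diffP/differentiable_continuous cs _] := D s; exact: cs.
- by move=> x _; rewrite derive1E; have [_ ->] := D x.
Qed.

Lemma lapm_ctail lam s : lapm lam `[s, +oo[%classic = lapm lam `]s, +oo[%classic.
Proof.
rewrite /lapm /density_measure integral_itv_obnd_cbnd//.
by apply/measurable_funTS/measurable_EFinP; exact: measurable_lapdens.
Qed.

Lemma lapm_le0 lam (A : set R) : measurable A -> A `<=` `]-oo, 0%R]%classic -> lapm lam A = 0.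
Proof.
move=> mA A0; rewrite /lapm /density_measure integral0_eq// => x /A0 /=; rewrite in_itv/= => x0.
by rewrite /lapdens indicE memNset ?mul0r//= in_itv/= andbT ltNge x0.
Qed.

Lemma lapmT lam : (0 < lam)%R -> lapm lam setT = lam^-1%:E.
Proof.
move=> l0; have := lapm_tail l0 (lexx 0%R); rewrite mulr0 oppr0 expR0 mul1r => <-.
rewrite [LHS](_ : _ = lapm lam (`]-oo, 0%R]%classic `|` `]0%R, +oo[%classic)).
  by rewrite setUC measureU0//; exact: lapm_le0.
by congr (lapm _ _); apply/seteqP; split => // x _ /=; rewrite !in_itv/= andbT; case: leP; [left|right].
Qed.

Lemma lapmT_fin lam : (0 < lam)%R -> lapm lam setT < +oo.
Proof. by move=> l0; apply: (@le_lt_trans _ _ (lam^-1)%:E); rewrite ?ltry// -lapmT. Qed.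

(** A null interval would give equal tails at [s] and [t], against the injectivity of the
    exponential. *)
Lemma lapm_itv_gt0 lam s t : (0 < lam)%R -> (0 <= s)%R -> (s < t)%R ->
  0 < lapm lam `]s, t]%classic.
Proof.
move=> l0 s0 st; rewrite lt0e measure_ge0 andbT; apply/eqP => h.
have : lapm lam `]s, +oo[%classic = lapm lam (`]s, t]%classic `|` `]t, +oo[%classic).
  congr (lapm _ _); apply/seteqP; split => x /=; rewrite !in_itv/= !andbT.
    by move=> sx; rewrite sx/=; case: (leP x t); [left|right].
  by case=> [/andP[]//|]; exact: lt_trans.
have t0 : (0 <= t)%R := le_trans s0 (ltW st).
have -> : lapm lam (`]s, t]%classic `|` `]t, +oo[%classic) = lapm lam `]t, +oo[%classic.
  by rewrite setUC; exact: measureU0.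
rewrite !lapm_tail//.
move=> e; have {e} e := EFin_inj e.
move: e => /(mulIf (invr_neq0 (lt0r_neq0 l0)))/expR_inj/oppr_inj/(mulfI (lt0r_neq0 l0)) e.
by rewrite e ltxx in st.
Qed.

Lemma integrable_lapm_dens lam (f : R -> R) : measurable_fun setT f ->
  (lapm lam).-integrable setT (EFin \o f) <->
  mu.-integrable setT (EFin \o (fun x => f x * lapdens lam x)%R).
Proof.
move=> mf.
have mfd : measurable_fun setT (fun x => f x * lapdens lam x)%R.
  by apply: measurable_funM => //; exact: measurable_lapdens.
have e : \int[lapm lam]_x `|(f x)%:E| = \int[mu]_x `|(f x * lapdens lam x)%:E|.
  rewrite ge0_integral_lapm//; last by apply: measurableT_comp => //; exact/measurable_EFinP.
  apply: eq_integral => x _ /=; rewrite -EFinM normrM; congr (_ * _)%:E.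
  by rewrite ger0_norm// lapdens_ge0.
split=> /integrableP[_ fin]; apply/integrableP; split => /=; first exact/measurable_EFinP.
- by rewrite -e.
- exact/measurable_EFinP.
- by rewrite e.
Qed.

Lemma Rintegral_lapm lam (f : R -> R) : (lapm lam).-integrable setT (EFin \o f) ->
  (\int[lapm lam]_x f x = \int[mu]_x (f x * lapdens lam x))%R.
Proof.
move=> intf; have [mf _] := integrable_EFinP intf.
rewrite /Rintegral; congr fine; rewrite integralE [RHS]integralE.
rewrite !ge0_integral_lapm//; last 2 first.
- by apply: measurable_funeneg; exact/measurable_EFinP.
- by apply: measurable_funepos; exact/measurable_EFinP.
congr (_ - _); apply: eq_integral => x _.
- by rewrite !funeposE -EFin_max -EFinM -EFin_max maxr_pMl ?lapdens_ge0// mul0r.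
- by rewrite !funenegE -!EFinN -!EFin_max -EFinM maxr_pMl ?lapdens_ge0// mul0r mulNr.
Qed.

(** The absolute value keeps the factor bounded by 1 on the whole line; on positive [x], the only
    points that the measures charge, it changes nothing. *)
Lemma Rintegral_lapm_shift lam k (f : R -> R) : (0 <= k)%R ->
  (lapm lam).-integrable setT (EFin \o f) ->
  (lapm (lam + k)).-integrable setT (EFin \o f) /\
  (\int[lapm (lam + k)]_x f x = \int[lapm lam]_x (expR (- (k * `|x|)) * f x))%R.
Proof.
move=> k0 intf; have [mf _] := integrable_EFinP intf.
have mk : measurable_fun setT (fun x : measurableTypeR R => expR (- (k * `|x|)))%R.
  apply: measurableT_comp => //; apply: measurableT_comp => //.
  by apply: measurable_funM => //; exact: measurableT_comp.
have intk : (lapm lam).-integrable setT (EFin \o (fun x => expR (- (k * `|x|)) * f x)%R).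
  apply: (le_integrable_EFin _ _ (integrable_norm intf)).
    exact: measurable_funM.
  move=> x; rewrite normrM ler_piMl// ger0_norm ?expR_ge0//.
  by rewrite expR_le1 oppr_le0 mulr_ge0.
have e : (fun x => f x * lapdens (lam + k) x)%R =
    (fun x => expR (- (k * `|x|)) * f x * lapdens lam x)%R.
  apply/funext => x; rewrite /lapdens indicE.
  have [|_] := boolP (x \in _); last by rewrite !mul0r !mulr0.
  rewrite inE/= in_itv/= andbT => x0; rewrite !mul1r gtr0_norm// mulrDl opprD expRD.
  by rewrite mulrAC mulrC [in RHS]mulrAC -!mulrA [in LHS]mulrC -!mulrA; ring.
have intk' : (lapm (lam + k)).-integrable setT (EFin \o f).
  apply/integrable_lapm_dens => //; rewrite e; apply/integrable_lapm_dens => //.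
  exact: measurable_funM.
split; first exact: intk'.
by rewrite (Rintegral_lapm intk') (Rintegral_lapm intk) e.
Qed.

End lapm.

#[global] Opaque lapm.

(** * Bernstein approximation and uniqueness of Laplace transforms *)

Lemma integrable_mull d (T : measurableType d) (R : realType)
    (mu : {measure set T -> \bar R}) (f : T -> R) (k : R) :
  mu.-integrable setT (EFin \o f) -> mu.-integrable setT (EFin \o (fun x => k * f x)%R).
Proof. by move=> intf; exact: (integrableZl measurableT k intf). Qed.

Section weierstrass.
Variable R : realType.
Implicit Types (g : nat -> R) (y a : R).
Local Open Scope ring_scope.

(* The Bernstein polynomial sum_j C(m,j) g(j) X^j (1-X)^(m-j), presented through
   the recursion obtained by conditioning on the first of m coin flips. *)
Fixpoint bernstein_poly (m : nat) g : {poly R} :=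
  if m is m'.+1 then
    'X * bernstein_poly m' (g \o succn) + (1 - 'X) * bernstein_poly m' g
  else (g 0%N)%:P.

Lemma bernstein_polyS m g y : (bernstein_poly m.+1 g).[y] =
  y * (bernstein_poly m (g \o succn)).[y] + (1 - y) * (bernstein_poly m g).[y].
Proof. by rewrite /= !hornerE. Qed.

Lemma bernstein_poly_le m g h y : 0 <= y <= 1 -> (forall j, g j <= h j) ->
  (bernstein_poly m g).[y] <= (bernstein_poly m h).[y].
Proof.
move=> /andP[y0 y1]; elim: m g h => [|m IH] g h gh; first by rewrite /= !hornerE.
rewrite !bernstein_polyS; apply: lerD; rewrite ler_wpM2l ?subr_ge0//; apply: IH => //.
by move=> j; exact: gh.
Qed.

Lemma bernstein_polyD m g h y : (bernstein_poly m (fun j => g j + h j)).[y] =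
  (bernstein_poly m g).[y] + (bernstein_poly m h).[y].
Proof.
elim: m g h => [|m IH] g h; first by rewrite /= !hornerE.
rewrite !bernstein_polyS -[_ \o _]/(fun j => (g \o succn) j + (h \o succn) j) !IH; ring.
Qed.

Lemma bernstein_polyM m c g y : (bernstein_poly m (fun j => c * g j)).[y] =
  c * (bernstein_poly m g).[y].
Proof.
elim: m g => [|m IH] g; first by rewrite /= !hornerE.
rewrite !bernstein_polyS -[_ \o _]/(fun j => c * (g \o succn) j) !IH; ring.
Qed.

Lemma bernstein_poly_cst m c y : (bernstein_poly m (fun=> c)).[y] = c.
Proof.
elim: m => [|m IH]; first by rewrite /= !hornerE.
by rewrite bernstein_polyS -[_ \o _]/(fun=> c) !IH; ring.
Qed.

(** The second moment about [a] of a binomial variable: variance plus squared bias. The induction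
    needs an arbitrary centre, since a success on the first flip moves it to [a - 1]. *)
Lemma bernstein_poly_var m a y : (bernstein_poly m (fun j => (j%:R - a) ^+ 2)).[y] =
  m%:R * (y * (1 - y)) + (m%:R * y - a) ^+ 2.
Proof.
elim: m a => [|m IH] a; first by rewrite /= !hornerE; ring.
rewrite bernstein_polyS (_ : _ \o _ = (fun j => (j%:R - (a - 1)) ^+ 2)); last first.
  by apply/funext => j /=; rewrite -natr1; ring.
by rewrite !IH -natr1; ring.
Qed.

(** Instead of splitting near and far values of j/m, the error t = |j/m - y| is bounded by $e/2 +
    t^2/(2e)$, so that only the binomial variance enters; its contribution is at most e/2 as soon as
    $m \ge e^{-2}$. *)
Lemma weierstrass_lipschitz (c : R -> R) (e : R) : 0 < e ->
  (forall x y, `|c x - c y| <= `|x - y|) ->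
  exists p : {poly R}, forall y, 0 <= y <= 1 -> `|p.[y] - c y| <= e.
Proof.
move=> e0 lipc; set m := (Num.truncn (e ^- 2)).+1.
have m0 : 0 < m%:R :> R by rewrite ltr0n.
have me : e ^- 2 <= m%:R by apply/ltW; exact: truncnS_gt.
exists (bernstein_poly m (fun j => c (j%:R / m%:R))) => y y01.
pose D (j : nat) : R := e / 2 + (2 * e * m%:R ^+ 2)^-1 * (j%:R - m%:R * y) ^+ 2.
have cD j : `|c (j%:R / m%:R) - c y| <= D j.
  apply: (le_trans (lipc _ _)).
  set t := `|_|.
  have -> : D j = e / 2 + t ^+ 2 / (2 * e).
    rewrite /D /t real_normK ?num_real//; field.
    by rewrite !gt_eqF.
  rewrite -subr_ge0 (_ : _ - _ = (t - e) ^+ 2 / (2 * e)).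
    by rewrite divr_ge0 ?sqr_ge0// mulr_ge0// ltW.
  by field; rewrite gt_eqF.
have DE : (bernstein_poly m D).[y] <= e.
  rewrite bernstein_polyD bernstein_poly_cst bernstein_polyM bernstein_poly_var.
  rewrite subrr expr0n addr0 [leRHS]splitr lerD2l.
  have /andP[y0 y1] := y01.
  have yy : y * (1 - y) <= 1 by nra.
  rewrite mulrC ler_pdivrMr ?mulr_gt0 ?exprn_gt0//.
  apply: (@le_trans _ _ m%:R).
    by rewrite -[leRHS]mulr1 ler_wpM2l// ltW.
  rewrite (_ : e / 2 * (2 * e * m%:R ^+ 2) = e ^+ 2 * m%:R * m%:R); last by field.
  rewrite ler_peMl ?(ltW m0)// -ler_pdivrMl ?exprn_gt0//.
  by rewrite mulr1.
have := @bernstein_poly_le m (fun j => c (j%:R / m%:R)) (fun j => c y + D j) y y01.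
have := @bernstein_poly_le m (fun j => c y + (-1) * D j) (fun j => c (j%:R / m%:R)) y y01.
rewrite !(bernstein_polyD _ (fun=> c y)) bernstein_poly_cst => h1 h2.
rewrite ler_norml; apply/andP; split.
  rewrite lerBrDl; apply: le_trans (h1 _).
    by rewrite lerD2l bernstein_polyM mulN1r lerN2.
  by move=> j; have := cD j; rewrite ler_norml => /andP[]; lra.
rewrite lerBlDl; apply: (le_trans (h2 _)); last by rewrite lerD2l.
by move=> j; have := cD j; rewrite ler_norml => /andP[]; lra.
Qed.

End weierstrass.

(** * From moments of a [0, 1]-valued function to Lipschitz observables *)

Section moment_convergence.
Context d (T : measurableType d) (R : realType).
Variable mu : {measure set T -> \bar R}.
Variable Y : T -> R.
Hypotheses (mY : measurable_fun setT Y) (Y01 : forall x, (0 <= Y x <= 1)%R).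
Local Open Scope ring_scope.

Let normY x : `|Y x| <= 1.
Proof. by have /andP[y0 y1] := Y01 x; rewrite ger0_norm. Qed.

Lemma integrable_bndM (h V : T -> R) (M : R) : measurable_fun setT h ->
  (forall x, `|h x| <= M) -> mu.-integrable setT (EFin \o V) ->
  mu.-integrable setT (EFin \o (fun x => h x * V x)).
Proof.
move=> mh hM intV; have [mV _] := integrable_EFinP intV.
apply: (@le_integrable_EFin _ _ _ _ _ (fun x => M * `|V x|)).
- exact: measurable_funM.
- by move=> x; rewrite normrM ler_wpM2r.
- by apply: integrable_mull; exact: integrable_norm.
Qed.

Let integrable_poly (p : {poly R}) (V : T -> R) :
  mu.-integrable setT (EFin \o V) ->
  measurable_fun setT (fun x => p.[Y x]) /\
  mu.-integrable setT (EFin \o (fun x => p.[Y x] * V x)).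
Proof.
move=> intV.
have mp : measurable_fun setT (fun x => p.[Y x]).
  elim/poly_ind: p => [|p c IH].
    by rewrite (_ : (fun x => _) = cst 0)//; apply/funext => x; rewrite horner0.
  under eq_fun do rewrite !hornerE.
  by apply: measurable_funD => //; exact: measurable_funM.
split => //.
suff [M pM] : exists M, forall x, `|p.[Y x]| <= M by exact: (integrable_bndM mp pM).
elim/poly_ind: p {mp} => [|p c [M IH]].
  by exists 0 => x; rewrite hornerE normr0.
exists (M + `|c|) => x; rewrite !hornerE (le_trans (ler_normD _ _))// lerD2r.
by rewrite normrM (le_trans _ (IH x))// ler_piMr.
Qed.

Lemma integrable_lipschitz (c : R -> R) (W : T -> R) :
  (forall x y, `|c x - c y| <= `|x - y|) -> mu.-integrable setT (EFin \o W) ->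
  mu.-integrable setT (EFin \o (fun x => c (Y x) * W x)).
Proof.
move=> lipc.
have cc : continuous c.
  move=> x; apply/cvgrPdist_lt => e e0; near=> y.
  by rewrite (le_lt_trans (lipc _ _))//; near: y; exact: cvgr_dist_lt.
have mcY : measurable_fun setT (c \o Y).
  by apply: measurableT_comp => //; exact: continuous_measurable_fun.
have bndc x : `|c (Y x)| <= `|c 0| + 1.
  rewrite -[c (Y x)](subrK (c 0)) addrC (le_trans (ler_normD _ _))// lerD2l.
  by rewrite (le_trans (lipc _ _))// subr0.
exact: integrable_bndM.
Unshelve. all: by end_near. Qed.

(** Polynomials converge by linearity. Replacing [c] by a uniformly close polynomial costs the
    distance times the total mass, and the masses stay bounded because the moment of order 0
    converges. *)
Lemma moment_cvg (I : Type) (F : set_system I) {FF : Filter F}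
    (V_ : I -> T -> R) (V : T -> R) (c : R -> R) :
  (forall i x, 0 <= V_ i x) -> (forall x, 0 <= V x) ->
  (forall i, mu.-integrable setT (EFin \o V_ i)) ->
  mu.-integrable setT (EFin \o V) ->
  (forall k : nat, \int[mu]_x (Y x ^+ k * V_ i x) @[i --> F] -->
     \int[mu]_x (Y x ^+ k * V x)) ->
  (forall x y, `|c x - c y| <= `|x - y|) ->
  \int[mu]_x (c (Y x) * V_ i x) @[i --> F] --> \int[mu]_x (c (Y x) * V x).
Proof.
move=> V_0 V0 intV_ intV hk lipc.
have poly_cvg (p : {poly R}) :
    \int[mu]_x (p.[Y x] * V_ i x) @[i --> F] --> \int[mu]_x (p.[Y x] * V x).
  have H (W : T -> R) : mu.-integrable setT (EFin \o W) ->
      \int[mu]_x (p.[Y x] * W x) = \sum_(k < size p) p`_k * \int[mu]_x (Y x ^+ k * W x).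
    move=> intW.
    have iW k : mu.-integrable setT (EFin \o (fun x => Y x ^+ k * W x)).
      have [_] := integrable_poly 'X^k intW; apply: eq_integrable => // x _ /=.
      by rewrite hornerXn.
    apply: EFin_inj; rewrite EFin_Rintegral; last by have [] := integrable_poly p intW.
    rewrite -sumEFin.
    transitivity (\sum_(k < size p) \int[mu]_x (p`_k * (Y x ^+ k * W x))%:E)%E.
      rewrite -integral_sum//; last by move=> k; exact: integrable_mull.
      apply: eq_integral => x _; rewrite horner_coef mulr_suml -sumEFin.
      by apply: eq_bigr => k _; rewrite mulrA.
    apply: eq_bigr => k _; rewrite -RintegralZl// EFin_Rintegral//.
    exact: integrable_mull.
  rewrite H//.
  have -> : (fun i => \int[mu]_x (p.[Y x] * V_ i x)) =
      (fun i => \sum_(k < size p) p`_k * \int[mu]_x (Y x ^+ k * V_ i x)).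
    by apply/funext => i; exact: H.
  apply: (@cvg_big _ _ +%R) => [x|k _]; first exact: add_continuous.
  by apply: cvgMr; exact: hk.
have intc W := @integrable_lipschitz c W lipc.
apply/cvgrPdist_lt => e e0.
(* [J] eventually exceeds all the masses. With the polynomial error e / (4 J), the two replacements
   and the polynomial difference each contribute at most e / 4. *)
pose J := \int[mu]_x V x + 1.
have J0 : 0 < J by rewrite ltr_wpDl// Rintegral_ge0.
have [p pc] := weierstrass_lipschitz (divr_gt0 e0 (mulr_gt0 (ltr0n R 4) J0)) lipc.
set d0 := e / (4 * J) in pc.
have err (W : T -> R) : mu.-integrable setT (EFin \o W) -> (forall x, 0 <= W x) ->
    `|\int[mu]_x (c (Y x) * W x) - \int[mu]_x (p.[Y x] * W x)| <= d0 * \int[mu]_x W x.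
  move=> intW W0; have [mp ip] := integrable_poly p intW.
  have [mW _] := integrable_EFinP intW.
  rewrite -RintegralB//; last exact: intc.
  rewrite -RintegralZl//.
  apply: normr_Rintegral_le.
  - have [mcW _] := integrable_EFinP (intc _ intW).
    by apply: measurable_funB => //; exact: measurable_funM.
  - move=> x; rewrite -mulrBl normrM (ger0_norm (W0 x)) ler_wpM2r//.
    by rewrite distrC pc.
  - exact: integrable_mull.
have h0 : \int[mu]_x V_ i x @[i --> F] --> \int[mu]_x V x.
  have := hk 0%N.
  have e0E (W : T -> R) : \int[mu]_x (Y x ^+ 0 * W x) = \int[mu]_x W x.
    by apply: eq_Rintegral => x _; rewrite expr0 mul1r.
  by rewrite e0E (_ : (fun i => _) = (fun i => \int[mu]_x V_ i x))//; apply/funext => i; exact: e0E.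
near=> i.
have A : `|\int[mu]_x (p.[Y x] * V x) - \int[mu]_x (p.[Y x] * V_ i x)| < e / 4.
  by near: i; apply: cvgr_dist_lt; [exact: poly_cvg | rewrite divr_gt0].
have B : \int[mu]_x V_ i x < J.
  by near: i; apply: (cvgr_lt _ h0); rewrite ltrDl.
have EV := err _ intV V0; have EVi := err _ (intV_ i) (V_0 i).
have d00 : 0 <= d0 by rewrite divr_ge0 ?mulr_ge0// ltW.
have dJ : d0 * J = e / 4 by rewrite /d0; field; rewrite gt_eqF.
have EV' : d0 * \int[mu]_x V x <= e / 4.
  by rewrite -dJ ler_wpM2l// lerDl.
have EVi' : d0 * \int[mu]_x V_ i x <= e / 4.
  by rewrite -dJ ler_wpM2l// ltW.
move: A EV EVi; rewrite ltr_norml !ler_norml ltr_norml.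
by move=> /andP[? ?] /andP[? ?] /andP[? ?]; apply/andP; split; lra.
Unshelve. all: by end_near. Qed.

(** Vanishing moments mean that the positive and negative parts of [f] have equal moments; the
    convergence lemma for a constant sequence then identifies their integrals against [c]. *)
Lemma moment_unique (f : T -> R) (c : R -> R) :
  mu.-integrable setT (EFin \o f) ->
  (forall k : nat, \int[mu]_x (Y x ^+ k * f x) = 0) ->
  (forall x y, `|c x - c y| <= `|x - y|) ->
  \int[mu]_x (c (Y x) * f x) = 0.
Proof.
move=> intf h lipc; have [mf _] := integrable_EFinP intf.
pose p x := Num.max (f x) 0; pose m x := Num.max (- f x) 0.
have intp : mu.-integrable setT (EFin \o p).
  apply: (le_integrable_EFin _ _ (integrable_norm intf)); first exact: measurable_maxr.
  by move=> x; rewrite /p /Num.max /=; case: ifP => _; rewrite ?normr0 ?normr_ge0.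
have intm : mu.-integrable setT (EFin \o m).
  apply: (le_integrable_EFin _ _ (integrable_norm intf)).
    by apply: measurable_maxr => //; exact: measurableT_comp.
  by move=> x; rewrite /m /Num.max /=; case: ifP => _; rewrite ?normr0 ?normr_ge0 ?normrN.
have fE x : f x = p x - m x.
  rewrite /p /m /Num.max oppr_lt0.
  by case: (ltgtP (f x) 0) => ?; lra.
have split_int (w : T -> R) : mu.-integrable setT (EFin \o (fun x => w x * p x)) ->
    mu.-integrable setT (EFin \o (fun x => w x * m x)) ->
    \int[mu]_x (w x * f x) = \int[mu]_x (w x * p x) - \int[mu]_x (w x * m x).
  move=> i1 i2; rewrite -RintegralB//.
  by apply: eq_Rintegral => x _; rewrite -mulrBr -fE.
rewrite split_int; [|exact: integrable_lipschitz..].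
apply/eqP; rewrite subr_eq0; apply/eqP.
suff H : \int[mu]_x (c (Y x) * p x) @[_ --> (\oo : set_system nat)] -->
    \int[mu]_x (c (Y x) * m x) by exact: (cvg_unique _ (cvg_cst _) H).
apply: (@moment_cvg nat \oo _ (fun=> p) m c) => //.
- by move=> _ x; rewrite le_max lexx orbT.
- by move=> x; rewrite le_max lexx orbT.
move=> k; have mk : measurable_fun setT (fun x => Y x ^+ k) by exact: measurable_funX.
have bk x : `|Y x ^+ k| <= 1 by rewrite normrX exprn_ile1.
have := h k; rewrite split_int; [|exact: (integrable_bndM mk bk)..].
by move/eqP; rewrite subr_eq0 => /eqP ->; exact: cvg_cst.
Qed.

End moment_convergence.

(** * Right-continuous functions with vanishing transforms along an arithmetic progression *)

Section laplace_uniqueness.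
Context {R : realType}.
Implicit Types (f : R -> R) (lam t : R).
(** The absolute value keeps the values in [0, 1] on the whole line, as the moment lemmas require of
    their variable. *)
Definition nexp (x : R) : R := expR (- `|x|)%R.

Lemma measurable_nexp : measurable_fun setT (nexp : measurableTypeR R -> R).
Proof.
apply: measurableT_comp => //; apply: measurableT_comp => //; exact: measurableT_comp.
Qed.

Lemma nexp01 x : (0 <= nexp x <= 1)%R.
Proof. by rewrite /nexp expR_ge0/= expR_le1 oppr_le0. Qed.

Lemma laplace_moment lam f (k : nat) : (0 < lam)%R ->
  (lapm lam).-integrable setT (EFin \o f) ->
  (\int[lapm lam]_x (nexp x ^+ k * f x) = \int[lapm (lam + k%:R)]_x f x)%R.
Proof.
move=> l0 intf; have [_ ->] := Rintegral_lapm_shift (ler0n R k) intf.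
by apply: eq_Rintegral => x _; rewrite /nexp -expRM_natl mulrN.
Qed.

(* A tent over the interval with endpoints exp(- t2) < exp(- t1), so that its
   composition with exp(- |x|) lives on ]t1, t2[. *)
Definition tent t1 t2 y : R :=
  Num.max 0%R (Num.min (y - expR (- t2)) (expR (- t1) - y))%R.

Lemma tent_lipschitz t1 t2 x y : (`|tent t1 t2 x - tent t1 t2 y| <= `|x - y|)%R.
Proof.
rewrite /tent ler_norml.
have := ler_norm (x - y)%R; have := ler_norm (y - x)%R; rewrite distrC.
set N := `|_|%R => h1 h2.
rewrite /Num.max /Num.min.
by repeat case: ifP => //=; rewrite ?ltNge => *; apply/andP; split; lra.
Qed.

Lemma tent_ge0 t1 t2 y : (0 <= tent t1 t2 y)%R.
Proof. by rewrite /tent le_max lexx. Qed.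

Lemma tent_gt0 t1 t2 x : (t1 < `|x| < t2)%R -> (0 < tent t1 t2 (nexp x))%R.
Proof.
move=> /andP[t1x xt2].
by rewrite /tent lt_max lt_min !subr_gt0 !ltr_expR !ltrN2 t1x xt2 orbT.
Qed.

Lemma tent_eq0 t1 t2 x : ~~ (t1 < `|x| < t2)%R -> tent t1 t2 (nexp x) = 0%R.
Proof.
rewrite negb_and -!leNgt => h.
apply/max_idPl; rewrite ge_min !subr_le0 !ler_expR !lerN2.
by case/orP: h => ->; rewrite ?orbT.
Qed.

Lemma ae_lapm_gt0 lam : {ae lapm lam, forall x : measurableTypeR R, (0 < x)%R}.
Proof.
exists `]-oo, 0%R]%classic; split => //; first exact: lapm_le0.
by move=> x /= /negP; rewrite -leNgt in_itv.
Qed.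

Lemma Rintegral_tent_gt0 lam t1 t2 f : (0 < lam)%R -> (0 <= t1)%R -> (t1 < t2)%R ->
  (lapm lam).-integrable setT (EFin \o f) ->
  (forall x, (t1 < x < t2)%R -> (0 < f x)%R) ->
  (0 < \int[lapm lam]_x (tent t1 t2 (nexp x) * f x))%R.
Proof.
move=> l0 t10 t12 intf f0.
have mtent : measurable_fun setT (tent t1 t2).
  apply: measurable_maxr => //; apply: measurable_minr; exact: measurable_funB.
have mtY : measurable_fun setT (fun x : measurableTypeR R => tent t1 t2 (nexp x)).
  exact: (measurableT_comp mtent measurable_nexp).
have bt x : (`|tent t1 t2 (nexp x)| <= `|tent t1 t2 0| + 1)%R.
  rewrite -[tent _ _ (nexp x)](subrK (tent t1 t2 0)) addrC (le_trans (ler_normD _ _))// lerD2l.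
  rewrite (le_trans (tent_lipschitz _ _ _ _))// subr0.
  by have /andP[h1 h2] := nexp01 x; rewrite ger0_norm.
have intt : (lapm lam).-integrable setT (EFin \o (fun x => tent t1 t2 (nexp x) * f x)%R).
  exact: (integrable_bndM mtY bt).
have [mf _] := integrable_EFinP intf.
pose g (x : R) : R := (`|tent t1 t2 (nexp x) * f x|)%R.
have intg : (lapm lam).-integrable setT (EFin \o g) := integrable_norm intt.
(* The sign of [f] is unknown outside ]t1, t2[, but there the tent vanishes on the positive
   half-line, so the product agrees almost everywhere with its absolute value. *)
have -> : (\int[lapm lam]_x (tent t1 t2 (nexp x) * f x) = \int[lapm lam]_x g x)%R.
  rewrite /Rintegral; congr fine; apply: ae_eq_integral => //.
  - exact: measurable_int intt.
  - exact: measurable_int intg.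
  - apply: filterS (ae_lapm_gt0 lam) => x x0 _; congr EFin; rewrite /g.
    have [/f0 fx|nx] := boolP (t1 < x < t2)%R.
      by rewrite ger0_norm// mulr_ge0// ?tent_ge0// ltW.
    by rewrite tent_eq0 ?mul0r ?normr0// gtr0_norm.
have g0 : (0 <= \int[lapm lam]_x g x)%R by apply: Rintegral_ge0 => x _; exact: normr_ge0.
rewrite lt_neqAle g0 andbT; apply/eqP => /esym h.
have /eqP : \int[lapm lam]_x (g x)%:E = 0.
  by have := EFin_Rintegral intg; rewrite h => <-.
have -> : \int[lapm lam]_x (g x)%:E = \int[lapm lam]_x `|(tent t1 t2 (nexp x) * f x)%:E|.
  by apply: eq_integral.
move/eqP/ae_eq_integral_abs => /(_ measurableT (measurable_int _ intt)) [N [mN N0 hN]].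
(* Half of the interval is enough, and its closed right end still lies inside ]t1, t2[. *)
have : lapm lam `]t1, ((t1 + t2) / 2)%R]%classic <= lapm lam N.
  apply: le_measure => //; rewrite ?inE// => x /=; rewrite in_itv/= => /andP[tx xt].
  have xt2 : (t1 < x < t2)%R by rewrite tx/= (le_lt_trans xt)// midf_lt.
  have xt2' : (t1 < `|x| < t2)%R by rewrite gtr0_norm//; exact: le_lt_trans tx.
  apply: hN => /= e; have /eqP := EFin_inj (e I).
  by rewrite gt_eqF// mulr_gt0 ?f0// tent_gt0.
by rewrite N0 leNgt lapm_itv_gt0// midf_lt.
Qed.

(* The hypothesis says that all polynomials in exp(- x) integrate to 0 against f;
   by Bernstein approximation so do the tents concentrated to the right of t. *)
Lemma laplace_uniqueness lam f : (0 < lam)%R ->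
  (lapm lam).-integrable setT (EFin \o f) ->
  (forall k : nat, \int[lapm (lam + k%:R)]_x f x = 0)%R ->
  (forall t, (0 < t)%R -> f s @[s --> t^'+] --> f t) ->
  forall t, (0 < t)%R -> f t = 0%R.
Proof.
move=> l0 intf h rc t t0.
wlog ft : f intf h rc / (0 < f t)%R => [hw|].
  have [||//] := ltgtP (f t) 0%R.
  - move=> ft; apply/oppr_inj; rewrite oppr0; apply: (hw (fun x => - f x)%R).
    + have := integrable_mull (-1)%R intf; apply: eq_integrable => // x _ /=.
      by rewrite mulN1r.
    + move=> k; have [intk _] := Rintegral_lapm_shift (ler0n R k) intf.
      have := @RintegralZl _ _ _ (lapm (lam + k%:R)) setT f (-1)%R measurableT intk.
      rewrite h mulr0 => <-; by apply: eq_Rintegral => x _; rewrite mulN1r.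
    + by move=> s s0; apply: cvgN; exact: rc.
    + by rewrite oppr_gt0.
  - by move=> ft; exact: hw.
exfalso.
have [e e0 he] : exists2 e, (0 < e)%R & forall x, (t < x < t + e)%R -> (0 < f x)%R.
  have /cvgr_gt/(_ _ ft)[e /= e0 he] := rc t t0.
  exists e => // x /andP[tx xe]; apply: he => //=.
  by rewrite distrC gtr0_norm ?subr_gt0// ltrBlDl.
have tte : (t < t + e)%R by rewrite ltrDl.
have := Rintegral_tent_gt0 l0 (ltW t0) tte intf he.
have h0 k : (\int[lapm lam]_x (nexp x ^+ k * f x) = 0)%R by rewrite laplace_moment.
have := moment_unique measurable_nexp nexp01 intf h0 (@tent_lipschitz t (t + e)).
by move=> ->; rewrite ltxx.
Qed.

End laplace_uniqueness.

(** * A Tauberian theorem *)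

Section rays.
Context {R : realType}.

Lemma measure_ray_unique (m1 m2 : {measure set (measurableTypeR R) -> \bar R}) :
  (forall s : R, m1 `]s, +oo[%classic = m2 `]s, +oo[%classic) ->
  (forall s : R, m1 `]s, +oo[%classic < +oo) ->
  forall A, measurable A -> m1 A = m2 A.
Proof.
move=> m12 fin A mA.
apply: (@measure_unique _ R (measurableTypeR R) (@RGenOInfty.G R)
  (fun n => `](- n%:R)%R, +oo[%classic)) => //.
- exact: RGenOInfty.measurableE.
- move=> _ _ [x ->] [y ->]; exists (Num.max x y); apply/seteqP; split => z /=;
    rewrite !in_itv/= !andbT gt_max; first by move=> [-> ->].
  by move=> /andP[].
- by move=> n; exists (- n%:R)%R.
- apply/seteqP; split => // x _; exists (Num.truncn `|x|).+1 => //=.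
  rewrite in_itv/= andbT ltrNl (le_lt_trans (ler_norm _))// normrN.
  exact: truncnS_gt.
- by move=> _ [x ->].
Qed.

Lemma lapm_ray (lam s : R) : (0 < lam)%R ->
  lapm lam `]s, +oo[%classic = (expR (- (lam * Num.max s 0)) / lam)%:E.
Proof.
move=> l0; rewrite /Num.max; case: ltP => s0; last exact: lapm_tail.
rewrite -lapm_tail//.
have -> : `]s, +oo[%classic = `]0%R, +oo[%classic `|` `]s, 0%R]%classic.
  apply/seteqP; split => x /=; rewrite !in_itv/= !andbT.
    by case: (leP x 0%R) => x0 sx; [right; rewrite sx|left].
  by case=> [|/andP[]//]; exact: lt_trans.
apply: measureU0 => //; apply: lapm_le0 => // x /=; rewrite !in_itv/=.
by move=> /andP[].
Qed.

(** The image of [lapm k] under multiplication by [c] has the same rays as $c^{-1}$ times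
    [lapm (k / c)]; comparing rays replaces a change of variables in Lebesgue measure. *)
Lemma ge0_integral_lapm_scale (k c : R) (f : measurableTypeR R -> \bar R) :
  (0 < k)%R -> (0 < c)%R -> measurable_fun setT f -> (forall x, 0 <= f x) ->
  \int[lapm k]_x f (c * x)%R = (c^-1)%:E * \int[lapm (k / c)]_x f x.
Proof.
move=> k0 c0 mf f0.
have mc : measurable_fun setT ( *%R c : measurableTypeR R -> measurableTypeR R).
  exact: measurable_funM.
have ci0 : (0 <= c^-1)%R by rewrite invr_ge0 ltW.
transitivity (\int[pushforward (lapm k) ( *%R c : measurableTypeR R -> measurableTypeR R)]_x f x).
  by rewrite ge0_integral_pushforward.
rewrite -[c^-1%R]/((NngNum ci0)%:num) -ge0_integral_mscale//.
apply: eq_measure_integral => A mA _.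
have pre s : ( *%R c) @^-1` `]s, +oo[%classic = `](s / c)%R, +oo[%classic.
  by apply/seteqP; split => x /=; rewrite !in_itv/= !andbT ltr_pdivrMr// mulrC.
apply: measure_ray_unique mA => s.
  transitivity (lapm k (( *%R c) @^-1` `]s, +oo[%classic)) => //.
  transitivity ((c^-1)%:E * lapm (k / c) `]s, +oo[%classic) => //.
  rewrite pre !lapm_ray ?divr_gt0// -EFinM; congr EFin.
  have -> : (Num.max (s / c) 0 = Num.max s 0 / c)%R.
    by rewrite maxr_pMl ?mul0r// invr_ge0 ltW.
  rewrite (_ : k * (Num.max s 0 / c) = k / c * Num.max s 0)%R; last by rewrite mulrCA mulrC mulrAC.
  by field; rewrite !gt_eqF.
apply: (@le_lt_trans _ _ (lapm k (( *%R c) @^-1` `]s, +oo[%classic))) => //.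
by rewrite pre lapm_ray// ltry.
Qed.

End rays.

(** * Power functions and the Gamma function *)

Section gamma.
Context {R : realType}.
Variable alpha : R.
Hypothesis alpha01 : (0 <= alpha <= 1)%R.

Let mpow : measurable_fun setT (fun x : measurableTypeR R => `|x| `^ alpha)%R.
Proof. exact: (measurableT_comp (measurable_powR alpha) (@normr_measurable R setT)). Qed.

(** For x > 0, $x^\alpha \le 1+x \le (1+2/k)e^{kx/2}$, which spends half of the exponential
    decay. *)
Lemma integrable_pow_lapm (k : R) : (0 < k)%R ->
  (lapm k).-integrable setT (EFin \o (fun x : R => `|x| `^ alpha)%R).
Proof.
move=> k0; have k20 : (0 < k / 2)%R by rewrite divr_gt0.
have int1 : (lapm (k / 2)).-integrable setT (EFin \o (cst 1%R : R -> R)).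
  apply: (@bounded_integrable _ _ _ _ _ 1%R) ; [exact: lapmT_fin | exact: measurable_cst|].
  by move=> x; rewrite normr1.
have := int1; rewrite integrable_lapm_dens// => int2.
have mp := mpow; apply/integrable_lapm_dens => //.
apply: (@le_integrable_EFin _ (measurableTypeR R) R lebesgue_measure _ (fun x => (1 + 2 / k) * (cst 1 x * lapdens (k / 2) x))%R).
- by apply: measurable_funM => //; exact: measurable_lapdens.
- move=> x; rewrite /lapdens indicE; have [|_] := boolP (x \in _); last by rewrite !mul0r !mulr0 normr0.
  rewrite inE/= in_itv/= andbT => x0; rewrite !mul1r (gtr0_norm x0) ger0_norm; last first.
    by rewrite mulr_ge0 ?expR_ge0// powR_ge0.
  have xp : (x `^ alpha <= 1 + x)%R.
    have [x1|x1] := leP 1%R x.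
      apply: (@le_trans _ _ (x `^ 1)%R); last by rewrite powRr1 ?(ltW x0)// lerDr ler01.
      by rewrite ler_powR//; have /andP[] := alpha01.
    apply: (@le_trans _ _ 1%R); last by rewrite lerDl ltW.
    have e1 : (1 = 1 `^ alpha :> R)%R by rewrite powR1.
    rewrite [leRHS]e1 ge0_ler_powR// ?nnegrE ?(ltW x0) ?(ltW x1)//.
    by have /andP[] := alpha01.
  have xe : (1 + x <= (1 + 2 / k) * expR (k / 2 * x))%R.
    have e1 := expR_ge1Dx (k / 2 * x)%R.
    have kx : (0 <= k / 2 * x)%R by rewrite mulr_ge0 ?ltW// divr_gt0.
    rewrite mulrDl mul1r lerD//; first by rewrite (le_trans _ e1)// lerDl.
    rewrite -[leLHS](@mulKf _ (k / 2)%R) ?gt_eqF// invf_div ler_wpM2l ?divr_ge0 ?(ltW k0)//.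
    by apply: le_trans e1; rewrite lerDr.
  apply: (@le_trans _ _ ((1 + 2 / k) * expR (k / 2 * x) * expR (- (k * x)))%R).
    by rewrite ler_wpM2r ?expR_ge0// (le_trans xp).
  rewrite -mulrA -expRD (_ : k / 2 * x + - (k * x) = - (k / 2 * x))%R//.
  by rewrite [in RHS]mulrAC; field.
- exact: integrable_mull.
Qed.

Lemma Gamma_lapm : Gamma (1 + alpha) = (\int[lapm 1]_x (`|x| `^ alpha))%R.
Proof.
have mp := mpow.
rewrite /Gamma /Rintegral; congr fine.
transitivity (\int[lebesgue_measure]_(x in `]0%R, +oo[)
    ((`|x| `^ alpha)%:E * (expR (- (1 * x)))%:E)); last first.
  apply/esym; apply: ge0_integral_lapm_itv.
    exact/measurable_EFinP.
  by move=> x; rewrite lee_fin powR_ge0.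
 apply: eq_integral => x; rewrite inE/= in_itv/= andbT => x0.
by rewrite -EFinM (addrC 1%R) addrK mul1r gtr0_norm.
Qed.

Lemma Gamma_gt0 : (0 < Gamma (1 + alpha))%R.
Proof.
rewrite Gamma_lapm -lte_fin EFin_Rintegral; last exact: integrable_pow_lapm.
apply: (@lt_le_trans _ _ (\int[lapm 1]_(x in `]1%R, +oo[) cst 1 x)).
  by rewrite integral_cst//= mul1e lapm_tail ?ler01// lte_fin divr_gt0 ?expR_gt0.
apply: (@le_trans _ _ (\int[lapm 1]_(x in `]1%R, +oo[) (`|x| `^ alpha)%:E)).
  apply: ge0_le_integral => //.
    by apply/measurable_funTS/measurable_EFinP; exact: mpow.
  move=> x /=; rewrite in_itv/= andbT => x1; rewrite lee_fin [leLHS](_ : _ = 1 `^ alpha)%R; last by rewrite powR1.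
  have x0 : (0 < x)%R by rewrite (lt_trans _ x1).
  rewrite ge0_ler_powR ?nnegrE//; first by have /andP[] := alpha01.
  by rewrite gtr0_norm// ltW.
apply: ge0_subset_integral => //.
by apply/measurable_EFinP; exact: mpow.
Qed.

Lemma Rintegral_pow_lapm (k : R) : (0 < k)%R ->
  (\int[lapm k]_x (`|x| `^ alpha) = Gamma (1 + alpha) * (k `^ (- alpha) / k))%R.
Proof.
move=> k0; apply: EFin_inj; rewrite EFin_Rintegral; last exact: integrable_pow_lapm.
have kap : (0 < k `^ alpha)%R by rewrite powR_gt0.
have mp : measurable_fun setT (fun x : measurableTypeR R => (`|x| `^ alpha)%:E).
  by apply/measurable_EFinP; exact: mpow.
have p0 (x : measurableTypeR R) : 0 <= (`|x| `^ alpha)%:E by rewrite lee_fin powR_ge0.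
have H := ge0_integral_lapm_scale k0 k0 mp p0.
have {}H : (k `^ alpha)%:E * \int[lapm k]_x (`|x| `^ alpha)%:E =
    (k^-1)%:E * \int[lapm 1]_x (`|x| `^ alpha)%:E.
  rewrite divff in H; last by rewrite gt_eqF.
  rewrite -H.
  transitivity (\int[lapm k]_x ((k `^ alpha)%:E * (`|x| `^ alpha)%:E)).
    apply/esym; apply: ge0_integralZl; [exact: measurableT|exact: mp|by []|].
    by rewrite lee_fin ltW.
  by apply: eq_integral => x _; rewrite normrM powRM// (gtr0_norm k0) EFinM.
move: H; rewrite -(EFin_Rintegral (integrable_pow_lapm k0)).
rewrite -(EFin_Rintegral (integrable_pow_lapm ltr01)) -Gamma_lapm -!EFinM => H.
have {}H := EFin_inj H; congr EFin.
apply: (mulfI (lt0r_neq0 kap)); rewrite H powRN; field.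
by rewrite !gt_eqF.
Qed.

End gamma.

(** * Karamata's theorem for a monotone function *)

Section karamata.
Context {R : realType}.
Variables (U w : R -> R) (alpha : R).
Hypothesis alpha01 : (0 <= alpha <= 1)%R.
Hypothesis U0 : forall t, (0 <= U t)%R.
Hypothesis ndU : nondecreasing_fun U.
Hypothesis w0 : forall lam : R, (0 < lam)%R -> (0 < w lam)%R.
Hypothesis Uw : forall lam : R, (0 < lam)%R ->
  \int[lapm lam]_x (U `|x|)%:E = (w lam / lam)%:E.
Hypothesis rv : forall x : R, (0 < x)%R ->
  (w (lam * x) / w lam)%R @[lam --> 0^'+] --> (x `^ (- alpha))%R.

Local Open Scope ring_scope.

(** [V] is the expected limit of the rescaled functions [W lam] as [lam] tends to 0+: its transform
    at [k] is $k^{-\alpha}/k$, the limit of those of [W lam] by regular variation. Convergence at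
    the single point 1 is the assertion sought. *)
Let V (x : R) : R := `|x| `^ alpha / Gamma (1 + alpha).
Let W (lam x : R) : R := U (`|x| / lam) / w lam.

Let mU : measurable_fun setT (fun x : measurableTypeR R => U `|x|).
Proof.
apply: (measurableT_comp (T2 := measurableTypeR R)); last exact: normr_measurable.
exact: nondecreasing_measurable.
Qed.

Let WE (lam k : R) : 0 < lam -> 0 < k ->
  (\int[lapm k]_x (W lam x)%:E = (w (lam * k) / w lam / k)%:E)%E.
Proof.
move=> l0 k0; have li0 : 0 < lam^-1 by rewrite invr_gt0.
have mEU : measurable_fun setT (fun x : measurableTypeR R => (U `|x|)%:E) by exact/measurable_EFinP.
have H := ge0_integral_lapm_scale k0 li0 mEU (fun x => U0 `|x|).
transitivity (((w lam)^-1)%:E * \int[lapm k]_x (U `|lam^-1 * x|)%:E)%E.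
  rewrite -ge0_integralZl//.
  - by apply: eq_integral => x _; rewrite -EFinM mulrC normrM (gtr0_norm li0) /W (mulrC `|x|).
  - apply: (measurableT_comp mEU); exact: measurable_funM.
  - by move=> x _; exact: U0.
  - by rewrite lee_fin invr_ge0 ltW// w0.
rewrite H invrK (mulrC k) Uw ?mulr_gt0// -!EFinM; congr EFin.
by field; rewrite !gt_eqF// w0.
Qed.

Let intW (lam k : R) : 0 < lam -> 0 < k -> (lapm k).-integrable setT (EFin \o W lam).
Proof.
move=> l0 k0; have W0 x : 0 <= W lam x by rewrite divr_ge0// ltW// w0.
apply/integrableP; split.
  apply/measurable_EFinP; apply: measurable_funM => //.
  rewrite (_ : (fun x => _) = (fun x => U `|lam^-1 * x|)).
    by apply: (measurableT_comp mU); exact: measurable_funM.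
  by apply/funext => x; rewrite normrM mulrC gtr0_norm ?invr_gt0.
under eq_integral => x _ do rewrite /= ger0_norm//.
by rewrite WE// ltry.
Qed.

Let intV (k : R) : 0 < k -> (lapm k).-integrable setT (EFin \o V).
Proof.
move=> k0; have := integrable_mull (Gamma (1 + alpha))^-1 (integrable_pow_lapm alpha01 k0).
by apply: eq_integrable => // x _ /=; rewrite mulrC.
Qed.

Let VE (k : R) : 0 < k -> \int[lapm k]_x V x = k `^ (- alpha) / k.
Proof.
move=> k0; have G0 := Gamma_gt0 alpha01.
transitivity ((Gamma (1 + alpha))^-1 * \int[lapm k]_x (`|x| `^ alpha)).
  rewrite -RintegralZl//; last exact: integrable_pow_lapm.
  by apply: eq_Rintegral => x _; rewrite mulrC.
by rewrite Rintegral_pow_lapm// mulKf// gt_eqF.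
Qed.

Let tent_cvg (t1 t2 : R) :
  \int[lapm 1]_x (tent t1 t2 (nexp x) * W lam x) @[lam --> 0^'+] -->
  \int[lapm 1]_x (tent t1 t2 (nexp x) * V x).
Proof.
(* The moment lemma wants nonnegative integrable functions for every index, whereas [W lam] is
   controlled only for positive [lam]; the other values are invisible to the filter. *)
pose W' (lam : R) := if 0 < lam then W lam else V.
have near0 (F G : R -> R) (l : R) : (forall lam, 0 < lam -> F lam = G lam) ->
    F lam @[lam --> 0^'+] --> l -> G lam @[lam --> 0^'+] --> l.
  move=> FG; apply: cvg_trans; apply: near_eq_cvg; near=> lam; apply: FG.
  by near: lam; exact: nbhs_right_gt.
suff : \int[lapm 1]_x (tent t1 t2 (nexp x) * W' lam x) @[lam --> 0^'+] -->
  \int[lapm 1]_x (tent t1 t2 (nexp x) * V x).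
  by apply: near0 => lam l0; rewrite /W' l0.
have V0 x : 0 <= V x by rewrite divr_ge0 ?powR_ge0// ltW// Gamma_gt0.
apply: (moment_cvg measurable_nexp nexp01).
- move=> lam x; rewrite /W'; case: ifP => [l0|_]; last exact: V0.
  by rewrite divr_ge0// ltW// w0.
- exact: V0.
- by move=> lam; rewrite /W'; case: ifP => [l0|_]; [exact: intW|exact: intV].
- exact: intV.
(* The k-th moment in exp(- x) under [lapm 1] is the transform at 1 + k, where regular variation
   applies with x = 1 + k. *)
- move=> k; have k1 : 0 < 1 + k%:R :> R by rewrite ltr_pwDl.
  rewrite laplace_moment//; last exact: intV.
  rewrite VE//; apply: (near0 (fun lam => w (lam * (1 + k%:R)) / w lam / (1 + k%:R))).
    move=> lam l0; rewrite /W' l0 laplace_moment//; last exact: intW.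
    by apply: EFin_inj; rewrite EFin_Rintegral ?WE//; exact: intW.
  by apply: cvgMl; exact: rv.
- exact: tent_lipschitz.
Unshelve. all: by end_near. Qed.

Let intT (t1 t2 : R) (f : R -> R) : (lapm 1).-integrable setT (EFin \o f) ->
  (lapm 1).-integrable setT (EFin \o (fun x => tent t1 t2 (nexp x) * f x)).
Proof.
move=> intf; exact: (integrable_lipschitz measurable_nexp nexp01 (@tent_lipschitz R t1 t2) intf).
Qed.

Let int_cst (c : R) : (lapm 1).-integrable setT (EFin \o (fun _ : R => c)).
Proof.
apply: (@bounded_integrable _ (measurableTypeR R) _ _ _ `|c|) => //.
  exact: lapmT_fin.
Qed.

(** Monotonicity places [W lam 1] below its tent average over ]1, 1 + h[ and above the one over ]1 -
    h, 1[. These averages converge to those of [V], which continuity of [V] at 1 keeps within [e] of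
    [V 1]. *)
Let W_cvg : W lam 1 @[lam --> 0^'+] --> (Gamma (1 + alpha))^-1.
Proof.
have G0 := Gamma_gt0 alpha01; have [a0 a1] := andP alpha01.
have V1 : V 1 = (Gamma (1 + alpha))^-1 by rewrite /V normr1 powR1 mul1r.
have cV : V x @[x --> (1 : R)] --> V 1.
  apply: cvgMl; apply: (@continuous_comp _ _ _ (fun y : R => `|y|) (fun y => y `^ alpha)).
    exact: norm_continuous.
  apply/differentiable_continuous/derivable1_diffP/derivable_powR.
  by rewrite normr1 in_itv/= ltr01.
have mV (x y : R) : 0 <= x -> x <= y -> V x <= V y.
  move=> x0 xy; rewrite ler_wpM2r ?invr_ge0 ?(ltW G0)//.
  rewrite !ger0_norm//; last exact: le_trans xy.
  by rewrite ge0_ler_powR// nnegrE// (le_trans x0).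
have mW (lam x y : R) : 0 < lam -> 0 <= x -> x <= y -> W lam x <= W lam y.
  move=> l0 x0 xy; rewrite ler_wpM2r ?invr_ge0 ?(ltW (w0 l0))//; apply: ndU.
  by rewrite ler_wpM2r ?invr_ge0 ?(ltW l0)// !ger0_norm// (le_trans x0).
pose A (t1 t2 : R) : R := \int[lapm 1]_x (tent t1 t2 (nexp x) * 1).
have A0 t1 t2 : 0 <= t1 -> t1 < t2 -> 0 < A t1 t2.
  by move=> t10 t12; apply: Rintegral_tent_gt0 => //; exact: int_cst.
have AE (t1 t2 c : R) : \int[lapm 1]_x (tent t1 t2 (nexp x) * c) = c * A t1 t2.
  rewrite -RintegralZl//; last exact: intT (int_cst 1).
  by apply: eq_Rintegral => x _; rewrite mulr1 mulrC.
have le_tent (t1 t2 : R) (f g : R -> R) : (lapm 1).-integrable setT (EFin \o f) ->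
    (lapm 1).-integrable setT (EFin \o g) ->
    (forall x, t1 < `|x| < t2 -> f x <= g x) ->
    \int[lapm 1]_x (tent t1 t2 (nexp x) * f x) <= \int[lapm 1]_x (tent t1 t2 (nexp x) * g x).
  move=> intf intg fg; apply: le_Rintegral => //; [exact: intT|exact: intT|].
  move=> x _; have [h|h] := boolP (t1 < `|x| < t2).
    by rewrite ler_wpM2l ?tent_ge0// fg.
  by rewrite tent_eq0// !mul0r.
apply/cvgrPdist_lt => e e0.
have [d /= d0 hd] : \forall x \near (1 : R), `|V 1 - V x| < e / 2.
  by move/cvgrPdist_lt : cV => /(_ (e / 2)); apply; rewrite divr_gt0.
pose h := Num.min (d / 2) (1 / 2).
have h0 : 0 < h by rewrite lt_min !divr_gt0.
have hd' : h < d by rewrite gt_min ltr_pdivrMr// ltr_pMr// ltr1n.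
have h1 : h < 1 by rewrite gt_min orbC ltr_pdivrMr// mul1r ltr1n.
have V2 : V (1 + h) < V 1 + e / 2.
  have := hd (1 + h); rewrite /= opprD addrA subrr sub0r normrN gtr0_norm// => /(_ hd').
  by rewrite ltr_norml => /andP[+ _]; rewrite ltrBrDl; lra.
have V3 : V 1 - e / 2 < V (1 - h).
  have := hd (1 - h); rewrite /= opprB addrCA subrr addr0 gtr0_norm// => /(_ hd').
  by rewrite ltr_norml => /andP[_]; lra.
have e2 : e / 2 < e by rewrite ltr_pdivrMr// ltr_pMr// ltr1n.
have V2' : V (1 + h) < V 1 + e by apply: (lt_trans V2); rewrite ltrD2l.
have V3' : V 1 - e < V (1 - h) by apply: lt_trans V3; rewrite ltrD2l ltrN2.
have c1 := @tent_cvg (1 : R) (1 + h); have c2 := @tent_cvg (1 - h) (1 : R).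
have t1 : (1 : R) < 1 + h by rewrite ltrDl.
have t2 : 1 - h < (1 : R) by rewrite ltrBlDr ltrDl.
have h2 : 0 <= 1 - h by rewrite subr_ge0 ltW.
have A1 := A0 _ _ ler01 t1; have A2 := A0 _ _ h2 t2.
have b1 : \int[lapm 1]_x (tent 1 (1 + h) (nexp x) * V x) < (V 1 + e) * A 1 (1 + h).
  apply: (@le_lt_trans _ _ (V (1 + h) * A 1 (1 + h))); last by rewrite (ltr_pM2r A1).
  rewrite -AE; apply: le_tent; [exact: intV|exact: int_cst|].
  move=> x /andP[x1 x2]; rewrite -[V x]/(`|x| `^ alpha / _) -[`|x|]normr_id.
  by apply: mV => //; exact: ltW.
have b2 : (V 1 - e) * A (1 - h) 1 < \int[lapm 1]_x (tent (1 - h) 1 (nexp x) * V x).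
  apply: (@lt_le_trans _ _ (V (1 - h) * A (1 - h) 1)); first by rewrite (ltr_pM2r A2).
  rewrite -AE; apply: le_tent; [exact: int_cst|exact: intV|].
  move=> x /andP[x1 x2]; rewrite -[V x]/(`|x| `^ alpha / _) -[`|x|]normr_id.
  by apply: mV => //; exact: ltW.
near=> lam.
have l0 : 0 < lam by near: lam; exact: nbhs_right_gt.
have u1 : W lam 1 * A 1 (1 + h) < (V 1 + e) * A 1 (1 + h).
  apply: (@le_lt_trans _ _ (\int[lapm 1]_x (tent 1 (1 + h) (nexp x) * W lam x))).
    rewrite -AE; apply: le_tent; [exact: int_cst|exact: intW|].
    move=> x /andP[x1 x2]; rewrite -[W lam x]/(U (`|x| / _) / _) -[`|x|]normr_id.
    by apply: mW => //; exact: ltW.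
  by near: lam; exact: (cvgr_lt _ c1).
have u2 : (V 1 - e) * A (1 - h) 1 < W lam 1 * A (1 - h) 1.
  apply: (@lt_le_trans _ _ (\int[lapm 1]_x (tent (1 - h) 1 (nexp x) * W lam x))).
    by near: lam; exact: (cvgr_gt _ c2).
  rewrite -AE; apply: le_tent; [exact: intW|exact: int_cst|].
  move=> x /andP[x1 x2]; rewrite -[W lam x]/(U (`|x| / _) / _) -[`|x|]normr_id.
  by apply: mW => //; exact: ltW.
move: u1 u2; rewrite (ltr_pM2r A1) (ltr_pM2r A2) => u1 u2.
rewrite -V1 ltr_norml; apply/andP; split; first by rewrite ltrNl opprB ltrBlDl.
by rewrite ltrBlDl -ltrBlDr.
Unshelve. all: by end_near. Qed.

(* By regular variation the rescaled measures U(x / lam) exp(- x) dx / w lam have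
   converging integrals against polynomials in exp(- x), hence against tents; the
   monotonicity of U turns this into pointwise convergence. *)
Lemma karamata : (U t * Gamma (1 + alpha) / w t^-1) @[t --> +oo] --> (1 : R).
Proof.
have G0 := Gamma_gt0 alpha01.
have H : W t^-1 1 @[t --> +oo] --> (Gamma (1 + alpha))^-1.
  apply: (@cvg_comp _ _ _ (fun t : R => t^-1) (fun l => W l 1) _ _ _ _ W_cvg).
  move=> B [e /= e0 eB]; exists e^-1; split; first exact: num_real.
  move=> t et; have t0 : 0 < t by apply: lt_trans et; rewrite invr_gt0.
  apply: eB => /=; last by rewrite invr_gt0.
  by rewrite sub0r normrN gtr0_norm ?invr_gt0// invf_plt// posrE.
have K : W t^-1 1 * Gamma (1 + alpha) @[t --> +oo] --> (1 : R).
  by rewrite -[X in _ --> X](mulVf (lt0r_neq0 G0)); apply: cvgMl.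
apply: cvg_trans K; apply: near_eq_cvg; near=> t.
have t0 : 0 < t by near: t; exact: nbhs_pinfty_gt.
by rewrite /W normr1 invrK mul1r mulrAC.
Unshelve. all: by end_near. Qed.

End karamata.

(** * Tensor test functions *)

Section smooth_real_functions.
Context {R : realType}.
Implicit Types (f g h : R -> R) (x : R).
Local Open Scope ring_scope.

(* Infinite differentiability as membership in a family of functions closed
   under differentiation; this makes the closure properties immediate. *)
Definition smooth1 f : Prop := exists2 S : set (R -> R), S f &
  forall g, S g -> exists2 g', S g' & forall x, is_derive x (1 : R) g (g' x).

Lemma smooth1_derive f : smooth1 f ->
  (forall x, is_derive x (1 : R) f (derive1 f x)) /\ smooth1 (derive1 f).
Proof.
move=> [S Sf hS]; have [f' Sf' ff'] := hS f Sf.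
have f'E : derive1 f = f'.
  by apply/funext => x; rewrite derive1E; have [_ ->] := ff' x.
by rewrite f'E; split => //; exists S.
Qed.

Lemma smooth1_continuous f : smooth1 f -> continuous f.
Proof.
move=> /smooth1_derive[df _] x.
by have [/derivable1_diffP/differentiable_continuous cf _] := df x; exact: cf.
Qed.

(** The derivative of a product is a sum of two products, so sums must be included for the family to
    be closed under differentiation. *)
Inductive mul_closure (S1 S2 : set (R -> R)) : set (R -> R) :=
| mul_closure_mul g h : S1 g -> S2 h -> mul_closure S1 S2 (fun x => g x * h x)
| mul_closure_add g h : mul_closure S1 S2 g -> mul_closure S1 S2 h ->
    mul_closure S1 S2 (fun x => g x + h x).

Lemma smooth1M f g : smooth1 f -> smooth1 g -> smooth1 (fun x => f x * g x).
Proof.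
move=> [S1 S1f h1] [S2 S2g h2]; exists (mul_closure S1 S2); first exact: mul_closure_mul.
move=> w; elim=> {w} [u v Su Sv|u v _ [u' Cu' uu'] _ [v' Cv' vv']].
- have [u' Su' uu'] := h1 _ Su; have [v' Sv' vv'] := h2 _ Sv.
  exists (fun x => u x * v' x + v x * u' x).
    apply: mul_closure_add; first exact: mul_closure_mul.
    by rewrite (_ : (fun x => _) = (fun x => u' x * v x));
      [exact: mul_closure_mul|apply/funext => x; rewrite mulrC].
  by move=> x; have := uu' x; have := vv' x => ? ?; exact: is_deriveM.
- exists (fun x => u' x + v' x); first exact: mul_closure_add.
  by move=> x; have := uu' x; have := vv' x => ? ?; exact: is_deriveD.
Qed.

Lemma smooth1_affine f (a b : R) : smooth1 f -> smooth1 (fun x => f (a * x + b)).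
Proof.
move=> [S Sf hS].
(* The constant [c] absorbs the powers of [a] that the chain rule produces. *)
exists [set h | exists c g, S g /\ h = (fun x => c * g (a * x + b))].
  by exists 1, f; split => //; apply/funext => x; rewrite mul1r.
move=> _ [c [g [/hS[g' Sg' gg'] ->]]].
exists (fun x => c * a * g' (a * x + b)).
  by exists (c * a), g'.
move=> x.
have A : is_derive x (1 : R) (fun x => a * x + b) a.
  by apply: is_derive_eq; rewrite /GRing.scale/= ?mulr1 ?mul0r ?addr0.
have B := gg' (a * x + b).
have C := @is_derive1_comp _ g (fun x => a * x + b) x _ _ B A.
apply: is_derive_eq.
by rewrite /GRing.scale/= ?mul0r ?add0r ?addr0; ring.
Qed.

(** One coordinate factor of [heat_kernel r], without its normalisation. *)
Definition gaussian (r x : R) : R := expR (- (x ^+ 2 / (4 * r))).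

Lemma is_derive_poly_gaussian (r : R) (p : {poly R}) x :
  is_derive x (1 : R) (fun x => p.[x] * gaussian r x)
    ((p^`() - (2 * r)^-1 *: (p * 'X)).[x] * gaussian r x).
Proof.
have A : is_derive x (1 : R) (fun x => - (x ^+ 2 / (4 * r))) (- (x / (2 * r))).
  have -> : (fun x => - (x ^+ 2 / (4 * r))) = (fun x => (- (4 * r)^-1) * x ^+ 2).
    by apply/funext => y; rewrite mulrC mulNr.
  apply: is_derive_eq; rewrite /GRing.scale/= !mulr1.
  (* At r = 0 all quotients are 0 by convention, the function is constant, and the formula still
     holds; no sign condition on [r] has to be carried along. *)
  have [->|r0] := eqVneq r 0; first by rewrite !mulr0 invr0; ring.
  by field.
have B := @is_derive1_comp _ expR (fun x => - (x ^+ 2 / (4 * r))) x _ _ (is_derive_expR _) A.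
have C := is_derive_poly p x.
apply: is_derive_eq; rewrite /GRing.scale/= !(hornerD, hornerN, hornerZ, hornerM, hornerX) /gaussian.
have [->|r0] := eqVneq r 0; first by rewrite !mulr0 invr0; ring.
by field.
Qed.

Lemma smooth1_gaussian (r : R) : smooth1 (gaussian r).
Proof.
exists [set h | exists p : {poly R}, h = (fun x => p.[x] * gaussian r x)].
  by exists 1; apply/funext => x; rewrite hornerE mul1r.
move=> _ [p ->]; exists (fun x => (p^`() - (2 * r)^-1 *: (p * 'X)).[x] * gaussian r x).
  by eexists.
by move=> x; exact: is_derive_poly_gaussian.
Qed.

(** The derivatives of exp(- 1/x), extended by 0, all have this form; it is the family that
    witnesses smoothness. *)
Definition flat_poly (p : {poly R}) (x : R) : R :=
  if 0 < x then p.[x^-1] * expR (- x^-1) else 0.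

(** Flatness at 0 to every order, by induction on [p]: a factor 1/x costs one power of [x], hence
    the use of the hypothesis at [m.+1], and for constants one term of the exponential series gives
    $e^{1/x} \ge x^{-(m+1)}/(m+1)!$. *)
Lemma flat_poly_bound (p : {poly R}) (m : nat) :
  exists K : R, forall x, x <= 1 -> `|flat_poly p x| <= K * `|x| ^+ m.
Proof.
suff [K [K0 hK]] : exists K : R, 0 <= K /\
    forall x, 0 < x -> x <= 1 -> `|p.[x^-1] * expR (- x^-1)| <= K * x ^+ m.
  exists K => x x1; rewrite /flat_poly; case: ifPn => x0.
    by rewrite (gtr0_norm x0) hK.
  by rewrite normr0 mulr_ge0// exprn_ge0.
elim/poly_ind: p m => [|p c IH] m.
  by exists 0; split => // x _ _; rewrite horner0 mul0r normr0 mul0r.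
have [K [K0 hK]] := IH m.+1.
exists (K + `|c| * (m.+1)`!%:R); split; first by rewrite addr_ge0// mulr_ge0.
move=> x x0 x1; rewrite !hornerE mulrDl (le_trans (ler_normD _ _))// mulrDl lerD//.
  have := hK x x0 x1; rewrite exprS mulrCA mulrA => h.
  rewrite mulrAC normrM (gtr0_norm (_ : 0 < x^-1)) ?invr_gt0// ler_pdivrMr//.
  by rewrite -mulrA (mulrC (x ^+ m)) -exprS -(mulrC (x ^+ m.+1)) mulrC; move: (hK x x0 x1).
rewrite normrM (ger0_norm (expR_ge0 _)) -mulrA ler_wpM2l//.
have xi0 : 0 <= x^-1 by rewrite invr_ge0 ltW.
have := expR_ge1Dxn m xi0.
have E0 : 0 < expR x^-1 by exact: expR_gt0.
rewrite expRN => h.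
have h2 : x^-1 ^+ m.+1 / (m.+1)`!%:R <= expR x^-1.
  by apply: le_trans h; rewrite lerDr.
rewrite invf_ple ?posrE//; last by rewrite mulr_gt0 ?ltr0n ?fact_gt0// exprn_gt0.
apply: le_trans h2; rewrite invfM mulrC ler_wpM2r ?invr_ge0//.
rewrite exprS exprVn -[leLHS]mul1r ler_wpM2r ?invr_ge0 ?exprn_ge0 ?(ltW x0)//.
by rewrite invf_ge1.
Qed.

Lemma is_derive_flat0 (f : R -> R) (K : R) : f 0 = 0 ->
  (forall x, x <= 1 -> `|f x| <= K * `|x| ^+ 2) -> is_derive (0 : R) (1 : R) f 0.
Proof.
move=> f0 fK.
have H : (h^-1 *: (f (h *: 1 + 0) - f 0))%R @[h --> 0^'] --> (0 : R).
  apply/cvgrPdist_lt => e e0; near=> h.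
  have h0 : h != 0 by near: h; exact: nbhs_dnbhs_neq.
  have h1 : `|h| < 1 by near: h; apply: dnbhs0_lt.
  rewrite sub0r normrN /GRing.scale/= mulr1 addr0 f0 subr0 normrM normfV.
  rewrite mulrC ltr_pdivrMr ?normr_gt0//.
  apply: (le_lt_trans (fK h (ltW (le_lt_trans (ler_norm _) h1)))).
  rewrite expr2 mulrA ltr_pM2r ?normr_gt0//.
  apply: (@le_lt_trans _ _ ((`|K| + 1) * `|h|)).
    by rewrite ler_wpM2r// (le_trans (ler_norm _))// lerDl.
  rewrite mulrC -ltr_pdivlMr ?ltr_wpDl//.
  by near: h; apply: dnbhs0_lt; rewrite divr_gt0// ltr_wpDl.
by apply: DeriveDef; [apply/cvg_ex; exists 0 | exact: cvg_lim].
Unshelve. all: by end_near. Qed.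

Lemma is_derive_flat_poly (p : {poly R}) x :
  is_derive x (1 : R) (flat_poly p) (flat_poly ('X ^+ 2 * (p - p^`())) x).
Proof.
have [x0|x0|->] := ltgtP x 0.
- rewrite [X in is_derive _ _ _ X](_ : _ = 0); last by rewrite /flat_poly ltNge (ltW x0).
  have := is_derive_cst (0 : R) x (1 : R); apply: near_eq_is_derive => //.
  near=> y; rewrite /flat_poly ifF//; apply/negbTE; rewrite -leNgt; apply/ltW.
  by near: y; exact: lt_nbhsl.
- rewrite [X in is_derive _ _ _ X](_ : _ = (p^`()).[x^-1] * (- x ^- 2) * expR (- x^-1)
     + p.[x^-1] * (x ^- 2 * expR (- x^-1))); last first.
    rewrite /flat_poly ifT// hornerM hornerXn hornerD hornerN -(exprVn x 2).
    by ring.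
  have A : is_derive x (1 : R) (fun y : R => y^-1) (- x ^- 2).
    apply: DeriveDef; first by apply: derivableV => //; rewrite gt_eqF.
    by rewrite deriveV ?gt_eqF// derive_id /GRing.scale/= mulr1.
  have B := @is_derive1_comp _ (fun y => p.[y]) (fun y : R => y^-1) x _ _ (is_derive_poly p _) A.
  have A' : is_derive x (1 : R) (fun y : R => - y^-1) (x ^- 2).
    by apply: is_derive_eq; rewrite opprK.
  have C := @is_derive1_comp _ expR (fun y : R => - y^-1) x _ _ (is_derive_expR _) A'.
  have D : is_derive x (1 : R) (fun y => p.[y^-1] * expR (- y^-1))
     ((p^`()).[x^-1] * (- x ^- 2) * expR (- x^-1) + p.[x^-1] * (x ^- 2 * expR (- x^-1))).
    apply: is_derive_eq; rewrite /GRing.scale/=; ring.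
  move: D; apply: near_eq_is_derive => //; near=> y; rewrite /flat_poly ifT//.
  by near: y; exact: lt_nbhsr.
- rewrite [X in is_derive _ _ _ X](_ : _ = 0); last by rewrite /flat_poly ltxx.
  (* A quadratic bound makes the difference quotient at 0 tend to 0. *)
  have [K hK] := flat_poly_bound p 2.
  by apply: (is_derive_flat0 _ hK); rewrite /flat_poly ltxx.
Unshelve. all: by end_near. Qed.

Definition flat : R -> R := flat_poly 1.

Lemma smooth1_flat : smooth1 flat.
Proof.
exists [set h | exists p : {poly R}, h = flat_poly p]; first by exists 1.
move=> _ [p ->]; exists (flat_poly ('X ^+ 2 * (p - p^`()))); first by eexists.
by move=> x; exact: is_derive_flat_poly.
Qed.

Lemma flatE x : flat x = if 0 < x then expR (- x^-1) else 0.
Proof. by rewrite /flat /flat_poly hornerE mul1r. Qed.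

Lemma flat01 x : 0 <= flat x <= 1.
Proof.
rewrite flatE; case: ifP => [x0|_]; last by rewrite lexx ler01.
by rewrite expR_ge0 expR_le1 oppr_le0 invr_ge0 ltW.
Qed.

Lemma flat_le0 x : x <= 0 -> flat x = 0.
Proof. by move=> x0; rewrite flatE ltNge x0. Qed.

End smooth_real_functions.

(** * Products of one-variable functions on $\mathbb{R}^n$ *)

Section tensor.
Context {R : realType} {n : nat}.
Implicit Types (g : 'I_n -> R -> R) (x : 'rV[R]_n).
Local Open Scope ring_scope.

Definition tensor g : 'rV[R]_n -> R := fun x => \prod_(i < n) g i (x ord0 i).

Definition derive_at (j : 'I_n) g : 'I_n -> R -> R :=
  fun i => if i == j then derive1 (g i) else g i.

Lemma continuous_tensor g : (forall i, continuous (g i)) -> continuous (tensor g).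
Proof.
move=> cg; rewrite /tensor; apply: continuous_big => [y|i _ x]; first exact: mul_continuous.
apply: (@continuous_comp _ _ _ (fun x : 'rV[R]_n => x ord0 i) (g i)); last exact: cg.
exact: coord_continuous.
Qed.

Lemma is_derive_tensor g j x : (forall y, is_derive y (1 : R) (g j) (derive1 (g j) y)) ->
  is_derive x (delta_mx ord0 j : 'rV[R]_n) (tensor g) (tensor (derive_at j g) x).
Proof.
move=> dg; set c := \prod_(i < n | i != j) g i (x ord0 i).
have E : tensor (derive_at j g) x = c * derive1 (g j) (x ord0 j).
  rewrite /tensor (bigD1 j)//= /derive_at eqxx mulrC; congr (_ * _).
  by apply: eq_bigr => i /negbTE ->.
have [/cvg_ex[l /= lH] dl] := dg (x ord0 j).
have H : (h^-1 *: (tensor g (h *: delta_mx ord0 j + x) - tensor g x)) @[h --> 0^']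
    --> tensor (derive_at j g) x.
  rewrite E -dl /derive (cvg_lim _ lH)//.
  have -> : (fun h : R => h^-1 *: (tensor g (h *: delta_mx ord0 j + x) - tensor g x)) =
      (fun h : R => c * (h^-1 *: (g j (h *: 1 + x ord0 j) - g j (x ord0 j)))).
    apply/funext => h; rewrite /tensor (bigD1 j)//= [X in _ - X](bigD1 j)//=.
    rewrite (eq_bigr (fun i => g i (x ord0 i))); last first.
      by move=> i /negbTE ij; rewrite !mxE eqxx/= ij mulr0 add0r.
    by rewrite !mxE !eqxx/= -/c /GRing.scale/=; ring.
  exact: cvgMr.
by apply: DeriveDef; [apply/cvg_ex; eexists; exact: H | exact: cvg_lim].
Qed.

Lemma partial_tensor g j : (forall i, smooth1 (g i)) ->
  partial j (tensor g) = tensor (derive_at j g).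
Proof.
move=> sg; apply/funext => x; have [dg _] := smooth1_derive (sg j).
by have [_] := is_derive_tensor x dg.
Qed.

Lemma smooth1_derive_at g j : (forall i, smooth1 (g i)) -> forall i, smooth1 (derive_at j g i).
Proof.
by move=> sg i; rewrite /derive_at; case: ifP => // _; have [] := smooth1_derive (sg i).
Qed.

(** Each partial derivative of a tensor product is again a tensor product, with one factor
    differentiated, so iterated ones never leave the class. *)
Lemma smooth_tensor g : (forall i, smooth1 (g i)) -> smooth (tensor g).
Proof.
move=> sg s.
have [g' sg' ->] : exists2 g', (forall i, smooth1 (g' i)) &
    foldr (@partial R n) (tensor g) s = tensor g'.
  elim: s => [|j s [g' sg' /= ->]]; first by exists g.
  by exists (derive_at j g'); [exact: smooth1_derive_at|exact: partial_tensor].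
split; first by apply: continuous_tensor => i; exact: smooth1_continuous.
by move=> i x; have [dg _] := smooth1_derive (sg' i); have [] := is_derive_tensor x dg.
Qed.

Lemma laplacian_tensor g : (forall i, smooth1 (g i)) ->
  laplacian (tensor g) = (fun x => \sum_(j < n) tensor (derive_at j (derive_at j g)) x).
Proof.
move=> sg; apply/funext => x; apply: eq_bigr => j _.
by rewrite !partial_tensor//; exact: smooth1_derive_at.
Qed.

Lemma test_function_tensor g (A B : 'I_n -> R) : (forall i, smooth1 (g i)) ->
  (forall i y, ~~ (A i <= y <= B i) -> g i y = 0) -> test_function (tensor g).
Proof.
move=> sg sup; split; first exact: smooth_tensor.
pose C : set 'rV[R]_n := [set x | forall i, `[A i, B i]%classic (x ord0 i)].
have cC : compact C by apply: (@rV_compact R n (fun i => `[A i, B i]%classic)) => i; exact: segment_compact.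
apply: (subclosed_compact _ cC); first exact: closed_closure.
rewrite [X in _ `<=` X](closure_id _).1; last first.
  by apply: compact_closed cC; exact: norm_hausdorff.
apply: closureS => x /= gx i; rewrite /= in_itv/=; apply: contraNT gx => h.
by rewrite /tensor (bigD1 i)//= (sup i)// mul0r.
Qed.

End tensor.

(** * The mean Bernstein function *)

(* A function nonincreasing and right-continuous in its first argument is the
   countable union over rationals of measurable rectangles at each level. *)
Lemma measurable_ray_section d (T : measurableType d) (R : realType)
    (f : R -> T -> \bar R) :
  (forall s, measurable_fun setT (f s)) ->
  (forall s r y, (s <= r)%R -> f r y <= f s y) ->
  (forall s y c, c < f s y -> exists2 r, (s < r)%R & c < f r y) ->
  measurable_fun setT (fun z : (measurableTypeR R * T)%type => f z.1 z.2).
Proof.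
move=> mf mono rc; apply: (@measurability _ _ _ _ setT _ (@ErealGenOInfty.G R)).
  exact: ErealGenOInfty.measurableE.
move=> _ [_ [c ->] <-]; rewrite setTI.
rewrite (_ : _ @^-1` _ = \bigcup_(r in [set: rat])
    (`]-oo, (ratr r : R)[%classic `*` [set y | c%:E < f (ratr r) y])).
  apply: bigcupT_measurable_rat => r; apply: measurableX => //.
  rewrite -[X in measurable X]setTI.
  exact: emeasurable_fun_o_infty.
apply/seteqP; split => [[s y] /=|[s y] [r _ [/= + cr]]].
  rewrite in_itv/= andbT => /rc[r sr cr].
  have [q] := rat_in_itvoo sr; rewrite in_itv/= => /andP[sq qr].
  exists q => //; split => /=; first by rewrite in_itv.
  exact: lt_le_trans (mono _ _ _ (ltW qr)).
by rewrite in_itv/= => sr; rewrite in_itv/= andbT (lt_le_trans cr)// mono// ltW.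
Qed.

(* Fubini for 1_{s < x}. *)
Lemma levy_integral_tail (R : realType)
    (m : {sigma_finite_measure set (measurableTypeR R) -> \bar R}) (lam : R) : (0 < lam)%R ->
  \int[m]_(s in `]0%R, +oo[) (1 - expR (- (lam * s)))%:E =
  lam%:E * \int[lapm lam]_s m `]s, +oo[%classic.
Proof.
move=> l0.
pose f (z : measurableTypeR R * measurableTypeR R) : \bar R := ((z.1 < z.2)%R%:R)%:E.
have mf : measurable_fun setT f.
  rewrite (_ : f = EFin \o \1_[set z : measurableTypeR R * measurableTypeR R | z.1 < z.2]%R); last first.
    apply/funext => z; rewrite /f /= indicE.
    by case: (boolP (z.1 < z.2)%R) => h; [rewrite mem_set|rewrite memNset//; exact/negP].
  apply/measurable_EFinP/measurable_indic.
  rewrite (_ : [set z | _] = (fun z : measurableTypeR R * measurableTypeR R => z.1 < z.2)%R @^-1` [set true]).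
    rewrite -[X in measurable X]setTI; exact: measurable_fun_ltr.
  by apply/seteqP; split => z.
have f0 z : 0 <= f z by rewrite lee_fin.
transitivity (lam%:E * \int[lapm lam]_s \int[m]_x f (s, x)); last first.
  congr (_ * _); apply: eq_integral => s _.
  rewrite -[RHS]mul1e -integral_cst// [RHS]integral_mkcond.
  apply: eq_integral => x _; rewrite /f patchE mem_setE in_itv/= andbT.
  by case: ifP.
rewrite (fubini_tonelli f)// -ge0_integralZl//; last 3 first.
- by apply: measurable_fun_fubini_tonelli_G.
- by move=> x _; exact: integral_ge0.
- by rewrite lee_fin ltW.
rewrite [LHS]integral_mkcond; apply: eq_integral => x _.
have -> : \int[lapm lam]_s f (s, x) = lapm lam `]-oo, x[%classic.
  rewrite -[RHS]mul1e -integral_cst// [RHS]integral_mkcond.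
  apply: eq_integral => s _; rewrite /f patchE mem_setE in_itv/=.
  by case: ifP.
rewrite patchE; case: ifPn.
  rewrite inE/= in_itv/= andbT => x0.
  have : lapm lam setT = lapm lam `]-oo, x[%classic + lapm lam `[x, +oo[%classic.
    rewrite -measureU//; last first.
      by rewrite -subset0 => z [] /=; rewrite !in_itv/= andbT ltNge => /negP.
    by congr (lapm _ _); apply/seteqP; split => // z _ /=; rewrite !in_itv/= andbT; case: (ltP z x); [left|right].
  rewrite lapm_ctail lapm_tail ?(ltW x0)// lapmT// => h.
  have fin : lapm lam `]-oo, x[%classic \is a fin_num.
    rewrite ge0_fin_numE//; apply: le_lt_trans (lapmT_fin l0).
    by apply: le_measure; rewrite ?inE.
  move: h; rewrite -(fineK fin) -EFinD => h; have {}h := EFin_inj h.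
  rewrite -EFinM; congr EFin.
  have := congr1 ( *%R lam) h.
  by rewrite divff ?gt_eqF// mulrDr mulrCA divff ?gt_eqF// mulr1 => ->; rewrite addrK.
rewrite notin_setE/= in_itv/= andbT => /negP; rewrite -leNgt => x0.
rewrite lapm_le0 ?mule0// => z /=; rewrite !in_itv/= => zx.
by rewrite (le_trans (ltW zx)).
Qed.

Lemma integral_lapm_cst (R : realType) (lam c : R) : (0 < lam)%R ->
  \int[lapm lam]__ c%:E = (c / lam)%:E.
Proof.
move=> l0; rewrite integral_cst//; transitivity (c%:E * lapm lam setT) => //.
by rewrite lapmT.
Qed.

Lemma integral_gt0 d (T : measurableType d) (R : realType)
    (m : {measure set T -> \bar R}) (D : set T) (f : T -> \bar R) :
  measurable D -> measurable_fun D f -> (forall x, D x -> 0 < f x) -> m D != 0 ->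
  0 < \int[m]_(x in D) f x.
Proof.
move=> mD mf f0 mD0; rewrite lt_neqAle integral_ge0 ?andbT; last first.
  by move=> x /f0/ltW.
apply/eqP => /esym h.
have /(ae_eq_integral_abs _ mD mf)[N [mN N0 DN]] : \int[m]_(x in D) `|f x| = 0.
  rewrite -h; apply: eq_integral => x; rewrite inE => /f0 fx.
  by rewrite gee0_abs// ltW.
move/eqP: mD0; apply; apply: (subset_measure0 mD mN _ N0) => x Dx; apply: DN => /= /(_ Dx) fx.
by have := f0 x Dx; rewrite fx ltxx.
Qed.

(** * The function E f(., Y) through the mean tail *)

Section levy.
Context {R : realType} {E : ptopologicalType}.
Variables (W : set (borel E)) (mW : measurable W).
Variables (p : probability (borel E) R) (pW : p W = 1).
Variables (a b : borel E -> R).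
Hypotheses (a_ge0 : forall y, (0 <= a y)%R) (b_ge0 : forall y, (0 <= b y)%R).
Variable nu : R.-sigmafker (borel E) ~> (measurableTypeR R).
Hypothesis nu_levy : forall y, truncated_moment nu y < +oo.
Hypothesis A1 : assumption_A1 W p a b.
Hypothesis A2 : assumption_A2 W p nu.
Hypothesis nu_infinite : forall y, nu y `]0%R, +oo[%classic = +oo.

(** A name for [nu y] to which the sigma-finiteness required by Tonelli can be attached. *)
Definition levy_measure y : set (measurableTypeR R) -> \bar R := nu y.
HB.instance Definition _ y := Measure.copy (levy_measure y) (nu y).
HB.instance Definition _ y := Measure_isSigmaFinite.Build _ _ _ (levy_measure y)
  (kernel_sigma_finite (s := nu) y).

Local Notation mu := (@lebesgue_measure R).
Local Notation tail s y := (nu y `]s, +oo[%classic).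

Let ma : measurable_fun setT a. Proof. by case: A1. Qed.
Let mb : measurable_fun setT b. Proof. by case: A1. Qed.

Let mtail (s : R) : measurable_fun setT (fun y => tail s y).
Proof. exact: (measurable_kernel nu). Qed.

Let tail_rc (s : R) y (c : \bar R) : c < tail s y -> exists2 r : R, (s < r)%R & c < tail r y.
Proof.
move=> cs; pose F (n : nat) := `]s + n.+1%:R^-1, +oo[%classic%R : set (measurableTypeR R).
have FE : `]s, +oo[%classic = \bigcup_n F n.
  apply/seteqP; split => x /=; rewrite ?in_itv/= ?andbT.
    move=> sx; exists (Num.truncn (x - s)^-1) => //; rewrite /F/= in_itv/= andbT -ltrBrDl.
    by rewrite invf_plt ?posrE ?subr_gt0//; exact: truncnS_gt.
  by move=> [n _]; rewrite /F/= in_itv/= andbT; apply: lt_trans; rewrite ltrDl invr_gt0.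
have ndF : nondecreasing_seq F.
  move=> m n mn; apply/subsetPset => x; rewrite /F/= !in_itv/= !andbT.
  by apply: le_lt_trans; rewrite lerD2l lef_pV2 ?posrE// ler_nat.
have H : nu y (F n) @[n --> \oo] --> tail s y.
  rewrite FE; apply: nondecreasing_cvg_mu.
  - by move=> i; rewrite /F.
  - by apply: bigcupT_measurable => i; rewrite /F.
  - exact: ndF.
have [n cn] : exists n, c < nu y (F n).
  apply: contrapT => /forallNP h.
  have : tail s y <= c.
    rewrite -(cvg_lim _ H)//; apply: lime_le; first by apply/cvg_ex; eexists; exact: H.
    by apply: nearW => n; rewrite leNgt; apply/negP.
  by rewrite leNgt cs.
by exists (s + n.+1%:R^-1)%R => //; rewrite ltrDl invr_gt0.
Qed.

Let tail_mono (s r : R) y : (s <= r)%R -> tail r y <= tail s y.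
Proof.
move=> sr; apply: le_measure; rewrite ?inE//.
by move=> x /=; rewrite !in_itv/= !andbT; exact: le_lt_trans.
Qed.

Lemma measurable_tail2 :
  measurable_fun setT (fun z : (measurableTypeR R * borel E)%type => tail z.1 z.2).
Proof. exact: (measurable_ray_section mtail tail_mono tail_rc). Qed.

Let mmin : measurable_fun setT (fun s : measurableTypeR R => (Num.min s 1)%:E).
Proof. by apply/measurable_EFinP; apply: measurable_minr. Qed.

Let min0 (s : R) : (0 < s)%R -> (0 < Num.min s 1)%R.
Proof. by move=> s0; rewrite lt_min s0 ltr01. Qed.

(** Markov's inequality for the function s -> min(s, 1). *)
Lemma tail_le (s : R) y : (0 < s)%R -> (Num.min s 1)%:E * tail s y <= truncated_moment nu y.
Proof.
move=> s0; rewrite -integral_cst//.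
apply: (@le_trans _ _ (\int[nu y]_(x in `]s, +oo[) (Num.min x 1)%:E)).
  apply: ge0_le_integral => //.
  - by move=> x _; rewrite lee_fin ltW// min0.
  - exact: measurable_funTS.
  - move=> x /=; rewrite in_itv/= andbT => sx.
    by rewrite lee_fin le_min !ge_min lexx orbT (ltW sx).
apply: ge0_subset_integral => //.
- exact: measurable_funTS.
- by move=> x /=; rewrite in_itv/= andbT => x0; rewrite lee_fin ltW// min0.
- by move=> x /=; rewrite !in_itv/= !andbT; exact: lt_trans.
Qed.

Lemma tail_fin (s : R) y : (0 < s)%R -> tail s y < +oo.
Proof.
move=> s0; rewrite ltNge leye_eq; apply/negP => /eqP h.
have := tail_le y s0; rewrite h gt0_muley ?lte_fin ?min0// => /le_lt_trans.
by move=> /(_ _ (nu_levy y)); rewrite ltxx.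
Qed.

Let mV : measurable_fun setT (truncated_moment nu).
Proof.
rewrite (_ : truncated_moment nu = fun y => \int[nu y]_s
    ((fun s : R => (Num.min s 1)%:E) \_ `]0%R, +oo[%classic) s); last first.
  by apply/funext => y; rewrite /truncated_moment integral_mkcond.
apply: measurable_fun_integral_kernel.
- exact: measurable_kernel.
- move=> z; rewrite patchE; case: ifPn => //; rewrite inE/= in_itv/= andbT => z0.
  by rewrite lee_fin ltW// min0.
- by apply/(measurable_restrictT _ _).1 => //; exact: measurable_funTS.
Qed.

Let V0 y : 0 <= truncated_moment nu y.
Proof.
by apply: integral_ge0 => x /=; rewrite in_itv/= andbT => x0; rewrite lee_fin ltW// min0.
Qed.

Let meanD (f g : borel E -> \bar R) : (forall y, 0 <= f y) -> (forall y, 0 <= g y) ->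
  measurable_fun setT f -> measurable_fun setT g ->
  mean W p (fun y => f y + g y) = mean W p f + mean W p g.
Proof.
move=> f0 g0 mf mg; apply: ge0_integralD => //; exact: measurable_funTS.
Qed.

Let meanZ (k : R) (g : borel E -> \bar R) : (0 <= k)%R -> (forall y, 0 <= g y) ->
  measurable_fun setT g -> mean W p (fun y => k%:E * g y) = k%:E * mean W p g.
Proof. by move=> k0 g0 mg; apply: ge0_integralZl => //; exact: measurable_funTS. Qed.

Let mean_le (f g : borel E -> \bar R) : (forall y, 0 <= f y) ->
  measurable_fun setT f -> measurable_fun setT g -> (forall y, f y <= g y) ->
  mean W p f <= mean W p g.
Proof.
by move=> f0 mf mg fg; apply: ge0_le_integral => //; exact: measurable_funTS.
Qed.

Let ea y : 0 <= (EFin \o a) y. Proof. by rewrite lee_fin. Qed.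
Let eb y : 0 <= (EFin \o b) y. Proof. by rewrite lee_fin. Qed.
Let mEa : measurable_fun setT (EFin \o a). Proof. exact/measurable_EFinP. Qed.
Let mEb : measurable_fun setT (EFin \o b). Proof. exact/measurable_EFinP. Qed.

Let mean_bnd (g : borel E -> \bar R) (M : R) : (forall y, 0 <= g y) -> measurable_fun setT g ->
  (forall y, g y <= M%:E) -> mean W p g < +oo.
Proof.
move=> g0 mg gM; apply: (@le_lt_trans _ _ (\int[p]_(y in W) cst M%:E y)).
  apply: ge0_le_integral => //; first exact: measurable_funTS.
by rewrite integral_cst// lte_mul_pinfty ?lee_fin// ?(le_lt_trans (probability_le1 _ _))// ?ltry//
   -lee_fin (le_trans (g0 point)).
Qed.

Lemma mean_a_fin : mean W p (EFin \o a) < +oo.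
Proof.
have [_ _ [[M h]|[//]]] := A1; apply: (@mean_bnd _ M).
- by move=> y; rewrite lee_fin.
- exact/measurable_EFinP.
- by move=> y; rewrite lee_fin; have [] := h y.
Qed.

Lemma mean_b_fin : mean W p (EFin \o b) < +oo.
Proof.
have [_ _ [[M h]|[]//]] := A1; apply: (@mean_bnd _ M).
- by move=> y; rewrite lee_fin.
- exact/measurable_EFinP.
- by move=> y; rewrite lee_fin; have [] := h y.
Qed.

Lemma mean_V_fin : mean W p (truncated_moment nu) < +oo.
Proof. by have [[M h]|//] := A2; apply: (@mean_bnd _ M). Qed.

Lemma nubar_ge0 s y : 0 <= nubar a nu s y.
Proof. by rewrite adde_ge0// lee_fin. Qed.

Lemma measurable_nubar2 : measurable_fun setT
  (fun z : (measurableTypeR R * borel E)%type => nubar a nu z.1 z.2).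
Proof.
apply: emeasurable_funD; last exact: measurable_tail2.
by apply/measurable_EFinP; exact: measurableT_comp.
Qed.

Lemma measurable_nubar s : measurable_fun setT (nubar a nu s).
Proof. by apply: emeasurable_funD => //; exact/measurable_EFinP. Qed.

Lemma mean_nubar_fin (s : R) : (0 < s)%R -> mean W p (nubar a nu s) < +oo.
Proof.
move=> s0; have m0 := min0 s0.
apply: (@le_lt_trans _ _ (mean W p (EFin \o a) + (Num.min s 1)^-1%:E * mean W p (truncated_moment nu))).
  have i0 : (0 <= (Num.min s 1)^-1)%R by rewrite invr_ge0 ltW.
  have iV0 y : 0 <= (Num.min s 1)^-1%:E * truncated_moment nu y by rewrite mule_ge0 ?lee_fin.
  have miV : measurable_fun setT (fun y => (Num.min s 1)^-1%:E * truncated_moment nu y).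
    exact: measurable_funeM.
  rewrite -meanZ// -meanD//; apply: mean_le.
  - by move=> y; exact: nubar_ge0.
  - exact: measurable_nubar.
  - exact: emeasurable_funD.
  - move=> y; rewrite leeD2l//.
    have -> : tail s y = (Num.min s 1)^-1%:E * ((Num.min s 1)%:E * tail s y).
      by rewrite muleA -EFinM mulVf ?mul1e// gt_eqF.
    by rewrite lee_wpmul2l ?lee_fin// tail_le.
rewrite lte_add_pinfty ?mean_a_fin// lte_mul_pinfty ?mean_V_fin// lee_fin invr_ge0.
exact: ltW.
Qed.

Lemma mean_nubar_ge0 s : 0 <= mean W p (nubar a nu s).
Proof. by apply: integral_ge0 => y _; exact: nubar_ge0. Qed.

Lemma measurable_mean_nubar : measurable_fun setT
  (fun s : measurableTypeR R => mean W p (nubar a nu s)).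
Proof.
rewrite (_ : (fun s => _) = fun s => \int[p]_y
   ((fun z : (measurableTypeR R * borel E)%type => nubar a nu z.1 z.2 * (\1_W z.2)%:E) (s, y))).
  apply: (@measurable_fun_fubini_tonelli_F _ _ _ _ _ p
     (fun z : (measurableTypeR R * borel E)%type => nubar a nu z.1 z.2 * (\1_W z.2)%:E)).
    apply: emeasurable_funM; first exact: measurable_nubar2.
    by apply/measurable_EFinP; exact: (measurableT_comp (measurable_indic mW) measurable_snd).
  by move=> z; rewrite mule_ge0 ?nubar_ge0// lee_fin.
apply/funext => s; rewrite /mean integral_mkcond; apply: eq_integral => y _ /=.
by rewrite patchE indicE; case: (_ \in _); rewrite ?mule1 ?mule0.
Qed.

Lemma Enubar_ge0 s : (0 <= Enubar W p a nu s)%R.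
Proof. by rewrite fine_ge0// mean_nubar_ge0. Qed.

Lemma EFin_Enubar s : (0 < s)%R -> (Enubar W p a nu s)%:E = mean W p (nubar a nu s).
Proof. by move=> s0; rewrite fineK// ge0_fin_numE ?mean_nubar_fin// mean_nubar_ge0. Qed.

Lemma measurable_Enubar : measurable_fun setT (Enubar W p a nu : measurableTypeR R -> R).
Proof. by apply: measurableT_comp => //; exact: measurable_mean_nubar. Qed.

Lemma EFin_Eb : (Eb W p b)%:E = mean W p (EFin \o b).
Proof.
by rewrite fineK// ge0_fin_numE ?mean_b_fin//; apply: integral_ge0 => y _; rewrite lee_fin.
Qed.

Lemma Eb_ge0 : (0 <= Eb W p b)%R.
Proof. by rewrite fine_ge0//; apply: integral_ge0 => y _; rewrite lee_fin. Qed.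

(** Tonelli turns the Lévy integral into [lam] times the Laplace transform of the tail, and the
    killing term equals [lam] times the transform of the constant [a y]. Divided by [lam], the
    Bernstein function is thus the transform of a mass [b y] at 0 plus [nubar]. *)
Lemma bernsteinE (lam : R) y : (0 < lam)%R ->
  bernstein a b nu lam y = lam%:E * ((b y)%:E + \int[lapm lam]_s nubar a nu s y).
Proof.
move=> l0.
have mt : measurable_fun setT (fun s : measurableTypeR R => tail s y).
  apply: (measurableT_comp measurable_tail2 (g := fun s : measurableTypeR R => (s, y))).
  exact: measurable_pair2.
rewrite /bernstein (levy_integral_tail (levy_measure y) l0).
rewrite [X in _ = _ * (_ + X)](_ : _ = (lam^-1 * a y)%:E + \int[lapm lam]_s tail s y); last first.
  rewrite ge0_integralD//; last by move=> s _; rewrite lee_fin.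
  by congr (_ + _); rewrite integral_lapm_cst// mulrC.
have i0 : 0 <= \int[lapm lam]_s tail s y by apply: integral_ge0 => s _; exact: measure_ge0.
rewrite addeA (@ge0_muleDr _ lam%:E _ _ _ i0); last first.
  by rewrite -EFinD lee_fin addr_ge0// mulr_ge0// invr_ge0 ltW.
congr (_ + _); rewrite -EFinD -EFinM; congr EFin.
by rewrite mulrDr mulrA divff ?gt_eqF// mul1r addrC mulrC.
Qed.

Let mint (lam : R) : measurable_fun setT (fun y => \int[lapm lam]_s nubar a nu s y).
Proof.
apply: (@measurable_fun_fubini_tonelli_G _ _ _ _ _ (lapm lam)
   (fun z : (measurableTypeR R * borel E)%type => nubar a nu z.1 z.2)).
  exact: measurable_nubar2.
by move=> z; exact: nubar_ge0.
Qed.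

Lemma mean_bernsteinE (lam : R) : (0 < lam)%R -> mean W p (bernstein a b nu lam) =
  lam%:E * (mean W p (EFin \o b) + \int[lapm lam]_s mean W p (nubar a nu s)).
Proof.
move=> l0; have int0 y : 0 <= \int[lapm lam]_s nubar a nu s y.
  by apply: integral_ge0 => s _; exact: nubar_ge0.
rewrite /mean; under eq_integral do rewrite bernsteinE//.
rewrite ge0_integralZl//; last 3 first.
- apply/measurable_funTS/emeasurable_funD; first exact/measurable_EFinP.
  exact: mint.
- by move=> y _; rewrite adde_ge0// lee_fin.
- by rewrite lee_fin ltW.
congr (_ * _); rewrite ge0_integralD//; last 3 first.
- by move=> y _; rewrite lee_fin.
- by apply/measurable_funTS/measurable_EFinP.
- by apply/measurable_funTS; exact: mint.
congr (_ + _).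
(* The indicator moves the restriction to [W] into the integrand, so that Tonelli is used on the
   whole space. *)
pose g (z : measurableTypeR R * borel E) := nubar a nu z.1 z.2 * (\1_W z.2)%:E.
have mg : measurable_fun setT g.
  apply: emeasurable_funM; first exact: measurable_nubar2.
  by apply/measurable_EFinP; exact: (measurableT_comp (measurable_indic mW) measurable_snd).
have g0 z : 0 <= g z by rewrite mule_ge0 ?nubar_ge0// lee_fin.
have gE s : \int[p]_(y in W) nubar a nu s y = \int[p]_y g (s, y).
  rewrite integral_mkcond; apply: eq_integral => y _ /=.
  by rewrite patchE /g/= indicE; case: (_ \in _); rewrite ?mule1 ?mule0.
under [RHS]eq_integral do rewrite gE.
rewrite (fubini_tonelli g mg g0) integral_mkcond; apply: eq_integral => y _.
rewrite patchE /g/= indicE; case: (_ \in _).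
  by apply: eq_integral => s _; rewrite mule1.
by rewrite integral0_eq// => s _; rewrite mule0.
Qed.

Lemma measurable_bernstein (lam : R) : (0 < lam)%R ->
  measurable_fun setT (bernstein a b nu lam).
Proof.
move=> l0.
rewrite (_ : bernstein _ _ _ _ = fun y => lam%:E * ((b y)%:E + \int[lapm lam]_s nubar a nu s y)).
  by apply: measurable_funeM; apply: emeasurable_funD; [exact/measurable_EFinP|exact: mint].
by apply/funext => y; exact: bernsteinE.
Qed.

(** Since $1-e^{-\lambda s} \le \max(\lambda,1)\min(s,1)$, the truncated moment controls the Lévy
    integral. *)
Lemma mean_bernstein_fin (lam : R) : (0 < lam)%R -> mean W p (bernstein a b nu lam) < +oo.
Proof.
move=> l0; pose c := Num.max lam 1%R.
have c0 : (0 < c)%R by rewrite lt_max l0.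
have bound (s : R) : (0 < s)%R -> (1 - expR (- (lam * s)) <= c * Num.min s 1)%R.
  move=> s0; have := expR_ge1Dx (- (lam * s)) => h1; have := expR_ge0 (- (lam * s)) => h2.
  have h3 : (lam * s <= c * s)%R by rewrite ler_wpM2r ?(ltW s0)// le_max lexx.
  have h4 : (1 <= c)%R by rewrite le_max lexx orbT.
  by rewrite /Num.min; case: ifP => _; lra.
have expos (s : R) : (0 < s)%R -> 0 <= (1 - expR (- (lam * s)))%:E.
  by move=> s0; rewrite lee_fin subr_ge0 expR_le1 oppr_le0 mulr_ge0// ltW.
have mexp : measurable_fun setT (fun s : measurableTypeR R => (1 - expR (- (lam * s)))%:E).
  apply/measurable_EFinP; apply: measurable_funB => //; apply: measurableT_comp => //.
  by apply: measurableT_comp => //; exact: measurable_funM.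
have le y : bernstein a b nu lam y <= (a y)%:E + lam%:E * (b y)%:E + c%:E * truncated_moment nu y.
  rewrite /bernstein -EFinM (mulrC lam) leeD2l// -ge0_integralZl//; last 3 first.
  - exact: measurable_funTS.
  - by move=> x /=; rewrite in_itv/= andbT => x0; rewrite lee_fin ltW// min0.
  - by rewrite lee_fin ltW.
  apply: ge0_le_integral => //.
  - by move=> s /=; rewrite in_itv/= andbT; exact: expos.
  - exact: measurable_funTS.
  - by apply: measurable_funeM; exact: measurable_funTS.
  - by move=> s /=; rewrite in_itv/= andbT => s0; rewrite -EFinM lee_fin bound.
have b0 y : 0 <= bernstein a b nu lam y.
  apply: adde_ge0; first by rewrite lee_fin addr_ge0// mulr_ge0// ltW.
  by apply: integral_ge0 => s /=; rewrite in_itv/= andbT; exact: expos.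
have mbern := measurable_bernstein l0.
apply: (@le_lt_trans _ _ (mean W p (EFin \o a) + lam%:E * mean W p (EFin \o b) + c%:E * mean W p (truncated_moment nu))).
  have lb y : 0 <= lam%:E * (EFin \o b) y by rewrite mule_ge0 ?lee_fin ?(ltW l0).
  have cV y : 0 <= c%:E * truncated_moment nu y by rewrite mule_ge0 ?lee_fin ?(ltW c0).
  have mlb : measurable_fun setT (fun y => lam%:E * (EFin \o b) y) by exact: measurable_funeM.
  have mcV : measurable_fun setT (fun y => c%:E * truncated_moment nu y).
    exact: measurable_funeM.
  rewrite -(meanZ (ltW l0) eb mEb) -(meanZ (ltW c0) V0 mV) -(meanD ea lb mEa mlb).
  rewrite -meanD//; last exact: emeasurable_funD.
    apply: mean_le => //; apply: emeasurable_funD => //; exact: emeasurable_funD.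
  by move=> y; exact: adde_ge0.
rewrite lte_add_pinfty//; first rewrite lte_add_pinfty ?mean_a_fin//.
- by rewrite lte_mul_pinfty ?mean_b_fin// lee_fin ltW.
- by rewrite lte_mul_pinfty ?mean_V_fin// lee_fin ltW.
Qed.

Lemma EFin_Ef (lam : R) : (0 < lam)%R -> (Ef W p a b nu lam)%:E =
  lam%:E * (mean W p (EFin \o b) + \int[lapm lam]_s mean W p (nubar a nu s)).
Proof.
move=> l0; rewrite -mean_bernsteinE// fineK// ge0_fin_numE ?mean_bernstein_fin//.
rewrite mean_bernsteinE// mule_ge0 ?lee_fin ?(ltW l0)// adde_ge0//; apply: integral_ge0 => y _.
  by rewrite lee_fin.
exact: mean_nubar_ge0.
Qed.

Let int_fin (lam : R) : (0 < lam)%R -> \int[lapm lam]_s mean W p (nubar a nu s) < +oo.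
Proof.
move=> l0; rewrite ltNge leye_eq; apply/negP => /eqP h.
have := EFin_Ef l0; rewrite h addey ?gt0_muley ?lte_fin//.
by rewrite -EFin_Eb.
Qed.

Lemma integral_Enubar (lam : R) : (0 < lam)%R ->
  \int[lapm lam]_s (Enubar W p a nu s)%:E = \int[lapm lam]_s mean W p (nubar a nu s).
Proof.
move=> l0; apply: ae_eq_integral => //.
- by apply/measurable_EFinP; exact: measurable_Enubar.
- exact: measurable_mean_nubar.
- by apply: filterS (ae_lapm_gt0 lam) => s s0 _; rewrite EFin_Enubar.
Qed.

Lemma integrable_Enubar (lam : R) : (0 < lam)%R ->
  (lapm lam).-integrable setT (EFin \o Enubar W p a nu).
Proof.
move=> l0; apply/integrableP; split.
  by apply/measurable_EFinP; exact: measurable_Enubar.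
under eq_integral do rewrite /= ger0_norm ?Enubar_ge0//.
by rewrite integral_Enubar// int_fin.
Qed.

Lemma EfE (lam : R) : (0 < lam)%R -> Ef W p a b nu lam =
  (lam * (Eb W p b + \int[lapm lam]_s Enubar W p a nu s))%R.
Proof.
move=> l0; apply: EFin_inj; rewrite EFin_Ef// -integral_Enubar// -EFin_Eb.
by rewrite -EFin_Rintegral ?EFinM ?EFinD//; exact: integrable_Enubar.
Qed.

Lemma bernstein_gt0 (lam : R) y : (0 < lam)%R -> 0 < bernstein a b nu lam y.
Proof.
move=> l0;
apply: (@lt_le_trans _ _ (\int[nu y]_(s in `]0%R, +oo[) (1 - expR (- (lam * s)))%:E)); last first.
  by apply: leeDr; rewrite -EFinD lee_fin addr_ge0// mulr_ge0// ltW.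
apply: integral_gt0 => //.
- apply/measurable_funTS/measurable_EFinP; apply: measurable_funB => //; apply: measurableT_comp => //.
  by apply: measurableT_comp => //; exact: measurable_funM.
- move=> x /=; rewrite in_itv/= andbT => x0; rewrite lte_fin subr_gt0 expR_lt1 oppr_lt0.
  by rewrite mulr_gt0.
- by apply/eqP => h; have := nu_infinite y; rewrite h.
Qed.

Lemma Ef_gt0 (lam : R) : (0 < lam)%R -> (0 < Ef W p a b nu lam)%R.
Proof.
move=> l0; rewrite -lte_fin EFin_Ef//.
rewrite -mean_bernsteinE//; apply: integral_gt0 => //.
- by apply: measurable_funTS; exact: measurable_bernstein.
- move=> y _; exact: bernstein_gt0.
- apply/eqP => h; have := pW; rewrite h => h0; have := EFin_inj h0 => /eqP.
  by rewrite eq_sym oner_eq0.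
Qed.
Lemma Ef_ge_a (lam : R) : (0 < lam)%R -> mean W p (EFin \o a) <= (Ef W p a b nu lam)%:E.
Proof.
move=> l0; rewrite EFin_Ef//.
apply: (@le_trans _ _ (lam%:E * \int[lapm lam]_s mean W p (EFin \o a))).
  by rewrite integral_cst//= lapmT// muleCA -EFinM divff ?gt_eqF// mule1.
apply: lee_wpmul2l; first by rewrite lee_fin ltW.
apply: (@le_trans _ _ (\int[lapm lam]_s mean W p (nubar a nu s))); last first.
  by rewrite leeDr// -EFin_Eb lee_fin Eb_ge0.
apply: ge0_le_integral => //.
- by move=> s _; apply: integral_ge0 => y _; rewrite lee_fin.
- exact: measurable_mean_nubar.
- move=> s _; apply: mean_le => //; first exact: measurable_nubar.
  by move=> y; rewrite leeDl.
Qed.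

Let nubar_fin (s : R) y : (0 < s)%R -> nubar a nu s y \is a fin_num.
Proof.
by move=> s0; rewrite ge0_fin_numE ?nubar_ge0// lte_add_pinfty ?ltry// tail_fin.
Qed.

Hypothesis nubar_ac : forall y, absolutely_continuous_pos (fun s => fine (nubar a nu s y)).

(** Absolute continuity is applied to a family consisting of a single interval, whence the index
    type ['I_1]. *)
Let nubar_continuous y (s : R) : (0 < s)%R ->
  {for s, continuous (fun s => fine (nubar a nu s y))}.
Proof.
move=> s0; apply/cvgrPdist_lt => e e0.
have h1 : (0 < s / 2)%R by rewrite divr_gt0.
have h2 : (s / 2 < s)%R by rewrite ltr_pdivrMr// ltr_pMr// ltr1n.
have h3 : (s < s * 2)%R by rewrite ltr_pMr// ltr1n.
have [del del0 hd] := nubar_ac y h1 (ltW (lt_trans h2 h3)) e0.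
near=> t.
have st : (s / 2 < t)%R by near: t; exact: lt_nbhsr.
have ts : (t < s * 2)%R by near: t; exact: lt_nbhsl.
have dt : (`|s - t| < del)%R by near: t; exact: cvgr_dist_lt.
have tr (l r : 'I_1 -> R) : trivIset setT (fun i => `]l i, r i[%classic).
  by apply/trivIsetP => i j _ _; rewrite (ord1 i) (ord1 j) eqxx.
have [le_st|lt_ts] := leP s t.
- have := hd 1%N (fun=> s) (fun=> t) _ (tr _ _) _; rewrite !big_ord1 distrC; apply.
    by move=> _; split => //; exact: ltW.
  by rewrite (le_lt_trans _ dt)// distrC ler_norm.
- have := hd 1%N (fun=> t) (fun=> s) _ (tr _ _) _; rewrite !big_ord1; apply.
    by move=> _; split => //; exact: ltW.
  by rewrite (le_lt_trans _ dt)// ler_norm.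
Unshelve. all: by end_near. Qed.

(** Tails decrease, so on ]s/2, 2s[ they are dominated by the integrable tail at s/2 and continuity
    passes under the mean. *)
Lemma continuous_Enubar (s : R) : (0 < s)%R -> {for s, continuous (Enubar W p a nu)}.
Proof.
move=> s0; have h1 : (0 < s / 2)%R by rewrite divr_gt0.
have h2 : (s / 2 < s)%R by rewrite ltr_pdivrMr// ltr_pMr// ltr1n.
have h3 : (s < s * 2)%R by rewrite ltr_pMr// ltr1n.
have ER t : (0 < t)%R -> Enubar W p a nu t = (\int[p]_(y in W) fine (nubar a nu t y))%R.
  move=> t0; rewrite /Enubar /mean /Rintegral; congr fine; apply: eq_integral => y _.
  by rewrite fineK// nubar_fin.
have intn t : (0 < t)%R -> p.-integrable W (EFin \o (fun y => fine (nubar a nu t y))).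
  move=> t0; apply/integrableP; split.
    by apply/measurable_EFinP; apply: measurableT_comp => //; apply: measurable_funTS; exact: measurable_nubar.
  under eq_integral => y _ do rewrite /= ger0_norm ?fine_ge0 ?nubar_ge0// fineK ?nubar_fin//.
  exact: mean_nubar_fin.
have H := @continuity_under_integral R _ _ p (fun t y => fine (nubar a nu t y)) W mW
   (s / 2) (s * 2)%R _ _ (fun y => fine (nubar a nu (s / 2)%R y)) (intn _ h1) _ s.
have {}H : {for s, continuous (fun t => \int[p]_(y in W) fine (nubar a nu t y))%R}.
  apply: H.
  - by move=> t /=; rewrite in_itv/= => /andP[h _]; apply: intn; exact: lt_trans h.
  - apply: aeW => y _ t; rewrite inE/= in_itv/= => /andP[h _].
    by apply: nubar_continuous; exact: lt_trans h.
  - move=> t /=; rewrite in_itv/= => /andP[h _]; apply: aeW => y _.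
    have t0 := lt_trans h1 h.
    rewrite ger0_norm ?fine_ge0 ?nubar_ge0// fine_le ?nubar_fin// leeD2l// tail_mono//.
    exact: ltW.
  - by rewrite inE/= in_itv/= h2 h3.
apply: (@cvg_trans _ ((fun t => \int[p]_(y in W) fine (nubar a nu t y))%R @ s)); last first.
  by rewrite ER//; exact: H.
apply: near_eq_cvg.
by near=> t; rewrite ER//; near: t; exact: lt_nbhsr.
Unshelve. all: by end_near. Qed.

Let EfV (t : R) : (0 < t)%R -> (t * Ef W p a b nu t^-1)%:E =
  mean W p (EFin \o b) +
  \int[mu]_(s in `]0%R, +oo[) (mean W p (nubar a nu s) * (expR (- (s / t)))%:E).
Proof.
move=> t0; have ti0 : (0 < t^-1)%R by rewrite invr_gt0.
rewrite EFinM EFin_Ef// muleA -EFinM divff ?gt_eqF// mul1e; congr (_ + _).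
apply: etrans; first exact: (ge0_integral_lapm_itv _ measurable_mean_nubar mean_nubar_ge0).
by apply: eq_integral => s _; rewrite (mulrC t^-1%R).
Qed.

Let limit := mean W p (EFin \o b) +
  \int[mu]_(s in `]0%R, +oo[) mean W p (nubar a nu s).

(** The function of [t] is nondecreasing, so it converges to its supremum along the reals; monotone
    convergence along the integers identifies that supremum. *)
Lemma Ef_limit : (t * Ef W p a b nu t^-1)%:E @[t --> +oo%R] --> limit.
Proof.
(* The value 0 at nonpositive times keeps the function nondecreasing on the whole line. *)
pose f (t : R) := if (0 < t)%R then (t * Ef W p a b nu t^-1)%:E else 0.
have mm : measurable_fun (`]0%R, +oo[%classic : set (measurableTypeR R)) (fun s => mean W p (nubar a nu s)).
  by apply: measurable_funTS; exact: measurable_mean_nubar.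
have me (t : R) : measurable_fun (`]0%R, +oo[%classic : set (measurableTypeR R)) (fun s : measurableTypeR R => (expR (- (s / t)))%:E).
  apply/measurable_funTS/measurable_EFinP; apply: measurableT_comp => //.
  by apply: measurableT_comp => //; exact: measurable_funM.
have le_exp (s t : R) (x : R) : (0 < s)%R -> (s <= t)%R -> (0 < x)%R ->
    mean W p (nubar a nu x) * (expR (- (x / s)))%:E <= mean W p (nubar a nu x) * (expR (- (x / t)))%:E.
  move=> s0 st x0; rewrite lee_wpmul2l ?mean_nubar_ge0// lee_fin ler_expR lerN2.
  by rewrite ler_pM2l// lef_pV2 ?posrE// (lt_le_trans s0).
have ndf (s t : R) : (s <= t)%R -> f s <= f t.
  move=> st; rewrite /f; have [t0|t0] := boolP (0 < t)%R; last first.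
    have /negbTE -> // : ~~ (0 < s)%R by apply: contraNN t0 => s0; exact: lt_le_trans st.
  have [s0|_] := boolP (0 < s)%R; last first.
    by rewrite lee_fin mulr_ge0 ?(ltW t0)// ltW// Ef_gt0// invr_gt0.
  rewrite [leLHS](EfV s0) [leRHS](EfV t0); apply: leeD2l.
  apply: (@ge0_le_integral _ (measurableTypeR R) R mu _ _
     (fun x => mean W p (nubar a nu x) * (expR (- (x / s)))%:E)
     (fun x => mean W p (nubar a nu x) * (expR (- (x / t)))%:E)).
  - exact: measurable_itv.
  - by move=> x _; rewrite mule_ge0 ?mean_nubar_ge0// lee_fin expR_ge0.
  - by apply: emeasurable_funM; [exact: mm|exact: me].
  - by apply: emeasurable_funM; [exact: mm|exact: me].
  - by move=> x /=; rewrite in_itv/= andbT; exact: le_exp.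
have cf := nondecreasing_cvge ndf.
have fn : f n.+1%:R @[n --> \oo] --> limit.
  rewrite (_ : (fun n => _) = (fun n : nat => mean W p (EFin \o b) +
     \int[mu]_(s in `]0%R, +oo[) (mean W p (nubar a nu s) * (expR (- (s / n.+1%:R)))%:E))); last first.
    by apply/funext => n; rewrite /f ltr0Sn EfV.
  apply: cvgeD; [|exact: cvg_cst|].
    by rewrite ge0_adde_def// inE ?integral_ge0// => y _; rewrite ?lee_fin// mean_nubar_ge0.
  pose g (n : nat) (x : measurableTypeR R) := mean W p (nubar a nu x) * (expR (- (x / n.+1%:R)))%:E.
  rewrite [X in _ --> X](_ : _ = \int[mu]_(s in `]0%R, +oo[) limn (g ^~ s)); last first.
    apply: eq_integral => x; rewrite inE/= in_itv/= andbT => x0; apply/esym/cvg_lim => //.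
    have fin : mean W p (nubar a nu x) \is a fin_num.
      by rewrite ge0_fin_numE ?mean_nubar_fin ?mean_nubar_ge0.
    rewrite -[X in _ --> X]mule1; apply: cvgeZl => //.
    apply: cvg_EFin; first exact: nearW.
    rewrite -[X in _ --> X](@expR0 R).
    have cx : (- (x / n.+1%:R))%R @[n --> \oo] --> (0 : R)%R.
      rewrite -(@oppr0 R); apply: cvgN; rewrite -(mulr0 x); apply: cvgMr.
      exact: cvg_harmonic.
    exact: (cvg_comp _ _ cx (@continuous_expR R 0%R)).
  apply: (@cvg_monotone_convergence _ _ _ mu _ _ g).
  - exact: measurable_itv.
  - by move=> n; apply: emeasurable_funM; [exact: mm|exact: me].
  - by move=> n x _; rewrite mule_ge0 ?mean_nubar_ge0// lee_fin expR_ge0.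
  - move=> x /=; rewrite in_itv/= andbT => x0 m n mn; apply: le_exp => //.
    by rewrite ler_nat ltnS.
have cfn : f n.+1%:R @[n --> \oo] --> ereal_sup (range f).
  apply: (cvg_comp _ _ _ cf).
  by have := @cvgr_idn R; rewrite -[X in X -> _]cvg_shiftS.
have -> : limit = ereal_sup (range f).
  exact: (cvg_unique _ fn cfn).
apply: cvg_trans cf; apply: near_eq_cvg; near=> t.
have t0 : (0 < t)%R by near: t; exact: nbhs_pinfty_gt.
by rewrite /f t0.
Unshelve. all: by end_near. Qed.

(** The limit is at least the value at t = 1, which is the Bernstein function at 1. *)
Lemma limit_gt0 : 0 < limit.
Proof.
apply: (@lt_le_trans _ _ (1 * Ef W p a b nu 1^-1)%:E).
  by rewrite mul1r lte_fin Ef_gt0// invr1.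
rewrite (EfV ltr01); apply: leeD2l; apply: ge0_le_integral.
- exact: measurable_itv.
- by move=> x _; rewrite mule_ge0 ?mean_nubar_ge0// lee_fin expR_ge0.
- apply: emeasurable_funM.
    by apply: measurable_funTS; exact: measurable_mean_nubar.
  apply/measurable_funTS/measurable_EFinP; apply: measurableT_comp => //.
  by apply: measurableT_comp => //; exact: measurable_funM.
- by apply: measurable_funTS; exact: measurable_mean_nubar.
- move=> x /=; rewrite in_itv/= andbT => x0.
  rewrite -[leRHS]mule1 lee_wpmul2l ?mean_nubar_ge0// lee_fin expR_le1 oppr_le0.
  by rewrite divr_ge0// ltW.
Qed.

End levy.

(** * The inverse subordinator *)

(** Layer-cake formula: |x| is the length of ]0, |x|[, and exchanging the integrals leaves the tails
    exp(- k s) / k. *)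
Lemma ge0_mean_lapm (R : realType) (k : R) : (0 < k)%R ->
  \int[lapm k]_x `|x|%:E = (k ^- 2)%:E.
Proof.
move=> k0.
pose f (z : measurableTypeR R * measurableTypeR R) : \bar R :=
  ((0 < z.2 < `|z.1|)%R%:R)%:E.
have mf : measurable_fun setT f.
  rewrite (_ : f = EFin \o \1_[set z : measurableTypeR R * measurableTypeR R | 0 < z.2 < `|z.1|]%R); last first.
    apply/funext => z; rewrite /f /= indicE.
    by case: (boolP (0 < z.2 < `|z.1|)%R) => h; [rewrite mem_set|rewrite memNset//; exact/negP].
  apply/measurable_EFinP/measurable_indic.
  have m2 : measurable_fun setT (fun z : measurableTypeR R * measurableTypeR R => z.2).
    exact: measurable_snd.
  have m1 : measurable_fun setT (fun z : measurableTypeR R * measurableTypeR R => `|z.1|%R).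
    by apply: measurableT_comp => //; exact: measurable_fst.
  rewrite (_ : [set z | _] = (fun z : measurableTypeR R * measurableTypeR R => (0 < z.2) && (z.2 < `|z.1|))%R @^-1` [set true]).
    rewrite -[X in measurable X]setTI; apply: measurable_and => //; exact: measurable_fun_ltr.
  by apply/seteqP; split => z.
have f0 z : 0 <= f z by rewrite lee_fin.
transitivity (\int[lapm k]_x \int[@lebesgue_measure R]_s f (x, s)).
  apply: eq_integral => x _; transitivity (@lebesgue_measure R `]0%R, `|x|%R[%classic).
    by rewrite lebesgue_measure_itv/= lte_fin; case: ltgtP (normr_ge0 x) => // [_|<-] _; rewrite ?oppr0 ?adde0.
  rewrite -[LHS]mul1e -integral_cst// [LHS]integral_mkcond.
  apply: eq_integral => s _; rewrite /f patchE mem_setE in_itv/=.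
  by case: ifP.
rewrite (fubini_tonelli f)//.
transitivity (\int[lapm k]__ (k^-1)%:E).
  rewrite ge0_integral_lapm//; last by move=> _; rewrite lee_fin invr_ge0 ltW.
  apply: eq_integral => s _; rewrite /lapdens indicE mem_setE in_itv/= andbT.
  have [s0|s0] := ltP 0%R s; last first.
    rewrite mul0r mule0 integral0_eq// => x _; rewrite /f /=.
    by rewrite ltNge s0.
  rewrite mul1r -EFinM mulrC -(lapm_tail k0 (ltW s0)).
  rewrite -[RHS]mul1e -integral_cst// [RHS]integral_mkcond.
  apply: ae_eq_integral => //.
  - exact: (measurableT_comp mf (measurable_pair2 s)) || exact: (measurableT_comp mf (measurable_pair1 s)).
  - by apply/(measurable_restrictT _ _).1.
  - apply: filterS (ae_lapm_gt0 k) => x x0 _; rewrite /f patchE mem_setE in_itv/= andbT s0/=.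
    by rewrite gtr0_norm//; case: ifP.
by rewrite integral_lapm_cst// -invfM.
Qed.

Section inverse_subordinator.
Context {d : measure_display} {Omega : measurableType d} {R : realType}.
Variable P : probability Omega R.
Variable sig : R -> Omega -> \bar R.
Hypothesis msig : forall t, (0 <= t)%R -> measurable_fun setT (sig t).
Hypothesis sig0 : forall w, sig 0%R w = 0.
Hypothesis sig_mono : forall w s t, (0 <= s)%R -> (s <= t)%R -> sig s w <= sig t w.
Variable kap : R -> R.
Hypothesis kap_gt0 : forall lam, (0 < lam)%R -> (0 < kap lam)%R.
Hypothesis sig_laplace : forall lam t : R, (0 < lam)%R -> (0 <= t)%R ->
  \int[P]_w expeR (- (lam%:E * sig t w)) = (expR (- (t * kap lam)))%:E.

Local Notation L := (inverse_process sig).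
Local Notation TO := (measurableTypeR R * Omega)%type.

Lemma inverse_process_ge0 t w : 0 <= L t w.
Proof. by apply: le_ereal_inf_tmp => _ [s [s0 _] <-]; rewrite lee_fin. Qed.

Lemma inverse_process_mono s t w : (s <= t)%R -> L s w <= L t w.
Proof.
move=> st; apply: ereal_inf_le_tmp => _ [r [r0 tr] <-]; exists r => //; split => //.
by apply: le_lt_trans tr; rewrite lee_fin.
Qed.

(** The inverse exceeds [s] exactly when the subordinator is still at most [t] at some time beyond
    [s]. Testing only the times s + 1/(k+1) makes the event an increasing countable union, from
    which joint measurability and the mass both follow. *)
Lemma inverse_process_gt s t w : (0 <= s)%R ->
  s%:E < L t w <-> exists k : nat, sig (s + k.+1%:R^-1)%R w <= t%:E.
Proof.
move=> s0; split=> [sL|[k hk]].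
  have [k hk] : exists k : nat, (s + k.+1%:R^-1)%:E < L t w.
    have [r sr rL] : exists2 r : R, (s < r)%R & r%:E <= L t w.
      case: (L t w) sL => [r| |] //; rewrite ?lte_fin => sr; first by exists r.
      by exists (s + 1)%R; rewrite ?ltrDl ?leey.
    exists (Num.truncn (r - s)^-1); apply: lt_le_trans rL.
    rewrite lte_fin -ltrBrDl invf_plt ?posrE ?subr_gt0//.
    exact: truncnS_gt.
  exists k; rewrite leNgt; apply/negP => h; move: hk; apply/negP; rewrite -leNgt.
  by apply: ereal_inf_lbound; exists (s + k.+1%:R^-1)%R => //; split => //; rewrite addr_ge0.
apply: (@lt_le_trans _ _ (s + k.+1%:R^-1)%:E); first by rewrite lte_fin ltrDl invr_gt0.
apply: le_ereal_inf_tmp => _ [r [r0 tr] <-]; rewrite lee_fin leNgt; apply/negP => rk.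
have := le_lt_trans hk tr; rewrite ltNge => /negP; apply; apply: sig_mono => //.
exact: ltW.
Qed.

Let K (r : R) : set TO := [set z | sig r z.2 <= z.1%:E].

Let mK r : (0 <= r)%R -> measurable (K r).
Proof.
move=> r0; rewrite -[K r]setTI; apply: measurable_lee => //.
  by apply: (measurableT_comp (f := sig r)); [exact: msig|exact: measurable_snd].
by apply/measurable_EFinP; exact: measurable_fst.
Qed.

Let K_seq s : (0 <= s)%R ->
  [set z : TO | s%:E < L z.1 z.2] = \bigcup_k K (s + k.+1%:R^-1)%R.
Proof.
move=> s0; apply/seteqP; split => [z /=|z [k _ hk] /=].
  by move/inverse_process_gt => /(_ s0)[k hk]; exists k.
by apply/inverse_process_gt => //; exists k.
Qed.

Let gt_lt0 s : (s < 0)%R -> [set z : TO | s%:E < L z.1 z.2] = setT.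
Proof.
move=> s0; apply/seteqP; split => // z _ /=.
by rewrite (lt_le_trans _ (inverse_process_ge0 _ _))// lte_fin.
Qed.

Let mgt s : measurable [set z : TO | s%:E < L z.1 z.2].
Proof.
have [s0|s0] := leP 0%R s; last by rewrite gt_lt0.
rewrite K_seq//; apply: bigcupT_measurable => k; apply: mK.
by rewrite addr_ge0.
Qed.

Lemma measurable_inverse_process : measurable_fun setT (fun z : TO => L z.1 z.2).
Proof.
apply: (@measurability _ _ _ _ setT _ (@ErealGenOInfty.G R)).
  exact: ErealGenOInfty.measurableE.
move=> _ [_ [c ->] <-]; rewrite setTI.
rewrite (_ : _ @^-1` _ = [set z : TO | c%:E < L z.1 z.2]) ?mgt//.
by apply/seteqP; split => z /=; rewrite in_itv/= andbT.
Qed.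

Lemma measurable_inverse_process_at t : measurable_fun setT (L t).
Proof. exact: (measurableT_comp measurable_inverse_process (measurable_pair1 t)). Qed.

Section laplace.
Variables (lam : R) (lam_gt0 : (0 < lam)%R).
Local Notation m := (lapm lam \x P).
Local Notation k := (kap lam).

Let int_indic (A : set TO) : measurable A ->
  m A = \int[P]_w lapm lam (ysection A w).
Proof.
move=> mA; rewrite -[LHS]mul1e -integral_cst// integral_mkcond.
rewrite (fubini_tonelli2 (m1 := lapm lam) (m2 := P)).
- apply: eq_integral => w _; rewrite /fubini_G -[RHS]mul1e -integral_cst; last exact: measurable_ysection.
  rewrite [RHS]integral_mkcond; apply: eq_integral => t _.
  by rewrite !patchE mem_ysection.
- by apply/(measurable_restrictT _ _).1.
- by move=> z; rewrite patchE; case: ifP.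
Qed.

(** For fixed [w] the admissible times form the ray starting at [sig r w], of mass exp(- lam sig) /
    lam, so the mean is the transform of the subordinator. At the cemetery the ray is empty, in
    accordance with exp(- oo) = 0. *)
Let mKE r : (0 <= r)%R -> m (K r) = (expR (- (r * k)) / lam)%:E.
Proof.
move=> r0; rewrite int_indic; last exact: mK.
have mf := measurable_fun_ysection (lapm lam) (mK r0).
have E w : lam%:E * lapm lam (ysection (K r) w) = expeR (- (lam%:E * sig r w)).
  have := sig_mono w (lexx 0%R) r0; rewrite sig0.
  have yE : ysection (K r) w = [set t | sig r w <= t%:E].
    by apply/seteqP; split => t; rewrite /ysection/= inE.
  rewrite yE; case: (sig r w) => [x| |] // x0.
    rewrite (_ : [set t | _] = `[x, +oo[%classic); last first.
      by apply/seteqP; split => t /=; rewrite in_itv/= andbT lee_fin.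
    rewrite lapm_ctail lapm_tail// -EFinM; congr EFin.
    by rewrite mulrCA divff ?mulr1// gt_eqF.
  rewrite gt0_muley ?lte_fin//= (_ : [set t | _] = set0) ?measure0 ?mule0//.
  by apply/seteqP; split => t //=; rewrite leye_eq.
have fin : \int[P]_w lapm lam (ysection (K r) w) = lam^-1%:E * (lam%:E * \int[P]_w lapm lam (ysection (K r) w)).
  by rewrite muleA -EFinM mulVf ?gt_eqF// mul1e.
rewrite fin -ge0_integralZl//; last by rewrite lee_fin ltW.
under eq_integral do rewrite E.
by rewrite sig_laplace// -EFinM mulrC.
Qed.

Let m_gt s : (0 <= s)%R -> m [set z | s%:E < L z.1 z.2] = (expR (- (s * k)) / lam)%:E.
Proof.
move=> s0; rewrite K_seq//.
have r0 n : (0 <= s + n.+1%:R^-1)%R by rewrite addr_ge0.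
have H : (m \o (fun n => K (s + n.+1%:R^-1)%R)) n @[n --> \oo] --> m (\bigcup_n K (s + n.+1%:R^-1)%R).
  apply: nondecreasing_cvg_mu.
  - by move=> n; exact: mK.
  - by apply: bigcupT_measurable => n; exact: mK.
  - move=> i j ij; apply/subsetPset => z; rewrite /K/=; apply: le_trans.
    by apply: sig_mono => //; rewrite lerD2l lef_pV2 ?posrE// ler_nat.
apply: (cvg_unique _ H) => //.
rewrite (_ : _ \o _ = EFin \o (fun n : nat => expR (- ((s + n.+1%:R^-1) * k)) / lam)%R); last first.
  by apply/funext => n /=; rewrite mKE.
apply: cvg_EFin; first exact: nearW.
apply: cvgMl.
have cx : (- ((s + n.+1%:R^-1) * k))%R @[n --> \oo] --> (- (s * k))%R.
  apply: cvgN; apply: cvgMl; rewrite -[X in _ --> X]addr0; apply: cvgD; first exact: cvg_cst.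
  exact: cvg_harmonic.
exact: (cvg_comp _ _ cx (@continuous_expR R _)).
Qed.

Let m_infty : m [set z | L z.1 z.2 = +oo] = 0.
Proof.
have mi : measurable [set z : TO | L z.1 z.2 = +oo].
  have := measurable_inverse_process measurableT (emeasurable_set1 +oo); rewrite setTI.
  by congr measurable.
have k0 := kap_gt0 lam_gt0.
apply/eqP; rewrite eq_le measure_ge0 andbT; apply/lee_addgt0Pr => e e0; rewrite add0e.
(* Chosen so that exp(- s k) / lam, the mass of the event L > s, is at most [e]. *)
pose s := Num.max 0%R (- ln (e * lam) / k)%R.
have s0 : (0 <= s)%R by rewrite le_max lexx.
apply: (@le_trans _ _ (m [set z | s%:E < L z.1 z.2])).
  by apply: le_measure; rewrite ?inE// => z /= ->; rewrite ltry.
rewrite m_gt// lee_fin ler_pdivrMr// -[leRHS]lnK ?posrE ?mulr_gt0// ler_expR lerNl.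
by rewrite -ler_pdivrMr// le_max lexx orbT.
Qed.

Let T (z : TO) : measurableTypeR R := fine (L z.1 z.2).

Let mT : measurable_fun setT T.
Proof. exact: (measurableT_comp _ measurable_inverse_process). Qed.

HB.instance Definition _ := isMeasurableFun.Build _ _ _ _ T mT.

(** In probabilistic terms, the inverse process at an independent exponential time of rate [lam] is
    exponential of rate [kap lam]. Replacing the value +oo by 0 is harmless because it is taken on a
    null set. *)
Let T_ray s : pushforward m T `]s, +oo[%classic = ((k / lam)%:E * lapm k `]s, +oo[%classic).
Proof.
have k0 := kap_gt0 lam_gt0.
rewrite lapm_ray// -EFinM (_ : (k / lam * _)%R = (expR (- (k * Num.max s 0)) / lam)%R); last first.
  by field; rewrite !gt_eqF.
have [s0|s0] := leP 0%R s.
  rewrite (mulrC k s) -m_gt//.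
  rewrite /pushforward.
  set A := _ @^-1` _; set Bs := [set z | _].
  have mi : measurable [set z : TO | L z.1 z.2 = +oo].
    have := measurable_inverse_process measurableT (emeasurable_set1 +oo); rewrite setTI.
    by congr measurable.
  have mA : measurable A by rewrite -[A]setTI; exact: mT.
  have -> : A = Bs `\` [set z | L z.1 z.2 = +oo].
    apply/seteqP; split => z; rewrite /A /Bs /T /= in_itv/= andbT.
      have := inverse_process_ge0 z.1 z.2; case: (L _ _) => [r| |] //= _ h.
      by move: h; rewrite ltNge s0.
    by move=> []; have := inverse_process_ge0 z.1 z.2; case: (L _ _).
  rewrite measureD//; [|exact: mgt|by rewrite [ltLHS](m_gt s0) ltry].
  rewrite [X in _ - X](_ : _ = 0) ?sube0//.
  apply: (@subset_measure0 _ _ _ m) m_infty => //.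
  by apply: measurableI => //; exact: mgt.
rewrite mulr0 oppr0 expR0 mul1r.
rewrite /pushforward (_ : T @^-1` _ = setT); last first.
  apply/seteqP; split => // z _ /=; rewrite in_itv/= andbT (lt_le_trans s0)//.
  by rewrite fine_ge0// inverse_process_ge0.
transitivity (\int[P]__ (lam^-1)%:E).
  rewrite int_indic//; apply: eq_integral => w _.
  rewrite (_ : ysection _ _ = setT); first exact: lapmT.
  by apply/seteqP; split => // t _; rewrite /ysection/= inE.
by rewrite integral_cst//= (_ : P _ = 1) ?mule1//; exact: probability_setT.
Qed.

Lemma inverse_process_occupation (h : measurableTypeR R -> \bar R) :
  measurable_fun setT h -> (forall s, 0 <= h s) ->
  \int[lapm lam]_t \int[P]_w h (fine (L t w)) = (k / lam)%:E * \int[lapm k]_s h s.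
Proof.
move=> mh h0; have c0 : (0 <= k / lam)%R by rewrite divr_ge0 ?ltW// kap_gt0.
rewrite -(fubini_tonelli1 (m1 := lapm lam) (m2 := P) (h \o T)); last 2 first.
- exact: measurableT_comp.
- by move=> z; exact: h0.
transitivity (\int[pushforward m T]_s h s).
  by rewrite ge0_integral_pushforward.
transitivity (\int[mscale (NngNum c0) (lapm k)]_s h s); last by rewrite ge0_integral_mscale.
apply: eq_measure_integral => A mA _; apply: measure_ray_unique mA => s; first exact: T_ray.
apply: (@le_lt_trans _ _ ((k / lam)%:E * lapm k `]s, +oo[%classic)).
  by rewrite -T_ray.
by rewrite lapm_ray ?kap_gt0// -EFinM ltry.
Qed.

Lemma mean_inverse_process_lapm :
  \int[lapm lam]_t \int[P]_w (fine (L t w))%:E = ((k^-1) / lam)%:E.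
Proof.
have k0 := kap_gt0 lam_gt0.
transitivity (\int[lapm lam]_t \int[P]_w `|fine (L t w)|%:E).
  apply: eq_integral => t _; apply: eq_integral => w _.
  by rewrite ger0_norm// fine_ge0// inverse_process_ge0.
rewrite (@inverse_process_occupation (fun s => `|s|%:E))//; last first.
  by apply/measurable_EFinP; exact: normr_measurable.
by rewrite ge0_mean_lapm// -EFinM; congr EFin; field; rewrite !gt_eqF.
Qed.

(** Nullity in the product only concerns almost every time. If L is infinite at [t] it is infinite
    throughout ]s, s + 1], which has positive mass, so the event at the given [t] must be null. *)
Lemma inverse_process_infty (t : R) : P [set w | L t w = +oo] = 0.
Proof.
pose s := Num.max t 0%R.
have mi : measurable [set w | L t w = +oo].
  have := measurable_inverse_process_at t measurableT (emeasurable_set1 +oo); rewrite setTI.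
  by congr measurable.
have : m (`]s, (s + 1)%R]%classic `*` [set w | L t w = +oo]) = 0.
  apply: subset_measure0 m_infty; first exact: measurableX.
    have := measurable_inverse_process measurableT (emeasurable_set1 +oo); rewrite setTI.
    by congr measurable.
  move=> [r w] [/= + h]; rewrite in_itv/= => /andP[sr _].
  apply/eqP; rewrite -leye_eq -h; apply: inverse_process_mono.
  by rewrite (le_trans _ (ltW sr))// le_max lexx.
rewrite product_measure1E// => /eqP; rewrite mule_eq0 => /orP[|/eqP//].
by rewrite gt_eqF// lapm_itv_gt0 ?le_max ?lexx ?orbT// ltrDl.
Qed.

End laplace.

Lemma inverse_process_fin t : {ae P, forall w, L t w \is a fin_num}.
Proof.
exists [set w | L t w = +oo]; split.
- have := measurable_inverse_process_at t measurableT (emeasurable_set1 +oo); rewrite setTI.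
  by congr measurable.
- exact: (inverse_process_infty ltr01).
- by move=> w /=; have := inverse_process_ge0 t w; case: (L t w).
Qed.

(** A time [s] that nearly attains the infimum satisfies sig s > t strictly, hence sig s > u n
    eventually, and then bounds the inverse at [u n] from above; monotonicity bounds it from
    below. *)
Lemma inverse_process_right (u : R^nat) t w : (forall n, (t < u n)%R) ->
  u n @[n --> \oo] --> t -> L t w \is a fin_num ->
  fine (L (u n) w) @[n --> \oo] --> fine (L t w).
Proof.
move=> tu cu Lfin; apply/cvgrPdist_lt => e e0.
have [_ [s [s0 ts] <-] sL] : exists2 y, [set s%:E | s in [set s | (0 <= s)%R /\ t%:E < sig s w]] y & y < L t w + e%:E.
  by apply: ereal_inf_lt; rewrite lteDl// lte_fin.
have uS : (\forall n \near \oo, forall r : R, sig s w = r%:E -> (u n < r)%R).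
  case: (sig s w) ts => [r| |] ts; [|by apply: nearW|by apply: nearW].
  rewrite lte_fin in ts; near=> n => _ [<-]; near: n; exact: (cvgr_lt _ cu).
near=> n.
have usr : forall r : R, sig s w = r%:E -> (u n < r)%R by near: n.
have us : (u n)%:E < sig s w.
  case: (sig s w) ts usr => [r| |]//; rewrite ?ltry// !lte_fin => tr; exact.
have h1 : L t w <= L (u n) w by apply: inverse_process_mono; exact: ltW.
have h2 : L (u n) w <= s%:E by apply: ereal_inf_lbound; exists s.
move: Lfin sL h1 h2; case: (L t w) => [x| |] //; case: (L (u n) w) => [y| |] //= _.
rewrite -EFinD !lte_fin !lee_fin => sx xy ys; rewrite distrC ger0_norm ?subr_ge0//; lra.
Unshelve. all: by end_near. Qed.

Lemma right_continuous_mean_inverse (h : R -> R) (M : R) t : continuous h ->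
  (forall x, `|h x| <= M)%R ->
  (\int[P]_w h (fine (L s w)))%R @[s --> t^'+] --> (\int[P]_w h (fine (L t w)))%R.
Proof.
move=> ch hM; apply/cvg_at_rightP => u [tu cu].
have mL s : measurable_fun setT (fun w => h (fine (L s w)) : measurableTypeR R).
  apply: (measurableT_comp (continuous_measurable_fun ch)).
  by apply: (measurableT_comp _ (measurable_inverse_process_at s)).
apply: (@Rintegral_dct_ae _ _ _ P (fun n w => h (fine (L (u n) w))) _ (fun=> M)) => //.
- by move=> n; exact: mL.
- exact: mL.
- apply: filterS (inverse_process_fin t) => w fw.
  apply: (cvg_comp _ _ (inverse_process_right tu cu fw)); exact: ch.
- apply: (@bounded_integrable _ _ _ P _ `|M|)%R => //.
  by apply: le_lt_trans (ltry 1%R); exact: probability_le1.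
Qed.

Definition mean_inverse (t : R) : R := fine (\int[P]_w (fine (L t w))%:E).

Let mfine t : measurable_fun setT (fun w => (fine (L t w))%:E).
Proof.
apply/measurable_EFinP; exact: (measurableT_comp _ (measurable_inverse_process_at t)).
Qed.

Let EL_ge0 t : 0 <= \int[P]_w (fine (L t w))%:E.
Proof. by apply: integral_ge0 => w _; rewrite lee_fin fine_ge0// inverse_process_ge0. Qed.

Let EL_mono s t : (s <= t)%R ->
  \int[P]_w (fine (L s w))%:E <= \int[P]_w (fine (L t w))%:E.
Proof.
move=> st; apply: ae_ge0_le_integral => //.
- by move=> w _; rewrite lee_fin fine_ge0// inverse_process_ge0.
- by move=> w _; rewrite lee_fin fine_ge0// inverse_process_ge0.
- apply: filterS2 (inverse_process_fin s) (inverse_process_fin t) => w sf tf _.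
  by rewrite lee_fin fine_le// inverse_process_mono.
Qed.

Let EL_measurable : measurable_fun setT (fun t : measurableTypeR R => \int[P]_w (fine (L t w))%:E).
Proof.
apply: (@measurable_fun_fubini_tonelli_F _ _ _ _ _ P (fun z : TO => (fine (L z.1 z.2))%:E)).
  by apply/measurable_EFinP; exact: (measurableT_comp _ measurable_inverse_process).
by move=> z; rewrite lee_fin fine_ge0// inverse_process_ge0.
Qed.

(** An infinite mean at [t] would persist at all later times, contradicting the finite transform at
    rate 1. *)
Lemma EFin_mean_inverse t : (mean_inverse t)%:E = \int[P]_w (fine (L t w))%:E.
Proof.
rewrite fineK// ge0_fin_numE// ltNge leye_eq; apply/negP => /eqP h.
pose s := Num.max t 0%R.
have : +oo <= ((kap 1)^-1 / 1)%:E.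
  rewrite -(mean_inverse_process_lapm ltr01).
  apply: (@le_trans _ _ (\int[lapm 1]_(r in `]s, (s + 1)%R]) \int[P]_w (fine (L r w))%:E)).
    apply: (@le_trans _ _ (\int[lapm 1]_(r in `]s, (s + 1)%R]) +oo)).
      rewrite integral_cst//= gt0_mulye//; apply: lapm_itv_gt0 => //; last by rewrite ltrDl.
      by rewrite le_max lexx orbT.
    apply: ge0_le_integral => //; first exact: measurable_funTS.
    move=> r /=; rewrite in_itv/= => /andP[sr _]; rewrite -h; apply: EL_mono.
    by rewrite (le_trans _ (ltW sr))// le_max lexx.
  by apply: ge0_subset_integral => //.
by rewrite leye_eq.
Qed.

Lemma mean_inverse_ge0 t : (0 <= mean_inverse t)%R.
Proof. by rewrite fine_ge0. Qed.

Lemma mean_inverse_mono : nondecreasing_fun mean_inverse.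
Proof. by move=> s t st; rewrite -lee_fin !EFin_mean_inverse EL_mono. Qed.

Lemma mean_inverse_lapm lam : (0 < lam)%R ->
  \int[lapm lam]_t (mean_inverse `|t|)%:E = ((kap lam)^-1 / lam)%:E.
Proof.
move=> l0; rewrite -(mean_inverse_process_lapm l0).
apply: ae_eq_integral => //.
- apply/measurable_EFinP.
  rewrite (_ : (fun t => _) = fine \o ((fun t : measurableTypeR R => \int[P]_w (fine (L t w))%:E) \o Num.Def.normr))//.
  apply: measurableT_comp; first exact: fine_measurable.
  by apply: (measurableT_comp EL_measurable); exact: normr_measurable.
- by apply: filterS (ae_lapm_gt0 lam) => t t0 _; rewrite EFin_mean_inverse gtr0_norm.
Qed.

End inverse_subordinator.

(** * Brownian motion at a random time *)

Section borel_rV.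
Context {R : realType} {n : nat}.

Lemma continuous_borel (T : ptopologicalType) (f : T -> R) : continuous f ->
  measurable_fun setT (f : borel T -> measurableTypeR R).
Proof.
move=> cf; apply: (@measurability _ _ _ (measurableTypeR R) setT _ (@RGenOpens.G R)).
  exact: RGenOpens.measurableE.
move=> _ [U + <-]; rewrite /RGenOpens.G setTI => -[a [b ->]].
apply: sub_sigma_algebra; apply: (@open_comp T R f); first by move=> x _; exact: cf.
exact: interval_open.
Qed.

Lemma measurable_coord (j : 'I_n) :
  measurable_fun setT (fun x : borel 'rV[R]_n => x ord0 j : measurableTypeR R).
Proof. by apply: (@continuous_borel 'rV[R]_n); exact: coord_continuous. Qed.

Lemma measurable_rV d (T : measurableType d) (f : T -> borel 'rV[R]_n) :
  (forall j, measurable_fun setT (fun x => f x ord0 j : measurableTypeR R)) ->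
  measurable_fun setT f.
Proof.
move=> mf; apply: (@measurability _ _ _ (borel 'rV[R]_n) setT f (@open 'rV[R]_n)) => //.
move=> _ [U oU <-]; rewrite setTI (open_rV_bigcup_ball oU) preimage_bigcup.
rewrite bigcup_mkcond; apply: countable_bigcupT_measurable => [|[w k]] /=.
  exact: countableP.
case: ifP => _ //.
set r := (_^-1)%R; set v : 'rV[R]_n := map_mx _ _.
have r0 : (0 < r)%R by rewrite invr_gt0.
rewrite (_ : _ @^-1` _ = \bigcap_(j in [set: 'I_n])
   ((fun x => f x ord0 j) @^-1` (ball (v ord0 j) r : set (measurableTypeR R)))).
  apply: fin_bigcap_measurable => [|j _]; first exact: finite_finset.
  rewrite -[X in measurable X]setTI.
  by apply: mf => //; exact: measurable_ball.
apply/seteqP; split => [x [_ /= h] j _|x h]; first exact: h.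
by split => // i j; rewrite !ord1; exact: h.
Qed.

Lemma continuous_sqnorm : continuous (sqnorm : 'rV[R]_n -> R).
Proof.
move=> x; rewrite /sqnorm.
apply: (@continuous_big _ _ +%R) => [|i _]; first exact: add_continuous.
move=> y; apply: (@continuous_comp _ _ _ (fun z : 'rV[R]_n => z ord0 i) (fun z : R => z ^+ 2)%R).
  exact: coord_continuous.
exact: exprn_continuous.
Qed.

Lemma heat_kernel_ge0 (s : R) (x : 'rV[R]_n) : (0 <= heat_kernel s x)%R.
Proof. by rewrite /heat_kernel mulr_ge0 ?powR_ge0 ?expR_ge0. Qed.

Lemma continuous_heat_kernel (s : R) : continuous (heat_kernel s : 'rV[R]_n -> R).
Proof.
move=> x; pose c : R := ((4 * pi * s) `^ (- (n%:R / 2)))%R.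
have ch : continuous (fun z : R => c * expR (- (z / (4 * s))))%R.
  move=> z; apply: cvgMr.
  apply: (@continuous_comp _ _ _ (fun z : R => - (z / (4 * s)))%R expR); last exact: continuous_expR.
  by apply: cvgN; apply: cvgMl; exact: cvg_id.
exact: (cvg_comp _ _ (@continuous_sqnorm x) (ch _)).
Qed.

Lemma measurable_heat_kernel (s : R) :
  measurable_fun setT (heat_kernel s : borel 'rV[R]_n -> measurableTypeR R).
Proof. by apply: (@continuous_borel 'rV[R]_n); exact: continuous_heat_kernel. Qed.

End borel_rV.

Section brownian.
Context {d : measure_display} {Omega : measurableType d} {R : realType}.
Variable P : probability Omega R.
Variable n : nat.
Variable B : R -> Omega -> borel 'rV[R]_n.
Hypothesis B_bm : brownian_motion P B.

Let mB s : (0 <= s)%R -> measurable_fun setT (B s).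
Proof. by case: B_bm => h _ _ _; exact: h. Qed.

Lemma brownian_law (s : R) (C : set (borel 'rV[R]_n)) : (0 < s)%R -> measurable C ->
  P (B s @^-1` C) = \int[lebesgue_rV n]_(x in C) (heat_kernel s x)%:E.
Proof.
move=> s0 mC; have [_ B0 _ /(_ 0%R s (lexx _) s0 setT C)] := B_bm.
rewrite subr0 probability_setT mul1e => <- //; last first.
  by move=> X [[S0 SC SU]] _; rewrite -(setD0 [set: Omega]); exact: SC.
by rewrite setTI; congr (P _); apply/seteqP; split => w /=; rewrite B0 subr0.
Qed.

Lemma ge0_brownian_mean (s : R) (f : borel 'rV[R]_n -> \bar R) : (0 < s)%R ->
  measurable_fun setT f -> (forall x, 0 <= f x) ->
  \int[P]_w f (B s w) = \int[lebesgue_rV n]_x (f x * (heat_kernel s x)%:E).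
Proof.
move=> s0 mf f0; have mBs := mB (ltW s0).
rewrite -(ge0_integral_density (nu := pushforward P (B s)))//.
- by rewrite ge0_integral_pushforward.
- exact: measurable_heat_kernel.
- by move=> x; exact: heat_kernel_ge0.
- by move=> A mA; exact: brownian_law.
Qed.

(** The total mass is read off the law of [B s], which spares the evaluation of a Gaussian
    integral. *)
Lemma heat_kernel_mass (s : R) : (0 < s)%R ->
  \int[lebesgue_rV n]_x (heat_kernel s x)%:E = 1.
Proof.
by move=> s0; rewrite -brownian_law// preimage_setT probability_setT.
Qed.

(* The absolute value makes this a continuous function on the whole line. *)
Definition brownian_mean (phi : 'rV[R]_n -> R) (s : R) : R :=
  (\int[P]_w phi (B `|s|%R w))%R.

Let P_fin : P setT < +oo.
Proof. by apply: le_lt_trans (ltry 1%R); exact: probability_le1. Qed.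

Let mphiB (phi : 'rV[R]_n -> R) s : continuous phi -> (0 <= s)%R ->
  measurable_fun setT (fun w => phi (B s w) : measurableTypeR R).
Proof.
by move=> cphi s0; apply: (measurableT_comp (@continuous_borel R 'rV[R]_n _ cphi)); exact: mB.
Qed.

Lemma brownian_cvg (u : R^nat) (l : R) w : (forall k, (0 <= u k)%R) -> (0 <= l)%R ->
  u k @[k --> \oo] --> l -> (B (u k) w : 'rV[R]_n) @[k --> \oo] --> (B l w : 'rV[R]_n).
Proof.
move=> u0 l0 cu; have [_ _ /(_ w) cB _] := B_bm.
have := continuous_within_itvcyP 0%R (fun t => B t w : 'rV[R]_n).
have {}cB : (B t w : 'rV[R]_n) @[t --> within `[0%R, +oo[%classic (nbhs l)] --> (B l w : 'rV[R]_n).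
  have := cB l; rewrite /continuous_at /= => h.
  by move: h; rewrite /prop_for /=; rewrite nbhs_subspace_in//= in_itv/= l0.
move=> _; apply: (cvg_comp u (fun t => B t w : 'rV[R]_n) _ cB).
move=> A [e /= e0 hA]; near=> k; apply: hA => /=; last by rewrite in_itv/= u0.
by near: k; exact: cvgr_dist_lt.
Unshelve. all: by end_near. Qed.

Lemma continuous_brownian_mean (phi : 'rV[R]_n -> R) (M : R) : continuous phi ->
  (forall x, `|phi x| <= M)%R -> continuous (brownian_mean phi).
Proof.
move=> cphi phiM s; apply/continuous_withinNx/cvgr_dnbhsP => u [_ cu].
have cu' : (`|u k|)%R @[k --> \oo] --> `|s|%R by exact: cvg_norm.
apply: (@Rintegral_dct _ _ _ P (fun k w => phi (B `|u k|%R w)) _ (fun=> M)) => //.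
- by move=> k; exact: mphiB.
- by move=> w; apply: (cvg_comp _ _ (brownian_cvg _ _ cu')); [| |exact: cphi].
- by apply: (@bounded_integrable _ _ _ P _ `|M|%R).
Qed.

Section time_change.
Variable l : Omega -> measurableTypeR R.
Hypotheses (ml : measurable_fun setT l) (l0 : forall w, (0 <= l w)%R).
Hypothesis indep : forall (D : set (measurableTypeR R)) (s : R) (C : set (borel 'rV[R]_n)),
  (0 <= s)%R -> measurable D -> measurable C ->
  P (l @^-1` D `&` B s @^-1` C) = P (l @^-1` D) * P (B s @^-1` C).

(** The random time is rounded up on a mesh of width 1/(k+1). On each cell it is then a fixed time,
    where independence can be used, and path continuity removes the rounding. *)
Let grid (k j : nat) : R := (j.+1%:R / k.+1%:R)%R.

Let approx (k : nat) (w : Omega) : R := grid k (Num.truncn (k.+1%:R * l w)).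

Let D (k j : nat) : set (measurableTypeR R) := `[(j%:R / k.+1%:R)%R, grid k j[%classic.

Let cell k j : set Omega := l @^-1` D k j.

Let mcell k j : measurable (cell k j).
Proof. by rewrite -[cell k j]setTI; apply: ml => //; exact: measurable_itv. Qed.

Let cell_truncn k j w : cell k j w <-> Num.truncn (k.+1%:R * l w) = j.
Proof.
rewrite /cell /D /grid /= in_itv/= ler_pdivrMr// ltr_pdivlMr// mulrC.
rewrite -truncn_eq ?mulr_ge0//; split; first by move/eqP.
by move=> ->.
Qed.

Let cell_cover k : \bigcup_j cell k j = setT.
Proof. by apply/seteqP; split => // w _; eexists => //; exact/cell_truncn. Qed.

Let cell_disjoint k : trivIset setT (cell k).
Proof.
apply/trivIsetP => i j _ _ /eqP ij; apply/seteqP; split => // w [] /cell_truncn h1 /cell_truncn h2.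
by case: ij; rewrite -h1 -h2.
Qed.

Let grid_ge0 k j : (0 <= grid k j)%R.
Proof. by rewrite divr_ge0. Qed.

Let approx_cell k j w : cell k j w -> approx k w = grid k j.
Proof. by move/cell_truncn; rewrite /approx => ->. Qed.

Let approx_cvg w : approx k w @[k --> \oo] --> l w.
Proof.
apply: (@squeeze_cvgr _ _ _ _ (fun=> l w) (fun k : nat => l w + k.+1%:R^-1)%R).
- apply: nearW => k.
  have /andP[h1 h2] := @truncn_itv R (k.+1%:R * l w)%R (mulr_ge0 (ler0n _ _) (l0 w)).
  rewrite /approx /grid; apply/andP; split.
    by rewrite ler_pdivlMr// mulrC ltW.
  by rewrite ler_pdivrMr// mulrDl mulVf ?pnatr_eq0// -[leLHS]natr1 lerD2r (le_trans h1)// mulrC.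
- exact: cvg_cst.
- rewrite -[X in _ --> X]addr0; apply: cvgD; first exact: cvg_cst.
  exact: cvg_harmonic.
Qed.

Let approx_ge0 k w : (0 <= approx k w)%R. Proof. exact: grid_ge0. Qed.

Let measurable_cellwise d' (T : measurableType d') (f : Omega -> T) (g : nat -> Omega -> T) k :
  (forall j, measurable_fun setT (g j)) -> (forall j w, cell k j w -> f w = g j w) ->
  measurable_fun setT f.
Proof.
move=> mg fg; rewrite -(cell_cover k); apply/measurable_fun_bigcup => // j.
apply: (@eq_measurable_fun _ _ _ _ _ (g j)).
  by move=> w; rewrite inE => h; rewrite (fg j).
exact: measurable_funTS.
Qed.

Let mapprox k : measurable_fun setT (fun w => B (approx k w) w).
Proof.
apply: (@measurable_cellwise _ _ _ (fun j => B (grid k j)) k).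
  by move=> j; exact: mB.
by move=> j w /approx_cell ->.
Qed.

Lemma measurable_time_change : measurable_fun setT (fun w => B (l w) w).
Proof.
apply: measurable_rV => j.
apply: (@measurable_fun_cvg _ _ _ setT (fun k w => B (approx k w) w ord0 j)).
  by move=> k; apply: (measurableT_comp (measurable_coord j)); exact: mapprox.
move=> w _.
have := brownian_cvg (w := w) (fun k => approx_ge0 k w) (l0 w) (@approx_cvg w).
move=> h; apply: (cvg_comp (fun k => B (approx k w) w : 'rV[R]_n) (fun x : 'rV[R]_n => x ord0 j) h).
exact: coord_continuous.
Qed.

(** Independence concerns events. It says that the image under [B s] of P restricted to the cell is
    the probability of the cell times the law of [B s], and integrals against equal measures
    agree. *)
Let cell_mean (f : borel 'rV[R]_n -> \bar R) k j s : (0 <= s)%R ->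
  measurable_fun setT f -> (forall x, 0 <= f x) ->
  \int[P]_(w in cell k j) f (B s w) = P (cell k j) * \int[P]_w f (B s w).
Proof.
move=> s0 mf f0; have mBs := mB s0.
have fin : P (cell k j) \is a fin_num by exact: fin_num_measure.
have c0 : (0 <= fine (P (cell k j)))%R by rewrite fine_ge0.
have mfB : measurable_fun setT (f \o B s) by exact: measurableT_comp.
transitivity (\int[mrestr P (mcell k j)]_w f (B s w)).
  rewrite (ge0_integral_density (mu := P) (g := \1_(cell k j)))//; last first.
    move=> A mA; rewrite integral_indic//.
    by rewrite /mrestr setIC.
  rewrite [LHS]integral_mkcond; apply: eq_integral => w _.
  by rewrite patchE indicE; case: ifP => _; rewrite ?mule1 ?mule0.
transitivity (\int[pushforward (mrestr P (mcell k j)) (B s)]_x f x).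
  by rewrite ge0_integral_pushforward.
transitivity (\int[pushforward (mscale (NngNum c0) P) (B s)]_x f x); last first.
  rewrite ge0_integral_pushforward//.
  apply: etrans; first apply: (@ge0_integral_mscale _ _ _ P setT measurableT (NngNum c0) (f \o B s)) => //.
  by move=> w _; exact: f0.
  by congr (_ * _); rewrite /= fineK.
apply: eq_measure_integral => A mA _.
transitivity (P (B s @^-1` A `&` cell k j)) => //.
transitivity ((fine (P (cell k j)))%:E * P (B s @^-1` A)) => //.
rewrite fineK// setIC indep//.
exact: measurable_itv.
Qed.

Let approx_mean (f : borel 'rV[R]_n -> \bar R) (g : R -> \bar R) k :
  measurable_fun setT f -> (forall x, 0 <= f x) -> (forall s, 0 <= g s) ->
  (forall s, (0 <= s)%R -> g s = \int[P]_w f (B s w)) ->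
  \int[P]_w f (B (approx k w) w) = \int[P]_w g (approx k w).
Proof.
move=> mf f0 g0 gE.
have splitE (h : Omega -> \bar R) : measurable_fun setT h -> (forall w, 0 <= h w) ->
    \int[P]_w h w = \sum_(j <oo) \int[P]_(w in cell k j) h w.
  move=> mh h0; rewrite -[X in \int[P]_(w in X) _](cell_cover k).
  apply: (ge0_integral_bigcup P (mcell k)); [by rewrite cell_cover|by []|exact: cell_disjoint].
rewrite !splitE//; last 2 first.
- apply: (@measurable_cellwise _ _ _ (fun j => cst (g (grid k j))) k).
    by move=> j; exact: measurable_cst.
  by move=> j w /approx_cell ->.
- by apply: (measurableT_comp mf); exact: mapprox.
apply: eq_eseriesr => j _.
transitivity (\int[P]_(w in cell k j) f (B (grid k j) w)).
  by apply: eq_integral => w; rewrite inE => /approx_cell ->.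
transitivity (\int[P]_(w in cell k j) g (grid k j)); last first.
  by apply: eq_integral => w; rewrite inE => /approx_cell ->.
by rewrite cell_mean// integral_cst// gE// muleC.
Qed.

(** The identity holds cell by cell for the rounded times. Both sides pass to the limit by dominated
    convergence, the left through continuity of the paths, the right through continuity of
    [brownian_mean]. *)
Lemma time_change_mean (phi : 'rV[R]_n -> R) (M : R) : continuous phi ->
  (forall x, (0 <= phi x <= M)%R) ->
  (\int[P]_w phi (B (l w) w) = \int[P]_w brownian_mean phi (l w))%R.
Proof.
move=> cphi phiM.
have phi0 x : (0 <= phi x)%R by have /andP[] := phiM x.
have nM x : (`|phi x| <= M)%R by rewrite ger0_norm//; have /andP[] := phiM x.
have iM : P.-integrable setT (EFin \o (fun _ : Omega => M)).
  by apply: (@bounded_integrable _ _ _ P _ `|M|%R).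
have mphi := @continuous_borel R 'rV[R]_n _ cphi.
have g0 s : (0 <= brownian_mean phi s)%R by apply: Rintegral_ge0 => w _; exact: phi0.
have cg := continuous_brownian_mean cphi nM.
have gE s : (0 <= s)%R -> (brownian_mean phi s)%:E = \int[P]_w (phi (B s w))%:E.
  move=> s0; rewrite /brownian_mean ger0_norm// EFin_Rintegral//.
  by apply: (@le_integrable_EFin _ _ _ P _ (fun=> M)) => //; exact: mphiB.
have gM s : (`|brownian_mean phi s| <= M)%R.
  rewrite ger0_norm// -lee_fin.
  have -> : brownian_mean phi s = brownian_mean phi `|s| by rewrite /brownian_mean normr_id.
  rewrite gE//; apply: (@le_trans _ _ (\int[P]_w M%:E)).
    apply: ge0_le_integral => //.
    - by move=> w _; rewrite lee_fin.
    - by apply/measurable_EFinP; exact: mphiB.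
    - by move=> w _; rewrite lee_fin; have /andP[] := phiM (B `|s|%R w).
  by rewrite integral_cst//= [X in _ * X]probability_setT mule1.
have mphiBl : measurable_fun setT (fun w => phi (B (l w) w) : measurableTypeR R).
  by apply: (measurableT_comp mphi); exact: measurable_time_change.
have h1 : (\int[P]_w phi (B (approx k w) w))%R @[k --> \oo] --> (\int[P]_w phi (B (l w) w))%R.
  apply: (@Rintegral_dct _ _ _ P (fun k w => phi (B (approx k w) w)) _ (fun=> M)) => //.
  - by move=> k; apply: (measurableT_comp mphi); exact: mapprox.
  - move=> w; have := brownian_cvg (w := w) (fun k => approx_ge0 k w) (l0 w) (@approx_cvg w).
    move=> h; apply: (cvg_comp (fun k => B (approx k w) w : 'rV[R]_n) phi h); exact: cphi.
have mga k : measurable_fun setT (fun w => brownian_mean phi (approx k w)).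
  apply: (@measurable_cellwise _ _ _ (fun j => cst (brownian_mean phi (grid k j))) k).
    by move=> j; exact: measurable_cst.
  by move=> j w /approx_cell ->.
have mgl : measurable_fun setT (fun w => brownian_mean phi (l w)).
  by apply: (measurableT_comp (continuous_measurable_fun cg)).
have h2 : (\int[P]_w brownian_mean phi (approx k w))%R @[k --> \oo] --> (\int[P]_w brownian_mean phi (l w))%R.
  apply: (@Rintegral_dct _ _ _ P (fun k w => brownian_mean phi (approx k w)) _ (fun=> M)) => //.
  - by move=> w; apply: (cvg_comp _ _ (@approx_cvg w)); exact: cg.
apply: (cvg_unique _ h1) => //.
rewrite (_ : (fun k => _) = (fun k => \int[P]_w brownian_mean phi (approx k w))%R)//.
apply/funext => k; rewrite /Rintegral; congr fine.
apply: (approx_mean (f := EFin \o phi) (g := EFin \o brownian_mean phi)) => //.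
- exact/measurable_EFinP.
Qed.

End time_change.

End brownian.

Lemma ge0_integral_lebesgue_reflect (R : realType) (c : R)
    (f : measurableTypeR R -> \bar R) : measurable_fun setT f -> (forall x, 0 <= f x) ->
  \int[lebesgue_measure]_x f (c - x)%R = \int[lebesgue_measure]_x f x.
Proof.
move=> mf f0; pose h (x : measurableTypeR R) : measurableTypeR R := (c - x)%R.
have mh : measurable_fun setT h by exact: measurable_funB.
transitivity (\int[pushforward lebesgue_measure h]_x f x).
  by rewrite ge0_integral_pushforward.
apply: eq_measure_integral => A mA _; apply/esym.
apply: (@lebesgue_measure_unique R (pushforward lebesgue_measure h)) => //.
move=> _ [[a b] _ <-].
rewrite /= /pushforward.
rewrite (_ : h @^-1` _ = `[(c - b)%R, (c - a)%R[%classic); last first.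
  by apply/seteqP; split => x; rewrite /h /= !in_itv/= => /andP[? ?]; apply/andP; split; lra.
rewrite !lebesgue_measure_itv/= !lte_fin ltrD2l ltrN2.
by case: ifP => // _; rewrite -!EFinD; congr EFin; ring.
Qed.

Lemma ge0_integral_lebesgue_rV_reflect (R : realType) (n : nat) (x : 'rV[R]_n)
    (f : borel 'rV[R]_n -> \bar R) : measurable_fun setT f -> (forall u, 0 <= f u) ->
  \int[lebesgue_rV n]_u f (x - u)%R = \int[lebesgue_rV n]_u f u.
Proof.
elim: n x f => [|n IH] x f mf f0.
  by apply: eq_integral => u _; congr f; apply/rowP; case.
have mr m (y : 'rV[R]_m) : measurable_fun setT (fun u : borel 'rV[R]_m => (y - u)%R : borel 'rV[R]_m).
  apply: measurable_rV => j.
  under eq_fun do rewrite !mxE.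
  by apply: measurable_funB => //; exact: measurable_coord.
pose g (z : measurableTypeR R * borel 'rV[R]_n) := f (cons_rV z).
have mg : measurable_fun setT g by apply: (measurableT_comp mf); exact: measurable_cons_rV.
have g0 z : 0 <= g z by exact: f0.
pose x0 : R := x ord0 ord0; pose x1 : 'rV[R]_n := (\row_j x ord0 (lift ord0 j))%R.
have gE z : f (x - cons_rV z)%R = g ((x0 - z.1)%R, (x1 - z.2)%R).
  congr f; apply/rowP => j; rewrite !mxE.
  by case: unliftP => [j' ->|->]; rewrite ?mxE.
have E (h : borel 'rV[R]_n.+1 -> \bar R) : measurable_fun setT h -> (forall u, 0 <= h u) ->
    \int[lebesgue_rV n.+1]_u h u = \int[@lebesgue_measure R]_a \int[lebesgue_rV n]_v h (cons_rV (a, v)).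
  move=> mh h0.
  transitivity (\int[@lebesgue_measure R \x lebesgue_rV n]_z h (cons_rV z)).
    apply: (ge0_integral_pushforward (@measurable_cons_rV R n) (@lebesgue_measure R \x lebesgue_rV n) measurableT mh).
    by move=> u _; exact: h0.
  rewrite (fubini_tonelli1 (h \o @cons_rV R n)) => //.
    by apply: (measurableT_comp mh); exact: measurable_cons_rV.
  by move=> z; exact: h0.
have mfr : measurable_fun setT (fun u : borel 'rV[R]_n.+1 => f (x - u)%R).
  by apply: (measurableT_comp mf); exact: mr.
rewrite (E _ mfr (fun u => f0 _)) (E _ mf f0).
pose F (a : measurableTypeR R) := \int[lebesgue_rV n]_v g (a, v).
transitivity (\int[@lebesgue_measure R]_a F (x0 - a)%R).
  apply: eq_integral => a _; under eq_integral do rewrite gE.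
  rewrite /F -(IH x1 (fun v => g ((x0 - a)%R, v)))//.
  exact: (measurableT_comp mg (measurable_pair1 _)).
apply: ge0_integral_lebesgue_reflect.
  exact: (@measurable_fun_fubini_tonelli_F _ _ _ _ _ (lebesgue_rV n) g).
by move=> a; exact: integral_ge0.
Qed.

(** * The equation under the Laplace transform *)

Lemma normr_fine_le (R : realDomainType) (z : \bar R) : `|fine z|%:E <= `|z|.
Proof. by case: z => [r| |] //=; rewrite normr0 leey. Qed.

Lemma integrable_Rfubini2 d1 d2 (T1 : measurableType d1) (T2 : measurableType d2)
    (R : realType) (m1 : {sigma_finite_measure set T1 -> \bar R})
    (m2 : {sigma_finite_measure set T2 -> \bar R}) (f : T1 * T2 -> R) :
  (m1 \x m2).-integrable setT (EFin \o f) ->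
  m2.-integrable setT (EFin \o (fun y => \int[m1]_x f (x, y))%R).
Proof.
move=> intf; have [mf _] := integrable_EFinP intf.
have mEf : measurable_fun setT (EFin \o f) by exact/measurable_EFinP.
have mG := measurable_fubini_G intf.
apply/integrableP; split.
  by apply/measurable_EFinP; exact: (measurableT_comp (fine_measurable measurableT) mG).
apply: le_lt_trans ((integrable21ltyP m1 m2 mEf).1 intf).
apply: ge0_le_integral => //.
- apply: measurableT_comp => //; apply/measurable_EFinP.
  exact: (measurableT_comp (fine_measurable measurableT) mG).
- apply: (@measurable_fun_fubini_tonelli_G _ _ _ _ _ m1 (fun z => `|(f z)%:E|)) => //.
  exact: measurableT_comp.
- move=> y _ /=; apply: (@le_trans _ _ `|\int[m1]_x (f (x, y))%:E|).
    rewrite (_ : (\int[m1]_x f (x, y))%R = fine (\int[m1]_x (f (x, y))%:E))//.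
    exact: normr_fine_le.
  by apply: le_abse_integral => //; exact: (measurableT_comp mEf (measurable_pair2 y)).
Qed.

Section lebesgue_affine.
Context {R : realType}.
Local Notation mu := (@lebesgue_measure R).

Lemma Rintegral_lebesgue_reflect (c : R) (f : R -> R) : mu.-integrable setT (EFin \o f) ->
  mu.-integrable setT (EFin \o (fun x => f (c - x)%R)) /\
  (\int[mu]_x f (c - x) = \int[mu]_x f x)%R.
Proof.
move=> intf; have [mf foo] := integrable_EFinP intf.
have mr : measurable_fun setT (fun x : measurableTypeR R => (c - x)%R : measurableTypeR R).
  exact: measurable_funB.
have mfr : measurable_fun setT (fun x : measurableTypeR R => f (c - x)%R).
  exact: (measurableT_comp mf mr).
have split (g : R -> R) : measurable_fun setT (g : measurableTypeR R -> R) ->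
    \int[mu]_x ((EFin \o (fun x => g (c - x)%R)) ^\+ x) = \int[mu]_x (EFin \o g)^\+ x /\
    \int[mu]_x ((EFin \o (fun x => g (c - x)%R)) ^\- x) = \int[mu]_x (EFin \o g)^\- x.
  move=> mg; split.
    transitivity (\int[mu]_x (EFin \o g)^\+ (c - x)%R); first by apply: eq_integral => x _; rewrite !funeposE.
    apply: ge0_integral_lebesgue_reflect => //.
    by apply: measurable_funepos; exact/measurable_EFinP.
  transitivity (\int[mu]_x (EFin \o g)^\- (c - x)%R); first by apply: eq_integral => x _; rewrite !funenegE.
  apply: ge0_integral_lebesgue_reflect => //.
  by apply: measurable_funeneg; exact/measurable_EFinP.
split; last first.
  rewrite /Rintegral; congr fine; rewrite [LHS]integralE [RHS]integralE.
  by have [-> ->] := split f mf.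
apply/integrableP; split; first exact/measurable_EFinP.
rewrite (@ge0_integral_lebesgue_reflect R c (fun x => `|(f x)%:E|)) => //.
by apply: measurableT_comp => //; exact/measurable_EFinP.
Qed.

(** A translation is the composition of two reflections. *)
Lemma Rintegral_lebesgue_shift (c : R) (f : R -> R) : mu.-integrable setT (EFin \o f) ->
  mu.-integrable setT (EFin \o (fun x => f (x - c)%R)) /\
  (\int[mu]_x f (x - c) = \int[mu]_x f x)%R.
Proof.
move=> intf.
have [i1 e1] := Rintegral_lebesgue_reflect 0 intf.
have [i2 e2] := Rintegral_lebesgue_reflect c i1.
have E x : f (0 - (c - x))%R = f (x - c)%R by rewrite sub0r opprB.
split; last by rewrite -e1 -e2; apply: eq_Rintegral => x _; rewrite E.
by move: i2; apply: eq_integrable => // x _ /=; rewrite E.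
Qed.

End lebesgue_affine.

(** * The Laplace transform of a convolution *)

Section laplace_convolution.
Context {R : realType}.
Local Notation mu := (@lebesgue_measure R).
Variables (lam : R) (u k : R -> R).
Hypotheses (iu : (lapm lam).-integrable setT (EFin \o u))
           (ik : (lapm lam).-integrable setT (EFin \o k)).

Let U s := (u s * lapdens lam s)%R.
Let K s := (k s * lapdens lam s)%R.

Let iU : mu.-integrable setT (EFin \o U).
Proof. by apply/integrable_lapm_dens => //; have [] := integrable_EFinP iu. Qed.

Let iK : mu.-integrable setT (EFin \o K).
Proof. by apply/integrable_lapm_dens => //; have [] := integrable_EFinP ik. Qed.

(** With the weights included, the exponentials multiply to the weight at the second variable and
    the indicators confine the first one to ]0, t[; Fubini can then be applied on the whole
    plane. *)
Let h (z : measurableTypeR R * measurableTypeR R) : R := (U z.1 * K (z.2 - z.1))%R.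

Let ih : (mu \x mu).-integrable setT (EFin \o h).
Proof.
have [mU Uoo] := integrable_EFinP iU; have [mK Koo] := integrable_EFinP iK.
have mh : measurable_fun setT h.
  apply: measurable_funM; first exact: (measurableT_comp mU measurable_fst).
  apply: (measurableT_comp mK); apply: measurable_funB; [exact: measurable_snd|exact: measurable_fst].
apply/integrable12ltyP; first exact/measurable_EFinP.
have KE s : \int[mu]_t `|(EFin \o h) (s, t)| = `|U s|%:E * \int[mu]_t `|K t|%:E.
  under eq_integral do rewrite /= /h/= normrM EFinM.
  rewrite ge0_integralZl; [|exact: measurableT|..]; last 3 first.
  - have ms : measurable_fun setT (fun t : measurableTypeR R => (t - s)%R : measurableTypeR R).
      exact: measurable_funB.
    apply/measurable_EFinP.
    exact: (measurableT_comp (normr_measurable (D := setT)) (measurableT_comp mK ms)).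
  - by move=> t _; rewrite lee_fin.
  - by rewrite lee_fin.
  congr (_ * _).
  have iKn : mu.-integrable setT (EFin \o (fun t => `|K t|%R)) by exact: integrable_norm iK.
  have [i1 e1] := Rintegral_lebesgue_shift s iKn.
  by rewrite -EFin_Rintegral// -[RHS]EFin_Rintegral// e1.
under eq_integral do rewrite KE.
rewrite ge0_integralZr//; last 2 first.
- by apply/measurable_EFinP; apply: measurableT_comp.
- exact: integral_ge0.
by rewrite lte_mul_pinfty// ?integral_ge0// ge0_fin_numE// integral_ge0.
Qed.

Let c (t : R) : R := (\int[mu]_(s in `]0%R, t[) (u s * k (t - s)))%R.

Hypothesis loc : forall t, (0 < t)%R -> mu.-integrable `]0%R, t[ (EFin \o (fun s => u s * k (t - s))%R).

Let hE t : (\int[mu]_s h (s, t) = c t * lapdens lam t)%R.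
Proof.
have [t0|t0] := leP t 0%R.
  rewrite /lapdens indicE memNset ?mul0r ?mulr0; last by rewrite /= in_itv/= andbT; apply/negP; rewrite -leNgt.
  rewrite (_ : (fun s => h (s, t)) = cst 0%R); first by rewrite /Rintegral integral0.
  apply/funext => s; rewrite /h /U /K /lapdens /= !indicE !mem_setE !in_itv/= !andbT subr_gt0.
  have [s0|s0] := ltP 0%R s; last by rewrite mul0r mulr0 mul0r.
  by rewrite ltNge (le_trans t0 (ltW s0))/= mul0r !mulr0.
rewrite /c -RintegralZr//; last exact: loc.
rewrite [RHS]Rintegral_mkcond; apply: eq_Rintegral => s _.
rewrite patchE mem_setE in_itv/= /h /U /K /lapdens /= !indicE !mem_setE !in_itv/= !andbT t0 subr_gt0.
case: (ltP 0%R s) => s0 /=; last by rewrite mul0r mulr0 mul0r.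
case: (ltP s t) => st /=; last by rewrite mul0r !mulr0.
rewrite !mul1r mulrACA -expRD; congr (_ * expR _)%R; ring.
Qed.

Let mc : measurable_fun setT c.
Proof.
(* The convolution inherits measurability from the inner Fubini integral, after its exponential
   weight is undone. *)
rewrite (_ : c = fun t => \int[mu]_s h (s, t) * expR (lam * t))%R.
  apply: measurable_funM.
    by have [] := integrable_EFinP (integrable_Rfubini2 ih).
  by apply: measurableT_comp => //; exact: measurable_funM.
apply/funext => t; rewrite hE; have [t0|t0] := leP t 0%R; last first.
  rewrite /lapdens indicE mem_set; last by rewrite /= in_itv/= t0.
  by rewrite mul1r -mulrA -expRD addNr expR0 mulr1.
by rewrite /c set_itv_ge ?Rintegral_set0 ?mul0r// bnd_simp -leNgt.
Qed.

Lemma laplace_convolution : (lapm lam).-integrable setT (EFin \o c) /\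
  (\int[lapm lam]_t c t = (\int[lapm lam]_t u t) * \int[lapm lam]_t k t)%R.
Proof.
have ic : (lapm lam).-integrable setT (EFin \o c).
  apply/integrable_lapm_dens; first exact: mc.
  have := integrable_Rfubini2 ih; apply: eq_integrable => // t _ /=.
  by rewrite hE.
split => //; rewrite !Rintegral_lapm//.
transitivity (\int[mu]_t \int[mu]_s h (s, t))%R.
  by apply: eq_Rintegral => t _; rewrite hE.
rewrite -(Rfubini ih) -RintegralZr//; apply: eq_Rintegral => s _.
have [i1 e1] := Rintegral_lebesgue_shift s iK.
by rewrite -e1 -RintegralZl.
Qed.

End laplace_convolution.

Lemma integrable_expR_lapm (R : realType) (w lam C : R) : (w < lam)%R ->
  (lapm lam).-integrable setT (EFin \o (fun t : R => C * expR (w * `|t|))%R).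
Proof.
move=> wl; apply: integrable_mull; apply/integrable_lapm_dens.
  apply: measurableT_comp => //; apply: measurable_funM => //; exact: normr_measurable.
have l0 : (0 < lam - w)%R by rewrite subr_gt0.
have : (lapm (lam - w)).-integrable setT (EFin \o (fun _ : R => 1%R : R)).
  by apply: (@bounded_integrable _ _ _ (lapm (lam - w)) _ 1%R) => //; [exact: lapmT_fin|move=> _; rewrite normr1].
move/integrable_lapm_dens => /(_ (measurable_cst _)).
apply: eq_integrable => // t _ /=; congr EFin; rewrite mul1r /lapdens indicE mem_setE in_itv/= andbT.
have [t0|_] := ltP 0%R t; last by rewrite !mul0r mulr0.
rewrite gtr0_norm// !mul1r -expRD; congr expR; ring.
Qed.

Lemma lapm_FTC2 (R : realType) (lam x y : R) (f G : R -> R) : (0 < x)%R -> (x < y)%R ->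
  measurable_fun setT (f : measurableTypeR R -> R) ->
  (forall t : R, (0 < t)%R -> {for t, continuous f}) ->
  (forall t : R, (0 < t)%R -> is_derive t (1 : R)%R G (f t * expR (- (lam * t)))%R) ->
  (\int[lapm lam]_t (\1_(`[x, y]%classic : set R) t * f t) = G y - G x)%R.
Proof.
move=> x0 xy mf cf dG.
have pos t : t \in `[x, y]%R -> (0 < t)%R by rewrite in_itv/= => /andP[h _]; exact: lt_le_trans h.
have cfe : {within `[x, y], continuous (fun t => f t * expR (- (lam * t)))%R}.
  apply: continuous_in_subspaceT => t; rewrite inE => /pos t0.
  apply: cvgM; first exact: cf.
  apply: (@continuous_comp _ _ _ (fun t : R => - (lam * t))%R expR); last exact: continuous_expR.
  by apply: cvgN; apply: cvgMr; exact: cvg_id.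
have ife : lebesgue_measure.-integrable `[x, y] (EFin \o (fun t => f t * expR (- (lam * t)))%R).
  by apply: continuous_compact_integrable => //; exact: segment_compact.
have E t : (\1_(`[x, y]%classic : set R) t * f t * lapdens lam t)%R =
    ((fun t => f t * expR (- (lam * t))) \_ `[x, y])%R t.
  rewrite patchE indicE mem_setE; case: ifPn => [h|_]; last by rewrite !mul0r.
  by rewrite mul1r /lapdens indicE mem_set ?mul1r//= in_itv/= pos.
have i1 : (lapm lam).-integrable setT (EFin \o (fun t => \1_(`[x, y]%classic : set R) t * f t)%R).
  apply/integrable_lapm_dens; first by apply: measurable_funM => //; exact: measurable_indic.
  have : lebesgue_measure.-integrable setT ((EFin \o (fun t => f t * expR (- (lam * t)))%R) \_ `[x, y]).
    by move: ife; rewrite integrable_mkcond//; exact: measurable_itv.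
  apply: eq_integrable => // t _ /=; rewrite E !patchE.
  by case: ifP.
rewrite Rintegral_lapm//; transitivity (\int[lebesgue_measure]_(t in `[x, y]) (f t * expR (- (lam * t))))%R.
  by rewrite [RHS]Rintegral_mkcond; apply: eq_Rintegral => t _; rewrite E.
apply: EFin_inj; rewrite EFinB.
have cG (t : R) : (0 < t)%R -> {for t, continuous G}.
  by move=> t0; apply/differentiable_continuous/derivable1_diffP; have [] := dG t t0.
rewrite -(continuous_FTC2 xy cfe).
- by rewrite /Rintegral fineK//; apply: integrable_fin_num ife; exact: measurable_itv.
- split.
  + by move=> t; rewrite in_itv/= => /andP[xt _]; have [] := dG t (lt_trans x0 xt).
  + by apply: cvg_at_right_filter; exact: cG.
  + by apply: cvg_at_left_filter; apply: cG; exact: lt_trans xy.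
- move=> t; rewrite in_itv/= => /andP[xt _]; have t0 := lt_trans x0 xt.
  by rewrite derive1E; exact: (@derive_val _ _ _ _ _ _ _ (dG t t0)).
Qed.

(** * Laplace transform of the evolution equation in time *)

Section laplace_of_equation.
Context {R : realType}.
Local Notation mu := (@lebesgue_measure R).
Variables (beta w Cu Cv : R) (u v k : R -> R).
Hypotheses (beta0 : (0 <= beta)%R) (w0 : (0 < w)%R).
Hypotheses (mu_ : measurable_fun setT (u : measurableTypeR R -> R))
           (mv : measurable_fun setT (v : measurableTypeR R -> R))
           (mk : measurable_fun setT (k : measurableTypeR R -> R)).
Hypothesis uC : forall t, (`|u t| <= Cu * expR (w * `|t|))%R.
Hypothesis vC : forall t, (`|v t| <= Cv * expR (w * `|t|))%R.
Hypothesis k0 : forall t, (0 <= k t)%R.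
Hypothesis ik : forall lam : R, (0 < lam)%R -> (lapm lam).-integrable setT (EFin \o k).
Hypothesis ck : forall t, (0 < t)%R -> {for t, continuous k}.
Hypothesis cv : forall t, (0 < t)%R -> {for t, continuous v}.
Hypothesis u0 : u t @[t --> 0^'+] --> u 0%R.

Definition open_convolution (t : R) : R := (\int[mu]_(s in `]0%R, t[) (u s * k (t - s)))%R.
Local Notation c := open_convolution.

(** The equation says that F' = v + u(0) k. Keeping the two terms together also covers [beta = 0],
    where [u] itself need not be differentiable. *)
Let F t := (beta * u t + c t)%R.

Hypothesis dF : forall t : R, (0 < t)%R -> is_derive t (1 : R)%R F (v t + u 0%R * k t)%R.

Let Kw (r : R) := (k r * lapdens w r)%R.

Let iKw : mu.-integrable setT (EFin \o Kw).
Proof. by apply/integrable_lapm_dens => //; exact: ik. Qed.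

Let Kw0 r : (0 <= Kw r)%R. Proof. by rewrite mulr_ge0// lapdens_ge0. Qed.

Let Cu0 : (0 <= Cu)%R.
Proof.
have := le_trans (normr_ge0 _) (uC 0%R).
by rewrite normr0 mulr0 expR0 mulr1.
Qed.

(** Writing exp(w s) = exp(w t) exp(- w (t - s)) transfers the growth of [u] to the kernel, so that
    the single integrable function [Kw] serves as a majorant for all [t]. *)
Let dom t s : (0 < s < t)%R -> (`|u s * k (t - s)| <= Cu * expR (w * t) * Kw (t - s))%R.
Proof.
move=> /andP[s0 st]; rewrite normrM (ger0_norm (k0 _)) /Kw /lapdens indicE mem_set; last first.
  by rewrite /= in_itv/= andbT subr_gt0.
rewrite mul1r -mulrA (mulrC (expR (w * t))) -mulrA -expRD mulrCA mulrC ler_wpM2l//.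
apply: le_trans (uC s) _; rewrite gtr0_norm// ler_wpM2l// ler_expR.
by rewrite mulrBr opprB subrK.
Qed.

Let iKt t : mu.-integrable setT (EFin \o (fun s => Cu * expR (w * t) * Kw (t - s))%R).
Proof. by apply: integrable_mull; have [] := Rintegral_lebesgue_reflect t iKw. Qed.

Let muk t : measurable_fun setT (fun s : measurableTypeR R => u s * k (t - s))%R.
Proof.
apply: measurable_funM => //.
have ms : measurable_fun setT (fun s : measurableTypeR R => (t - s)%R : measurableTypeR R).
  exact: measurable_funB.
exact: (measurableT_comp mk ms).
Qed.

Lemma convolution_loc t : (0 < t)%R ->
  mu.-integrable `]0%R, t[ (EFin \o (fun s => u s * k (t - s))%R).
Proof.
move=> t0; apply: (@le_integrable _ _ _ mu `]0%R, t[ _ _ (EFin \o (fun s => Cu * expR (w * t) * Kw (t - s))%R)).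
- exact: measurable_itv.
- by apply/measurable_EFinP; exact: measurable_funTS.
- move=> s /=; rewrite in_itv/= => st; rewrite lee_fin (le_trans (dom st))// ler_norm//.
- exact: integrableS (iKt t).
Qed.

(** It measures the size of the convolution up to the factor exp(w t): bounded in [t], which settles
    the behaviour at infinity, and tending to 0 with [t], which removes the boundary term at 0. *)
Let J (t : R) : R := (\int[mu]_s (\1_(`]0%R, t[%classic : set R) s * Kw s))%R.

Let iJ t : mu.-integrable setT (EFin \o (fun s => \1_(`]0%R, t[%classic : set R) s * Kw s)%R).
Proof.
have [mKw _] := integrable_EFinP iKw.
apply: (@le_integrable_EFin _ _ _ mu _ Kw) => //.
- by apply: measurable_funM => //; exact: measurable_indic.
- by move=> s; rewrite ger0_norm ?mulr_ge0// ler_piMl// indicE; case: (_ \in _).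
Qed.

Let c_le t : (0 < t)%R -> (`|c t| <= Cu * expR (w * t) * J t)%R.
Proof.
move=> t0; have [i1 e1] := Rintegral_lebesgue_reflect t (iJ t).
rewrite /J -e1 -RintegralZl// /c Rintegral_mkcond.
apply: normr_Rintegral_le; last exact: integrable_mull.
  by apply/(measurable_restrictT _ _).1 => //; exact: measurable_funTS.
move=> s; rewrite patchE indicE !mem_setE !in_itv/= subr_gt0 ltrBlDr ltrDl.
case: ifPn => [st|_]; last by rewrite normr0 !mulr_ge0// expR_ge0.
by rewrite andbC st mul1r; exact: dom.
Qed.

Let J_bound t : (J t <= \int[mu]_s Kw s)%R.
Proof.
rewrite -lee_fin /J !EFin_Rintegral//; apply: ge0_le_integral => //.
- by move=> s _; rewrite lee_fin mulr_ge0.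
- by apply/measurable_EFinP; have [] := integrable_EFinP (iJ t).
- by apply/measurable_EFinP; have [] := integrable_EFinP iKw.
- by move=> s _; rewrite lee_fin ler_piMl// indicE; case: (_ \in _).
Qed.

Let J_cvg0 : J n.+1%:R^-1 @[n --> \oo] --> (0 : R)%R.
Proof.
have [mKw _] := integrable_EFinP iKw.
have -> : (0 : R)%R = (\int[mu]__ 0)%R by rewrite /Rintegral integral0.
apply: (@Rintegral_dct _ _ _ mu _ _ Kw) => //.
- by move=> n; apply: measurable_funM => //; exact: measurable_indic.
- move=> s; have [s0|s0] := leP s 0%R.
    rewrite (_ : (fun n => _) = (fun=> 0%R)); first exact: cvg_cst.
    by apply/funext => n; rewrite indicE mem_setE in_itv/= ltNge s0 mul0r.
  apply: cvg_near_cst; near=> n; rewrite indicE mem_setE in_itv/= s0/=.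
  rewrite ltNge ltW ?mul0r//; near: n.
  exact: (cvgr_lt _ (@cvg_harmonic R)).
- by move=> n s; rewrite ger0_norm ?mulr_ge0// ler_piMl// indicE; case: (_ \in _).
Unshelve. all: by end_near. Qed.

Section fixed_lam.
Variables (lam : R) (wlam : (w < lam)%R).

Let lam0 : (0 < lam)%R. Proof. exact: lt_trans wlam. Qed.

Lemma integrable_exp_bounded (f : R -> R) (C : R) : measurable_fun setT f ->
  (forall t, `|f t| <= C * expR (w * `|t|))%R -> (lapm lam).-integrable setT (EFin \o f).
Proof.
move=> mf fC; apply: (@le_integrable_EFin _ (measurableTypeR R) R (lapm lam) _ (fun t => C * expR (w * `|t|))%R) => //.
exact: integrable_expR_lapm.
Qed.

Let iu := integrable_exp_bounded mu_ uC.
Let iv := integrable_exp_bounded mv vC.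

Let f t := (v t + u 0 * k t - lam * F t)%R.

Let ic : (lapm lam).-integrable setT (EFin \o c).
Proof. by have [] := laplace_convolution iu (ik lam0) convolution_loc. Qed.

Let iF : (lapm lam).-integrable setT (EFin \o F).
Proof. by apply: (@integrableD _ _ _ (lapm lam) setT measurableT (EFin \o (fun t => beta * u t)%R) (EFin \o c)) => //; exact: integrable_mull. Qed.

Let iuk : (lapm lam).-integrable setT (EFin \o (fun t => u 0%R * k t)%R).
Proof. by apply: integrable_mull; exact: ik. Qed.

Let ivuk : (lapm lam).-integrable setT (EFin \o (fun t => v t + u 0%R * k t)%R).
Proof. exact: (@integrableD _ _ _ (lapm lam) setT measurableT (EFin \o v) _ iv iuk). Qed.

Let ilF : (lapm lam).-integrable setT (EFin \o (fun t => lam * F t)%R).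
Proof. exact: integrable_mull. Qed.

Let if_ : (lapm lam).-integrable setT (EFin \o f).
Proof. exact: (@integrableB _ _ _ (lapm lam) setT measurableT _ _ ivuk ilF). Qed.

Let G t := (expR (- (lam * t)) * F t)%R.

Let dG (t : R) : (0 < t)%R -> is_derive t (1 : R)%R G (f t * expR (- (lam * t)))%R.
Proof.
move=> t0; have h := dF t0.
have e : is_derive t (1 : R)%R (fun t : R => expR (- (lam * t)))%R (- lam * expR (- (lam * t)))%R.
  apply: is_derive_eq; rewrite /GRing.scale/=; ring.
apply: is_derive_eq; rewrite /f /GRing.scale/=; ring.
Qed.

Let ftc (x y : R) : (0 < x)%R -> (x < y)%R ->
  (\int[lapm lam]_t (\1_(`[x, y]%classic : set R) t * f t) = G y - G x)%R.
Proof.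
move=> x0 xy; have mf : measurable_fun setT f by have [] := integrable_EFinP if_.
have cF (t : R) : (0 < t)%R -> {for t, continuous F}.
  by move=> t0; apply/differentiable_continuous/derivable1_diffP; have [] := dF t0.
apply: lapm_FTC2 => // t t0.
apply: cvgB; first by apply: cvgD; [exact: cv|apply: cvgMr; exact: ck].
by apply: cvgMr; exact: cF.
Qed.

(** The derivative is known only for t > 0, so the fundamental theorem is applied on compact
    intervals exhausting the half-line, and the boundary terms are followed to the limit. *)
Let Rint_f : (\int[lapm lam]_t f t = - (beta * u 0))%R.
Proof.
have mf : measurable_fun setT f by have [] := integrable_EFinP if_.
(* The shift by 2 keeps x_ n <= 1 < y_ n already for n = 0. *)
pose x_ (n : nat) : R := (n.+1%:R^-1)%R; pose y_ (n : nat) : R := (n.+2%:R)%R.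
have x0 n : (0 < x_ n)%R by rewrite invr_gt0.
have xy n : (x_ n < y_ n)%R.
  apply: (@le_lt_trans _ _ 1%R); first by rewrite invf_le1// ler1n.
  by rewrite ltr1n.
have cx : x_ n @[n --> \oo] --> (0 : R)%R by exact: cvg_harmonic.
have cy : y_ n @[n --> \oo] --> +oo%R.
  have := @cvgr_idn R; rewrite -[X in X -> _]cvg_shiftS.
  by rewrite -[X in X -> _]cvg_shiftS.
have h1 : (\int[lapm lam]_t (\1_(`[x_ n, y_ n]%classic : set R) t * f t))%R @[n --> \oo] -->
    (\int[lapm lam]_t f t)%R.
  apply: (@Rintegral_dct_ae _ (measurableTypeR R) R (lapm lam) _ _ (fun t => `|f t|)%R) => //.
  - by move=> n; apply: measurable_funM => //; exact: measurable_indic.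
  - apply: filterS (ae_lapm_gt0 lam) => t t0.
    apply: cvg_near_cst; near=> n; rewrite indicE mem_set ?mul1r//= in_itv/=.
    apply/andP; split; apply: ltW; near: n.
      exact: (cvgr_lt _ cx).
    by move/cvgryPgt : cy; apply.
  - exact: (integrable_norm if_).
  - by move=> n t; rewrite normrM ler_piMl// indicE; case: (_ \in _); rewrite ?normr1 ?normr0.
have h2 : (G (y_ n) - G (x_ n))%R @[n --> \oo] --> (- (beta * u 0))%R.
  rewrite -[X in _ --> X]add0r; apply: cvgB.
    (* At the right end |F y| <= D exp(w y), which exp(- lam y) outweighs because [lam > w]. *)
    pose D := (beta * Cu + Cu * \int[mu]_s Kw s)%R.
    have D0 : (0 <= D)%R by rewrite addr_ge0 ?mulr_ge0 ?Rintegral_ge0.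
    have lw : (0 < lam - w)%R by rewrite subr_gt0.
    apply/cvgr0Pnorm_lt => e e0; near=> n.
    have yn0 : (0 < y_ n)%R by exact: lt_trans (xy n).
    apply: (@le_lt_trans _ _ (D * expR (- ((lam - w) * y_ n)))%R).
      rewrite /G normrM (ger0_norm (expR_ge0 _)).
      have -> : expR (- ((lam - w) * y_ n)) = (expR (- (lam * y_ n)) * expR (w * y_ n))%R.
        by rewrite -expRD; congr expR; ring.
      rewrite mulrCA ler_wpM2l ?expR_ge0// /F (le_trans (ler_normD _ _))// /D mulrDl lerD//.
        rewrite normrM (ger0_norm beta0) -mulrA ler_wpM2l//.
        by apply: le_trans (uC _) _; rewrite gtr0_norm.
      apply: le_trans (c_le yn0) _; rewrite mulrAC ler_wpM2r ?expR_ge0// ler_wpM2l//.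
    have z0 : (0 < e / (D + 1))%R by rewrite divr_gt0// ltr_wpDl.
    apply: (@le_lt_trans _ _ ((D + 1) * expR (- ((lam - w) * y_ n)))%R).
      by rewrite ler_wpM2r ?expR_ge0// lerDl.
    rewrite mulrC -ltr_pdivlMr ?ltr_wpDl// -[ltRHS]lnK ?posrE// ltr_expR ltrNl.
    rewrite -ltr_pdivrMl//; near: n; move/cvgryPgt : cy; apply.
  rewrite -[X in _ --> X]mul1r; apply: cvgM.
    have cx' : (- (lam * x_ n))%R @[n --> \oo] --> (0 : R)%R.
      by rewrite -(@oppr0 R); apply: cvgN; rewrite -(mulr0 lam); apply: cvgMr.
    rewrite -(@expR0 R); exact: (cvg_comp _ _ cx' (@continuous_expR R _)).
  (* At the left end [u] tends to u(0), while the convolution vanishes with [J]. *)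
  rewrite -[X in _ --> X]addr0; apply: cvgD.
    apply: cvgMr; move/cvg_at_rightP : u0; apply; split => //.
  apply: (@squeeze_cvgr _ _ _ _ (fun n => - (Cu * expR w * J (x_ n)))%R (fun n => Cu * expR w * J (x_ n))%R).
  - apply: nearW => n; rewrite -ler_norml (le_trans (c_le (x0 n)))// ler_wpM2r//.
      by apply: Rintegral_ge0 => s _; rewrite mulr_ge0.
    by rewrite ler_wpM2l// ler_expR ler_piMr ?(ltW w0)// invf_le1// ler1n.
  - by rewrite -(@oppr0 R); apply: cvgN; rewrite -(mulr0 (Cu * expR w)%R); apply: cvgMr; exact: J_cvg0.
  - by rewrite -(mulr0 (Cu * expR w)%R); apply: cvgMr; exact: J_cvg0.
apply: (cvg_unique _ h1) => //.
rewrite (_ : (fun n => _) = (fun n => G (y_ n) - G (x_ n))%R)//.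
by apply/funext => n; exact: ftc.
Unshelve. all: by end_near. Qed.

Lemma laplace_equation :
  (lam * (beta + \int[lapm lam]_t k t) * \int[lapm lam]_t u t - \int[lapm lam]_t v t =
   u 0 * (beta + \int[lapm lam]_t k t))%R.
Proof.
have := Rint_f; rewrite /f RintegralB// RintegralD// !RintegralZl//; last exact: ik.
have -> : (\int[lapm lam]_t F t = beta * \int[lapm lam]_t u t + (\int[lapm lam]_t u t) * \int[lapm lam]_t k t)%R.
  have [_ <-] := laplace_convolution iu (ik lam0) convolution_loc.
  rewrite /F RintegralD//; last exact: integrable_mull.
  by rewrite RintegralZl.
move=> h; lra.
Qed.

End fixed_lam.

End laplace_of_equation.

Lemma test_function_bounded (R : realType) (n : nat) (phi : 'rV[R]_n -> R) :
  test_function phi -> continuous phi /\ exists M : R, forall x, (`|phi x| <= M)%R.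
Proof.
move=> [smo cK]; have cphi : continuous phi by have [] := smo [::].
split => //; have [M [_ hM]] := compact_bounded (continuous_compact (continuous_subspaceT cphi) cK).
exists (`|M| + 1)%R => x; have [->|px] := eqVneq (phi x) 0%R.
  by rewrite normr0 addr_ge0.
apply: hM; first by rewrite (le_lt_trans (ler_norm _))// ltrDl.
by exists x => //; exact: subset_closure.
Qed.

Lemma Rintegral_sum d (T : measurableType d) (R : realType) (m : {measure set T -> \bar R})
    (I : Type) (r : seq I) (f : I -> T -> R) :
  (forall i, m.-integrable setT (EFin \o f i)) ->
  (\int[m]_x (\sum_(i <- r) f i x) = \sum_(i <- r) \int[m]_x f i x)%R.
Proof.
move=> fi; pose P (g : T -> R) (v : R) := m.-integrable setT (EFin \o g) /\ (\int[m]_x g x = v)%R.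
suff [] : P (fun x => \sum_(i <- r) f i x)%R (\sum_(i <- r) \int[m]_x f i x)%R by [].
elim: r => [|i r [IHi IHe]].
  rewrite (_ : (fun x => _) = fun=> 0%R); last by apply/funext => x; rewrite big_nil.
  by rewrite big_nil; split; [exact: integrable0|rewrite /Rintegral integral0].
rewrite (_ : (fun x => _) = fun x => f i x + \sum_(j <- r) f j x)%R; last first.
  by apply/funext => x; rewrite big_cons.
rewrite big_cons; split; last by rewrite RintegralD// IHe.
exact: (@integrableD _ _ _ m setT measurableT _ _ (fi i) IHi).
Qed.

Lemma derive1_eq0_outside (R : realType) (f : R -> R) (A B : R) :
  (forall y, ~~ (A <= y <= B)%R -> f y = 0%R) ->
  forall y, ~~ (A <= y <= B)%R -> derive1 f y = 0%R.
Proof.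
move=> f0 y; rewrite negb_and -!ltNge => hy.
rewrite derive1E (@near_eq_derive _ _ _ f (cst 0%R)) ?derive_cst//.
case/orP: hy => hy; near=> z; apply: f0; rewrite negb_and -!ltNge.
- by apply/orP; left; near: z; exact: lt_nbhsl.
- by apply/orP; right; near: z; exact: lt_nbhsr.
Unshelve. all: by end_near. Qed.

(** * Pairing a fundamental solution with functions of space *)

Section density.
Context {R : realType} {n : nat}.
Local Notation mu := (@lebesgue_measure R).
Variables (beta : R) (k kap : R -> R).
Hypotheses (beta0 : (0 <= beta)%R) (mk : measurable_fun setT (k : measurableTypeR R -> R)).
Hypothesis k0 : forall t, (0 <= k t)%R.
Hypothesis ik : forall lam : R, (0 < lam)%R -> (lapm lam).-integrable setT (EFin \o k).
Hypothesis ck : forall t, (0 < t)%R -> {for t, continuous k}.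
Hypothesis kapE : forall lam : R, (0 < lam)%R -> kap lam = (lam * (beta + \int[lapm lam]_t k t))%R.

Variables (q : 'rV[R]_n -> R -> R) (C w : R).
Hypothesis w0 : (0 < w)%R.
Hypothesis mq : measurable_fun [set z : (borel 'rV[R]_n * measurableTypeR R)%type | (0 < z.2)%R]
        (fun z => q z.1 z.2 : measurableTypeR R).
Hypothesis qC : forall t : R, (0 < t)%R ->
  \int[lebesgue_rV n]_x `|q x t|%:E <= (C * expR (w * t))%:E.

Let conv (u : R -> R) (t : R) : R := (\int[mu]_(s in `[0%R, t]) (u s * k (t - s)))%R.

Hypothesis eqn : forall phi, test_function phi ->
  {within `[0%R, +oo[%classic, continuous (tested q phi)} /\
  forall t : R, (0 < t)%R ->
    [/\ beta <> 0%R -> derivable (tested q phi) t 1%R, derivable (conv (tested q phi)) t 1%R &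
     (beta * derive1 (tested q phi) t + derive1 (conv (tested q phi)) t - tested q phi 0 * k t =
      \int[lebesgue_rV n]_x (laplacian phi x * q x t))%R].

Local Notation TQ := (borel 'rV[R]_n * measurableTypeR R)%type.

(* q is unconstrained at nonpositive times. *)
Definition density0 (z : TQ) : R := if (0 < z.2)%R then q z.1 z.2 else 0%R.
Local Notation Q := density0.

Lemma measurable_density0 : measurable_fun setT (Q : TQ -> measurableTypeR R).
Proof.
have mD : measurable [set z : TQ | (0 < z.2)%R].
  rewrite (_ : [set z | _] = setT `*` (`]0%R, +oo[%classic : set (measurableTypeR R))).
    exact: measurableX.
  by apply/seteqP; split => z /=; rewrite in_itv/= andbT; [|case].
have := (measurable_restrictT _ mD).1 mq.
congr measurable_fun; apply/funext => z; rewrite patchE /density0.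
have [h|h] := boolP (0 < z.2)%R; first by rewrite mem_set.
by rewrite memNset//; exact/negP.
Qed.

Let msec t : measurable_fun setT (fun x : borel 'rV[R]_n => Q (x, t) : measurableTypeR R).
Proof. exact: (measurableT_comp measurable_density0 (measurable_pair2 t)). Qed.

Lemma integrable_density_at t : (0 < t)%R -> (lebesgue_rV n).-integrable setT (EFin \o q^~ t).
Proof.
move=> t0; apply/integrableP; split; last first.
  by apply: le_lt_trans (qC t0) _; rewrite ltry.
apply/measurable_EFinP; have := msec t; congr measurable_fun.
by apply/funext => x; rewrite /density0 /= t0.
Qed.

Let qC_norm t : \int[lebesgue_rV n]_x `|Q (x, t)|%:E <= (`|C| * expR (w * `|t|))%:E.
Proof.
have [t0|t0] := ltP 0%R t.
  apply: (@le_trans _ _ (C * expR (w * t))%:E).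
    rewrite (eq_integral (fun x : borel 'rV[R]_n => `|q x t|%:E)) ?qC// => x _.
    by rewrite /density0/= t0.
  by rewrite lee_fin (gtr0_norm t0) ler_wpM2r ?expR_ge0// ler_norm.
rewrite (eq_integral (fun=> 0)) ?integral0 ?lee_fin ?mulr_ge0 ?expR_ge0// => x _.
by rewrite /density0/= ltNge t0/= normr0.
Qed.

Section fixed_lam.
Variables (lam : R) (wlam : (w < lam)%R).
Let lam0 : (0 < lam)%R. Proof. exact: lt_trans wlam. Qed.
Local Notation m := (lebesgue_rV n \x lapm lam).

Lemma integrable_density : m.-integrable setT (EFin \o Q).
Proof.
have mQ : measurable_fun setT (EFin \o Q) by apply/measurable_EFinP; exact: measurable_density0.
apply/(integrable21ltyP _ _ mQ).
have iC := integrable_expR_lapm `|C|%R wlam.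
apply: le_lt_trans (integrable_EFinP iC).2.
apply: ge0_le_integral => //.
- by move=> t _; exact: integral_ge0.
- apply: (@measurable_fun_fubini_tonelli_G _ _ _ _ _ (lebesgue_rV n) (fun z => `|(EFin \o Q) z|)) => //.
  exact: measurableT_comp.
- by apply/measurable_EFinP; apply: measurableT_comp => //; have [] := integrable_EFinP iC.
- by move=> t _; apply: le_trans (qC_norm t) _; rewrite lee_fin ler_norm.
Qed.

(** The functional Q(phi) of the overview, written as one space-time integral so that limits in
    [phi] and further Fubini exchanges need a single integrability statement, that of [Q]. *)
Definition Laplace_pairing (phi : 'rV[R]_n -> R) : R := (\int[m]_z (phi z.1 * Q z))%R.
Local Notation Lam := Laplace_pairing.

Let mfst (phi : 'rV[R]_n -> R) : measurable_fun setT (phi : borel 'rV[R]_n -> measurableTypeR R) ->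
  measurable_fun setT (fun z : TQ => phi z.1).
Proof. by move=> mphi; exact: (measurableT_comp mphi measurable_fst). Qed.

Lemma integrable_pairing (phi : 'rV[R]_n -> R) (M : R) :
  measurable_fun setT (phi : borel 'rV[R]_n -> measurableTypeR R) ->
  (forall x, `|phi x| <= M)%R -> m.-integrable setT (EFin \o (fun z => phi z.1 * Q z)%R).
Proof.
move=> mphi phiM; apply: (@integrable_bndM _ _ _ m (fun z => phi z.1) Q M).
- exact: mfst.
- by move=> z; exact: phiM.
- exact: integrable_density.
Qed.

Lemma Laplace_pairingE (phi : 'rV[R]_n -> R) (M : R) :
  measurable_fun setT (phi : borel 'rV[R]_n -> measurableTypeR R) ->
  (forall x, `|phi x| <= M)%R ->
  Lam phi = (\int[lapm lam]_t \int[lebesgue_rV n]_x (phi x * Q (x, t)))%R.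
Proof. by move=> mphi phiM; rewrite /Lam (Rfubini2 (integrable_pairing mphi phiM)). Qed.

Let v_measurable (phi : 'rV[R]_n -> R) (M : R) :
  measurable_fun setT (phi : borel 'rV[R]_n -> measurableTypeR R) ->
  (forall x, `|phi x| <= M)%R ->
  measurable_fun setT (fun t : measurableTypeR R => \int[lebesgue_rV n]_x (phi x * Q (x, t)))%R.
Proof.
move=> mphi phiM.
by have [] := integrable_EFinP (integrable_Rfubini2 (integrable_pairing mphi phiM)).
Qed.

Let v_bound (phi : 'rV[R]_n -> R) (M t : R) :
  measurable_fun setT (phi : borel 'rV[R]_n -> measurableTypeR R) ->
  (forall x, `|phi x| <= M)%R ->
  (`|\int[lebesgue_rV n]_x (phi x * Q (x, t))| <= M * `|C| * expR (w * `|t|))%R.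
Proof.
move=> mphi phiM; have M0 : (0 <= M)%R by exact: le_trans (phiM 0%R).
have iQ : (lebesgue_rV n).-integrable setT (EFin \o (fun x => M * `|Q (x, t)|)%R).
  apply: integrable_mull; apply/integrableP; split.
    by apply/measurable_EFinP; apply: measurableT_comp => //; exact: msec.
  under eq_integral do rewrite /= normr_id.
  by apply: le_lt_trans (qC_norm t) _; rewrite ltry.
apply: (@le_trans _ _ (\int[lebesgue_rV n]_x (M * `|Q (x, t)|))%R).
  apply: normr_Rintegral_le => //.
    by apply: measurable_funM => //; exact: msec.
  by move=> x; rewrite normrM ler_wpM2r.
rewrite -lee_fin (EFin_Rintegral iQ); under eq_integral do rewrite EFinM.
rewrite ge0_integralZl//; last first.
  by apply/measurable_EFinP; apply: measurableT_comp => //; exact: msec.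
by rewrite -mulrA EFinM lee_wpmul2l ?lee_fin ?qC_norm.
Qed.

Let tested_pos (phi : 'rV[R]_n -> R) t : (0 < t)%R ->
  tested q phi t = (\int[lebesgue_rV n]_x (phi x * Q (x, t)))%R.
Proof.
move=> t0; rewrite /tested leNgt t0/=; apply: eq_Rintegral => x _.
by rewrite /density0/= t0.
Qed.

Let tested0 (phi : 'rV[R]_n -> R) t : (t <= 0)%R -> tested q phi t = phi 0%R.
Proof. by rewrite /tested => ->. Qed.

Lemma measurable_tested (phi : 'rV[R]_n -> R) (M : R) :
  measurable_fun setT (phi : borel 'rV[R]_n -> measurableTypeR R) ->
  (forall x, `|phi x| <= M)%R ->
  measurable_fun setT (tested q phi : measurableTypeR R -> R).
Proof.
move=> mphi phiM.
rewrite (_ : tested q phi = fun t => if (t <= 0)%R then phi 0%R else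
    (\int[lebesgue_rV n]_x (phi x * Q (x, t)))%R); last first.
  apply/funext => t; case: ifPn => [|h]; first exact: tested0.
  by apply: tested_pos; rewrite ltNge.
apply: measurable_fun_ifT => //; last exact: (v_measurable mphi phiM).
exact: measurable_fun_ler.
Qed.

Lemma tested_bound (phi : 'rV[R]_n -> R) (M t : R) :
  measurable_fun setT (phi : borel 'rV[R]_n -> measurableTypeR R) ->
  (forall x, `|phi x| <= M)%R ->
  (`|tested q phi t| <= M * (`|C| + 1) * expR (w * `|t|))%R.
Proof.
move=> mphi phiM; have M0 : (0 <= M)%R by exact: le_trans (phiM 0%R).
have [t0|t0] := ltP 0%R t.
  rewrite tested_pos// (le_trans (v_bound t mphi phiM))// ler_wpM2r ?expR_ge0//.
  by rewrite ler_wpM2l// lerDl.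
rewrite tested0// (le_trans (phiM _))// -mulrA ler_peMr//.
rewrite -[leLHS]mulr1 ler_pM//; first by rewrite lerDr.
by rewrite -expR0 ler_expR mulr_ge0// ltW.
Qed.

Lemma integrable_tested (phi : 'rV[R]_n -> R) (M : R) :
  measurable_fun setT (phi : borel 'rV[R]_n -> measurableTypeR R) ->
  (forall x, `|phi x| <= M)%R -> (lapm lam).-integrable setT (EFin \o tested q phi).
Proof.
move=> mphi phiM; apply: (@integrable_exp_bounded _ w lam wlam _ (M * (`|C| + 1))%R).
  exact: measurable_tested phiM.
by move=> t; exact: tested_bound.
Qed.

Lemma Laplace_tested (phi : 'rV[R]_n -> R) (M : R) :
  measurable_fun setT (phi : borel 'rV[R]_n -> measurableTypeR R) ->
  (forall x, `|phi x| <= M)%R -> (\int[lapm lam]_t tested q phi t = Lam phi)%R.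
Proof.
move=> mphi phiM; rewrite (Laplace_pairingE mphi phiM) /Rintegral; congr fine.
apply: ae_eq_integral => //.
- by apply/measurable_EFinP; exact: measurable_tested phiM.
- by apply/measurable_EFinP; exact: v_measurable phiM.
- by apply: filterS (ae_lapm_gt0 lam) => t t0 _; rewrite tested_pos.
Qed.

Lemma tested_continuous (phi : 'rV[R]_n -> R) t : test_function phi -> (0 < t)%R ->
  {for t, continuous (tested q phi)}.
Proof.
move=> tphi t0; have [+ _] := eqn tphi.
by move/continuous_within_itvcyP => -[+ _]; apply; rewrite in_itv/= andbT.
Qed.

Lemma tested_cvg0 (phi : 'rV[R]_n -> R) : test_function phi ->
  tested q phi t @[t --> 0^'+] --> tested q phi 0.
Proof. by move=> tphi; have [/continuous_within_itvcyP[_ //] _] := eqn tphi. Qed.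

Lemma tensor_equation (g : 'I_n -> R -> R) (A B : 'I_n -> R) :
  (forall i, smooth1 (g i)) -> (forall i y, ~~ (A i <= y <= B i)%R -> g i y = 0%R) ->
  (kap lam * Lam (tensor g) - Lam (laplacian (tensor g)) = tensor g 0%R * (kap lam / lam))%R.
Proof.
move=> sg supp.
have tg := test_function_tensor sg supp.
(* The Laplacian of a tensor product is a finite sum of tensor test functions. The continuity in
   time required of [tested] thus makes the right-hand side of the equation continuous, as the
   fundamental theorem demands. *)
have tgj j : test_function (tensor (derive_at j (derive_at j g))).
  apply: (@test_function_tensor _ _ _ A B).
    by move=> i; apply: smooth1_derive_at; exact: smooth1_derive_at.
  move=> i; have [->|/negbTE ij] := eqVneq i j; last by rewrite /derive_at ij; exact: supp.
  rewrite /derive_at eqxx.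
  by apply: derive1_eq0_outside; apply: derive1_eq0_outside; exact: supp.
have [cg [M gM]] := test_function_bounded tg.
have /choice[N gN] : forall j, exists N, forall x, (`|tensor (derive_at j (derive_at j g)) x| <= N)%R.
  by move=> j; have [_] := test_function_bounded (tgj j).
have cgj j : continuous (tensor (derive_at j (derive_at j g))).
  by have [] := test_function_bounded (tgj j).
have mg := @continuous_borel R 'rV[R]_n _ cg.
have LE := laplacian_tensor sg.
have mL : measurable_fun setT (laplacian (tensor g) : borel 'rV[R]_n -> measurableTypeR R).
  rewrite LE; apply: measurable_sum => j; exact: (@continuous_borel R 'rV[R]_n _ (cgj j)).
have LM x : (`|laplacian (tensor g) x| <= \sum_(j < n) N j)%R.
  by rewrite LE (le_trans (ler_norm_sum _ _ _))// ler_sum.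
pose u := tested q (tensor g).
pose v t := (\int[lebesgue_rV n]_x (laplacian (tensor g) x * Q (x, t)))%R.
have vE t : (0 < t)%R -> v t = (\sum_(j < n) tested q (tensor (derive_at j (derive_at j g))) t)%R.
  move=> t0; have iqt := integrable_density_at t0.
  transitivity (\int[lebesgue_rV n]_x \sum_(j < n) (tensor (derive_at j (derive_at j g)) x * q x t))%R.
    apply: eq_Rintegral => x _; rewrite LE /= mulr_suml; apply: eq_bigr => j _.
    by rewrite /density0/= t0.
  rewrite Rintegral_sum//; first by apply: eq_bigr => j _; rewrite /tested leNgt t0.
  move=> j; apply: (@integrable_bndM _ _ _ (lebesgue_rV n) _ _ (N j)) => //.
  exact: (@continuous_borel R 'rV[R]_n _ (cgj j)).
have cv t : (0 < t)%R -> {for t, continuous v}.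
  move=> t0.
  have h : {for t, continuous (fun s => \sum_(j < n) tested q (tensor (derive_at j (derive_at j g))) s)%R}.
    apply: cvg_big => [|j _]; first exact: add_continuous.
    exact: tested_continuous.
  rewrite /prop_for /continuous_at vE//; apply: cvg_trans h; apply: near_eq_cvg.
  by near=> s; rewrite vE//; near: s; exact: lt_nbhsr.
have iloc := convolution_loc w0 (measurable_tested mg gM) mk (fun t => tested_bound t mg gM) k0 ik.
have convE t : (0 < t)%R -> conv u t = open_convolution u k t.
  move=> t0; rewrite /conv /open_convolution /Rintegral; congr fine.
  have ms : measurable_fun setT (fun s : measurableTypeR R => (t - s)%R : measurableTypeR R).
    exact: measurable_funB.
  have muk : measurable_fun setT (fun s : measurableTypeR R => (u s * k (t - s))%:E).
    apply/measurable_EFinP; apply: measurable_funM; first exact: measurable_tested gM.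
    exact: (measurableT_comp mk ms).
  rewrite integral_itv_bndo_bndc; last exact: measurable_funTS.
  by rewrite integral_itv_obnd_cbnd//; exact: measurable_funTS.
have [_ eqg] := eqn tg.
have dF (t : R) : (0 < t)%R -> is_derive t (1 : R)%R (fun t => beta * u t + open_convolution u k t)%R
    (v t + u 0 * k t)%R.
  move=> t0; have [du dc e] := eqg t t0.
  have dconv : is_derive t (1 : R)%R (open_convolution u k) (derive1 (conv u) t).
    apply: (@near_eq_is_derive _ _ _ (conv u)).
      by near=> s; rewrite convE//; near: s; exact: lt_nbhsr.
    by rewrite derive1E; apply: DeriveDef.
  have dbu : is_derive t (1 : R)%R (fun t => beta * u t)%R (beta * derive1 u t)%R.
    have [->|b0] := eqVneq beta 0%R.
      rewrite mul0r (_ : (fun _ => _) = cst 0%R); first exact: is_derive_cst.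
      by apply/funext => s; rewrite mul0r.
    have dut : is_derive t (1 : R)%R u (derive1 u t).
      by rewrite derive1E; apply: DeriveDef => //; apply: du; exact/eqP.
    by apply: is_derive_eq.
  have -> : (v t + u 0 * k t = beta * derive1 u t + derive1 (conv u) t)%R.
    rewrite /v (_ : (\int[_]_x _)%R = (\int[lebesgue_rV n]_x (laplacian (tensor g) x * q x t))%R).
      by rewrite -e /u subrK.
    by apply: eq_Rintegral => x _; rewrite /density0/= t0.
  exact: is_deriveD.
have := laplace_equation beta0 w0 (measurable_tested mg gM) (v_measurable mL LM) mk
  (fun t => tested_bound t mg gM) (fun t => v_bound t mL LM) k0 ik ck cv (tested_cvg0 tg) dF wlam.
rewrite (Laplace_tested mg gM) -(Laplace_pairingE mL LM) -kapE// => ->.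
by rewrite tested0// (kapE lam0); congr (_ * _)%R; rewrite [RHS]mulrC mulrA mulVf ?mul1r// gt_eqF.
Unshelve. all: by end_near. Qed.

End fixed_lam.

End density.

(** * Gaussian test functions and the heat resolvent *)

Section gaussian_factors.
Context {R : realType}.
Implicit Types (r x y : R).
Local Open Scope ring_scope.

Lemma xexpRN_le1 x : 0 <= x -> x * expR (- x) <= 1.
Proof.
move=> x0; rewrite expRN ler_pdivrMr ?expR_gt0// mul1r.
by apply: le_trans (expR_ge1Dx x); rewrite lerDr.
Qed.

Lemma gaussian01 r x : 0 < r -> 0 <= gaussian r x <= 1.
Proof.
move=> r0; rewrite /gaussian expR_ge0/= expR_le1 oppr_le0.
by rewrite divr_ge0 ?sqr_ge0// mulr_ge0// ltW.
Qed.

Lemma sqr_gaussian_le r x : 0 < r -> x ^+ 2 * gaussian r x <= 4 * r.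
Proof.
move=> r0; have r4 : 0 < 4 * r by rewrite mulr_gt0.
have := @xexpRN_le1 (x ^+ 2 / (4 * r)) _; rewrite divr_ge0 ?sqr_ge0 ?(ltW r4)// => /(_ isT).
by rewrite mulrAC ler_pdivrMr// mul1r.
Qed.

Definition dgaussian r x := - (x / (2 * r)) * gaussian r x.
Definition ddgaussian r x := (x ^+ 2 / (4 * r ^+ 2) - (2 * r)^-1) * gaussian r x.

Lemma is_derive_gaussian r x : is_derive x (1 : R) (gaussian r) (dgaussian r x).
Proof.
have := is_derive_poly_gaussian r 1 x.
rewrite (_ : (fun x => _) = gaussian r); last by apply/funext => y; rewrite hornerC mul1r.
move/is_derive_eq; apply; rewrite /dgaussian derivC mul1r sub0r hornerN hornerZ hornerX.
by congr (_ * _); rewrite mulrC.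
Qed.

Lemma is_derive_dgaussian r x : 0 < r -> is_derive x (1 : R) (dgaussian r) (ddgaussian r x).
Proof.
move=> r0; have := is_derive_poly_gaussian r (- (2 * r)^-1 *: 'X) x.
rewrite (_ : (fun x => _) = dgaussian r); last first.
  by apply/funext => y; rewrite hornerZ hornerX /dgaussian mulNr (mulrC y).
move/is_derive_eq; apply; rewrite /ddgaussian derivZ derivX; congr (_ * _).
rewrite hornerD hornerN !hornerZ hornerM hornerZ !hornerX hornerC.
by field; rewrite gt_eqF.
Qed.

Lemma dgaussian_le r x : 0 < r -> `|dgaussian r x| <= (1 + 4 * r) / (2 * r).
Proof.
move=> r0; have r2 : 0 < 2 * r by rewrite mulr_gt0.
have /andP[g0 g1] := gaussian01 x r0; have h := sqr_gaussian_le x r0.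
rewrite /dgaussian normrM normrN normrM (ger0_norm g0) (gtr0_norm (_ : 0 < (2 * r)^-1)) ?invr_gt0//.
rewrite mulrAC ler_pM2r ?invr_gt0//.
have hx : `|x| <= 1 + x ^+ 2.
  rewrite -real_normK ?num_real//; have := sqr_ge0 (`|x| - 1); rewrite sqrrB1; have := normr_ge0 x; nra.
apply: le_trans (ler_wpM2r g0 hx) _; rewrite mulrDl mul1r; lra.
Qed.

Lemma ddgaussian_le r x : 0 < r -> `|ddgaussian r x| <= r^-1 + (2 * r)^-1.
Proof.
move=> r0; have r2 : 0 < 2 * r by rewrite mulr_gt0.
have /andP[g0 g1] := gaussian01 x r0; have h := sqr_gaussian_le x r0.
rewrite /ddgaussian mulrBl (le_trans (ler_normB _ _))// lerD//.
  have r4 : 0 < 4 * r ^+ 2 by rewrite mulr_gt0// exprn_gt0.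
  rewrite ger0_norm; last by rewrite mulr_ge0// divr_ge0 ?sqr_ge0// (ltW r4).
  rewrite mulrAC ler_pdivrMr//.
  by apply: le_trans h _; rewrite expr2 mulrCA mulKf ?gt_eqF// mulrC.
by rewrite normrM (ger0_norm g0) gtr0_norm ?invr_gt0// ler_piMr// invr_ge0 (ltW r2).
Qed.

Definition bump x := flat (x + 1) * flat (- x + 1).

Lemma smooth1_bump : smooth1 bump.
Proof.
apply: smooth1M.
  rewrite (_ : (fun x => _) = (fun x => flat (1 * x + 1))).
    exact: smooth1_affine smooth1_flat.
  by apply/funext => x; rewrite mul1r.
rewrite (_ : (fun x => _) = (fun x => flat ((-1) * x + 1))).
  exact: smooth1_affine smooth1_flat.
by apply/funext => x; rewrite mulN1r.
Qed.

Lemma bump_out y : ~~ (-1 <= y <= 1) -> bump y = 0.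
Proof.
rewrite negb_and -!ltNge => /orP[h|h]; rewrite /bump.
  by rewrite flat_le0 ?mul0r//; lra.
by rewrite (@flat_le0 _ (- y + 1)) ?mulr0//; lra.
Qed.

Lemma bump0_gt0 : 0 < bump 0.
Proof. by rewrite /bump oppr0 add0r flatE ltr01 mulr_gt0 ?expR_gt0. Qed.

Lemma bounded_support (f : R -> R) (A B : R) : continuous f ->
  (forall y, ~~ (A <= y <= B) -> f y = 0) -> exists M, forall y, `|f y| <= M.
Proof.
move=> cf f0.
have := continuous_compact (continuous_subspaceT cf) (@segment_compact _ A B).
move=> /compact_bounded[M [_ hM]]; exists (`|M| + 1) => y.
have [h|/f0 ->] := boolP (A <= y <= B); last by rewrite normr0 addr_ge0.
apply: hM; first by rewrite (le_lt_trans (ler_norm _))// ltrDl.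
by exists y => //=; rewrite in_itv.
Qed.

End gaussian_factors.

Lemma sqnormN (R : realType) (n : nat) (x : 'rV[R]_n) : sqnorm (- x)%R = sqnorm x.
Proof. by apply: eq_bigr => i _; rewrite mxE sqrrN. Qed.

Lemma heat_kernelN (R : realType) (n : nat) (r : R) (x : 'rV[R]_n) :
  heat_kernel r (- x)%R = heat_kernel r x.
Proof. by rewrite /heat_kernel sqnormN. Qed.

(** * From compactly supported to Gaussian test functions *)

Section cutoff.
Context {R : realType} {n : nat}.
Local Notation TQ := (borel 'rV[R]_n * measurableTypeR R)%type.
Variables (m : {sigma_finite_measure set TQ -> \bar R}) (Q : TQ -> R) (K c : R).
Hypothesis iQ : m.-integrable setT (EFin \o Q).

Let Lam (phi : 'rV[R]_n -> R) : R := (\int[m]_z (phi z.1 * Q z))%R.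

Hypothesis tensor_eq : forall (g : 'I_n -> R -> R) (A B : 'I_n -> R),
  (forall i, smooth1 (g i)) -> (forall i y, ~~ (A i <= y <= B i)%R -> g i y = 0%R) ->
  (K * Lam (tensor g) - Lam (laplacian (tensor g)) = tensor g 0 * c)%R.

Let mfst (phi : 'rV[R]_n -> R) : continuous phi -> measurable_fun setT (fun z : TQ => phi z.1).
Proof.
by move=> cphi; exact: (measurableT_comp (@continuous_borel R 'rV[R]_n _ cphi) measurable_fst).
Qed.

Let Lam_cvg (phi_ : nat -> 'rV[R]_n -> R) (phi : 'rV[R]_n -> R) (M : R) :
  (forall k, continuous (phi_ k)) -> continuous phi ->
  (forall x, phi_ k x @[k --> \oo] --> phi x) -> (forall k x, `|phi_ k x| <= M)%R ->
  Lam (phi_ k) @[k --> \oo] --> Lam phi.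
Proof.
move=> c_ cphi cv M_; have [mQ _] := integrable_EFinP iQ.
apply: (@Rintegral_dct _ _ _ m (fun k z => phi_ k z.1 * Q z)%R _ (fun z => M * `|Q z|)%R).
- by move=> k; apply: measurable_funM => //; exact: mfst.
- by move=> z; apply: cvgMl; exact: cv.
- by apply: integrable_mull; exact: integrable_norm iQ.
- by move=> k z; rewrite normrM ler_wpM2r.
Qed.

(** The summands of the Laplacian in the limit: [g2 i] stands for the second derivative of [g i],
    obtained as a pointwise limit. *)
Let jet (g g2 : 'I_n -> R -> R) (j i : 'I_n) : R -> R := if i == j then g2 i else g i.

Let tM (M : R) (f : 'I_n -> R -> R) x : (forall i y, `|f i y| <= M)%R -> (`|tensor f x| <= M ^+ n)%R.
Proof.
move=> h; rewrite /tensor normr_prod.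
have -> : (M ^+ n = \prod_(i < n) M)%R by rewrite prodr_const card_ord.
by apply: ler_prod => i _; rewrite normr_ge0 h.
Qed.

Let LamZ (phi : 'rV[R]_n -> R) (M a : R) : continuous phi -> (forall x, `|phi x| <= M)%R ->
  Lam (fun x => a * phi x)%R = (a * Lam phi)%R.
Proof.
move=> cphi phiM; rewrite /Lam -RintegralZl//.
  by apply: eq_Rintegral => z _; rewrite mulrA.
exact: (integrable_bndM (mfst cphi) (fun z => phiM z.1) iQ).
Qed.

(** As [Q] is integrable, bounded pointwise convergence of the test functions and of their
    Laplacians is enough. The Laplacian of a tensor product involves the factors and their second
    derivatives only, so first derivatives need no control. *)
Lemma tensor_equation_limit (g_ : nat -> 'I_n -> R -> R) (g g2 : 'I_n -> R -> R)
    (A B : nat -> 'I_n -> R) (M : R) :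
  (forall k i, smooth1 (g_ k i)) ->
  (forall k i y, ~~ (A k i <= y <= B k i)%R -> g_ k i y = 0%R) ->
  (forall i, continuous (g i)) -> (forall i, continuous (g2 i)) ->
  (forall k i y, `|g_ k i y| <= M)%R ->
  (forall k i y, `|derive1 (derive1 (g_ k i)) y| <= M)%R ->
  (forall i y, g_ k i y @[k --> \oo] --> g i y) ->
  (forall i y, derive1 (derive1 (g_ k i)) y @[k --> \oo] --> g2 i y) ->
  (K * Lam (tensor g) - Lam (fun x => \sum_(j < n) tensor (jet g g2 j) x) =
   tensor g 0 * c)%R.
Proof.
move=> sg supp cg cg2 gM g2M gg gg2.
have sg2 k j i : smooth1 (derive_at j (derive_at j (g_ k)) i).
  by apply: smooth1_derive_at => {}i; exact: smooth1_derive_at.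
have dE k j i y : derive_at j (derive_at j (g_ k)) i y =
    (if i == j then derive1 (derive1 (g_ k i)) y else g_ k i y).
  by rewrite /derive_at; case: eqVneq.
have tcvg (f_ : nat -> 'I_n -> R -> R) (f : 'I_n -> R -> R) x :
    (forall i y, f_ k i y @[k --> \oo] --> f i y) -> tensor (f_ k) x @[k --> \oo] --> tensor f x.
  move=> h; rewrite /tensor; apply: cvg_big => [|i _]; last exact: h.
  by move=> z; exact: mul_continuous.
have h1 : Lam (tensor (g_ k)) @[k --> \oo] --> Lam (tensor g).
  apply: (@Lam_cvg _ _ (M ^+ n)%R).
  - by move=> k; apply: continuous_tensor => i; exact: smooth1_continuous.
  - exact: continuous_tensor.
  - by move=> x; exact: tcvg.
  - by move=> k x; apply: tM.
have h2 : Lam (laplacian (tensor (g_ k))) @[k --> \oo] --> Lam (fun x => \sum_(j < n) tensor (jet g g2 j) x)%R.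
  rewrite (_ : (fun k => _) = (fun k => Lam (fun x => \sum_(j < n) tensor (derive_at j (derive_at j (g_ k))) x)%R)); last first.
    by apply/funext => k; rewrite (laplacian_tensor (sg k)).
  apply: (@Lam_cvg _ _ (\sum_(j < n) M ^+ n)%R).
  - move=> k; apply: continuous_big => [y|j _]; first exact: add_continuous.
    by apply: continuous_tensor => i; exact: smooth1_continuous.
  - apply: continuous_big => [y|j _]; first exact: add_continuous.
    by apply: continuous_tensor => i; rewrite /jet; case: ifP.
  - move=> x; apply: cvg_big => [|j _]; first exact: add_continuous.
    apply: tcvg => i y; rewrite (_ : (fun k => _) = (fun k => if i == j then derive1 (derive1 (g_ k i)) y else g_ k i y)).
      by rewrite /jet; case: ifP => _; [exact: gg2|exact: gg].
    by apply/funext => k; rewrite dE.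
  - move=> k x; rewrite (le_trans (ler_norm_sum _ _ _))// ler_sum// => j _.
    by apply: tM => i y; rewrite dE; case: ifP.
have h3 : (tensor (g_ k) 0 * c)%R @[k --> \oo] --> (tensor g 0 * c)%R.
  by apply: cvgMl; exact: tcvg.
have h4 : (K * Lam (tensor (g_ k)) - Lam (laplacian (tensor (g_ k))))%R @[k --> \oo] -->
    (K * Lam (tensor g) - Lam (fun x => \sum_(j < n) tensor (jet g g2 j) x))%R.
  by apply: cvgB => //; exact: cvgMr.
apply: (cvg_unique _ h4) => //; rewrite (_ : (fun k => _) = (fun k => tensor (g_ k) 0 * c)%R)//.
by apply/funext => k; rewrite (tensor_eq (sg k) (supp k)).
Qed.

(** The common value of the Laplacian of the heat kernel in [x] and of its derivative in [r]; the
    former is obtained through the cutoffs, the latter in [is_derive_heat_kernel]. *)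
Definition dheat_kernel (r : R) (x : 'rV[R]_n) : R :=
  ((sqnorm x / (4 * r ^+ 2) - n%:R / (2 * r)) * heat_kernel r x)%R.

Let tensor_gaussian (r : R) (x : 'rV[R]_n) :
  heat_kernel r x = ((4 * pi * r) `^ (- (n%:R / 2)) * \prod_(i < n) gaussian r (x ord0 i))%R.
Proof.
rewrite /heat_kernel; congr (_ * _)%R; rewrite /sqnorm mulr_suml -sumrN expR_sum.
by apply: eq_bigr.
Qed.

(** Each Gaussian factor is multiplied by the stretched cutoff bump(x / (k+1)). Every derivative
    falling on the cutoff brings a factor 1/(k+1), so in the limit only the derivatives of the
    Gaussian survive, multiplied by [bump 0]. *)
Lemma gaussian_equation (r : R) (y : 'rV[R]_n) : (0 < r)%R ->
  (K * Lam (fun x => heat_kernel r (x - y)) - Lam (fun x => dheat_kernel r (x - y)) =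
   heat_kernel r y * c)%R.
Proof.
move=> r0.
have [b1 sb1] := smooth1_derive (@smooth1_bump R).
have [b2 sb2] := smooth1_derive sb1.
pose b' := derive1 (@bump R); pose b'' := derive1 b'.
have [M0 bM0] := bounded_support (smooth1_continuous (@smooth1_bump R)) (@bump_out R).
have b'out := derive1_eq0_outside (@bump_out R).
have [M1 bM1] := bounded_support (smooth1_continuous sb1) b'out.
have [M2 bM2] := bounded_support (smooth1_continuous sb2) (derive1_eq0_outside b'out).
pose e (k : nat) : R := (k.+1%:R^-1)%R.
have e0 k : (0 < e k)%R by rewrite invr_gt0.
have e1 k : (e k <= 1)%R by rewrite invf_le1// ler1n.
pose g_ k i x := (bump (e k * x) * gaussian r (x - y ord0 i))%R.
pose g i x := (bump 0 * gaussian r (x - y ord0 i))%R.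
pose g2 i x := (bump 0 * ddgaussian r (x - y ord0 i))%R.
pose N1 : R := ((1 + 4 * r) / (2 * r))%R; pose N2 : R := (r^-1 + (2 * r)^-1)%R.
pose d1 k i x := (e k * b' (e k * x) * gaussian r (x - y ord0 i) + bump (e k * x) * dgaussian r (x - y ord0 i))%R.
pose d2 k i x := (e k ^+ 2 * b'' (e k * x) * gaussian r (x - y ord0 i) +
   2 * e k * b' (e k * x) * dgaussian r (x - y ord0 i) +
   bump (e k * x) * ddgaussian r (x - y ord0 i))%R.
have sg k i : smooth1 (g_ k i).
  apply: smooth1M.
    rewrite (_ : (fun x => _) = (fun x => bump (e k * x + 0))%R).
      exact: smooth1_affine (@smooth1_bump R).
    by apply/funext => x; rewrite addr0.
  rewrite (_ : (fun x => _) = (fun x => gaussian r (1 * x + - y ord0 i))%R).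
    exact: smooth1_affine (smooth1_gaussian r).
  by apply/funext => x; rewrite mul1r.
have daff (f f' : R -> R) (a b x : R) : (forall x, is_derive x (1 : R)%R f (f' x)) ->
    is_derive x (1 : R)%R (fun x => f (a * x + b))%R (a * f' (a * x + b))%R.
  move=> h; have ha : is_derive x (1 : R)%R (fun x => a * x + b)%R a.
    by apply: is_derive_eq; rewrite addr0 /GRing.scale/= mulr1.
  by have := @is_derive1_comp _ f (fun x => a * x + b)%R x _ _ (h _) ha; rewrite mulrC.
have dshift (f f' : R -> R) (b x : R) : (forall x, is_derive x (1 : R)%R f (f' x)) ->
    is_derive x (1 : R)%R (fun x => f (x - b))%R (f' (x - b))%R.
  move=> /(daff _ _ 1%R (- b)%R x); rewrite !mul1r; congr is_derive.
  by apply/funext => z; rewrite mul1r.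
have dscale (f f' : R -> R) (a x : R) : (forall x, is_derive x (1 : R)%R f (f' x)) ->
    is_derive x (1 : R)%R (fun x => f (a * x))%R (a * f' (a * x))%R.
  move=> /(daff _ _ a 0%R x); rewrite !addr0; congr is_derive.
  by apply/funext => z; rewrite addr0.
have gd1 k i : derive1 (g_ k i) = d1 k i.
  apply/funext => x; rewrite derive1E.
  have ha := dscale _ _ (e k) x b1.
  have hb := dshift _ _ (y ord0 i) x (is_derive_gaussian r).
  have -> := @derive_val _ _ _ _ _ _ _ (is_deriveM ha hb).
  by rewrite /d1 /b' /GRing.scale/=; ring.
have gd2 k i : derive1 (derive1 (g_ k i)) = d2 k i.
  rewrite gd1; apply/funext => x; rewrite derive1E.
  have ha := dscale _ _ (e k) x b1.
  have ha' := dscale _ _ (e k) x b2.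
  have hb := dshift _ _ (y ord0 i) x (is_derive_gaussian r).
  have hb' := dshift _ _ (y ord0 i) x (fun x => is_derive_dgaussian x r0).
  have hs : is_derive x (1 : R)%R (fun x => e k * b' (e k * x))%R (e k * (e k * b'' (e k * x)))%R.
    by apply: is_derive_eq.
  have -> := @derive_val _ _ _ _ _ _ _ (is_deriveD (is_deriveM hs hb) (is_deriveM ha hb')).
  by rewrite /d2 /b'' /b' /GRing.scale/=; ring.
have M0p : (0 <= M0)%R := le_trans (normr_ge0 _) (bM0 0%R).
have M1p : (0 <= M1)%R := le_trans (normr_ge0 _) (bM1 0%R).
have M2p : (0 <= M2)%R := le_trans (normr_ge0 _) (bM2 0%R).
have N1p : (0 <= N1)%R := le_trans (normr_ge0 _) (dgaussian_le 0%R r0).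
have N2p : (0 <= N2)%R := le_trans (normr_ge0 _) (ddgaussian_le 0%R r0).
have Tp : (0 <= M2 + 2 * M1 * N1 + M0 * N2)%R.
  by apply: addr_ge0; [apply: addr_ge0 => //; apply: mulr_ge0 => //; exact: mulr_ge0|exact: mulr_ge0].
have gauss1 x : (`|gaussian r x| <= 1)%R.
  by have /andP[h1 h2] := gaussian01 x r0; rewrite ger0_norm.
have ce : e k @[k --> \oo] --> (0 : R)%R by exact: cvg_harmonic.
have cs x : (e k * x)%R @[k --> \oo] --> (0 : R)%R.
  by rewrite -(mul0r x); exact: cvgMl.
have c0 x : bump (e k * x)%R @[k --> \oo] --> (bump 0 : R)%R.
  exact: (cvg_comp (fun k => e k * x)%R (@bump R) (cs x) (smooth1_continuous (@smooth1_bump R) (x := 0%R))).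
have c1 x : b' (e k * x)%R @[k --> \oo] --> (b' 0 : R)%R.
  exact: (cvg_comp (fun k => e k * x)%R b' (cs x) (smooth1_continuous sb1 (x := 0%R))).
have c2 x : b'' (e k * x)%R @[k --> \oo] --> (b'' 0 : R)%R.
  exact: (cvg_comp (fun k => e k * x)%R b'' (cs x) (smooth1_continuous sb2 (x := 0%R))).
have cgauss : continuous (gaussian r) := smooth1_continuous (smooth1_gaussian r).
have cddgauss : continuous (ddgaussian r).
  move=> x; apply: cvgM; last exact: cgauss.
  apply: cvgB; last exact: cvg_cst.
  by apply: cvgMl; exact: exprn_continuous.
have csub (f : R -> R) (b : R) : continuous f -> continuous (fun x => bump 0 * f (x - b))%R.
  move=> cf x; apply: cvgMr.
  apply: (@continuous_comp _ _ _ (fun x => x - b)%R f); last exact: cf.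
  by apply: cvgB; [exact: cvg_id|exact: cvg_cst].
have := @tensor_equation_limit g_ g g2 (fun k _ => - k.+1%:R)%R (fun k _ => k.+1%:R)
  (M0 + (M2 + 2 * M1 * N1 + M0 * N2))%R sg _ (fun i => csub _ _ cgauss) (fun i => csub _ _ cddgauss).
move=> /(_ _)/wrap[].
  move=> k i z hz; rewrite /g_ bump_out ?mul0r//; apply: contra hz.
  by rewrite /e (mulrC _ z) ler_pdivrMr// ler_pdivlMr// mulN1r mul1r.
move=> /(_ _)/wrap[].
  move=> k i z; rewrite /g_ normrM (@le_trans _ _ M0)//; last by rewrite lerDl.
  by rewrite -[leRHS]mulr1 ler_pM.
move=> /(_ _)/wrap[].
  move=> k i z; rewrite gd2 (@le_trans _ _ (M2 + 2 * M1 * N1 + M0 * N2))%R//; last by rewrite lerDr.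
  rewrite /d2 (le_trans (ler_normD _ _))// lerD//; last first.
    by rewrite normrM ler_pM// ddgaussian_le.
  rewrite (le_trans (ler_normD _ _))// lerD//.
    rewrite normrM -[leRHS]mulr1 ler_pM// normrM -[leRHS]mul1r ler_pM//.
    by rewrite normrX expr_le1// gtr0_norm.
  rewrite normrM ler_pM// ?dgaussian_le// normrM ler_pM//.
  by rewrite normrM gtr0_norm// gtr0_norm// ler_piMr.
move=> /(_ _)/wrap[].
  by move=> i z; apply: cvgMl; exact: c0.
move=> /(_ _)/wrap[].
  move=> i z; rewrite (_ : (fun k => _) = fun k => d2 k i z); last by apply/funext => k; rewrite gd2.
  rewrite -[X in _ --> X]add0r; apply: cvgD; last by apply: cvgMl; exact: c0.
  rewrite -[X in _ --> X]addr0; apply: cvgD.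
    rewrite -(mul0r (gaussian r (z - y ord0 i))); apply: cvgMl.
    rewrite -(mul0r (b'' 0%R)); apply: cvgM; last exact: c2.
    by rewrite -(mulr0 (0 : R)%R); exact: (cvgM ce ce).
  rewrite -(mul0r (dgaussian r (z - y ord0 i))); apply: cvgMl.
  rewrite -(mul0r (b' 0%R)); apply: cvgM; last exact: c1.
  by rewrite -(mulr0 (2 : R)%R); exact: (cvgMr ce).
(* This constant restores the normalisation of the heat kernel and removes the n factors [bump 0]
   left by the cutoff. *)
pose a := ((4 * pi * r) `^ (- (n%:R / 2)) / bump 0 ^+ n)%R.
have bn0 : (bump (0 : R) ^+ n != 0)%R by rewrite expf_neq0// gt_eqF// bump0_gt0.
have tE x : heat_kernel r (x - y) = (a * tensor g x)%R.
  rewrite tensor_gaussian /a -[RHS]mulrA; congr (_ * _)%R.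
  rewrite /tensor /g big_split/= prodr_const card_ord mulKf//.
  by apply: eq_bigr => i _; rewrite !mxE.
have jE x j : tensor (jet g g2 j) x =
    (((x ord0 j - y ord0 j) ^+ 2 / (4 * r ^+ 2) - (2 * r)^-1) * tensor g x)%R.
  rewrite /tensor (bigD1 j)//= [in RHS](bigD1 j)//= /jet eqxx mulrA; congr (_ * _)%R.
    by rewrite /g2 /g /ddgaussian mulrCA.
  by apply: eq_bigr => i /negbTE ->.
have sE x : dheat_kernel r (x - y) = (a * \sum_(j < n) tensor (jet g g2 j) x)%R.
  rewrite /dheat_kernel tE mulrCA; congr (_ * _)%R.
  under eq_bigr do rewrite jE.
  rewrite -mulr_suml sumrB -mulr_suml sumr_const card_ord; congr ((_ / _ - _) * _)%R.
    by apply: eq_bigr => i _; rewrite !mxE.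
  by rewrite mulr_natl.
have bump0M : (`|bump 0| <= M0)%R by exact: bM0.
have cg : continuous (tensor g) by apply: continuous_tensor => i; exact: csub.
have cj : continuous (fun x => \sum_(j < n) tensor (jet g g2 j) x)%R.
  apply: continuous_big => [z|j _]; first exact: add_continuous.
  by apply: continuous_tensor => i; rewrite /jet; case: ifP => _; exact: csub.
have gM x : (`|tensor g x| <= M0 ^+ n)%R.
  by apply: tM => i z; rewrite normrM -[leRHS]mulr1 ler_pM.
have jM x : (`|\sum_(j < n) tensor (jet g g2 j) x| <= \sum_(j < n) (M0 + M0 * N2) ^+ n)%R.
  rewrite (le_trans (ler_norm_sum _ _ _))// ler_sum// => j _; apply: tM => i z.
  rewrite /jet; case: ifP => _; rewrite normrM.
    apply: (@le_trans _ _ (M0 * N2)%R); last by rewrite lerDr.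
    by rewrite ler_pM// ddgaussian_le.
  apply: (@le_trans _ _ (M0 * 1)%R); last by rewrite mulr1 lerDl mulr_ge0.
  by rewrite ler_pM.
move=> h.
have -> : heat_kernel r y = (a * tensor g 0)%R.
  by rewrite -[RHS]tE sub0r heat_kernelN.
rewrite (_ : (fun x => heat_kernel _ _) = fun x => a * tensor g x)%R; last exact/funext.
rewrite (_ : (fun x => dheat_kernel _ _) = fun x => a * \sum_(j < n) tensor (jet g g2 j) x)%R; last exact/funext.
by rewrite (LamZ _ cg gM) (LamZ _ cj jM) mulrCA -mulrBr h mulrA.
Qed.

End cutoff.

Lemma measurable_inv (R : realType) : measurable_fun setT (fun x : R => x^-1%R).
Proof.
rewrite -(setUv [set 0%R : R]); apply/measurable_funU => //; first exact: measurableC.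
split; first exact: measurable_fun_set1.
apply: open_continuous_measurable_fun.
  by rewrite openC; apply: accessible_closed_set1; apply: hausdorff_accessible; exact: Rhausdorff.
by move=> x; rewrite inE/= => /eqP x0; exact: inv_continuous.
Qed.

Lemma expRN_cvg0 (R : realType) (K : R) (y : R^nat) : (0 < K)%R ->
  y k @[k --> \oo] --> +oo%R -> expR (- (K * y k))%R @[k --> \oo] --> (0 : R)%R.
Proof.
move=> K0 cy; apply/cvgr0Pnorm_lt => e e0; near=> k.
rewrite ger0_norm ?expR_ge0// -[ltRHS]lnK ?posrE// ltr_expR ltrNl -ltr_pdivrMl//.
by near: k; move/cvgryPgt : cy; apply.
Unshelve. all: by end_near. Qed.

(** * The heat kernel as a function of its time parameter *)

Section heat_time.
Context {R : realType} {n : nat}.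
Implicit Types (r : R) (x : 'rV[R]_n).
Local Open Scope ring_scope.

Lemma sqnorm_ge0 x : 0 <= sqnorm x.
Proof. by apply: sumr_ge0 => i _; exact: sqr_ge0. Qed.

Let a : R := (n%:R / 2).

Let a0 : 0 <= a. Proof. by rewrite divr_ge0. Qed.

Let heatE r x : 0 < r -> heat_kernel r x = expR (- a * ln (4 * pi * r) + - (sqnorm x * (4 * r)^-1)).
Proof.
move=> r0; have h : 0 < 4 * pi * r by rewrite !mulr_gt0// pi_gt0.
by rewrite expRD /heat_kernel /powR gt_eqF.
Qed.

Lemma is_derive_heat_kernel r x : 0 < r ->
  is_derive r (1 : R) (fun r => heat_kernel r x) (dheat_kernel r x).
Proof.
move=> r0; have h : 0 < 4 * pi * r by rewrite !mulr_gt0// pi_gt0.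
apply: (@near_eq_is_derive _ _ _ (fun r => expR (- a * ln (4 * pi * r) + - (sqnorm x * (4 * r)^-1)))).
  by near=> s; rewrite heatE//; near: s; exact: lt_nbhsr.
have d4 : is_derive r (1 : R) (fun r : R => 4 * r) 4.
  by apply: is_derive_eq; rewrite /GRing.scale/= mulr1.
have d4p : is_derive r (1 : R) (fun r : R => 4 * pi * r) (4 * pi).
  by apply: is_derive_eq; rewrite /GRing.scale/= mulr1.
have dl := @is_derive1_comp _ (@ln R) (fun r : R => 4 * pi * r) r _ _ (is_derive1_ln h) d4p.
have n4 : 4 * r != 0 by rewrite gt_eqF// mulr_gt0.
have dV := @is_deriveV _ (fun r : R => 4 * r) r 4 1 n4 d4.
have dE : is_derive r (1 : R) (fun r : R => - a * ln (4 * pi * r) + - (sqnorm x * (4 * r)^-1))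
    (sqnorm x / (4 * r ^+ 2) - n%:R / (2 * r)).
  have dl' : is_derive r (1 : R) (fun r : R => ln (4 * pi * r)) ((4 * pi * r)^-1 * (4 * pi)) := dl.
  have dm := is_deriveZ (- a) dl'.
  have ds := is_deriveZ (sqnorm x) dV.
  have := is_deriveD dm (is_deriveN ds).
  move/is_derive_eq; apply; rewrite /GRing.scale/= /a.
  have -> : (4 * pi * r)^-1 * (4 * pi) = r^-1.
    by rewrite invfM mulrAC mulVf ?mul1r// gt_eqF// mulr_gt0// pi_gt0.
  by field; rewrite gt_eqF.
have := @is_derive1_comp _ expR _ r _ _ (is_derive_expR _) dE.
move/is_derive_eq; apply; rewrite /dheat_kernel heatE//.
by rewrite mulrC.
Unshelve. all: by end_near. Qed.

(** The value of the heat kernel at the origin, its maximum over space; being nonincreasing in [r],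
    it bounds the kernels at all later times. *)
Definition heat_max r : R := (4 * pi * r) `^ (- a).

Lemma heat_max_ge0 r : 0 <= heat_max r. Proof. exact: powR_ge0. Qed.

Lemma heat_max_le r s : 0 < r -> r <= s -> heat_max s <= heat_max r.
Proof.
move=> r0 rs; have s0 := lt_le_trans r0 rs; rewrite /heat_max !powRN.
have h : 0 < 4 * pi * r by rewrite !mulr_gt0// pi_gt0.
have h' : 0 < 4 * pi * s by rewrite !mulr_gt0// pi_gt0.
rewrite lef_pV2 ?posrE ?powR_gt0//; apply: ge0_ler_powR => //; rewrite ?nnegrE ?(ltW h) ?(ltW h')//.
by rewrite ler_pM2l// mulr_gt0// pi_gt0.
Qed.

Lemma heat_kernel_le r s x : 0 < r -> r <= s -> `|heat_kernel s x| <= heat_max r.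
Proof.
move=> r0 rs; have s0 := lt_le_trans r0 rs.
rewrite (ger0_norm (heat_kernel_ge0 _ _)); apply: le_trans (heat_max_le r0 rs).
rewrite /heat_kernel ler_piMr ?powR_ge0// expR_le1 oppr_le0 divr_ge0 ?sqnorm_ge0//.
by rewrite mulr_ge0// ltW.
Qed.

(** With $z = |x|^2/(4r)$ the derivative is [heat_max r / r] times $(z - n/2)e^{-z}$, and $z e^{-z}
    \le 1$ gives the factor 1 + n/2. *)
Definition dheat_max r : R := (1 + a) / r * heat_max r.

Lemma dheat_kernel_le r s x : 0 < r -> r <= s -> `|dheat_kernel s x| <= dheat_max r.
Proof.
move=> r0 rs; have s0 := lt_le_trans r0 rs.
have s4 : 0 < 4 * s by rewrite mulr_gt0.
have is_ir : s^-1 <= r^-1 by rewrite lef_pV2.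
have z0 : 0 <= sqnorm x / (4 * s) by rewrite divr_ge0 ?sqnorm_ge0// ltW.
have := xexpRN_le1 z0; set z := sqnorm x / (4 * s) => hz.
have e1 : expR (- z) <= 1 by rewrite expR_le1 oppr_le0.
have e0 := expR_ge0 (- z).
have -> : dheat_kernel s x = s^-1 * heat_max s * (z * expR (- z) - a * expR (- z)).
  rewrite /dheat_kernel /heat_kernel -/(heat_max s) -/z /a /z.
  by field; rewrite gt_eqF.
rewrite normrM ger0_norm ?mulr_ge0 ?invr_ge0 ?(ltW s0) ?heat_max_ge0//.
have -> : dheat_max r = r^-1 * heat_max r * (1 + a) by rewrite /dheat_max; ring.
apply: ler_pM => //.
- by rewrite mulr_ge0 ?heat_max_ge0// invr_ge0 ltW.
- by apply: ler_pM; rewrite ?heat_max_ge0 ?heat_max_le// invr_ge0 ltW.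
- rewrite (le_trans (ler_normB _ _))// lerD//; first by rewrite ger0_norm// mulr_ge0.
  by rewrite ger0_norm ?mulr_ge0// ler_piMr.
Qed.

End heat_time.

(** * Integration of the Gaussian equation over the heat time *)

Section heat_resolvent.
Context {R : realType} {n : nat}.
Local Notation TQ := (borel 'rV[R]_n * measurableTypeR R)%type.
Variables (K r0 : R).
Hypotheses (K0 : (0 < K)%R) (r00 : (0 < r0)%R).

(** The bounds on the kernels are uniform only away from r = 0, hence a cut at [r0], which is sent
    to 0 at the very end. *)
Let after (r : R) : R := \1_(`[r0, +oo[%classic : set R) r.

Lemma measurable_heat_pair : measurable_fun setT
  (fun z : (borel 'rV[R]_n * measurableTypeR R)%type => heat_kernel z.2 z.1 : measurableTypeR R).
Proof.
have m1 : measurable_fun setT (fun z : TQ => sqnorm z.1 : measurableTypeR R).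
  exact: (measurableT_comp (@continuous_borel R 'rV[R]_n _ (@continuous_sqnorm R n)) measurable_fst).
have m2 : measurable_fun setT (fun z : TQ => z.2) := measurable_snd.
apply: measurable_funM.
  apply: (measurableT_comp (measurable_powR _)).
  by apply: measurable_funM => //; exact: measurable_cst.
apply: measurableT_comp => //; apply: measurableT_comp => //.
apply: measurable_funM => //; apply: (measurableT_comp (@measurable_inv R)).
by apply: measurable_funM => //; exact: measurable_cst.
Qed.

Let measurable_dheat_pair : measurable_fun setT
  (fun z : (borel 'rV[R]_n * measurableTypeR R)%type => dheat_kernel z.2 z.1 : measurableTypeR R).
Proof.
have m1 : measurable_fun setT (fun z : TQ => sqnorm z.1 : measurableTypeR R).
  exact: (measurableT_comp (@continuous_borel R 'rV[R]_n _ (@continuous_sqnorm R n)) measurable_fst).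
have m2 : measurable_fun setT (fun z : TQ => z.2) := measurable_snd.
apply: measurable_funM; last exact: measurable_heat_pair.
apply: measurable_funB; apply: measurable_funM => //; apply: (measurableT_comp (@measurable_inv R)).
  by apply: measurable_funM => //; apply: measurable_funX.
by apply: measurable_funM => //; exact: measurable_cst.
Qed.

Let mheat (x : 'rV[R]_n) :
  measurable_fun setT (fun r : measurableTypeR R => heat_kernel r x : measurableTypeR R).
Proof. exact: (measurableT_comp measurable_heat_pair (measurable_pair1 (x : borel 'rV[R]_n))). Qed.

Let mdheat (x : 'rV[R]_n) :
  measurable_fun setT (fun r : measurableTypeR R => dheat_kernel r x : measurableTypeR R).
Proof. exact: (measurableT_comp measurable_dheat_pair (measurable_pair1 (x : borel 'rV[R]_n))). Qed.

Let mkern (x : 'rV[R]_n) :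
  measurable_fun setT (fun r : measurableTypeR R => dheat_kernel r x - K * heat_kernel r x : measurableTypeR R)%R.
Proof.
apply: measurable_funB; first exact: mdheat.
by apply: measurable_funM => //; exact: mheat.
Qed.

Let after_pos r : after r != 0%R -> (r0 <= r)%R.
Proof. by rewrite /after indicE mem_setE in_itv/= andbT; case: leP => //; rewrite eqxx. Qed.

Let after01 r : (0 <= after r <= 1)%R.
Proof. by rewrite /after indicE; case: (_ \in _); rewrite ?lexx ?ler01. Qed.

Let kern (r : R) (x : 'rV[R]_n) : R := (after r * (dheat_kernel r x - K * heat_kernel r x))%R.

Let kern_le r x : (`|kern r x| <= dheat_max (n := n) r0 + K * heat_max (n := n) r0)%R.
Proof.
have b0 : (0 <= dheat_max (n := n) r0 + K * heat_max (n := n) r0)%R.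
  apply: addr_ge0; last by rewrite mulr_ge0 ?heat_max_ge0// ltW.
  exact: le_trans (dheat_kernel_le (0%R : 'rV[R]_n) r00 (lexx _)).
rewrite /kern; have [->|/after_pos h] := eqVneq (after r) 0%R; first by rewrite mul0r normr0.
have /andP[a0 a1] := after01 r.
rewrite normrM (ger0_norm a0) (le_trans (ler_piMl (normr_ge0 _) a1))//.
rewrite (le_trans (ler_normB _ _))// lerD ?dheat_kernel_le// normrM (gtr0_norm K0).
by rewrite ler_wpM2l ?heat_kernel_le// ltW.
Qed.

Let lapK_fin : lapm K setT < +oo := lapmT_fin K0.

(** With its weight exp(- K r), the integrand is the derivative of exp(- K r) times the heat kernel,
    which vanishes at infinity; only the value at [r0] remains. *)
Lemma heat_resolvent (x : 'rV[R]_n) :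
  (\int[lapm K]_r kern r x = - (expR (- (K * r0)) * heat_kernel r0 x))%R.
Proof.
pose f r : R := (dheat_kernel r x - K * heat_kernel r x)%R.
pose G r : R := (expR (- (K * r)) * heat_kernel r x)%R.
have mf : measurable_fun setT (f : measurableTypeR R -> R) by exact: mkern.
have dG (r : R) : (0 < r)%R -> is_derive r (1 : R)%R G (f r * expR (- (K * r)))%R.
  move=> rp; have dh := is_derive_heat_kernel x rp.
  have e : is_derive r (1 : R)%R (fun t : R => expR (- (K * t)))%R (- K * expR (- (K * r)))%R.
    apply: is_derive_eq; rewrite /GRing.scale/=; ring.
  apply: is_derive_eq; rewrite /f /GRing.scale/=; ring.
have ch (r : R) : (0 < r)%R -> {for r, continuous (fun r => heat_kernel r x)}.
  move=> rp; apply/differentiable_continuous/derivable1_diffP.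
  by have [] := is_derive_heat_kernel x rp.
have cf (r : R) : (0 < r)%R -> {for r, continuous f}.
  move=> rp; apply: cvgB; last by apply: cvgMr; exact: ch.
  apply: cvgM; last exact: ch.
  apply: cvgB; apply: cvgMr; apply: cvgV; rewrite ?gt_eqF// ?mulr_gt0 ?exprn_gt0//.
    by apply: cvgMr; exact: exprn_continuous.
  by apply: cvgMr; exact: cvg_id.
pose y_ (k : nat) : R := (r0 + k.+1%:R)%R.
have cy : y_ k @[k --> \oo] --> +oo%R.
  apply/cvgryPgt => A; have := @cvgr_idn R; rewrite -[X in X -> _]cvg_shiftS => /cvgryPgt/(_ A).
  by apply: filterS => k hk; apply: lt_le_trans hk _; rewrite lerDr ltW.
have h1 : (\int[lapm K]_r (\1_(`[r0, y_ k]%classic : set R) r * f r))%R @[k --> \oo] --> (\int[lapm K]_r kern r x)%R.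
  apply: (@Rintegral_dct _ (measurableTypeR R) R (lapm K) _ _ (fun=> dheat_max (n := n) r0 + K * heat_max (n := n) r0)%R).
  - by move=> k; apply: measurable_funM => //; exact: measurable_indic.
  - move=> r; apply: cvg_near_cst; near=> k; rewrite /kern /after !indicE !mem_setE !in_itv/= andbT.
    rewrite (_ : (r <= y_ k)%R = true) ?andbT//; apply/ltW; near: k.
    by move/cvgryPgt : cy; apply.
  - by apply: (@bounded_integrable _ _ _ (lapm K) _ `|dheat_max (n := n) r0 + K * heat_max (n := n) r0|%R).
  - move=> k r; apply: le_trans (kern_le r x); rewrite /kern !normrM ler_wpM2r//.
    rewrite /after !indicE !mem_setE !in_itv/= andbT.
    by case: (r0 <= r)%R => //=; case: (r <= _)%R; rewrite ?normr1 ?normr0.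
have h2 : (G (y_ k) - G r0)%R @[k --> \oo] --> (- (expR (- (K * r0)) * heat_kernel r0 x))%R.
  rewrite -[X in _ --> X]add0r; apply: cvgB; last exact: cvg_cst.
  apply: (@squeeze_cvgr _ _ _ _ (fun=> 0%R) (fun k => expR (- (K * y_ k)) * heat_max (n := n) r0)%R).
  - apply: nearW => k; rewrite /G mulr_ge0 ?expR_ge0 ?heat_kernel_ge0//= ler_wpM2l ?expR_ge0//.
    by rewrite (le_trans (ler_norm _))// heat_kernel_le// /y_ lerDl.
  - exact: cvg_cst.
  - rewrite -(mul0r (heat_max (n := n) r0)); apply: cvgMl; exact: expRN_cvg0.
apply: (cvg_unique _ h1) => //.
rewrite (_ : (fun k => _) = (fun k => G (y_ k) - G r0)%R)//.
by apply/funext => k; apply: lapm_FTC2 => //; rewrite /y_ ltrDl.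
Unshelve. all: by end_near. Qed.

Variables (m : {sigma_finite_measure set TQ -> \bar R}) (Q : TQ -> R) (c : R).
Hypothesis iQ : m.-integrable setT (EFin \o Q).

Let Lam (phi : 'rV[R]_n -> R) : R := (\int[m]_z (phi z.1 * Q z))%R.

Hypothesis gauss_eq : forall (r : R) (y : 'rV[R]_n), (0 < r)%R ->
  (K * Lam (fun x => heat_kernel r (x - y)) - Lam (fun x => dheat_kernel r (x - y)) =
   heat_kernel r y * c)%R.

Let msub (y : 'rV[R]_n) : measurable_fun setT (fun z : TQ => (z.1 - y)%R : borel 'rV[R]_n).
Proof.
apply: measurable_rV => j; under eq_fun do rewrite !mxE.
by apply: measurable_funB => //; exact: (measurableT_comp (measurable_coord j) measurable_fst).
Qed.

(* The equation for Gaussian test functions reads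
   - d/dr (exp(- K r) Lam (heat_kernel r)) = c exp(- K r) heat_kernel r, and is
   integrated over r >= r0. *)
Lemma pairing_resolvent (y : 'rV[R]_n) :
  (expR (- (K * r0)) * Lam (fun x => heat_kernel r0 (x - y)) =
   c * \int[lapm K]_r (after r * heat_kernel r y))%R.
Proof.
pose D : R := (dheat_max (n := n) r0 + K * heat_max (n := n) r0)%R.
pose k (z : TQ * measurableTypeR R) : R := kern z.2 (z.1.1 - y)%R.
have iD : (lapm K).-integrable setT (EFin \o (fun _ : R => D)).
  by apply: (@bounded_integrable _ _ _ (lapm K) _ `|D|%R).
have mafter : measurable_fun setT (after : measurableTypeR R -> R) by exact: measurable_indic.
have mpair : measurable_fun setT (fun z : TQ * measurableTypeR R => ((z.1.1 - y)%R : borel 'rV[R]_n, z.2)).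
  apply: measurable_fun_pair; last exact: measurable_snd.
  exact: (measurableT_comp (msub y) measurable_fst).
have mk : measurable_fun setT k.
  apply: measurable_funM; first exact: (measurableT_comp mafter measurable_snd).
  apply: measurable_funB; first exact: (measurableT_comp measurable_dheat_pair mpair).
  by apply: measurable_funM => //; exact: (measurableT_comp measurable_heat_pair mpair).
have ik := Rfubini_bounded mk (fun z r => kern_le r (z.1 - y)%R) iQ iD.
have := Rfubini ik.
have mh r : measurable_fun setT (fun z : TQ => heat_kernel r (z.1 - y)).
  exact: (measurableT_comp (@measurable_heat_kernel R n r) (msub y)).
have mdh r : measurable_fun setT (fun z : TQ => dheat_kernel r (z.1 - y)).
  apply: (measurableT_comp measurable_dheat_pair (g := fun z : TQ => ((z.1 - y)%R : borel 'rV[R]_n, r : measurableTypeR R))).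
  by apply: measurable_fun_pair; [exact: msub|exact: measurable_cst].
have ih r : (r0 <= r)%R -> m.-integrable setT (EFin \o (fun z => heat_kernel r (z.1 - y) * Q z)%R).
  by move=> r0r; apply: (integrable_bndM (mh r) _ iQ) => z; exact: (heat_kernel_le _ r00 r0r).
have idh r : (r0 <= r)%R -> m.-integrable setT (EFin \o (fun z => dheat_kernel r (z.1 - y) * Q z)%R).
  by move=> r0r; apply: (integrable_bndM (mdh r) _ iQ) => z; exact: (dheat_kernel_le _ r00 r0r).
(* Integrating over [r] first uses the telescoping identity [heat_resolvent]; integrating over space
   and time first, in [E2], uses the equation. *)
have E1 : (\int[m]_z \int[lapm K]_r (k (z, r) * Q z) =
    - expR (- (K * r0)) * Lam (fun x => heat_kernel r0 (x - y)))%R.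
  rewrite /Lam -RintegralZl//; last exact: ih.
  apply: eq_Rintegral => z _; rewrite /k /= RintegralZr//.
    by rewrite heat_resolvent; ring.
  apply: (bounded_integrable (M := D) lapK_fin _ (fun r => kern_le r (z.1 - y)%R)).
  by apply: measurable_funM => //; exact: mkern.
have E2 : (\int[lapm K]_r \int[m]_z (k (z, r) * Q z) =
    - c * \int[lapm K]_r (after r * heat_kernel r y))%R.
  rewrite -RintegralZl//; last first.
    apply: (@bounded_integrable _ _ _ (lapm K) _ (heat_max (n := n) r0)) => //.
      by apply: measurable_funM => //; exact: mheat.
    move=> r; have [->|/after_pos h] := eqVneq (after r) 0%R; first by rewrite mul0r normr0 heat_max_ge0.
    have /andP[a0 a1] := after01 r.
    by rewrite normrM (ger0_norm a0) (le_trans (ler_piMl (normr_ge0 _) a1))// heat_kernel_le.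
  apply: eq_Rintegral => r _; rewrite /k /kern /=.
  have [->|/after_pos h] := eqVneq (after r) 0%R.
    under eq_Rintegral => z _ do rewrite !mul0r.
    by rewrite /Rintegral integral0 mul0r mulr0.
  have rp := lt_le_trans r00 h.
  transitivity (\int[m]_z (after r * (dheat_kernel r (z.1 - y) * Q z - K * (heat_kernel r (z.1 - y) * Q z))))%R.
    by apply: eq_Rintegral => z _; ring.
  have iK : m.-integrable setT (EFin \o (fun z => K * (heat_kernel r (z.1 - y) * Q z))%R).
    exact: (integrable_mull K (ih r h)).
  rewrite RintegralZl//; last exact: (@integrableB _ _ _ m setT measurableT _ _ (idh r h) iK).
  rewrite RintegralB//; last exact: idh.
  rewrite RintegralZl//; last exact: ih.
  have e := gauss_eq y rp; rewrite /Lam in e.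
  by rewrite -opprB e; ring.
move=> h; apply: oppr_inj; rewrite -[LHS]mulNr -[RHS]mulNr.
exact: etrans (esym E1) (etrans h E2).
Qed.

End heat_resolvent.

(** * The Laplace pairing as a Brownian expectation *)

Section pairing_brownian.
Context {d : measure_display} {Omega : measurableType d} {R : realType}.
Variable P : probability Omega R.
Variable n : nat.
Variable B : R -> Omega -> borel 'rV[R]_n.
Hypothesis B_bm : brownian_motion P B.
Local Notation TQ := (borel 'rV[R]_n * measurableTypeR R)%type.
Local Notation leb := (lebesgue_rV n).
Variables (m : {sigma_finite_measure set TQ -> \bar R}) (Q : TQ -> R) (K c : R).
Hypotheses (K0 : (0 < K)%R) (iQ : m.-integrable setT (EFin \o Q)).

Let Lam (phi : 'rV[R]_n -> R) : R := (\int[m]_z (phi z.1 * Q z))%R.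

Hypothesis gauss_eq : forall (r : R) (y : 'rV[R]_n), (0 < r)%R ->
  (K * Lam (fun x => heat_kernel r (x - y)) - Lam (fun x => dheat_kernel r (x - y)) =
   heat_kernel r y * c)%R.

Variable psi : 'rV[R]_n -> R.
Hypotheses (cpsi : continuous psi) (psi01 : forall x, (0 <= psi x <= 1)%R).
Hypothesis ipsi : leb.-integrable setT (EFin \o psi).

Let psi0 x : (0 <= psi x)%R. Proof. by have /andP[] := psi01 x. Qed.
Let psi1 x : (`|psi x| <= 1)%R. Proof. by rewrite ger0_norm//; have /andP[] := psi01 x. Qed.

Let mpsi : measurable_fun setT (psi : borel 'rV[R]_n -> measurableTypeR R).
Proof. exact: (@continuous_borel R 'rV[R]_n _ cpsi). Qed.

Let mrefl (x : 'rV[R]_n) :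
  measurable_fun setT (fun u : borel 'rV[R]_n => (x - u)%R : borel 'rV[R]_n).
Proof.
apply: measurable_rV => j; under eq_fun do rewrite !mxE.
by apply: measurable_funB => //; exact: measurable_coord.
Qed.

(** The heat semigroup applied to [psi]. As an expectation, its convergence to [psi] when [r] tends
    to 0 follows from continuity of the paths at 0. *)
Let smoothed (r : R) (x : 'rV[R]_n) : R := (\int[P]_w psi (x - B r w))%R.

Let P_fin : P setT < +oo.
Proof. by apply: le_lt_trans (ltry 1%R); exact: probability_le1. Qed.

Let mB s : (0 <= s)%R -> measurable_fun setT (B s).
Proof. by case: B_bm => h _ _ _; exact: h. Qed.

Let heat_smoothed (r : R) (x : 'rV[R]_n) : (0 < r)%R ->
  (\int[leb]_y (psi y * heat_kernel r (x - y)) = smoothed r x)%R.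
Proof.
move=> r0; rewrite /smoothed /Rintegral; congr fine.
rewrite (ge0_brownian_mean B_bm r0 (f := fun u => (psi (x - u))%:E)) => //; last 2 first.
- by apply/measurable_EFinP; exact: (measurableT_comp mpsi (mrefl x)).
- by move=> u; rewrite lee_fin.
pose f (u : borel 'rV[R]_n) : \bar R := (psi (x - u) * heat_kernel r u)%:E.
transitivity (\int[leb]_y f (x - y)%R).
  by apply: eq_integral => y _; rewrite /f subKr.
rewrite (ge0_integral_lebesgue_rV_reflect x (f := f)).
- by apply: eq_integral => u _; rewrite /f EFinM.
- apply/measurable_EFinP; apply: measurable_funM.
    exact: (measurableT_comp mpsi (mrefl x)).
  exact: measurable_heat_kernel.
- by move=> u; rewrite lee_fin mulr_ge0 ?heat_kernel_ge0.
Qed.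

Let heat_mean (r : R) : (0 < r)%R ->
  (\int[leb]_y (psi y * heat_kernel r y) = brownian_mean P B psi r)%R.
Proof.
move=> r0; rewrite /brownian_mean gtr0_norm// /Rintegral; congr fine.
rewrite (ge0_brownian_mean B_bm r0 (f := EFin \o psi)) => //.
exact/measurable_EFinP.
Qed.

(** The resolvent identity at each centre [y] is integrated against psi(y) dy. Exchanging integrals
    produces the smoothed [psi] on one side and the mean of psi(B(s)) on the other. *)
Let smoothed_eq (r : R) : (0 < r)%R ->
  (expR (- (K * r)) * Lam (smoothed r) =
   c * \int[lapm K]_s (\1_(`[r, +oo[%classic : set R) s * brownian_mean P B psi s))%R.
Proof.
move=> r0.
pose H y := (\int[m]_z (heat_kernel r (z.1 - y) * Q z))%R.
pose G (y : 'rV[R]_n) := (\int[lapm K]_s (\1_(`[r, +oo[%classic : set R) s * heat_kernel s y))%R.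
have HG y : (expR (- (K * r)) * H y = c * G y)%R := pairing_resolvent K0 r0 iQ gauss_eq y.
have mh y : measurable_fun setT (fun z : TQ => heat_kernel r (z.1 - y)).
  apply: (measurableT_comp (@measurable_heat_kernel R n r)).
  apply: measurable_rV => j; under eq_fun do rewrite !mxE.
  by apply: measurable_funB => //; exact: (measurableT_comp (measurable_coord j) measurable_fst).
have ipsih (x : 'rV[R]_n) : leb.-integrable setT (EFin \o (fun y => psi y * heat_kernel r (x - y))%R).
  apply: (@le_integrable_EFin _ _ _ leb _ (fun y => heat_max (n := n) r * psi y)%R).
  - apply: measurable_funM; first exact: mpsi.
    exact: (measurableT_comp (@measurable_heat_kernel R n r) (mrefl x)).
  - move=> y; rewrite normrM (ger0_norm (psi0 _)) mulrC ler_wpM2r//.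
    exact: (heat_kernel_le _ r0 (lexx r)).
  - exact: integrable_mull.
pose k1 (z : TQ * borel 'rV[R]_n) : R := (psi z.2 * heat_kernel r (z.1.1 - z.2))%R.
have mk1 : measurable_fun setT k1.
  apply: measurable_funM; first exact: (measurableT_comp mpsi measurable_snd).
  apply: (measurableT_comp (@measurable_heat_kernel R n r)).
  apply: measurable_rV => j; under eq_fun do rewrite !mxE.
  apply: measurable_funB.
    by apply: (measurableT_comp (measurable_coord j)); exact: (measurableT_comp measurable_fst measurable_fst).
  exact: (measurableT_comp (measurable_coord j) measurable_snd).
have ik1 := Rfubini_bounded mk1 (K := fun y : borel 'rV[R]_n => heat_max (n := n) r * psi y)%R _ iQ (integrable_mull _ ipsi).
move: ik1 => /(_ _)/wrap[].
  move=> z y; rewrite /k1 /= normrM (ger0_norm (psi0 _)) mulrC ler_wpM2r//.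
  by rewrite heat_kernel_le.
move=> ik1; have e1 := Rfubini ik1.
have E1 : (\int[leb]_y (psi y * H y) = Lam (smoothed r))%R.
  rewrite /Lam; transitivity (\int[m]_z \int[leb]_y (k1 (z, y) * Q z))%R.
    rewrite e1; apply: eq_Rintegral => y _; rewrite /H -RintegralZl//.
      by apply: eq_Rintegral => z _; rewrite /k1/= mulrA.
    by apply: (integrable_bndM (mh y) _ iQ) => z; exact: (heat_kernel_le _ r0 (lexx r)).
  apply: eq_Rintegral => z _; rewrite /k1/= RintegralZr ?heat_smoothed//.
have mafter : measurable_fun setT (\1_(`[r, +oo[%classic : set R) : measurableTypeR R -> R) by exact: measurable_indic.
pose k2 (z : borel 'rV[R]_n * measurableTypeR R) : R := (\1_(`[r, +oo[%classic : set R) z.2 * heat_kernel z.2 z.1)%R.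
have mk2 : measurable_fun setT k2.
  apply: measurable_funM; first exact: (measurableT_comp mafter measurable_snd).
  exact: measurable_heat_pair.
have iD : (lapm K).-integrable setT (EFin \o (fun _ : R => heat_max (n := n) r)).
  by apply: (@bounded_integrable _ _ _ (lapm K) _ `|heat_max (n := n) r|%R) => //; exact: lapmT_fin.
have k2le y s : (`|k2 (y, s)| <= heat_max (n := n) r)%R.
  rewrite /k2 /= indicE mem_setE in_itv/= andbT.
  by case: (leP r s) => h; rewrite ?mul1r ?heat_kernel_le// mul0r normr0 heat_max_ge0.
have iG y : (lapm K).-integrable setT (EFin \o (fun s => k2 (y, s))).
  apply: (@le_integrable_EFin _ (measurableTypeR R) R (lapm K) _ (fun=> heat_max (n := n) r)) => //.
  exact: (measurableT_comp mk2 (measurable_pair1 y)).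
have e2 := Rfubini (Rfubini_bounded mk2 k2le ipsi iD).
have E2 : (\int[leb]_y (psi y * G y) = \int[lapm K]_s (\1_(`[r, +oo[%classic : set R) s * brownian_mean P B psi s))%R.
  transitivity (\int[leb]_y \int[lapm K]_s (k2 (y, s) * psi y))%R.
    apply: eq_Rintegral => y _; rewrite RintegralZr//; first by rewrite mulrC.
    exact: iG.
  rewrite e2; apply: eq_Rintegral => s _; rewrite /k2/=.
  have [->|] := eqVneq (\1_(`[r, +oo[%classic : set R) s : R) 0%R.
    under eq_Rintegral => z _ do rewrite !mul0r.
    by rewrite /Rintegral integral0 mul0r.
  rewrite indicE mem_setE in_itv/= andbT; case: leP => [rs _|]; last by rewrite eqxx.
  rewrite mul1r -heat_mean ?(lt_le_trans r0)//.
  by apply: eq_Rintegral => y _; rewrite mul1r mulrC.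
have ipH : leb.-integrable setT (EFin \o (fun y => psi y * H y)%R).
  have := integrable_Rfubini2 ik1; apply: eq_integrable => // y _ /=; congr EFin.
  rewrite /H -RintegralZl//; first by apply: eq_Rintegral => z _; rewrite /k1/= mulrA.
  by apply: (integrable_bndM (mh y) _ iQ) => z; exact: (heat_kernel_le _ r0 (lexx r)).
have mG : measurable_fun setT (G : borel 'rV[R]_n -> measurableTypeR R).
  apply: (measurableT_comp (fine_measurable measurableT)).
  apply: (@measurable_fun_fubini_tonelli_F _ _ _ _ _ (lapm K) (EFin \o k2)).
    exact/measurable_EFinP.
  by move=> z; rewrite lee_fin mulr_ge0 ?heat_kernel_ge0// indicE.
have ipG : leb.-integrable setT (EFin \o (fun y => G y * psi y)%R).
  apply: (integrable_bndM mG _ ipsi (M := \int[lapm K]_s heat_max (n := n) r)%R) => y.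
  apply: normr_Rintegral_le; [|by move=> s; exact: (k2le y s)|exact: iD].
  exact: (measurableT_comp mk2 (measurable_pair1 y)).
have ipG' : leb.-integrable setT (EFin \o (fun y => psi y * G y)%R).
  by move: ipG; apply: eq_integrable => // y _ /=; rewrite mulrC.
rewrite -E1 -E2 -[LHS]RintegralZl// -[RHS]RintegralZl//.
by apply: eq_Rintegral => y _; rewrite mulrCA HG mulrCA.
Qed.

(** The cut [r] tends to 0: the smoothed functions tend boundedly to [psi], and the truncated time
    integral fills the half-line. *)
Lemma pairing_brownian : (Lam psi = c * \int[lapm K]_s brownian_mean P B psi s)%R.
Proof.
pose r_ (k : nat) : R := (k.+1%:R^-1)%R.
have r0 k : (0 < r_ k)%R by rewrite invr_gt0.
have cr : r_ k @[k --> \oo] --> (0 : R)%R by exact: cvg_harmonic.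
have msub r : (0 <= r)%R -> measurable_fun setT (fun z : borel 'rV[R]_n * Omega => psi (z.1 - B r z.2) : measurableTypeR R).
  move=> r00; apply: (measurableT_comp mpsi); apply: measurable_rV => j; under eq_fun do rewrite !mxE.
  apply: measurable_funB; first exact: (measurableT_comp (measurable_coord j) measurable_fst).
  by apply: (measurableT_comp (measurable_coord j)); exact: (measurableT_comp (mB r00) measurable_snd).
have i1 : P.-integrable setT (EFin \o (fun _ : Omega => 1%R : R)).
  by apply: (@bounded_integrable _ _ _ P _ 1%R) => // _; rewrite normr1.
have smoothed_cvg x : smoothed (r_ k) x @[k --> \oo] --> psi x.
  have -> : psi x = (\int[P]_w psi (x - B 0 w))%R.
    have [_ B0 _ _] := B_bm.
    rewrite (_ : (fun w => _) = cst (psi x)); last by apply/funext => w; rewrite B0 subr0.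
    by rewrite Rintegral_cst// [X in fine X]probability_setT mulr1.
  apply: (@Rintegral_dct _ _ _ P (fun k w => psi (x - B (r_ k) w)%R) _ (fun=> 1%R)) => //.
  - by move=> k; apply: (measurableT_comp (msub (r_ k) _) (measurable_pair1 _)); exact: ltW.
  - move=> w; have h := brownian_cvg B_bm (w := w) (fun k => ltW (r0 k)) (lexx 0%R) cr.
    have hx : (x - (B (r_ k) w : 'rV[R]_n))%R @[k --> \oo] --> (x - (B 0 w : 'rV[R]_n))%R.
      by apply: cvgB h; exact: cvg_cst.
    by move=> A hA; exact: (hx _ (cpsi hA)).
have msm k : measurable_fun setT (smoothed (r_ k) : borel 'rV[R]_n -> measurableTypeR R).
  rewrite /smoothed; apply: measurableT_comp => //.
  apply: (@measurable_fun_fubini_tonelli_F _ _ _ _ _ P (fun z : borel 'rV[R]_n * Omega => (psi (z.1 - B (r_ k) z.2))%:E)).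
    by apply/measurable_EFinP; apply: msub; exact: ltW.
  by move=> z; rewrite lee_fin.
have sm1 k x : (`|smoothed (r_ k) x| <= 1)%R.
  have -> : (1 = \int[P]_w 1 :> R)%R by rewrite Rintegral_cst// mul1r [X in fine X]probability_setT.
  apply: normr_Rintegral_le => //.
  by apply: (measurableT_comp (msub (r_ k) _) (measurable_pair1 _)); exact: ltW.
have h1 : (expR (- (K * r_ k)) * Lam (smoothed (r_ k)))%R @[k --> \oo] --> Lam psi.
  rewrite -[X in _ --> X]mul1r; apply: cvgM.
    have cx : (- (K * r_ k))%R @[k --> \oo] --> (0 : R)%R.
      by rewrite -(@oppr0 R); apply: cvgN; rewrite -(mulr0 K); apply: cvgMr.
    rewrite -(@expR0 R); exact: (cvg_comp _ _ cx (@continuous_expR R _)).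
  have [mQ _] := integrable_EFinP iQ.
  apply: (@Rintegral_dct _ _ _ m (fun k z => smoothed (r_ k) z.1 * Q z)%R _ (fun z => `|Q z|)%R).
  - by move=> k; apply: measurable_funM => //; exact: (measurableT_comp (msm k) measurable_fst).
  - by move=> z; apply: cvgMl; exact: smoothed_cvg.
  - exact: integrable_norm iQ.
  - by move=> k z; rewrite normrM ler_piMl.
have cbm := continuous_brownian_mean B_bm cpsi psi1.
have bm1 s : (`|brownian_mean P B psi s| <= 1)%R.
  have -> : (1 = \int[P]_w 1 :> R)%R by rewrite Rintegral_cst// mul1r [X in fine X]probability_setT.
  by apply: normr_Rintegral_le => //; apply: (measurableT_comp mpsi); exact: mB.
have mbm : measurable_fun setT (brownian_mean P B psi : measurableTypeR R -> R) := continuous_measurable_fun cbm.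
have h2 : (c * \int[lapm K]_s (\1_(`[r_ k, +oo[%classic : set R) s * brownian_mean P B psi s))%R @[k --> \oo] -->
    (c * \int[lapm K]_s brownian_mean P B psi s)%R.
  apply: cvgMr.
  apply: (@Rintegral_dct_ae _ (measurableTypeR R) R (lapm K) (fun k s => \1_(`[r_ k, +oo[%classic : set R) s * brownian_mean P B psi s)%R _ (fun=> 1%R)).
  - by move=> k; apply: measurable_funM => //; exact: measurable_indic.
  - exact: mbm.
  - apply: filterS (ae_lapm_gt0 K) => s s0; apply: cvg_near_cst; near=> k.
    rewrite indicE mem_set ?mul1r//= in_itv/= andbT ltW//.
    by near: k; exact: (cvgr_lt _ cr).
  - by apply: (@bounded_integrable _ _ _ (lapm K) _ 1%R) => //; [exact: lapmT_fin|move=> _; rewrite normr1].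
  - by move=> k s; rewrite normrM indicE; case: (_ \in _); rewrite ?normr1 ?mul1r// normr0 mul0r.
apply: (cvg_unique _ h1) => //.
rewrite (_ : (fun k => _) = (fun k => c * \int[lapm K]_s (\1_(`[r_ k, +oo[%classic : set R) s * brownian_mean P B psi s))%R)//.
by apply/funext => k; exact: smoothed_eq.
Unshelve. all: by end_near. Qed.

End pairing_brownian.

(** * Measures determined by boxes *)

Section boxes.
Context {R : realType} {n : nat}.
Implicit Types (A B : 'I_n -> R).

Definition box A B : set (borel 'rV[R]_n) := [set x | forall i, (A i < x ord0 i < B i)%R].

Lemma measurable_box A B : measurable (box A B).
Proof.
rewrite (_ : box A B = \bigcap_(i in [set: 'I_n])
    ((fun x : borel 'rV[R]_n => x ord0 i : measurableTypeR R) @^-1` `]A i, B i[%classic)).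
  apply: fin_bigcap_measurable => [|i _]; first exact: finite_finset.
  by rewrite -[X in measurable X]setTI; apply: measurable_coord => //; exact: measurable_itv.
apply/seteqP; split => x; first by move=> h i _ /=; rewrite in_itv/= h.
by move=> h i; have := h i I; rewrite /= in_itv.
Qed.

Let boxes : set (set (borel 'rV[R]_n)) := range (fun AB => box AB.1 AB.2).

(** Balls of the maximum norm are open boxes, and countably many of them with rational data exhaust
    any open set. *)
Lemma borel_boxes : measurable = <<s boxes >> :> set (set (borel 'rV[R]_n)).
Proof.
rewrite eqEsubset; split => E; last first.
  apply: smallest_sub; first exact: sigma_algebra_measurable.
  by move=> _ [[A B] _ <-]; exact: measurable_box.
apply: smallest_sub; first exact: smallest_sigma_algebra.
move=> U oU; rewrite (open_rV_bigcup_ball oU) bigcup_mkcond.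
pose T' : measurableType _ := g_sigma_algebraType boxes.
apply: (@countable_bigcupT_measurable _ T') => [|[v k]] /=; first exact: countableP.
case: ifP => _; last exact: (@measurable0 _ T').
apply: sub_sigma_algebra; set r := (_^-1)%R; set c := map_mx _ _.
have r0 : (0 < r)%R by rewrite invr_gt0.
exists (fun i => c ord0 i - r, fun i => c ord0 i + r)%R => //.
apply/seteqP; split => x /=.
  by move=> h; split => // i j; rewrite !ord1 -ball_normE/= distrC ltr_distl; exact: h.
by move=> [_ h] i; have := h ord0 i; rewrite -ball_normE/= distrC ltr_distl.
Qed.

Lemma box_measure_unique (m1 m2 : {measure set (borel 'rV[R]_n) -> \bar R}) :
  (forall A B, m1 (box A B) = m2 (box A B)) -> (forall A B, m1 (box A B) < +oo) ->
  forall E, measurable E -> m1 E = m2 E.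
Proof.
move=> m12 m1oo E mE.
apply: (measure_unique boxes (fun k : nat => box (fun=> - k%:R)%R (fun=> k%:R)%R)) => //.
- exact: borel_boxes.
- move=> _ _ [[A B] _ <-] [[A' B'] _ <-].
  exists (fun i => Num.max (A i) (A' i), fun i => Num.min (B i) (B' i)) => //=.
  apply/seteqP; split => x /=.
    move=> h; split => i; have := h i; rewrite /= gt_max lt_min.
      by move=> /andP[/andP[-> _] /andP[-> _]].
    by move=> /andP[/andP[_ ->] /andP[_ ->]].
  move=> [h h'] i; rewrite /= gt_max lt_min.
  by have /andP[-> ->] := h i; have /andP[-> ->] := h' i.
- by move=> k; exists (fun=> - k%:R, fun=> k%:R)%R.
- apply/seteqP; split => // x _.
  (* A sum of integer bounds on the coordinates exceeds each of them, so one centred box contains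
     [x]. *)
  exists (\sum_(i < n) (Num.truncn `|x ord0 i|).+1)%N => // i.
  rewrite -ltr_norml (lt_le_trans (truncnS_gt _))// ler_nat.
  by rewrite (bigD1 i)//= leq_addr.
- by move=> _ [[A B] _ <-]; exact: m12.
Qed.

(** Since [g] may be signed, the law plus the measure with density g^- is compared with the measure
    with density g^+. Both are measures finite on boxes, so their agreement there extends to all
    Borel sets. *)
Lemma law_density_boxes d (Omega : measurableType d) (P : probability Omega R)
    (X : Omega -> borel 'rV[R]_n) (g : 'rV[R]_n -> R) :
  measurable_fun setT X -> (lebesgue_rV n).-integrable setT (EFin \o g) ->
  (forall A B, (fine (P (X @^-1` box A B)) = \int[lebesgue_rV n]_x (\1_(box A B) x * g x))%R) ->
  forall E, measurable E -> P (X @^-1` E) = \int[lebesgue_rV n]_(x in E) (g x)%:E.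
Proof.
move=> mX ig h E mE; have [mg _] := integrable_EFinP ig.
pose gp (x : borel 'rV[R]_n) : R := Num.max (g x) 0%R.
pose gm (x : borel 'rV[R]_n) : R := Num.max (- g x)%R 0%R.
have mgp : measurable_fun setT gp by exact: measurable_maxr.
have mgm : measurable_fun setT gm by apply: measurable_maxr => //; exact: measurable_funN.
have gp0 x : (0 <= gp x)%R by rewrite le_max lexx orbT.
have gm0 x : (0 <= gm x)%R by rewrite le_max lexx orbT.
have gE x : (g x = gp x - gm x)%R by rewrite /gp /gm; case: (leP (g x) 0%R) => h1; case: leP => h2; lra.
have gpn x : (gp x <= `|g x|)%R by rewrite ge_max ler_norm normr_ge0.
have gmn x : (gm x <= `|g x|)%R by rewrite ge_max normr_ge0 andbT -normrN ler_norm.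
have inorm : (lebesgue_rV n).-integrable setT (EFin \o (fun x => `|g x|%R)) := integrable_norm ig.
have igp : (lebesgue_rV n).-integrable setT (EFin \o gp).
  by apply: (le_integrable_EFin mgp _ inorm) => x; rewrite ger0_norm.
have igm : (lebesgue_rV n).-integrable setT (EFin \o gm).
  by apply: (le_integrable_EFin mgm _ inorm) => x; rewrite ger0_norm.
pose mp := density_measure (lebesgue_rV n) mgp gp0.
pose mm := density_measure (lebesgue_rV n) mgm gm0.
have split (F : set (borel 'rV[R]_n)) : measurable F ->
    [/\ mp F = (\int[lebesgue_rV n]_x (\1_F x * gp x))%R%:E,
        mm F = (\int[lebesgue_rV n]_x (\1_F x * gm x))%R%:E &
        (\int[lebesgue_rV n]_x (\1_F x * g x) =
         \int[lebesgue_rV n]_x (\1_F x * gp x) - \int[lebesgue_rV n]_x (\1_F x * gm x))%R].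
  move=> mF; have m1 : measurable_fun setT (\1_F : borel 'rV[R]_n -> R) by exact: measurable_indic.
  have b1 x : (`|\1_F x : R| <= 1)%R by rewrite indicE; case: (_ \in _); rewrite ?normr1 ?normr0.
  have ip := integrable_bndM m1 b1 igp; have im := integrable_bndM m1 b1 igm.
  split.
  - rewrite EFin_Rintegral// /mp/= /density_measure integral_mkcond; apply: eq_integral => x _.
    by rewrite patchE indicE; case: ifP => _; rewrite ?mul1r ?mul0r.
  - rewrite EFin_Rintegral// /mm/= /density_measure integral_mkcond; apply: eq_integral => x _.
    by rewrite patchE indicE; case: ifP => _; rewrite ?mul1r ?mul0r.
  - by rewrite -RintegralB//; apply: eq_Rintegral => x _; rewrite -mulrBr -gE.
have PX F : measurable F -> P (X @^-1` F) \is a fin_num.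
  by move=> mF; apply: fin_num_measure; rewrite -[X in measurable X]setTI; exact: mX.
pose X' : {mfun Omega >-> borel 'rV[R]_n} := HB.pack X (isMeasurableFun.Build _ _ _ _ X mX).
have addE (F : set (borel 'rV[R]_n)) : measurable F -> measure_add (distribution P X') mm F =
    P (X @^-1` F) + (\int[lebesgue_rV n]_x (\1_F x * gm x))%R%:E.
  by move=> mF; rewrite measure_addE; congr (_ + _); have [] := split _ mF.
have EU : measure_add (distribution P X') mm E = mp E.
  apply: (box_measure_unique _ _ mE) => A B; have mAB := measurable_box A B.
    have [ep em e] := split _ mAB.
    transitivity (measure_add (distribution P X') mm (box A B)); first by [].
    transitivity (mp (box A B)); last by [].
    rewrite (addE _ mAB) ep -(fineK (PX _ mAB)) h e -EFinD.
    by congr EFin; ring.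
  have [_ em _] := split _ mAB.
  rewrite [ltLHS](_ : _ = measure_add (distribution P X') mm (box A B))//.
  by rewrite (addE _ mAB) lte_add_pinfty ?ltry//; have := PX _ mAB; rewrite ge0_fin_numE.
have [ep em e] := split _ mE.
have ep1 := ep; rewrite -EU (addE _ mE) in ep1.
have -> : P (X @^-1` E) = (\int[lebesgue_rV n]_x (\1_E x * g x))%R%:E.
  rewrite e EFinB -ep1 addeK//.
have m1 : measurable_fun setT (\1_E : borel 'rV[R]_n -> R) by exact: measurable_indic.
have b1 x : (`|\1_E x : R| <= 1)%R by rewrite indicE; case: (_ \in _); rewrite ?normr1 ?normr0.
rewrite EFin_Rintegral; last exact: (integrable_bndM m1 b1 ig).
rewrite [RHS]integral_mkcond; apply: eq_integral => x _.
by rewrite patchE indicE; case: ifP => _; rewrite ?mul1r ?mul0r.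
Qed.

(** As [k] grows, flat((k+1) z) tends to 1 for z > 0 and stays 0 for z <= 0, so these smooth
    functions approach the indicator of the open interval from inside its closure. *)
Definition box_bump A B (k : nat) (i : 'I_n) (y : R) : R :=
  (flat (k.+1%:R * (y - A i)) * flat (k.+1%:R * (B i - y)))%R.

Lemma smooth1_box_bump A B k i : smooth1 (box_bump A B k i).
Proof.
apply: smooth1M.
  rewrite (_ : (fun y => _) = (fun y => flat (k.+1%:R * y + - (k.+1%:R * A i)))%R).
    exact: smooth1_affine smooth1_flat.
  by apply/funext => y; rewrite mulrBr.
rewrite (_ : (fun y => _) = (fun y => flat ((- k.+1%:R) * y + k.+1%:R * B i))%R).
  exact: smooth1_affine smooth1_flat.
by apply/funext => y; congr flat; ring.
Qed.

Lemma box_bump_out A B k i y : ~~ (A i <= y <= B i)%R -> box_bump A B k i y = 0%R.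
Proof.
rewrite negb_and -!ltNge /box_bump => /orP[h|h].
  by rewrite flat_le0 ?mul0r// mulr_ge0_le0// subr_le0 ltW.
by rewrite [X in (_ * X)%R]flat_le0 ?mulr0// mulr_ge0_le0// subr_le0 ltW.
Qed.

Lemma box_bump01 A B k i y : (0 <= box_bump A B k i y <= 1)%R.
Proof.
have /andP[h1 h2] := flat01 (k.+1%:R * (y - A i))%R.
have /andP[h3 h4] := flat01 (k.+1%:R * (B i - y))%R.
by rewrite mulr_ge0//= mulr_ile1.
Qed.

Lemma tensor_box_bump01 A B k x : (0 <= tensor (box_bump A B k) x <= 1)%R.
Proof.
apply/andP; split; first by apply: prodr_ge0 => i _; have /andP[] := box_bump01 A B k i (x ord0 i).
by apply: prodr_ile1 => i _; exact: box_bump01.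
Qed.

Lemma flat_scale_cvg (y : R) : flat (k.+1%:R * y)%R @[k --> \oo] --> ((0 < y)%R%:R : R)%R.
Proof.
have [y0|y0] := ltP 0%R y; last first.
  rewrite (_ : (fun k => _) = fun=> 0%R); first exact: cvg_cst.
  by apply/funext => k; rewrite flat_le0// mulr_ge0_le0.
rewrite (_ : (fun k => _) = (fun k : nat => expR (- (k.+1%:R^-1 * y^-1)))%R); last first.
  by apply/funext => k; rewrite flatE mulr_gt0// invfM.
have cx : (- (k.+1%:R^-1 * y^-1))%R @[k --> \oo] --> (0 : R)%R.
  rewrite -(@oppr0 R); apply: cvgN; rewrite -(mul0r (y^-1)%R); apply: cvgMl; exact: cvg_harmonic.
rewrite [X in _ --> X](_ : _ = expR 0); last by rewrite expR0.
by apply: continuous_cvg cx; exact: continuous_expR.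
Qed.

Lemma tensor_box_bump_cvg A B x : tensor (box_bump A B k) x @[k --> \oo] --> (\1_(box A B) x : R).
Proof.
have -> : (\1_(box A B) x : R) = (\prod_(i < n) ((0 < x ord0 i - A i)%R%:R * (0 < B i - x ord0 i)%R%:R))%R.
  rewrite indicE; have [xAB|xAB] := boolP (x \in box A B).
    move: xAB; rewrite inE => h; rewrite big1// => i _.
    by rewrite !subr_gt0; have /andP[-> ->] := h i; rewrite mulr1.
  move: xAB; rewrite notin_setE => /existsNP[i]; rewrite (bigD1 i)//= !subr_gt0.
  by case: (A i < _)%R => //=; case: (_ < B i)%R => //= _; rewrite ?mulr0 ?mul0r.
apply: cvg_big => [|i _]; first by move=> z; exact: mul_continuous.
by apply: cvgM; exact: flat_scale_cvg.
Qed.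

(** On the closed box the squared norm is at most [S], so the heat kernel at time 1 is at least [e]
    there; a multiple of this kernel, of finite mass, dominates the bump. *)
Lemma integrable_box_bump A B k :
  (forall s : R, (0 < s)%R -> \int[lebesgue_rV n]_x (heat_kernel s x)%:E = 1) ->
  (lebesgue_rV n).-integrable setT (EFin \o tensor (box_bump A B k)).
Proof.
move=> mass; pose S := (\sum_(i < n) (A i ^+ 2 + B i ^+ 2))%R.
pose e : R := ((4 * pi * 1) `^ (- (n%:R / 2)) * expR (- (S / (4 * 1))))%R.
have e0 : (0 < e)%R by rewrite mulr_gt0 ?expR_gt0// powR_gt0// !mulr_gt0// pi_gt0.
apply: (@le_integrable_EFin _ _ _ (lebesgue_rV n) _ (fun x => e^-1 * heat_kernel 1 x)%R).
- apply: (@continuous_borel R 'rV[R]_n); apply: continuous_tensor => i.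
  exact/smooth1_continuous/smooth1_box_bump.
- move=> x; have /andP[h0 h1] := tensor_box_bump01 A B k x; rewrite (ger0_norm h0).
  have hk0 : (0 <= e^-1 * heat_kernel 1 x)%R by rewrite mulr_ge0 ?heat_kernel_ge0// invr_ge0 ltW.
  have [xAB|] := boolP [forall i, A i <= x ord0 i <= B i]%R; last first.
    rewrite negb_forall => /existsP[i hi].
    by rewrite /tensor (bigD1 i)//= box_bump_out// mul0r.
  apply: le_trans h1 _; rewrite -[leLHS](mulVf (lt0r_neq0 e0)) ler_wpM2l ?invr_ge0 ?(ltW e0)//.
  rewrite ler_wpM2l ?powR_ge0// ler_expR lerN2 ler_wpM2r ?invr_ge0 ?mulr_ge0//.
  apply: ler_sum => i _; have /forallP/(_ i)/andP[h2 h3] := xAB.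
  have := sqr_ge0 (x ord0 i); case: (leP 0%R (x ord0 i)) => hx; nra.
- apply: integrable_mull; apply/integrableP; split.
    by apply/measurable_EFinP; exact: measurable_heat_kernel.
  under eq_integral => x _ do rewrite /= ger0_norm ?heat_kernel_ge0//.
  by rewrite mass// ltry.
Qed.

End boxes.

(** * The law of the delayed Brownian motion *)

(* The library's instance for products of sigma-finite measures is shadowed by
   the one for products of subprobabilities. *)
Lemma product_sigma_finite d1 d2 (T1 : measurableType d1) (T2 : measurableType d2)
    (R : realType) (m1 : {sigma_finite_measure set T1 -> \bar R})
    (m2 : {sigma_finite_measure set T2 -> \bar R}) : sigma_finite setT (m1 \x m2).
Proof.
have /sigma_finiteP[F [TF ndF Foo]] := sigma_finiteT m1.
have /sigma_finiteP[G [TG ndG Goo]] := sigma_finiteT m2.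
exists (fun k => F k `*` G k).
  apply/seteqP; split => // -[x y] _.
  have [i _ Fi] : (\bigcup_k F k) x by rewrite -TF.
  have [j _ Gj] : (\bigcup_k G k) y by rewrite -TG.
  exists (maxn i j) => //; split => /=.
    by apply: (subsetPset _ _ (ndF _ _ (leq_maxl i j))).
  by apply: (subsetPset _ _ (ndG _ _ (leq_maxr i j))).
move=> k; have [mF Fy] := Foo k; have [mG Gy] := Goo k; split; first exact: measurableX.
by rewrite product_measure1E// lte_mul_pinfty// ge0_fin_numE.
Qed.

Section delayed_brownian_motion.
Context {R : realType} {n : nat}.
Context {d : measure_display} {Omega : measurableType d}.
Local Notation mu := (@lebesgue_measure R).
Variables (P : probability Omega R) (sig : R -> Omega -> \bar R) (B : R -> Omega -> borel 'rV[R]_n).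
Hypothesis msig : forall t, (0 <= t)%R -> measurable_fun setT (sig t).
Hypothesis sig0 : forall w, sig 0%R w = 0.
Hypothesis sig_mono : forall w s t, (0 <= s)%R -> (s <= t)%R -> sig s w <= sig t w.
Variables (beta : R) (k kap : R -> R).
Hypothesis kap_gt0 : forall lam, (0 < lam)%R -> (0 < kap lam)%R.
Hypothesis sig_laplace : forall lam t : R, (0 < lam)%R -> (0 <= t)%R ->
  \int[P]_w expeR (- (lam%:E * sig t w)) = (expR (- (t * kap lam)))%:E.
Hypothesis B_bm : brownian_motion P B.
Hypothesis BL_indep : independent_processes P B (inverse_process sig).
Local Notation L := (inverse_process sig).
Local Notation Bm := (brownian_mean P B).

Let P_fin : P setT < +oo.
Proof. by rewrite probability_setT ltry. Qed.

Let ml t : measurable_fun setT (fun w => fine (L t w) : measurableTypeR R).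
Proof.
exact: (measurableT_comp (fine_measurable measurableT) (measurable_inverse_process_at msig sig_mono t)).
Qed.

Let l0 t w : (0 <= fine (L t w))%R.
Proof. by rewrite fine_ge0// inverse_process_ge0. Qed.

Let indep t : (0 <= t)%R -> forall (D : set (measurableTypeR R)) (s : R) (C : set (borel 'rV[R]_n)),
  (0 <= s)%R -> measurable D -> measurable C ->
  P ((fun w => fine (L t w)) @^-1` D `&` B s @^-1` C) =
  P ((fun w => fine (L t w)) @^-1` D) * P (B s @^-1` C).
Proof.
move=> t0 D s C s0 mD mC; rewrite setIC muleC; apply: BL_indep.
  by apply: sub_sigma_algebra; exists s; split => //; exists C.
apply: sub_sigma_algebra; exists t; split => //; exists (fine @^-1` D) => //.
by rewrite -[X in measurable X]setTI; exact: (fine_measurable measurableT).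
Qed.

Lemma delayed_mean (t : R) (phi : 'rV[R]_n -> R) (M : R) : (0 <= t)%R -> continuous phi ->
  (forall x, 0 <= phi x <= M)%R ->
  (\int[P]_w phi (B (fine (L t w)) w) = \int[P]_w Bm phi (fine (L t w)))%R.
Proof. by move=> t0 cphi phiM; apply: (time_change_mean B_bm (ml t) (l0 t) (indep t0) cphi phiM). Qed.

Lemma measurable_delayed (t : R) : measurable_fun setT (fun w => B (fine (L t w)) w).
Proof. exact: (measurable_time_change B_bm (ml t) (l0 t)). Qed.

Section observable.
Variable psi : 'rV[R]_n -> R.
Hypotheses (cpsi : continuous psi) (psi01 : forall x, (0 <= psi x <= 1)%R).

Let psi_norm x : (`|psi x| <= 1)%R.
Proof. by have /andP[h0 h1] := psi01 x; rewrite ger0_norm. Qed.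

Let cBm : continuous (Bm psi). Proof. exact: (continuous_brownian_mean B_bm cpsi psi_norm). Qed.

Let mBm : measurable_fun setT (Bm psi : measurableTypeR R -> measurableTypeR R).
Proof. exact: continuous_measurable_fun. Qed.

Let mpsiB (s : R) : measurable_fun setT (fun w => psi (B `|s|%R w) : measurableTypeR R).
Proof.
have [mB _ _ _] := B_bm.
exact: (measurableT_comp (@continuous_borel R 'rV[R]_n _ cpsi) (mB _ (normr_ge0 s))).
Qed.

Let Bm0 s : (0 <= Bm psi s)%R.
Proof. by apply: Rintegral_ge0 => w _; have /andP[] := psi01 (B `|s|%R w). Qed.

Let Bm_norm s : (`|Bm psi s| <= 1)%R.
Proof.
apply: (@le_trans _ _ (\int[P]_w 1)%R).
  apply: normr_Rintegral_le; [exact: mpsiB|by move=> w; exact: psi_norm|].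
  by apply: (@bounded_integrable _ _ _ P _ 1%R) => // w; rewrite normr1.
by rewrite Rintegral_cst//= probability_setT mul1r.
Qed.

Let iBml t : P.-integrable setT (EFin \o (fun w => Bm psi (fine (L t w)))).
Proof.
apply: (@bounded_integrable _ _ _ P _ 1%R P_fin) => [|w]; last exact: Bm_norm.
exact: (measurableT_comp mBm (ml t)).
Qed.

(** By [delayed_mean] this is the mean of psi(B(L(t))). In this form it involves the law of L(t)
    alone, and the occupation formula yields its Laplace transform. *)
Definition delayed_observable (t : R) : R := (\int[P]_w Bm psi (fine (L t w)))%R.

Lemma measurable_delayed_observable :
  measurable_fun setT (delayed_observable : measurableTypeR R -> measurableTypeR R).
Proof.
have mL := measurable_inverse_process msig sig_mono.
have mf := measurableT_comp (fine_measurable measurableT) mL.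
have mh := measurableT_comp (@EFin_measurable R setT) (measurableT_comp mBm mf).
have := @measurable_fun_fubini_tonelli_F _ _ _ _ R P _ mh.
move=> h; apply: (measurableT_comp (fine_measurable measurableT)); apply: h.
by move=> z; rewrite lee_fin; exact: Bm0.
Qed.

Lemma delayed_observable_bound (t : R) : (`|delayed_observable t| <= 1)%R.
Proof.
apply: (@le_trans _ _ (\int[P]_w 1)%R).
  apply: normr_Rintegral_le; [exact: (measurableT_comp mBm (ml t))|by move=> w; exact: Bm_norm|].
  by apply: (@bounded_integrable _ _ _ P _ 1%R) => // w; rewrite normr1.
by rewrite Rintegral_cst//= probability_setT mul1r.
Qed.

Lemma Laplace_delayed_observable (lam : R) : (0 < lam)%R ->
  (\int[lapm lam]_t delayed_observable t = kap lam / lam * \int[lapm (kap lam)]_s Bm psi s)%R.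
Proof.
move=> lam0; have k0 := kap_gt0 lam0.
have mh : measurable_fun setT (EFin \o Bm psi : measurableTypeR R -> \bar R) by exact/measurable_EFinP.
have e := @inverse_process_occupation _ _ _ P sig msig sig0 sig_mono kap kap_gt0 sig_laplace lam lam0
  (EFin \o Bm psi) mh Bm0.
have io : (lapm lam).-integrable setT (EFin \o delayed_observable).
  apply: (@bounded_integrable _ _ _ _ _ 1%R); first exact: lapmT_fin.
    exact: measurable_delayed_observable.
  exact: delayed_observable_bound.
have iB : (lapm (kap lam)).-integrable setT (EFin \o Bm psi).
  by apply: (@bounded_integrable _ _ _ _ _ 1%R); [exact: lapmT_fin|exact: mBm|exact: Bm_norm].
apply: EFin_inj; rewrite (EFin_Rintegral io) EFinM (EFin_Rintegral iB) -e.
by apply: eq_integral => t _; rewrite (EFin_Rintegral (iBml t)).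
Qed.

Lemma delayed_observable_right (t : R) : delayed_observable s @[s --> t^'+] --> delayed_observable t.
Proof.
exact: (@right_continuous_mean_inverse _ _ _ P sig msig sig0 sig_mono kap kap_gt0 sig_laplace
  (Bm psi) 1%R t cBm Bm_norm).
Qed.

End observable.

Hypothesis beta0 : (0 <= beta)%R.
Hypothesis mk : measurable_fun setT (k : measurableTypeR R -> R).
Hypothesis k0 : forall t, (0 <= k t)%R.
Hypothesis ik : forall lam : R, (0 < lam)%R -> (lapm lam).-integrable setT (EFin \o k).
Hypothesis ck : forall t, (0 < t)%R -> {for t, continuous k}.
Hypothesis kapE : forall lam : R, (0 < lam)%R -> kap lam = (lam * (beta + \int[lapm lam]_t k t))%R.
Variables (q : 'rV[R]_n -> R -> R) (C w : R).
Hypothesis w0 : (0 < w)%R.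
Hypothesis mq : measurable_fun [set z : (borel 'rV[R]_n * measurableTypeR R)%type | (0 < z.2)%R]
        (fun z => q z.1 z.2 : measurableTypeR R).
Hypothesis qC : forall t : R, (0 < t)%R ->
  \int[lebesgue_rV n]_x `|q x t|%:E <= (C * expR (w * t))%:E.
Let conv (u : R -> R) (t : R) : R := (\int[mu]_(s in `[0%R, t]) (u s * k (t - s)))%R.
Hypothesis eqn : forall phi, test_function phi ->
  {within `[0%R, +oo[%classic, continuous (tested q phi)} /\
  forall t : R, (0 < t)%R ->
    [/\ beta <> 0%R -> derivable (tested q phi) t 1%R, derivable (conv (tested q phi)) t 1%R &
     (beta * derive1 (tested q phi) t + derive1 (conv (tested q phi)) t - tested q phi 0 * k t =
      \int[lebesgue_rV n]_x (laplacian phi x * q x t))%R].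

Lemma Laplace_pairing_delayed (lam : R) (psi : 'rV[R]_n -> R) : (w < lam)%R ->
  continuous psi -> (forall x, 0 <= psi x <= 1)%R ->
  (lebesgue_rV n).-integrable setT (EFin \o psi) ->
  Laplace_pairing q lam psi = (\int[lapm lam]_t delayed_observable psi t)%R.
Proof.
move=> wlam cpsi psi01 ipsi; have lam0 := lt_trans w0 wlam; have K0 := kap_gt0 lam0.
rewrite (Laplace_delayed_observable cpsi psi01 lam0).
have iQ := integrable_density mq qC wlam.
have tE g A D := @tensor_equation R n beta k kap beta0 mk k0 ik ck kapE q C w w0 mq qC eqn lam wlam g A D.
pose m : {sigma_finite_measure set (borel 'rV[R]_n * measurableTypeR R)%type -> \bar R} :=
  HB.pack (lebesgue_rV n \x lapm lam)%E (Measure_isSigmaFinite.Build _ _ _ _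
    (product_sigma_finite (lebesgue_rV n) (lapm lam))).
have gE (r : R) y r0 := @gaussian_equation R n m _ _ _ iQ tE r y r0.
exact: (@pairing_brownian _ _ _ P n B B_bm m (density0 q) _ _ K0 iQ gE psi cpsi psi01 ipsi).
Qed.

Lemma tested_box_bump (A D : 'I_n -> R) (j : nat) (t : R) : (0 < t)%R ->
  tested q (tensor (box_bump A D j)) t =
  (\int[P]_w tensor (box_bump A D j) (B (fine (L t w)) w))%R.
Proof.
move=> t0; set psi := tensor _.
have cpsi : continuous psi.
  by apply: continuous_tensor => i; exact/smooth1_continuous/smooth1_box_bump.
have psi01 := tensor_box_bump01 A D j; rewrite -/psi in psi01.
have psi_norm x : (`|psi x| <= 1)%R by have /andP[h0 h1] := psi01 x; rewrite ger0_norm.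
have tpsi : test_function psi.
  apply: (@test_function_tensor _ _ _ A D) => [i|i y]; first exact: smooth1_box_bump.
  exact: box_bump_out.
have mpsi : measurable_fun setT (psi : borel 'rV[R]_n -> measurableTypeR R).
  exact: (@continuous_borel R 'rV[R]_n _ cpsi).
have ipsi : (lebesgue_rV n).-integrable setT (EFin \o psi).
  by apply: integrable_box_bump => s s0; exact: (heat_kernel_mass B_bm).
rewrite (delayed_mean (ltW t0) cpsi psi01) -/(delayed_observable psi t).
(* The transforms are compared along the rates w + 1 + m, all above the growth rate of [q]. *)
have w1 m : (w < w + 1 + m%:R)%R by rewrite -addrA ltrDl ltr_wpDr.
have iT m := integrable_tested w0 mq qC (w1 m) mpsi psi_norm.
have iO m : (lapm (w + 1 + m%:R)).-integrable setT (EFin \o delayed_observable psi).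
  apply: (@bounded_integrable _ _ _ _ _ 1%R); first exact/lapmT_fin/(lt_trans w0).
    exact: measurable_delayed_observable.
  exact: delayed_observable_bound.
apply/eqP; rewrite -subr_eq0; apply/eqP.
apply: (@laplace_uniqueness R (w + 1) (fun t => tested q psi t - delayed_observable psi t)%R) => //.
- by rewrite addr_gt0.
- by have := integrableB measurableT (iT 0%N) (iO 0%N); rewrite addr0.
- move=> m; rewrite (RintegralB measurableT (iT m) (iO m)).
  by rewrite (Laplace_tested mq qC (w1 m) mpsi psi_norm) Laplace_pairing_delayed// subrr.
- move=> s s0; apply: cvgB; last exact: delayed_observable_right.
  exact/cvg_at_right_filter/(tested_continuous eqn tpsi s0).
Qed.

Theorem delayed_density (t : R) (A : set (borel 'rV[R]_n)) : (0 < t)%R -> measurable A ->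
  P [set w | A (B (fine (L t w)) w)] = \int[lebesgue_rV n]_(x in A) (q x t)%:E.
Proof.
move=> t0 mA; have iq := integrable_density_at mq qC t0.
apply: (law_density_boxes (measurable_delayed t) iq _ mA) => D1 D2.
have [mqt _] := integrable_EFinP iq.
have mpsi j : measurable_fun setT (tensor (box_bump D1 D2 j) : borel 'rV[R]_n -> measurableTypeR R).
  apply: (@continuous_borel R 'rV[R]_n); apply: continuous_tensor => i.
  exact/smooth1_continuous/smooth1_box_bump.
have psi_norm j x : (`|tensor (box_bump D1 D2 j) x| <= 1)%R.
  by have /andP[h0 h1] := tensor_box_bump01 D1 D2 j x; rewrite ger0_norm.
have c1 : (\int[P]_w tensor (box_bump D1 D2 j) (B (fine (L t w)) w))%R @[j --> \oo] -->
    (\int[P]_w \1_(box D1 D2) (B (fine (L t w)) w))%R.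
  apply: (@Rintegral_dct _ _ _ P _ _ (fun=> 1%R)).
  - by move=> j; exact: (measurableT_comp (mpsi j) (measurable_delayed t)).
  - by move=> v; exact: tensor_box_bump_cvg.
  - by apply: (@bounded_integrable _ _ _ _ _ 1%R) => // v; rewrite normr1.
  - by move=> j v; exact: psi_norm.
have c2 : (\int[lebesgue_rV n]_x (tensor (box_bump D1 D2 j) x * q x t))%R @[j --> \oo] -->
    (\int[lebesgue_rV n]_x (\1_(box D1 D2) x * q x t))%R.
  apply: (@Rintegral_dct _ _ _ (lebesgue_rV n) _ _ (fun x => `|q x t|%R)).
  - by move=> j; apply: measurable_funM => //; exact: mpsi.
  - by move=> x; apply: cvgMl; exact: tensor_box_bump_cvg.
  - exact: integrable_norm iq.
  - by move=> j x; rewrite normrM ler_piMl.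
transitivity (\int[P]_w \1_(box D1 D2) (B (fine (L t w)) w))%R.
  rewrite /Rintegral; congr fine.
  rewrite -[X in P X]setIT -integral_indic//; last first.
    by rewrite -[X in measurable X]setTI; apply: measurable_delayed => //; exact: measurable_box.
have e : (fun j => \int[P]_w tensor (box_bump D1 D2 j) (B (fine (L t w)) w))%R =
    (fun j => \int[lebesgue_rV n]_x (tensor (box_bump D1 D2 j) x * q x t))%R.
  by apply/funext => j; rewrite -tested_box_bump// /tested leNgt t0.
rewrite e in c1; exact: (cvg_unique _ c1 c2).
Qed.

End delayed_brownian_motion.

(** * The second moment *)

(** The integral of [g] over the set where it is negative equals a probability, so that set is null
    and [g] may be replaced by its positive part. *)
Lemma integral_law_density d d' (Omega : measurableType d) (T : measurableType d') (R : realType)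
    (P : probability Omega R) (m : {measure set T -> \bar R}) (X : Omega -> T) (g h : T -> R) :
  measurable_fun setT X -> m.-integrable setT (EFin \o g) ->
  (forall A, measurable A -> P (X @^-1` A) = \int[m]_(x in A) (g x)%:E) ->
  measurable_fun setT h -> (forall x, 0 <= h x)%R ->
  \int[m]_x (h x * g x)%:E = \int[P]_w (h (X w))%:E.
Proof.
move=> mX ig law mh h0; have [mg _] := integrable_EFinP ig.
pose gp x : R := Num.max (g x) 0%R.
have mgp : measurable_fun setT gp by exact: measurable_maxr.
have gp0 x : (0 <= gp x)%R by rewrite le_max lexx orbT.
pose A := [set x | (g x < 0)%R].
have mA : measurable A.
  by rewrite -[A]setTI; exact: measurable_fun_ltr.
have A0 : \int[m]_(x in A) `|(g x)%:E| = 0.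
  apply/eqP; rewrite eq_le; apply/andP; split; last exact: integral_ge0.
  rewrite (eq_integral (fun x => - (g x)%:E)); last first.
    by move=> x; rewrite inE /A/= => gx; rewrite /= ltr0_norm.
  rewrite integralN ?leeN2 //; last first.
    have iA := integrableS measurableT mA (@subsetT _ A) ig.
    exact: (integrable_add_def mA iA).
  by rewrite oppe_le0 -law.
have gE : {ae m, forall x, g x = gp x}.
  have /(ae_eq_integral_abs m mA) : measurable_fun A (EFin \o g).
    by apply/measurable_funTS/measurable_EFinP.
  move=> [/(_ A0) + _]; apply: filterS => x /= h1; rewrite /gp; case: (ltP (g x) 0%R) => // gx.
  by have [e] := h1 (gx : A x); rewrite e ltxx in gx.
pose X' : {mfun Omega >-> T} := HB.pack X (isMeasurableFun.Build _ _ _ _ X mX).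
have law' D : measurable D -> distribution P X' D = \int[m]_(x in D) (gp x)%:E.
  move=> mD; rewrite /distribution /pushforward/= law//.
  apply: ae_eq_integral => //; [exact/measurable_funTS/measurable_EFinP|exact/measurable_funTS/measurable_EFinP|].
  by apply: filterS gE => x /= -> _.
transitivity (\int[m]_x (h x * gp x)%:E).
  apply: ae_eq_integral => //; [exact/measurable_EFinP/measurable_funM|exact/measurable_EFinP/measurable_funM|].
  by apply: filterS gE => x /= -> _.
rewrite -[LHS](ge0_integral_density (f := EFin \o h) mgp gp0 law'); last 2 first.
- exact/measurable_EFinP.
- by move=> x; rewrite lee_fin.
rewrite ge0_integral_distribution//; first exact/measurable_EFinP.
Qed.

Lemma cvg_integral_min d (T : measurableType d) (R : realType) (m : {measure set T -> \bar R})
    (f : T -> R) : measurable_fun setT f -> (forall x, 0 <= f x)%R ->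
  \int[m]_x (Num.min (f x) j%:R)%:E @[j --> \oo] --> \int[m]_x (f x)%:E.
Proof.
move=> mf f0; have mmin (j : nat) : measurable_fun setT (fun x => (Num.min (f x) j%:R)%:E).
  by apply/measurable_EFinP; exact: measurable_minr.
have := @cvg_monotone_convergence _ _ _ m setT measurableT (fun j x => (Num.min (f x) j%:R)%:E) mmin.
move=> /(_ _)/wrap[].
  by move=> j x _; rewrite lee_fin le_min f0/=.
move=> /(_ _)/wrap[].
  by move=> x _ i j ij; rewrite lee_fin le_min ge_min lexx/= ge_min ler_nat ij orbT.
rewrite [X in _ --> X](_ : _ = \int[m]_x (f x)%:E)//; apply: eq_integral => x _.
apply: cvg_lim; first exact: ereal_hausdorff.
apply: cvg_EFin; first exact: nearW.
apply: cvg_near_cst; near=> j => /=; apply/min_idPl.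
near: j; exact: nbhs_infty_ger.
Unshelve. all: by end_near. Qed.

(** Lebesgue measure is invariant under u -> x - u, whence the independence of [x]. Positive and
    negative parts are reflected separately because the sign of [q] is not prescribed. *)
Lemma second_moment_law d (Omega : measurableType d) (R : realType) (n : nat)
    (P : probability Omega R) (X : Omega -> borel 'rV[R]_n) (q : 'rV[R]_n -> R -> R) (t : R) :
  measurable_fun setT X -> (lebesgue_rV n).-integrable setT (EFin \o q^~ t) ->
  (forall A, measurable A -> P (X @^-1` A) = \int[lebesgue_rV n]_(x in A) (q x t)%:E) ->
  forall x, second_moment q x t = \int[P]_w (sqnorm (X w))%:E.
Proof.
move=> mX iq law x; have [mq _] := integrable_EFinP iq.
have msq : measurable_fun setT (@sqnorm R n : borel 'rV[R]_n -> R).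
  exact: (@continuous_borel R 'rV[R]_n _ (@continuous_sqnorm R n)).
rewrite -(integral_law_density mX iq law msq (@sqnorm_ge0 R n)).
pose f (u : borel 'rV[R]_n) := (sqnorm u * q u t)%:E.
have mf : measurable_fun setT f by apply/measurable_EFinP; exact: measurable_funM.
rewrite /second_moment.
rewrite [LHS](integralE _ _ (fun u : borel 'rV[R]_n => f ((x - u)%R : 'rV[R]_n))) [RHS](integralE _ _ f); congr (_ - _).
  rewrite -(ge0_integral_lebesgue_rV_reflect x (measurable_funepos mf) (funepos_ge0 f)).
  by apply: eq_integral => u _; rewrite !funeposE.
rewrite -(ge0_integral_lebesgue_rV_reflect x (measurable_funeneg mf) (funeneg_ge0 f)).
by apply: eq_integral => u _; rewrite !funenegE.
Qed.

Section difference_quotient.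
Context {R : realType}.
Local Open Scope ring_scope.

Lemma is_derive_affine0 (c e : R) : is_derive (0 : R) (1 : R) (fun u : R => c + e * u) e.
Proof.
by apply: is_derive_eq; rewrite /GRing.scale/=; ring.
Qed.

Lemma difference_quotient_cvg (f : R -> R) (c : R) : is_derive (0 : R) (1 : R) f c ->
  (j.+1%:R * (f j.+1%:R^-1 - f 0)) @[j --> \oo] --> c.
Proof.
move=> [d1 <-]; have := d1; rewrite /derivable /derive => h.
have c0 : (j.+1%:R^-1 : R) @[j --> \oo] --> 0^'.
  move=> A A0; have hA := @cvg_harmonic R _ A0.
  apply: (@filterS _ \oo _ (fun j : nat => (j.+1%:R^-1 : R) != 0 -> A (j.+1%:R^-1)) _ _ hA) => j.
  by apply; rewrite invr_eq0.
have := cvg_comp _ _ c0 h; apply: cvg_trans; apply: near_eq_cvg; apply: nearW => j /=.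
by rewrite invrK addr0 [X in f X]mulr1.
Qed.

End difference_quotient.

(** * The second moment of Brownian motion *)

Section gaussian_moment.
Context {R : realType} {n : nat}.
Context {d : measure_display} {Omega : measurableType d}.
Variables (P : probability Omega R) (B : R -> Omega -> borel 'rV[R]_n).
Hypothesis B_bm : brownian_motion P B.
Local Open Scope ring_scope.
Local Notation a := (- (n%:R / 2) : R).

Let p4 (s : R) : 0 < s -> 0 < 4 * pi * s. Proof. by move=> s0; rewrite !mulr_gt0// pi_gt0. Qed.

(** Adding $c|x|^2$ to the exponent changes $1/(4s)$ into $(1+4sc)/(4s)$, so the product is again a
    heat kernel up to normalisation. *)
Lemma heat_kernel_exp (c s : R) (x : 'rV[R]_n) : 0 <= c -> 0 < s ->
  expR (- (c * sqnorm x)) * heat_kernel s x =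
  (1 + 4 * s * c) `^ a * heat_kernel (s / (1 + 4 * s * c)) x.
Proof.
move=> c0 s0; have h : 0 < 1 + 4 * s * c by rewrite ltr_pwDl// !mulr_ge0// ltW.
have s' : 0 < s / (1 + 4 * s * c) by rewrite divr_gt0.
rewrite /heat_kernel mulrCA -expRD mulrA -powRM ?(ltW h) ?(ltW (p4 s'))//.
congr (_ `^ _ * expR _); first by field; rewrite gt_eqF.
by field; rewrite !gt_eqF.
Qed.

Lemma integral_heat_kernel_exp (c s : R) : 0 <= c -> 0 < s ->
  \int[lebesgue_rV n]_x (expR (- (c * sqnorm x)) * heat_kernel s x) = (1 + 4 * s * c) `^ a.
Proof.
move=> c0 s0; have h : 0 < 1 + 4 * s * c by rewrite ltr_pwDl// !mulr_ge0// ltW.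
have s' : 0 < s / (1 + 4 * s * c) by rewrite divr_gt0.
under eq_Rintegral => x _ do rewrite heat_kernel_exp//.
rewrite /Rintegral; under eq_integral => x _ do rewrite EFinM.
rewrite ge0_integralZl//; last 3 first.
- by apply/measurable_EFinP; exact: measurable_heat_kernel.
- by move=> x _; rewrite lee_fin heat_kernel_ge0.
- by rewrite lee_fin powR_ge0.
by rewrite (heat_kernel_mass B_bm)// mule1.
Qed.

Lemma integrable_heat_kernel (s : R) : 0 < s ->
  (lebesgue_rV n).-integrable setT (EFin \o heat_kernel s).
Proof.
move=> s0; apply/integrableP; split.
  by apply/measurable_EFinP; exact: measurable_heat_kernel.
under eq_integral => x _ do rewrite /= ger0_norm ?heat_kernel_ge0//.
by rewrite (heat_kernel_mass B_bm)// ltry.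
Qed.

Lemma integrable_sqnorm_heat_kernel (s : R) : 0 < s ->
  (lebesgue_rV n).-integrable setT (EFin \o (fun x => sqnorm x * heat_kernel s x)).
Proof.
move=> s0; have s2 : 0 < 2 * s by rewrite mulr_gt0.
(* Half of the exponent absorbs the squared norm, with bound 8 s; the other half is the kernel at
   time 2 s, up to the ratio $2^{n/2}$ of the normalisations. *)
pose c := 8 * s * (2^-1 `^ a).
apply: (@le_integrable_EFin _ _ _ (lebesgue_rV n) _ (fun x => c * heat_kernel (2 * s) x)).
- apply: measurable_funM; last exact: measurable_heat_kernel.
  exact: (@continuous_borel R 'rV[R]_n _ (@continuous_sqnorm R n)).
- move=> x; rewrite ger0_norm; last by apply: mulr_ge0; [exact: sqnorm_ge0|exact: heat_kernel_ge0].
  have z0 : 0 <= sqnorm x / (8 * s) by rewrite divr_ge0 ?sqnorm_ge0 ?mulr_ge0// ltW.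
  rewrite /heat_kernel mulrCA [leRHS](_ : _ = (4 * pi * s) `^ a * (8 * s * expR (- (sqnorm x / (8 * s))))).
    apply: ler_wpM2l; first exact: powR_ge0.
    rewrite (_ : - (sqnorm x / (4 * s)) = - (sqnorm x / (8 * s)) + - (sqnorm x / (8 * s))); last first.
      by field; rewrite gt_eqF.
    rewrite expRD mulrA ler_wpM2r ?expR_ge0//.
    have := xexpRN_le1 z0; rewrite mulrAC ler_pdivrMr ?mulr_gt0// mul1r; exact.
  rewrite (_ : 4 * pi * s = 2^-1 * (4 * pi * (2 * s))); last by field.
  rewrite [in RHS]powRM ?invr_ge0 ?(ltW (p4 s2))// /c.
  rewrite (_ : 4 * (2 * s) = 8 * s) ; last by ring.
  by ring.
- by apply: integrable_mull; exact: integrable_heat_kernel.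
Qed.

(** The moment is minus the derivative at 0 of the transform $c \mapsto (1+4sc)^{-n/2}$. The
    quotients $j(1-e^{-|x|^2/j})$ are dominated by $|x|^2$, so the derivative may be taken under the
    integral. *)
Lemma integral_sqnorm_heat_kernel (s : R) : 0 < s ->
  \int[lebesgue_rV n]_x (sqnorm x * heat_kernel s x) = 2 * n%:R * s.
Proof.
move=> s0; pose f (u : R) : R := (1 + 4 * s * u) `^ a.
have df : is_derive (0 : R) (1 : R) f (a * (4 * s)).
  have d1 : is_derive (0 : R) (1 : R) (fun u : R => 1 + 4 * s * u) (4 * s).
    exact: is_derive_affine0.
  have d2 : is_derive ((fun u : R => 1 + 4 * s * u) 0) (1 : R) (fun y => y `^ a) (a * 1 `^ (a - 1)).
    by rewrite /= mulr0 addr0; exact: is_derive1_powR.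
  have := @is_derive1_comp R (fun y => y `^ a) (fun u => 1 + 4 * s * u) 0 _ _ d2 d1.
  by rewrite powR1 mulr1.
have cf := difference_quotient_cvg df.
pose g (j : nat) (x : 'rV[R]_n) : R :=
  j.+1%:R * (1 - expR (- (j.+1%:R^-1 * sqnorm x))) * heat_kernel s x.
have g_cvg x : g j x @[j --> \oo] --> sqnorm x * heat_kernel s x.
  apply: cvgMl; have d1 : is_derive (0 : R) (1 : R) (fun u : R => 0 + - sqnorm x * u) (- sqnorm x).
    exact: is_derive_affine0.
  have d2 : is_derive ((fun u : R => 0 + - sqnorm x * u) 0) (1 : R) expR (expR 0).
    by rewrite /= mulr0 addr0; exact: is_derive_expR.
  have := @is_derive1_comp R expR (fun u => 0 + - sqnorm x * u) 0 _ _ d2 d1.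
  rewrite expR0 mul1r => /difference_quotient_cvg/cvgN.
  rewrite opprK; apply: cvg_trans; apply: near_eq_cvg; apply: nearW => j /=.
  transitivity (- (j.+1%:R * (expR (0 + - sqnorm x / j.+1%:R) - expR (0 + - sqnorm x * 0)))); first by [].
  by rewrite mulr0 addr0 expR0 add0r mulNr (mulrC (sqnorm x)) -mulrN opprB.
have g_le j x : `|g j x| <= sqnorm x * heat_kernel s x.
  have z0 : 0 <= j.+1%:R^-1 * sqnorm x by rewrite mulr_ge0 ?sqnorm_ge0.
  have e1 : 0 <= 1 - expR (- (j.+1%:R^-1 * sqnorm x)).
    by rewrite subr_ge0 expR_le1 oppr_le0.
  rewrite ger0_norm; last by apply: mulr_ge0; [exact: mulr_ge0|exact: heat_kernel_ge0].
  apply: ler_wpM2r; first exact: heat_kernel_ge0.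
  have h : 1 - expR (- (j.+1%:R^-1 * sqnorm x)) <= j.+1%:R^-1 * sqnorm x.
    by rewrite lerBlDr -lerBlDl; exact: expR_ge1Dx.
  apply: le_trans (ler_wpM2l (ler0n _ _) h) _.
  by rewrite mulrA divff ?mul1r.
have mg j : measurable_fun setT (g j : borel 'rV[R]_n -> R).
  apply: measurable_funM; last exact: measurable_heat_kernel.
  apply: measurable_funM => //; apply: measurable_funB => //.
  apply: measurableT_comp => //; apply: measurableT_comp => //; apply: measurable_funM => //.
  exact: (@continuous_borel R 'rV[R]_n _ (@continuous_sqnorm R n)).
have c1 := Rintegral_dct mg g_cvg (integrable_sqnorm_heat_kernel s0) g_le.
have gE j : \int[lebesgue_rV n]_x g j x = - (j.+1%:R * (f j.+1%:R^-1 - f 0)).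
  have mass : \int[lebesgue_rV n]_x heat_kernel s x = 1.
    by rewrite /Rintegral (heat_kernel_mass B_bm).
  have j0 : 0 <= j.+1%:R^-1 :> R by [].
  have iE : (lebesgue_rV n).-integrable setT
      (EFin \o (fun x => expR (- (j.+1%:R^-1 * sqnorm x)) * heat_kernel s x)).
    rewrite (_ : (fun x => _) = (fun x => (1 + 4 * s * j.+1%:R^-1) `^ a *
        heat_kernel (s / (1 + 4 * s * j.+1%:R^-1)) x)).
      apply/integrable_mull/integrable_heat_kernel.
      by rewrite divr_gt0// ltr_pwDl// !mulr_ge0// ltW.
    by apply/funext => x; rewrite heat_kernel_exp.
  rewrite /f mulr0 addr0 powR1 -integral_heat_kernel_exp// -[X in _ * (_ - X)]mass.
  rewrite -mulrN opprB -RintegralB//; last exact: integrable_heat_kernel.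
  rewrite -RintegralZl//; last first.
    by have := integrableB measurableT (integrable_heat_kernel s0) iE.
  by apply: eq_Rintegral => x _; rewrite /g -mulrA mulrBl mul1r.
have c2 : \int[lebesgue_rV n]_x g j x @[j --> \oo] --> - (a * (4 * s)).
  by under eq_cvg => j do rewrite gE; exact: cvgN.
rewrite (cvg_unique _ c1 c2)//.
by field.
Qed.

Local Close Scope ring_scope.

Lemma brownian_second_moment (s : R) : (0 <= s)%R ->
  \int[P]_w (sqnorm (B s w))%:E = (2 * n%:R * s)%:E.
Proof.
rewrite le_eqVlt => /predU1P[<-|s0].
  rewrite mulr0; apply: integral0_eq => w _; have [_ -> _ _] := B_bm.
  by rewrite /sqnorm big1// => i _; rewrite mxE expr0n.
have msq : measurable_fun setT (@sqnorm R n : borel 'rV[R]_n -> R).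
  exact: (@continuous_borel R 'rV[R]_n _ (@continuous_sqnorm R n)).
rewrite (@ge0_brownian_mean _ _ _ P n B B_bm s (EFin \o @sqnorm R n) s0).
- rewrite -integral_sqnorm_heat_kernel// EFin_Rintegral; last exact: integrable_sqnorm_heat_kernel.
  by apply: eq_integral => x _.
- exact/measurable_EFinP.
- by move=> x; rewrite lee_fin sqnorm_ge0.
Qed.

End gaussian_moment.

(** * The second moment of the delayed motion and a bound on E L(t) *)

Section delayed_second_moment.
Context {R : realType} {n : nat}.
Context {d : measure_display} {Omega : measurableType d}.
Variables (P : probability Omega R) (sig : R -> Omega -> \bar R) (B : R -> Omega -> borel 'rV[R]_n).
Hypothesis msig : forall t, (0 <= t)%R -> measurable_fun setT (sig t).
Hypothesis sig0 : forall w, sig 0%R w = 0.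
Hypothesis sig_mono : forall w s t, (0 <= s)%R -> (s <= t)%R -> sig s w <= sig t w.
Variable kap : R -> R.
Hypothesis kap_gt0 : forall lam, (0 < lam)%R -> (0 < kap lam)%R.
Hypothesis sig_laplace : forall lam t : R, (0 < lam)%R -> (0 <= t)%R ->
  \int[P]_w expeR (- (lam%:E * sig t w)) = (expR (- (t * kap lam)))%:E.
Hypothesis B_bm : brownian_motion P B.
Hypothesis BL_indep : independent_processes P B (inverse_process sig).
Local Notation L := (inverse_process sig).

(** The time-change formula is available for bounded functions only, so the squared norm is
    truncated at the level [j] and both sides increase to their limits. *)
Lemma delayed_second_moment (t : R) : (0 <= t)%R ->
  \int[P]_w (sqnorm (B (fine (L t w)) w))%:E = (2 * n%:R * mean_inverse P sig t)%:E.
Proof.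
move=> t0; pose phi (j : nat) (x : 'rV[R]_n) : R := Num.min (sqnorm x) j%:R.
have msq : measurable_fun setT (@sqnorm R n : borel 'rV[R]_n -> R).
  exact: (@continuous_borel R 'rV[R]_n _ (@continuous_sqnorm R n)).
have cphi j : continuous (phi j).
  by move=> x; apply: continuous_min; [exact: continuous_sqnorm|exact: cst_continuous].
have phi0 j x : (0 <= phi j x <= j%:R)%R by rewrite le_min sqnorm_ge0 ler0n ge_min lexx orbT.
have phi_norm j x : (`|phi j x| <= j%:R)%R by have /andP[h0 h1] := phi0 j x; rewrite ger0_norm.
have l0 w : (0 <= fine (L t w))%R by rewrite fine_ge0// inverse_process_ge0.
have [mB _ _ _] := B_bm.
have mX := measurable_delayed msig sig_mono B_bm t.
have ml : measurable_fun setT (fun w => fine (L t w) : measurableTypeR R).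
  exact: (measurableT_comp (fine_measurable measurableT) (measurable_inverse_process_at msig sig_mono t)).
have mb j : measurable_fun setT (fun w => brownian_mean P B (phi j) (fine (L t w))).
  apply: (measurableT_comp (T2 := measurableTypeR R)) ml.
  exact: continuous_measurable_fun (continuous_brownian_mean B_bm (cphi j) (phi_norm j)).
have P_fin : P setT < +oo by rewrite probability_setT ltry.
have bE j s : (0 <= s)%R -> (brownian_mean P B (phi j) s)%:E = \int[P]_w (phi j (B s w))%:E.
  move=> s0; rewrite /brownian_mean ger0_norm// EFin_Rintegral//.
  apply: (@bounded_integrable _ _ _ P _ j%:R) => //.
  exact: (measurableT_comp (@continuous_borel R 'rV[R]_n _ (cphi j)) (mB _ s0)).
have b_cvg s : (0 <= s)%R -> (brownian_mean P B (phi j) s)%:E @[j --> \oo] --> (2 * n%:R * s)%:E.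
  move=> s0; rewrite -(brownian_second_moment B_bm s0).
  under eq_cvg => j do rewrite bE//.
  apply: cvg_integral_min => [|w]; last exact: sqnorm_ge0.
  exact: (measurableT_comp msq (mB _ s0)).
have b_mono s i j : (0 <= s)%R -> (i <= j)%N ->
    (brownian_mean P B (phi i) s <= brownian_mean P B (phi j) s)%R.
  move=> s0 ij; rewrite -lee_fin !bE//; apply: ge0_le_integral => //.
  - by move=> w _; rewrite lee_fin; have /andP[] := phi0 i (B s w).
  - apply/measurable_EFinP.
    exact: (measurableT_comp (@continuous_borel R 'rV[R]_n _ (cphi i)) (mB _ s0)).
  - apply/measurable_EFinP.
    exact: (measurableT_comp (@continuous_borel R 'rV[R]_n _ (cphi j)) (mB _ s0)).
  - by move=> w _; rewrite lee_fin le_min ge_min lexx/= ge_min ler_nat ij orbT.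
have b_ge0 j s : (0 <= brownian_mean P B (phi j) s)%R.
  by apply: Rintegral_ge0 => w _; have /andP[] := phi0 j (B `|s|%R w).
have b_norm j s : (`|brownian_mean P B (phi j) s| <= j%:R)%R.
  apply: (@le_trans _ _ (\int[P]_w (j%:R : R))%R).
    apply: normr_Rintegral_le.
    - exact: (measurableT_comp (@continuous_borel R 'rV[R]_n _ (cphi j)) (mB _ (normr_ge0 s))).
    - by move=> w; exact: phi_norm.
    - by apply: (@bounded_integrable _ _ _ P _ j%:R) => // w; rewrite normr_nat.
  by rewrite Rintegral_cst//= probability_setT mulr1.
have c1 := @cvg_integral_min _ _ _ P (fun w => sqnorm (B (fine (L t w)) w))
  (measurableT_comp msq mX) (fun w => sqnorm_ge0 _).
have c2 : \int[P]_w (brownian_mean P B (phi j) (fine (L t w)))%:E @[j --> \oo] -->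
    \int[P]_w (2 * n%:R * fine (L t w))%:E.
  have mE j : measurable_fun setT (fun w => (brownian_mean P B (phi j) (fine (L t w)))%:E).
    exact/measurable_EFinP.
  have := @cvg_monotone_convergence _ _ _ P setT measurableT
    (fun j w => (brownian_mean P B (phi j) (fine (L t w)))%:E) mE.
  move=> /(_ _)/wrap[]; first by move=> j w _; rewrite lee_fin.
  move=> /(_ _)/wrap[]; first by move=> w _ i j ij; rewrite lee_fin b_mono.
  rewrite [X in _ --> X](_ : _ = \int[P]_w (2 * n%:R * fine (L t w))%:E)//.
  by apply: eq_integral => w _; apply: cvg_lim; [exact: ereal_hausdorff|exact: b_cvg].
have e : (fun j => \int[P]_w (Num.min (sqnorm (B (fine (L t w)) w)) j%:R)%:E) =
    (fun j => \int[P]_w (brownian_mean P B (phi j) (fine (L t w)))%:E).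
  apply/funext => j; have h := delayed_mean msig sig_mono B_bm BL_indep t0 (cphi j) (phi0 j).
  rewrite -[RHS]EFin_Rintegral; last first.
    by apply: (@bounded_integrable _ _ _ P _ j%:R) => // w; exact: b_norm.
  rewrite -h EFin_Rintegral//; apply: (@bounded_integrable _ _ _ P _ j%:R) => //.
    exact: (measurableT_comp (@continuous_borel R 'rV[R]_n _ (cphi j)) mX).
rewrite e in c1; rewrite (cvg_unique _ c1 c2)//.
rewrite EFinM (EFin_mean_inverse msig sig0 sig_mono kap_gt0 sig_laplace) -ge0_integralZl//.
- exact/measurable_EFinP.
- by move=> w _; rewrite lee_fin.
Qed.

(** By monotonicity the value at [t] times the mass exp(- lam t) / lam of the tail is at most the
    whole transform, 1 / (lam kap(lam)). *)
Lemma mean_inverse_le (t lam : R) : (0 <= t)%R -> (0 < lam)%R ->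
  (mean_inverse P sig t <= expR (lam * t) / kap lam)%R.
Proof.
move=> t0 lam0; have k0 := kap_gt0 lam0.
have U0 := mean_inverse_ge0 P sig.
have ndU := mean_inverse_mono msig sig0 sig_mono kap_gt0 sig_laplace.
have e : \int[lapm lam]_(s in `]t, +oo[) (mean_inverse P sig t)%:E =
    (mean_inverse P sig t)%:E * lapm lam `]t, +oo[%classic.
  by rewrite integral_cst; [|exact: measurable_itv].
have h : \int[lapm lam]_(s in `]t, +oo[) (mean_inverse P sig t)%:E <= ((kap lam)^-1 / lam)%:E.
  rewrite -(mean_inverse_lapm msig sig0 sig_mono kap_gt0 sig_laplace lam0).
  rewrite integral_mkcond; apply: ge0_le_integral => //.
  - by move=> s _; rewrite patchE; case: ifP => // _; rewrite lee_fin.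
  - apply/(measurable_restrictT _ (measurable_itv _)); exact: measurable_cst.
  - apply/measurable_EFinP.
    apply: (measurableT_comp (T2 := measurableTypeR R)); last exact: normr_measurable.
    exact: nondecreasing_measurable.
  - move=> s _; rewrite patchE; case: ifPn => [|_]; last by rewrite lee_fin.
    rewrite inE/= in_itv/= andbT => ts; rewrite lee_fin; apply: ndU.
    by rewrite (le_trans (ltW ts))// ler_norm.
move: h; rewrite e lapm_tail// -EFinM lee_fin mulrA ler_pM2r ?invr_gt0//.
by rewrite expRN -ler_pdivlMr ?invr_gt0 ?expR_gt0// invrK mulrC.
Qed.

End delayed_second_moment.

Theorem theorem5p1 (R : realType)
    (* the mixing space and the Levy mixing data *)
    (E : ptopologicalType) (E_polish : polish R E)
    (W : set (borel E)) (W_borel : measurable W)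
    (p : probability (borel E) R) (pW : p W = 1)
    (a b : borel E -> R)
    (a_ge0 : forall y, (0 <= a y)%R) (b_ge0 : forall y, (0 <= b y)%R)
    (nu : R.-sigmafker (borel E) ~> (measurableTypeR R))
    (nu_pos : forall y, nu y `]-oo, 0%R]%classic = 0)
    (nu_levy : forall y, truncated_moment nu y < +oo)
    (A1 : assumption_A1 W p a b) (A2 : assumption_A2 W p nu)
    (* the hypotheses of the theorem *)
    (nu_infinite : forall y, nu y `]0%R, +oo[%classic = +oo)
    (nubar_ac : forall y, absolutely_continuous_pos (fun s => fine (nubar a nu s y)))
    (Ef_rv : regularly_varying_at0 (Ef W p a b nu))
    (alpha : R) (alpha01 : (0 <= alpha <= 1)%R)
    (Ef_alpha : forall x : R, (0 < x)%R ->
       (Ef W p a b nu (lam * x) / Ef W p a b nu lam)%R @[lam --> 0^'+]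
         --> (x `^ alpha)%R)
    (* the distributed order subordinator and the independent Brownian motion *)
    (d : measure_display) (Omega : measurableType d) (P : probability Omega R)
    (sig : R -> Omega -> \bar R)
    (sig_sub : distributed_order_subordinator P W p a b nu sig)
    (n : nat) (n_gt0 : (0 < n)%N)
    (B : R -> Omega -> borel 'rV[R]_n) (B_bm : brownian_motion P B)
    (BL_indep : independent_processes P B (inverse_process sig))
    (* the fundamental solution *)
    (q : 'rV[R]_n -> R -> R) (q_sol : fundamental_solution W p a b nu q) :
  let L := inverse_process sig in
  let M x t := fine (second_moment q x t) in
  [/\ (* (1) *)
      forall t : R, (0 < t)%R -> forall A : set (borel 'rV[R]_n), measurable A ->
        P [set w | A (B (fine (L t w)) w)] = \int[lebesgue_rV n]_(x in A) (q x t)%:E,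
      (* (2) *)
      forall x : 'rV[R]_n, equivalent_at_infty
        (fun t => (2 * n%:R)^-1 * Gamma (1 + alpha) * M x t)%R
        (fun t => (Ef W p a b nu t^-1)^-1)%R,
      (* (3) *)
      0 < mean W p (EFin \o a) -> forall x : 'rV[R]_n,
        exists l : R, second_moment q x t @[t --> +oo%R] --> l%:E
    & (* (4) *)
      let limit := mean W p (EFin \o b) +
        \int[lebesgue_measure]_(s in `]0%R, +oo[) mean W p (nubar a nu s) in
      0 < limit /\
      forall x : 'rV[R]_n,
        (t / ((2 * n%:R)^-1 * Gamma (1 + alpha) * M x t))%:E @[t --> +oo%R] --> limit].
Proof.
move=> L M; have [A1a A1b A1c] := A1.
have [[[msig sig0 sig_mono _] _] lapl] := sig_sub.
have [mq [C0 [w0 qC0]] qeq] := q_sol.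
(* The growth bound is enlarged to have C >= 0 and w > 0: with C >= 0, raising the rate [w0] to [w]
   preserves the inequality. *)
pose C := Num.max C0 0%R; pose w := Num.max w0 1%R.
have w_gt0 : (0 < w)%R by rewrite lt_max ltr01 orbT.
have qC t : (0 < t)%R -> \int[lebesgue_rV n]_x `|q x t|%:E <= (C * expR (w * t))%:E.
  move=> t0; apply: le_trans (qC0 t t0) _; rewrite lee_fin.
  apply: (@le_trans _ _ (C * expR (w0 * t))%R).
    by rewrite ler_wpM2r ?expR_ge0// le_max lexx.
  by rewrite ler_wpM2l ?le_max ?lexx ?orbT// ler_expR ler_pM2r// le_max lexx.
pose kap := Ef W p a b nu.
have kap_gt0 lam : (0 < lam)%R -> (0 < kap lam)%R.
  exact: (Ef_gt0 W_borel pW a_ge0 b_ge0 A1 A2 nu_infinite).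
have eqn phi : test_function phi -> {within `[0%R, +oo[%classic, continuous (tested q phi)} /\
    forall t : R, (0 < t)%R -> [/\ Eb W p b <> 0%R -> derivable (tested q phi) t 1%R,
      derivable (convolution W p a nu (tested q phi)) t 1%R &
      distributed_derivative W p a b nu (tested q phi) t
        = (\int[lebesgue_rV n]_x (laplacian phi x * q x t))%R].
  by move=> /qeq[? h]; split => // t /h[[? ?] ?]; split.
have density t (t0 : (0 < t)%R) (A : set (borel 'rV[R]_n)) : measurable A ->
    P [set w | A (B (fine (L t w)) w)] = \int[lebesgue_rV n]_(x in A) (q x t)%:E.
  move=> mA; apply: (@delayed_density R n d Omega P sig B msig sig0 sig_mono
    (Eb W p b) (Enubar W p a nu) kap kap_gt0 lapl B_bm BL_indep
    (Eb_ge0 W p b_ge0) (measurable_Enubar W_borel a_ge0 nu A1) (Enubar_ge0 W p a_ge0 nu)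
    (integrable_Enubar W_borel a_ge0 b_ge0 A1 A2)
    (continuous_Enubar W_borel a_ge0 nu_levy A1 A2 nubar_ac)
    (EfE W_borel a_ge0 b_ge0 A1 A2) q C w w_gt0 mq qC eqn t A t0 mA).
pose U := mean_inverse P sig.
have U0 t : (0 <= U t)%R by exact: mean_inverse_ge0.
have ndU : nondecreasing_fun U by exact: (mean_inverse_mono msig sig0 sig_mono kap_gt0 lapl).
have n0 : (0 < n%:R :> R)%R by rewrite ltr0n.
have second x t : (0 < t)%R -> second_moment q x t = (2 * n%:R * U t)%:E.
  move=> t0; rewrite -(delayed_second_moment msig sig0 sig_mono kap_gt0 lapl B_bm BL_indep (ltW t0)).
  apply: second_moment_law.
  - exact: (measurable_delayed msig sig_mono B_bm t).
  - exact: (integrable_density_at mq qC t0).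
  - by move=> A mA; exact: density.
have asym x : equivalent_at_infty
    (fun t => (2 * n%:R)^-1 * Gamma (1 + alpha) * M x t)%R (fun t => (kap t^-1)^-1)%R.
  (* The Tauberian theorem is applied with 1 / kap, which varies regularly with index -alpha at
     0. *)
  have w1 lam : (0 < lam)%R -> (0 < (kap lam)^-1)%R by move=> l0; rewrite invr_gt0 kap_gt0.
  have Uw lam : (0 < lam)%R -> \int[lapm lam]_s (U `|s|)%:E = ((kap lam)^-1 / lam)%:E.
    exact: (mean_inverse_lapm msig sig0 sig_mono kap_gt0 lapl).
  have rv y : (0 < y)%R ->
      ((kap (lam * y))^-1 / (kap lam)^-1)%R @[lam --> 0^'+] --> (y `^ (- alpha))%R.
    move=> y0; rewrite powRN.
    have F0 : Filter (0 : R)^'+ by typeclasses eauto.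
    have := @cvgV _ _ _ F0 _ _ (lt0r_neq0 (powR_gt0 alpha y0)) (Ef_alpha y y0).
    by apply: cvg_trans; apply: near_eq_cvg; near=> lam; rewrite /= invfM.
  have := karamata alpha01 U0 ndU w1 Uw rv.
  apply: cvg_trans; apply: near_eq_cvg; near=> t; congr (_ / _)%R.
  have t0 : (0 < t)%R by near: t; exact: nbhs_pinfty_gt.
  by rewrite /M second//=; field; rewrite gt_eqF.
split.
- by move=> t t0 A mA; exact: density.
- exact: asym.
- move=> a0 x; have Ea_fin := mean_a_fin W_borel a_ge0 A1.
  pose Ea := fine (mean W p (EFin \o a)).
  have EaE : Ea%:E = mean W p (EFin \o a) by rewrite fineK// ge0_fin_numE// ltW.
  have Ea0 : (0 < Ea)%R by rewrite -lte_fin EaE.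
  have ub : has_ubound (range U).
    (* Taking the rate 1/s in the bound on the mean makes the exponential equal to exp(1), and [kap]
       is at least E a(Y). The maximum with 1 covers nonpositive [t]. *)
    exists (expR 1 / Ea)%R => _ [t _ <-]; pose s := Num.max t 1%R.
    have s0 : (0 < s)%R by rewrite lt_max ltr01 orbT.
    have si : (0 < s^-1)%R by rewrite invr_gt0.
    apply: (@le_trans _ _ (U s)); first by apply: ndU; rewrite le_max lexx.
    have := mean_inverse_le msig sig0 sig_mono kap_gt0 lapl (ltW s0) si.
    rewrite mulVf ?gt_eqF// => /le_trans; apply; rewrite ler_wpM2l ?expR_ge0//.
    rewrite lef_pV2 ?posrE ?kap_gt0// -lee_fin EaE.
    exact: (Ef_ge_a W_borel a_ge0 b_ge0 A1 A2).
  exists (2 * n%:R * sup (range U))%R.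
  have h : (2 * n%:R * U t)%:E @[t --> +oo%R] --> (2 * n%:R * sup (range U))%:E.
    by apply: cvg_EFin; [exact: nearW|apply: cvgMr; exact: nondecreasing_cvgr].
  apply: cvg_trans h; apply: near_eq_cvg; near=> t.
  have t0 : (0 < t)%R by near: t; exact: nbhs_pinfty_gt.
  by rewrite second.
- move=> limit; split; first exact: (limit_gt0 W_borel pW a_ge0 b_ge0 A1 A2 nu_infinite).
  move=> x; have lim1 := Ef_limit W_borel pW a_ge0 b_ge0 A1 A2 nu_infinite.
  (* The ratio of assertion (2): the quotient in (4) is t kap(1/t) divided by [r t], and [r t] tends
     to 1. *)
  pose r t : R := ((2 * n%:R)^-1 * Gamma (1 + alpha) * M x t / (kap t^-1)^-1)%R.
  have Foo : Filter (nbhs (+oo%R : set_system R)) by typeclasses eauto.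
  have inv0 := @cvgV R R _ Foo r 1%R (oner_neq0 R) (asym x).
  have inv1 : ((r t)^-1)%:E @[t --> +oo%R] --> 1%:E.
    by apply: cvg_EFin; [exact: nearW|rewrite -[X in _ --> X]invr1; exact: inv0].
  (* The limit may be +oo, so the product of limits is taken in the extended reals, where its being
     defined must be checked. *)
  have def1 : limit *? 1%:E by rewrite mule_defE abse1 (negbTE onee_neq0) andbF.
  have := @cvgeM _ _ Foo _ _ _ _ _ def1 lim1 inv1; rewrite mule1.
  apply: cvg_trans; apply: near_eq_cvg; near=> t.
  have t0 : (0 < t^-1)%R by rewrite invr_gt0; near: t; exact: nbhs_pinfty_gt.
  rewrite /= -EFinM; congr EFin.
  have k0 : (kap t^-1 != 0)%R by rewrite gt_eqF// kap_gt0.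
  rewrite -/(kap t^-1%R) /r; set X := (_ * M x t)%R.
  by rewrite invfM invrK (mulrC X^-1%R) mulrA mulfK.
Unshelve. all: by end_near. Qed.
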